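(* Let $\phi:\mathbb D\to\mathbb D$ be a parabolic inner function of positive hyperbolic step. Then for every unimodular constant $\tau$ there exists a non-constant inner function $u$ such that $u\circ\phi=\tau u$.
   Context: $\mathbb D$ is the open unit disk, $\mathbb T$ its boundary. For $n\in\mathbb N_0$, $\phi^{[n]}$ denotes the $n$-th iterate of $\phi$. The pseudo-hyperbolic distance is $\rho(z_1,z_2)=\left|\frac{z_2-z_1}{1-\overline{z_2}z_1}\right|$. A holomorphic self-map $\phi$ of $\mathbb D$ is of positive hyperbolic step if $\lim_{n\to\infty}\rho(\phi^{[n]}(z_0),\phi^{[n+1]}(z_0))>0$ for some $z_0\in\mathbb D$. A holomorphic self-map of $\mathbb D$ is parabolic if its Denjoy--Wolff point lies on $\mathbb T$ and its angular derivative there equals $1$. *)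

(* Defs.v *)
From Stdlib Require Import Reals.
From Coquelicot Require Import Coquelicot.

Open Scope R_scope.

Definition in_disk (z : C) : Prop := Cmod z < 1.

Definition holomorphic_on_disk (f : C -> C) : Prop :=
  forall z : C, in_disk z ->
    ex_derive (K := C_AbsRing) (V := C_NormedModule) f z.

Definition holo_self_map (f : C -> C) : Prop :=
  holomorphic_on_disk f /\ forall z, in_disk z -> in_disk (f z).

Definition iterate (f : C -> C) (n : nat) : C -> C := Nat.iter n f.

Definition rho (z1 z2 : C) : R :=
  Cmod (Cminus z2 z1 / Cminus (RtoC 1) (Cmult (Cconj z2) z1))%C.

Definition null_set (N : R -> Prop) : Prop :=
  forall eps : R, 0 < eps ->
    exists a b : nat -> R,
      (forall k, a k <= b k) /\
      (forall t, N t -> exists k, a k <= t <= b k) /\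
      (forall n, sum_f_R0 (fun k => b k - a k) n < eps).

Definition polar (r theta : R) : C := (r * cos theta, r * sin theta).

Definition radial_limit (f : C -> C) (theta : R) (L : C) : Prop :=
  forall eps : R, 0 < eps -> exists delta : R, 0 < delta /\
    forall r : R, 1 - delta < r < 1 -> Cmod (Cminus (f (polar r theta)) L) < eps.

Definition inner (f : C -> C) : Prop :=
  holomorphic_on_disk f /\
  (forall z, in_disk z -> Cmod (f z) <= 1) /\
  exists N : R -> Prop, null_set N /\
    forall theta : R, ~ N theta ->
      exists L : C, Cmod L = 1 /\ radial_limit f theta L.

Definition constant_on_disk (f : C -> C) : Prop :=
  exists c : C, forall z, in_disk z -> f z = c.

Definition positive_hyperbolic_step (phi : C -> C) : Prop :=
  exists z0 : C, in_disk z0 /\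
    exists l : R, 0 < l /\
      is_lim_seq (fun n => rho (iterate phi n z0) (iterate phi (S n) z0)) l.

Definition denjoy_wolff_point (phi : C -> C) (w : C) : Prop :=
  forall z, in_disk z ->
    forall eps : R, 0 < eps -> exists N : nat, forall n, (N <= n)%nat ->
      Cmod (Cminus (iterate phi n z) w) < eps.

(* nontangential (angular) limit of g at w in T equals L: limit along every
   Stolz angle { z in D : |z - w| < M (1 - |z|) }, M > 1 *)
Definition angular_limit (g : C -> C) (w L : C) : Prop :=
  forall M : R, 1 < M -> forall eps : R, 0 < eps ->
    exists delta : R, 0 < delta /\
      forall z, in_disk z -> Cmod (Cminus z w) < M * (1 - Cmod z) ->
        Cmod (Cminus z w) < delta -> Cmod (Cminus (g z) L) < eps.

Definition angular_derivative (phi : C -> C) (w c : C) : Prop :=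
  angular_limit phi w w /\
  angular_limit (fun z => Cdiv (Cminus (phi z) w) (Cminus z w)) w c.

Definition parabolic (phi : C -> C) : Prop :=
  exists w : C, Cmod w = 1 /\ denjoy_wolff_point phi w /\
    angular_derivative phi w (RtoC 1).

(* Main.v *)
Require Import Defs.
From Stdlib Require Import Reals Lra Lia Classical IndefiniteDescription List Cantor.
From Coquelicot Require Import Coquelicot.

(** Let [z_n] be an orbit of [phi] and [tau_n] the disk automorphism with [tau_n z_n = 0] and [tau_n z_{n+1} > 0].
    By Schwarz-Pick the maps [tau_n o phi^n] converge locally uniformly; positivity of the hyperbolic step makes
    the limit [sigma] non-constant and gives [sigma o phi = A o sigma] for a disk automorphism [A].  Julia's inequality
    for [phi] at its Denjoy-Wolff point, transported by [tau_n], shows that [A] is parabolic, so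
    [h = i (xi + sigma) / (xi - sigma)] satisfies [h o phi = h + b] with [b] real and non-zero.  Then
    [u = exp (i c h)], with [c > 0] such that [exp (i c b) = tau], solves [u o phi = tau u].

    To see that [u] is inner, call [f] inner in the mean if the averages of [1 - |f|^2] over the circles [|z| = r]
    tend to [0] as [r -> 1].  This property passes to compositions (compare the Taylor coefficients of the outer function
    through iterated backward shifts), to [sigma] (the quotients of the approximants are close to [1] in mean), and hence
    to [u], the composition of an atomic singular inner function with [conj xi * sigma].  Conversely a function inner in
    the mean has unimodular radial limits almost everywhere: on a short arc compare [u] with the phase [c] of one of its
    values; the positive harmonic function [1 - Re (conj c u)] has small boundary mass there, and a stopping time on dyadic
    intervals bounds its radial upper limit off a small set. *)

(** Radial limits are known only off a null set, and neither composition nor the limit defining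
    [sigma] respects such exceptional sets directly. The averaged condition [inner_mean] mentions
    only Riemann integrals of continuous functions over circles and survives both operations;
    [inner] is translated into it once at the start and recovered once at the end.

    The classification of A has to exclude two cases. If A moved the boundary point xi, then [sigma]
    would stay away from xi, its orbits would be recurrent, Julia's inequality would be an equality,
    and a Moebius image of [sigma] would have constant modulus. If A fixed xi with multiplier q > 1,
    it would move every point by a pseudo-hyperbolic distance of at least (q - 1) / (q + 1), while
    angular derivative 1 makes the steps of phi along the radius arbitrarily small. The translation
    length b can have either sign, so positivity of c is bought with a multiple of 2 pi in the
    argument of tau. *)

Ltac as_C_eq := match goal with |- @eq _ ?a ?b => change (@eq C a b) end.

(** * Modulus inequalities *)

Lemma Cmod_minus_sym (a b : C) : Cmod (a - b) = Cmod (b - a).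
Proof. rewrite <- Cmod_opp. f_equal. ring. Qed.

Lemma Cmod_minus_le (a b : C) : Cmod (a - b) <= Cmod a + Cmod b.
Proof.
  replace (a - b)%C with (a + - b)%C by ring.
  rewrite <- (Cmod_opp b). apply Cmod_triangle.
Qed.

Lemma Cmod_minus_ge (a b : C) : Cmod a - Cmod b <= Cmod (a - b).
Proof.
  pose proof (Cmod_triangle (a - b) b) as H.
  replace (a - b + b)%C with a in H by ring. lra.
Qed.

Lemma Cminus_diag (z : C) : (z - z)%C = RtoC 0.
Proof. ring. Qed.

Lemma Cmod_RtoC (x : R) : Cmod (RtoC x) = Rabs x.
Proof. apply Cmod_R. Qed.

Lemma Cmod_lt_neq (a b : C) : Cmod a < Cmod b -> (b - a)%C <> 0.
Proof.
  intros H E. pose proof (Cmod_minus_ge b a) as H1.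
  rewrite E, Cmod_0 in H1. lra.
Qed.

Lemma Cmod_sqr (z : C) : Cmod z * Cmod z = fst z * fst z + snd z * snd z.
Proof.
  unfold Cmod. rewrite sqrt_sqrt; [ring|].
  pose proof (pow2_ge_0 (fst z)); pose proof (pow2_ge_0 (snd z)); lra.
Qed.

Lemma Cmod_ge_fst (z : C) : Rabs (fst z) <= Cmod z.
Proof. apply re_le_Cmod. Qed.

Lemma Cmod_ge_snd (z : C) : Rabs (snd z) <= Cmod z.
Proof.
  rewrite <- (Rabs_pos_eq (Cmod z)) by apply Cmod_ge_0.
  apply Rsqr_le_abs_0. unfold Rsqr. rewrite Cmod_sqr.
  pose proof (Rle_0_sqr (fst z)) as H. unfold Rsqr in H. lra.
Qed.

Lemma Cmod_le_sum (z : C) : Cmod z <= Rabs (fst z) + Rabs (snd z).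
Proof.
  pose proof (Rabs_pos (fst z)); pose proof (Rabs_pos (snd z)).
  rewrite <- (Rabs_pos_eq (Cmod z)) by apply Cmod_ge_0.
  rewrite <- (Rabs_pos_eq (Rabs (fst z) + Rabs (snd z))) by lra.
  apply Rsqr_le_abs_0. unfold Rsqr. rewrite Cmod_sqr.
  replace (fst z * fst z) with (Rabs (fst z) * Rabs (fst z))
    by (rewrite <- Rabs_mult; apply Rabs_pos_eq; apply Rle_0_sqr).
  replace (snd z * snd z) with (Rabs (snd z) * Rabs (snd z))
    by (rewrite <- Rabs_mult; apply Rabs_pos_eq; apply Rle_0_sqr).
  nra.
Qed.

(** * Continuity and complex differentiability *)

(** The distance is a parameter so that one algebra of limits serves functions of a complex variable
    ([dC]) and functions of the angle ([dR]). *)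
Definition contg {T : Type} (d : T -> T -> R) (f : T -> C) (x : T) : Prop :=
  forall eps, 0 < eps -> exists delta, 0 < delta /\
    forall y, d y x < delta -> Cmod (f y - f x) < eps.

Definition dC (w z : C) : R := Cmod (w - z).
Definition dR (s t : R) : R := Rabs (s - t).
Notation ccont := (contg dC).
Notation pcont := (contg dR).

Lemma contg_const {T} (d : T -> T -> R) (c : C) x : contg d (fun _ => c) x.
Proof.
  intros e He. exists 1. split; [lra|]. intros y _.
  replace (c - c)%C with (RtoC 0) by ring. rewrite Cmod_0. exact He.
Qed.

Lemma contg_plus {T} (d : T -> T -> R) f g x :
  contg d f x -> contg d g x -> contg d (fun y => f y + g y)%C x.
Proof.
  intros Hf Hg e He.
  destruct (Hf (e/2)) as [a [Ha H1]]; [lra|].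
  destruct (Hg (e/2)) as [b [Hb H2]]; [lra|].
  exists (Rmin a b). split; [apply Rmin_pos; lra|].
  intros y Hy. pose proof (Rmin_l a b); pose proof (Rmin_r a b).
  replace (f y + g y - (f x + g x))%C with ((f y - f x) + (g y - g x))%C by ring.
  eapply Rle_lt_trans; [apply Cmod_triangle|].
  specialize (H1 y); specialize (H2 y). lra.
Qed.

Lemma contg_opp {T} (d : T -> T -> R) f x :
  contg d f x -> contg d (fun y => - f y)%C x.
Proof.
  intros Hf e He. destruct (Hf e He) as [a [Ha H1]]. exists a; split; [lra|].
  intros y Hy. replace (- f y - - f x)%C with (- (f y - f x))%C by ring.
  rewrite Cmod_opp. auto.
Qed.

Lemma contg_minus {T} (d : T -> T -> R) f g x :
  contg d f x -> contg d g x -> contg d (fun y => f y - g y)%C x.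
Proof. intros. apply contg_plus; [|apply contg_opp]; assumption. Qed.

Lemma contg_mult {T} (d : T -> T -> R) f g x :
  contg d f x -> contg d g x -> contg d (fun y => f y * g y)%C x.
Proof.
  intros Hf Hg e He.
  set (M := Cmod (f x) + Cmod (g x) + 1).
  pose proof (Cmod_ge_0 (f x)); pose proof (Cmod_ge_0 (g x)).
  assert (HM : 0 < M) by (unfold M; lra).
  assert (Hd : 0 < Rmin 1 (e / (2 * M))).
  { apply Rmin_pos; [lra|]. apply Rdiv_lt_0_compat; lra. }
  destruct (Hf _ Hd) as [a [Ha H1]].
  destruct (Hg _ Hd) as [b [Hb H2]].
  exists (Rmin a b). split; [apply Rmin_pos; lra|].
  intros y Hy. pose proof (Rmin_l a b); pose proof (Rmin_r a b).
  specialize (H1 y ltac:(lra)); specialize (H2 y ltac:(lra)).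
  pose proof (Rmin_l 1 (e / (2 * M))); pose proof (Rmin_r 1 (e / (2 * M))).
  set (t := Rmin 1 (e / (2 * M))) in *.
  replace (f y * g y - f x * g x)%C
    with ((f y - f x) * (g y - g x) + f x * (g y - g x) + g x * (f y - f x))%C by ring.
  pose proof (Cmod_ge_0 (f y - f x)); pose proof (Cmod_ge_0 (g y - g x)).
  assert (Cmod ((f y - f x) * (g y - g x) + f x * (g y - g x) + g x * (f y - f x))
    <= Cmod (f y - f x) * Cmod (g y - g x) + Cmod (f x) * Cmod (g y - g x)
       + Cmod (g x) * Cmod (f y - f x)).
  { rewrite <- !Cmod_mult. eapply Rle_trans; [apply Cmod_triangle|].
    apply Rplus_le_compat_r. apply Cmod_triangle. }
  assert (t * M <= e / 2).
  { apply Rle_trans with (e / (2 * M) * M); [apply Rmult_le_compat_r; lra|].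
    right. field. lra. }
  unfold M in *. nra.
Qed.

Lemma contg_Cmod {T} (d : T -> T -> R) f x :
  contg d f x -> contg d (fun y => RtoC (Cmod (f y))) x.
Proof.
  intros Hf e He. destruct (Hf e He) as [a [Ha H1]]. exists a; split; [lra|].
  intros y Hy. specialize (H1 y Hy). rewrite <- RtoC_minus, Cmod_RtoC.
  pose proof (Cmod_minus_ge (f y) (f x)). pose proof (Cmod_minus_ge (f x) (f y)).
  rewrite (Cmod_minus_sym (f x)) in H0. apply Rabs_def1; lra.
Qed.

Lemma contg_inv {T} (d : T -> T -> R) (f : T -> C) x :
  f x <> 0 -> contg d f x -> contg d (fun y => / f y)%C x.
Proof.
  intros Hn Hf e He.
  assert (Hm : 0 < Cmod (f x)) by (apply (proj1 (Cmod_gt_0 _)); exact Hn).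
  set (m := Cmod (f x)) in *.
  assert (Hd : 0 < Rmin (m / 2) (e * (m * m) / 4)).
  { apply Rmin_pos; [lra|]. assert (0 < e * (m * m)) by (repeat apply Rmult_lt_0_compat; lra). lra. }
  destruct (Hf _ Hd) as [a [Ha H1]]. exists a; split; [lra|].
  intros y Hy. specialize (H1 y Hy).
  pose proof (Rmin_l (m / 2) (e * (m * m) / 4)); pose proof (Rmin_r (m / 2) (e * (m * m) / 4)).
  pose proof (Cmod_minus_ge (f x) (f y)) as H3. rewrite Cmod_minus_sym in H3. fold m in H3.
  assert (Hy2 : m / 2 < Cmod (f y)) by lra.
  assert (Hny : f y <> 0) by (intro E; rewrite E, Cmod_0 in Hy2; lra).
  replace (/ f y - / f x)%C with (- (f y - f x) * / (f y * f x))%C by (field; auto).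
  rewrite Cmod_mult, Cmod_opp, Cmod_inv, Cmod_mult by (apply Cmult_neq_0; auto).
  fold m. apply Rmult_lt_reg_r with (Cmod (f y) * m). nra.
  rewrite Rmult_assoc, Rinv_l by nra.
  assert (e * (m * m) / 4 < e * (Cmod (f y) * m)) by nra. lra.
Qed.

Lemma contg_div {T} (d : T -> T -> R) (f g : T -> C) x :
  g x <> 0 -> contg d f x -> contg d g x -> contg d (fun y => f y / g y)%C x.
Proof. intros. apply contg_mult; [|apply contg_inv]; assumption. Qed.

Lemma contg_comp {T} (d : T -> T -> R) (f : C -> C) g x :
  ccont f (g x) -> contg d g x -> contg d (fun y => f (g y)) x.
Proof.
  intros Hf Hg e He. destruct (Hf e He) as [a [Ha H1]].
  destruct (Hg a Ha) as [b [Hb H2]]. exists b; split; [exact Hb|].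
  intros y Hy. apply H1, H2, Hy.
Qed.

Lemma contg_ext_loc {T} (d : T -> T -> R) f g x (r : R) : d x x = 0 -> 0 < r ->
  (forall y, d y x < r -> f y = g y) -> contg d f x -> contg d g x.
Proof.
  intros Hd Hr He Hf e H. destruct (Hf e H) as [a [Ha H1]].
  exists (Rmin a r). split; [apply Rmin_pos; lra|].
  intros y Hy. pose proof (Rmin_l a r); pose proof (Rmin_r a r).
  rewrite <- !He by lra. apply H1; lra.
Qed.

Lemma ccont_id z : ccont (fun w => w) z.
Proof. intros e He. exists e. auto. Qed.

(** Multiplying the error bound out by |w - z| admits w = z, so the chain rule needs no case
    distinction where the inner function repeats a value. *)
Definition cdiff (f : C -> C) (z l : C) : Prop :=
  forall eps, 0 < eps -> exists delta, 0 < delta /\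
    forall w, Cmod (w - z) < delta ->
      Cmod (f w - f z - l * (w - z)) <= eps * Cmod (w - z).

Lemma cdiff_is_derive f z l :
  cdiff f z l <-> is_derive (K := C_AbsRing) (V := C_NormedModule) f z l.
Proof.
  split.
  - intros H. split.
    + apply is_linear_scal_l.
    + intros y Hy. apply (@is_filter_lim_locally_unique C_AbsRing (AbsRing_NormedModule C_AbsRing)) in Hy. subst y.
      intros eps. destruct (H eps (cond_pos eps)) as [d [Hd H1]].
      exists (mkposreal d Hd). intros w Hw.
      specialize (H1 w Hw).
      unfold minus, plus, opp, scal, norm; simpl. unfold mult; simpl.
      replace (f w + - f z + - ((w + - z) * l))%C with (f w - f z - l * (w - z))%C by ring.
      exact H1.
  - intros [_ H] e He.
    destruct (H z (fun P h => h) (mkposreal e He)) as [d Hd].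
    exists d. split; [apply cond_pos|]. intros w Hw. specialize (Hd w Hw).
    unfold minus, plus, opp, scal, norm in Hd; simpl in Hd. unfold mult in Hd; simpl in Hd.
    replace (f w - f z - l * (w - z))%C with (f w + - f z + - ((w + - z) * l))%C by ring.
    exact Hd.
Qed.

Lemma cdiff_ccont f z l : cdiff f z l -> ccont f z.
Proof.
  intros H e He. destruct (H 1 ltac:(lra)) as [d [Hd H1]].
  pose proof (Cmod_ge_0 l).
  exists (Rmin d (e / (2 + Cmod l))).
  assert (0 < e / (2 + Cmod l)) by (apply Rdiv_lt_0_compat; lra).
  split; [apply Rmin_pos; lra|]. unfold dC. intros w Hw.
  pose proof (Rmin_l d (e / (2 + Cmod l))); pose proof (Rmin_r d (e / (2 + Cmod l))).
  specialize (H1 w ltac:(lra)).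
  replace (f w - f z)%C with ((f w - f z - l * (w - z)) + l * (w - z))%C by ring.
  eapply Rle_lt_trans; [apply Cmod_triangle|]. rewrite Cmod_mult.
  assert (Cmod (w - z) * (2 + Cmod l) < e).
  { apply Rlt_le_trans with (e / (2 + Cmod l) * (2 + Cmod l)); [apply Rmult_lt_compat_r; lra|].
    right; field; lra. }
  pose proof (Cmod_ge_0 (w - z)). nra.
Qed.

Lemma cdiff_const c z : cdiff (fun _ => c) z 0.
Proof.
  intros e He. exists 1. split; [lra|]. intros w _.
  replace (c - c - 0 * (w - z))%C with (RtoC 0) by ring. rewrite Cmod_0.
  apply Rmult_le_pos; [lra|apply Cmod_ge_0].
Qed.

Lemma cdiff_id z : cdiff (fun w => w) z 1.
Proof.
  intros e He. exists 1. split; [lra|]. intros w _.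
  replace (w - z - 1 * (w - z))%C with (RtoC 0) by ring. rewrite Cmod_0.
  apply Rmult_le_pos; [lra|apply Cmod_ge_0].
Qed.

Lemma cdiff_plus f g z l m : cdiff f z l -> cdiff g z m ->
  cdiff (fun w => f w + g w)%C z (l + m).
Proof.
  intros Hf Hg e He.
  destruct (Hf (e/2)) as [a [Ha H1]]; [lra|].
  destruct (Hg (e/2)) as [b [Hb H2]]; [lra|].
  exists (Rmin a b). split; [apply Rmin_pos; lra|].
  intros w Hw. pose proof (Rmin_l a b); pose proof (Rmin_r a b).
  specialize (H1 w ltac:(lra)); specialize (H2 w ltac:(lra)).
  replace (f w + g w - (f z + g z) - (l + m) * (w - z))%C
    with ((f w - f z - l * (w - z)) + (g w - g z - m * (w - z)))%C by ring.
  eapply Rle_trans; [apply Cmod_triangle|]. lra.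
Qed.

Lemma cdiff_comp f g z l m : cdiff f (g z) l -> cdiff g z m ->
  cdiff (fun w => f (g w)) z (l * m).
Proof.
  intros Hf Hg e He.
  pose proof (Cmod_ge_0 l); pose proof (Cmod_ge_0 m).
  set (e1 := Rmin 1 (e / (2 * (2 + Cmod m)))).
  set (e2 := Rmin 1 (e / (2 * (1 + Cmod l)))).
  assert (0 < e1) by (apply Rmin_pos; [lra|apply Rdiv_lt_0_compat; lra]).
  assert (0 < e2) by (apply Rmin_pos; [lra|apply Rdiv_lt_0_compat; lra]).
  assert (E1 : e1 * (2 + Cmod m) <= e / 2).
  { apply Rle_trans with (e / (2 * (2 + Cmod m)) * (2 + Cmod m)).
    apply Rmult_le_compat_r; [lra|apply Rmin_r]. right; field; lra. }
  assert (E2 : e2 * (1 + Cmod l) <= e / 2).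
  { apply Rle_trans with (e / (2 * (1 + Cmod l)) * (1 + Cmod l)).
    apply Rmult_le_compat_r; [lra|apply Rmin_r]. right; field; lra. }
  assert (E3 : e2 <= 1) by apply Rmin_l.
  destruct (Hf e1) as [a [Ha H3]]; [lra|].
  destruct (Hg e2) as [b [Hb H4]]; [lra|].
  destruct (cdiff_ccont _ _ _ Hg a Ha) as [c [Hc H5]]. unfold dC in H5.
  exists (Rmin b c). split; [apply Rmin_pos; lra|].
  intros w Hw. pose proof (Rmin_l b c); pose proof (Rmin_r b c).
  specialize (H4 w ltac:(lra)); specialize (H5 w ltac:(lra)).
  specialize (H3 (g w) H5).
  replace (f (g w) - f (g z) - l * m * (w - z))%C
    with ((f (g w) - f (g z) - l * (g w - g z)) + l * (g w - g z - m * (w - z)))%C by ring.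
  assert (Cmod (g w - g z) <= (1 + Cmod m) * Cmod (w - z)).
  { replace (g w - g z)%C with ((g w - g z - m * (w - z)) + m * (w - z))%C by ring.
    eapply Rle_trans; [apply Cmod_triangle|]. rewrite Cmod_mult.
    pose proof (Cmod_ge_0 (w - z)). nra. }
  eapply Rle_trans; [apply Cmod_triangle|]. rewrite Cmod_mult.
  pose proof (Cmod_ge_0 (w - z)).
  assert (Cmod l * Cmod (g w - g z - m * (w - z)) <= Cmod l * (e2 * Cmod (w - z)))
    by (apply Rmult_le_compat_l; lra).
  assert (e1 * Cmod (g w - g z) <= e1 * ((1 + Cmod m) * Cmod (w - z)))
    by (apply Rmult_le_compat_l; lra).
  assert (e1 * (2 + Cmod m) * Cmod (w - z) <= e / 2 * Cmod (w - z))
    by (apply Rmult_le_compat_r; lra).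
  assert (e2 * (1 + Cmod l) * Cmod (w - z) <= e / 2 * Cmod (w - z))
    by (apply Rmult_le_compat_r; lra).
  nra.
Qed.

Lemma cdiff_mult f g z l m : cdiff f z l -> cdiff g z m ->
  cdiff (fun w => f w * g w)%C z (l * g z + f z * m).
Proof.
  intros Hf Hg e He.
  pose proof (Cmod_ge_0 l); pose proof (Cmod_ge_0 m).
  pose proof (Cmod_ge_0 (f z)); pose proof (Cmod_ge_0 (g z)).
  set (M := Cmod l + Cmod m + Cmod (f z) + Cmod (g z) + 1).
  assert (HM : 1 <= M) by (unfold M; lra).
  assert (He1 : 0 < Rmin 1 (e / (4 * M)))
    by (apply Rmin_pos; [lra|apply Rdiv_lt_0_compat; lra]).
  destruct (Hf _ He1) as [a [Ha H3]].
  destruct (Hg _ He1) as [b [Hb H4]].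
  destruct (cdiff_ccont _ _ _ Hg _ He1) as [c [Hc H5]]. unfold dC in H5.
  exists (Rmin a (Rmin b c)). split; [repeat apply Rmin_pos; lra|].
  intros w Hw. pose proof (Rmin_l a (Rmin b c)); pose proof (Rmin_r a (Rmin b c)).
  pose proof (Rmin_l b c); pose proof (Rmin_r b c).
  specialize (H3 w ltac:(lra)); specialize (H4 w ltac:(lra)); specialize (H5 w ltac:(lra)).
  set (t := Rmin 1 (e / (4 * M))) in *.
  assert (Et : t * M <= e / 4).
  { apply Rle_trans with (e / (4 * M) * M).
    apply Rmult_le_compat_r; [lra|apply Rmin_r]. right; field; lra. }
  assert (Ht : t <= 1) by apply Rmin_l.
  replace (f w * g w - f z * g z - (l * g z + f z * m) * (w - z))%C
    with ((f w - f z - l * (w - z)) * (g w - g z) + (f w - f z - l * (w - z)) * g z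
          + l * (w - z) * (g w - g z) + f z * (g w - g z - m * (w - z)))%C by ring.
  eapply Rle_trans; [apply Cmod_triangle|].
  eapply Rle_trans; [apply Rplus_le_compat_r, Cmod_triangle|].
  eapply Rle_trans; [apply Rplus_le_compat_r, Rplus_le_compat_r, Cmod_triangle|].
  rewrite !Cmod_mult.
  set (x := Cmod (w - z)) in *. assert (0 <= x) by apply Cmod_ge_0.
  set (F := Cmod (f w - f z - l * (w - z))) in *. assert (0 <= F) by apply Cmod_ge_0.
  set (G := Cmod (g w - g z - m * (w - z))) in *. assert (0 <= G) by apply Cmod_ge_0.
  set (D := Cmod (g w - g z)) in *. assert (0 <= D) by apply Cmod_ge_0.
  assert (0 < t) by exact He1.
  assert (HT : 4 * (t * M) * x <= e * x) by (apply Rmult_le_compat_r; lra).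
  assert (F * D <= (t * x) * 1) by (apply Rmult_le_compat; lra).
  assert (F * Cmod (g z) <= t * x * Cmod (g z)) by (apply Rmult_le_compat_r; lra).
  assert (Cmod l * x * D <= Cmod l * x * t) by (apply Rmult_le_compat_l; [nra|lra]).
  assert (Cmod (f z) * G <= Cmod (f z) * (t * x)) by (apply Rmult_le_compat_l; lra).
  assert (0 <= t * x) by nra. unfold M in HT. nra.
Qed.

Lemma cdiff_ext_loc f g z l (r : R) : 0 < r ->
  (forall w, Cmod (w - z) < r -> f w = g w) -> cdiff f z l -> cdiff g z l.
Proof.
  intros Hr He Hf e H. destruct (Hf e H) as [a [Ha H1]].
  exists (Rmin a r). split; [apply Rmin_pos; lra|].
  intros w Hw. pose proof (Rmin_l a r); pose proof (Rmin_r a r).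
  rewrite <- !He. apply H1; lra. rewrite Cminus_diag, Cmod_0; lra. lra.
Qed.

Lemma cdiff_inv0 (z : C) : z <> 0 -> cdiff (fun w => / w)%C z (- / (z * z)).
Proof.
  intros Hz e He.
  assert (Hm : 0 < Cmod z) by (apply (proj1 (Cmod_gt_0 _)); exact Hz).
  set (m := Cmod z) in *.
  assert (Hm3 : 0 < m * m * m) by (repeat apply Rmult_lt_0_compat; lra).
  exists (Rmin (m / 2) (e * (m * m * m) / 2)).
  assert (0 < e * (m * m * m)) by (apply Rmult_lt_0_compat; lra).
  split; [apply Rmin_pos; lra|].
  intros w Hw.
  pose proof (Rmin_l (m / 2) (e * (m * m * m) / 2)); pose proof (Rmin_r (m / 2) (e * (m * m * m) / 2)).
  pose proof (Cmod_minus_ge z w) as H3. rewrite Cmod_minus_sym in H3. fold m in H3.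
  assert (Hy2 : m / 2 < Cmod w) by lra.
  assert (Hnw : w <> 0) by (intro E; rewrite E, Cmod_0 in Hy2; lra).
  replace (/ w - / z - - / (z * z) * (w - z))%C
    with ((w - z) * ((w - z) * / (z * z * w)))%C by (field; auto).
  rewrite Cmod_mult, (Cmod_mult (w - z)), Cmod_inv, !Cmod_mult
    by (repeat apply Cmult_neq_0; auto).
  fold m. rewrite (Rmult_comm e). apply Rmult_le_compat_l; [apply Cmod_ge_0|].
  assert (Hp : 0 < m * m * Cmod w) by (repeat apply Rmult_lt_0_compat; lra).
  apply Rmult_le_reg_r with (m * m * Cmod w); [exact Hp|].
  rewrite Rmult_assoc, Rinv_l by lra.
  assert (e * (m * m * m) / 2 <= e * (m * m * Cmod w)).
  { apply Rle_trans with (e * (m * m * (m / 2))); [lra|].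
    apply Rmult_le_compat_l; [lra|]. apply Rmult_le_compat_l; nra. }
  lra.
Qed.

(** The radius is a parameter because auxiliary functions, such as w -> 1 / (r^2 - conj z w), are
    considered on disks fitted to the circle of integration. *)
Definition hol (rad : R) (f : C -> C) : Prop :=
  forall z, Cmod z < rad -> exists l, cdiff f z l.

Lemma hol_on_disk f : holomorphic_on_disk f <-> hol 1 f.
Proof.
  split; intros H z Hz.
  - destruct (H z Hz) as [l Hl]. exists l. apply cdiff_is_derive, Hl.
  - destruct (H z Hz) as [l Hl]. exists l. apply cdiff_is_derive, Hl.
Qed.

Lemma hol_ccont rad f z : hol rad f -> Cmod z < rad -> ccont f z.
Proof. intros H Hz. destruct (H z Hz) as [l Hl]. eapply cdiff_ccont, Hl. Qed.

Lemma hol_sub rad rad' f : rad' <= rad -> hol rad f -> hol rad' f.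
Proof. intros H Hf z Hz. apply Hf. lra. Qed.

Lemma hol_const rad c : hol rad (fun _ => c).
Proof. intros z _. exists (RtoC 0). apply cdiff_const. Qed.

Lemma hol_id rad : hol rad (fun w => w).
Proof. intros z _. exists (RtoC 1). apply cdiff_id. Qed.

Lemma hol_plus rad f g : hol rad f -> hol rad g -> hol rad (fun w => f w + g w)%C.
Proof.
  intros Hf Hg z Hz. destruct (Hf z Hz) as [l Hl]. destruct (Hg z Hz) as [m Hm].
  eexists. apply cdiff_plus; eassumption.
Qed.

Lemma hol_mult rad f g : hol rad f -> hol rad g -> hol rad (fun w => f w * g w)%C.
Proof.
  intros Hf Hg z Hz. destruct (Hf z Hz) as [l Hl]. destruct (Hg z Hz) as [m Hm].
  eexists. apply cdiff_mult; eassumption.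
Qed.

Lemma hol_ext rad f g : (forall z, Cmod z < rad -> f z = g z) -> hol rad f -> hol rad g.
Proof.
  intros He Hf z Hz. destruct (Hf z Hz) as [l Hl]. exists l.
  apply cdiff_ext_loc with f (rad - Cmod z); [lra| |exact Hl].
  intros w Hw. apply He. pose proof (Cmod_triangle (w - z) z) as H.
  replace (w - z + z)%C with w in H by ring. lra.
Qed.

Lemma hol_opp rad f : hol rad f -> hol rad (fun w => - f w)%C.
Proof.
  intros Hf. apply hol_ext with (fun w => Copp (RtoC 1) * f w)%C.
  intros z _. ring.
  apply hol_mult; [apply hol_const|exact Hf].
Qed.

Lemma hol_minus rad f g : hol rad f -> hol rad g -> hol rad (fun w => f w - g w)%C.
Proof. intros. apply hol_plus; [|apply hol_opp]; assumption. Qed.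

Lemma hol_comp rad rad' f g : hol rad' f -> hol rad g ->
  (forall z, Cmod z < rad -> Cmod (g z) < rad') -> hol rad (fun w => f (g w)).
Proof.
  intros Hf Hg Hm z Hz. destruct (Hg z Hz) as [m Hl]. destruct (Hf (g z) (Hm z Hz)) as [l Hll].
  eexists. apply cdiff_comp; eassumption.
Qed.

Lemma hol_inv rad (f : C -> C) : hol rad f -> (forall z, Cmod z < rad -> f z <> 0) ->
  hol rad (fun w => / f w)%C.
Proof.
  intros Hf Hn z Hz. destruct (Hf z Hz) as [m Hl]. eexists.
  apply (cdiff_comp (fun w => / w)%C f z); [apply cdiff_inv0; auto|exact Hl].
Qed.

Lemma hol_div rad (f g : C -> C) : hol rad f -> hol rad g ->
  (forall z, Cmod z < rad -> g z <> 0) -> hol rad (fun w => f w / g w)%C.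
Proof. intros. apply hol_mult; [|apply hol_inv]; assumption. Qed.

(** * Integrals of complex functions of a real variable *)

Lemma pcont_fst g t : pcont g t -> continuous (fun s => fst (g s)) t.
Proof.
  intros H. apply continuity_pt_filterlim. intros e He.
  destruct (H e He) as [d [Hd H1]]. exists d. split; [exact Hd|].
  intros s [_ Hs]. unfold dist in *; simpl in *; unfold R_dist in *.
  eapply Rle_lt_trans; [|apply (H1 s Hs)]. apply (Cmod_ge_fst (g s - g t)).
Qed.

Lemma pcont_snd g t : pcont g t -> continuous (fun s => snd (g s)) t.
Proof.
  intros H. apply continuity_pt_filterlim. intros e He.
  destruct (H e He) as [d [Hd H1]]. exists d. split; [exact Hd|].
  intros s [_ Hs]. unfold dist in *; simpl in *; unfold R_dist in *.
  eapply Rle_lt_trans; [|apply (H1 s Hs)]. apply (Cmod_ge_snd (g s - g t)).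
Qed.

Lemma pcont_pair (f g : R -> R) t : continuous f t -> continuous g t ->
  pcont (fun s => (f s, g s)) t.
Proof.
  intros Hf Hg e He. apply continuity_pt_filterlim in Hf, Hg.
  destruct (Hf (e/2)) as [a [Ha H1]]; [lra|].
  destruct (Hg (e/2)) as [b [Hb H2]]; [lra|].
  exists (Rmin a b). split; [apply Rmin_pos; lra|].
  intros s Hs. pose proof (Rmin_l a b); pose proof (Rmin_r a b). unfold dR in Hs.
  destruct (Req_dec s t) as [->|Hn]. rewrite Cminus_diag, Cmod_0; exact He.
  eapply Rle_lt_trans; [apply Cmod_le_sum|]. simpl.
  assert (Rabs (f s + - f t) < e / 2) by (apply H1; split; [split; [exact I|auto]|unfold dist; simpl; unfold R_dist; lra]).
  assert (Rabs (g s + - g t) < e / 2) by (apply H2; split; [split; [exact I|auto]|unfold dist; simpl; unfold R_dist; lra]).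
  lra.
Qed.

Lemma pcont_RtoC (f : R -> R) t : continuous f t -> pcont (fun s => RtoC (f s)) t.
Proof. intros H. apply pcont_pair; [exact H|apply continuous_const]. Qed.

Definition pdiff (g : R -> C) (t : R) (l : C) : Prop :=
  is_derive (fun s => fst (g s)) t (fst l) /\ is_derive (fun s => snd (g s)) t (snd l).

Definition pdiff_eps (g : R -> C) (t : R) (l : C) : Prop :=
  forall eps, 0 < eps -> exists delta, 0 < delta /\
    forall s, Rabs (s - t) < delta ->
      Cmod (g s - g t - RtoC (s - t) * l) <= eps * Rabs (s - t).

Lemma is_derive_eps (f : R -> R) t l : is_derive f t l <->
  (forall eps, 0 < eps -> exists delta, 0 < delta /\
    forall s, Rabs (s - t) < delta -> Rabs (f s - f t - (s - t) * l) <= eps * Rabs (s - t)).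
Proof.
  split.
  - intros [_ H] e He. destruct (H t (fun P h => h) (mkposreal e He)) as [d Hd].
    exists d. split; [apply cond_pos|]. intros s Hs. exact (Hd s Hs).
  - intros H. split; [apply (is_linear_scal_l (K := R_AbsRing) (V := R_NormedModule))|].
    intros y Hy. apply (@is_filter_lim_locally_unique R_AbsRing (AbsRing_NormedModule R_AbsRing)) in Hy. subst y.
    intros eps. destruct (H eps (cond_pos eps)) as [d [Hd H1]].
    exists (mkposreal d Hd). intros w Hw. exact (H1 w Hw).
Qed.

(** The componentwise form is what the real fundamental theorem of calculus consumes; the form with
    eps is what composition with a complex derivative needs. *)
Lemma pdiff_iff g t l : pdiff g t l <-> pdiff_eps g t l.
Proof.
  assert (E1 : forall s, fst (g s - g t - RtoC (s - t) * l)%C = fst (g s) - fst (g t) - (s - t) * fst l)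
    by (intros; simpl; ring).
  assert (E2 : forall s, snd (g s - g t - RtoC (s - t) * l)%C = snd (g s) - snd (g t) - (s - t) * snd l)
    by (intros; simpl; ring).
  split.
  - intros [H1 H2] e He. pose proof (proj1 (is_derive_eps _ _ _) H1 (e/2) ltac:(lra)) as [a [Ha H3]].
    pose proof (proj1 (is_derive_eps _ _ _) H2 (e/2) ltac:(lra)) as [b [Hb H4]].
    exists (Rmin a b). split; [apply Rmin_pos; lra|].
    intros s Hs. pose proof (Rmin_l a b); pose proof (Rmin_r a b).
    specialize (H3 s ltac:(lra)); specialize (H4 s ltac:(lra)).
    eapply Rle_trans; [apply Cmod_le_sum|]. rewrite E1, E2. lra.
  - intros H. split; apply is_derive_eps; intros e He; destruct (H e He) as [a [Ha H3]];
      exists a; (split; [exact Ha|]); intros s Hs; specialize (H3 s Hs).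
    + rewrite <- E1. eapply Rle_trans; [apply Cmod_ge_fst|exact H3].
    + rewrite <- E2. eapply Rle_trans; [apply Cmod_ge_snd|exact H3].
Qed.

Lemma pdiff_pcont g t l : pdiff g t l -> pcont g t.
Proof.
  intros [H1 H2]. assert (H := pcont_pair _ _ t
    (ex_derive_continuous _ _ (ex_intro _ _ H1)) (ex_derive_continuous _ _ (ex_intro _ _ H2))).
  intros e He. destruct (H e He) as [d [Hd Hd2]]. exists d. split; [exact Hd|].
  intros s Hs. specialize (Hd2 s Hs). rewrite <- !surjective_pairing in Hd2. exact Hd2.
Qed.

Lemma pdiff_comp f g t l m : cdiff f (g t) m -> pdiff g t l ->
  pdiff (fun s => f (g s)) t (m * l).
Proof.
  intros Hf Hg. assert (Hcont := pdiff_pcont _ _ _ Hg).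
  apply pdiff_iff. apply pdiff_iff in Hg. intros e He.
  pose proof (Cmod_ge_0 l); pose proof (Cmod_ge_0 m).
  set (e1 := Rmin 1 (e / (2 * (2 + Cmod l)))).
  set (e2 := Rmin 1 (e / (2 * (1 + Cmod m)))).
  assert (0 < e1) by (apply Rmin_pos; [lra|apply Rdiv_lt_0_compat; lra]).
  assert (0 < e2) by (apply Rmin_pos; [lra|apply Rdiv_lt_0_compat; lra]).
  assert (E1 : e1 * (2 + Cmod l) <= e / 2).
  { apply Rle_trans with (e / (2 * (2 + Cmod l)) * (2 + Cmod l)).
    apply Rmult_le_compat_r; [lra|apply Rmin_r]. right; field; lra. }
  assert (E2 : e2 * (1 + Cmod m) <= e / 2).
  { apply Rle_trans with (e / (2 * (1 + Cmod m)) * (1 + Cmod m)).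
    apply Rmult_le_compat_r; [lra|apply Rmin_r]. right; field; lra. }
  assert (E3 : e2 <= 1) by apply Rmin_l.
  destruct (Hf e1) as [a [Ha H3]]; [lra|].
  destruct (Hg e2) as [b [Hb H4]]; [lra|].
  destruct (Hcont a Ha) as [c [Hc H5]]. unfold dR in H5.
  exists (Rmin b c). split; [apply Rmin_pos; lra|].
  intros s Hs. pose proof (Rmin_l b c); pose proof (Rmin_r b c).
  specialize (H4 s ltac:(lra)); specialize (H5 s ltac:(lra)).
  specialize (H3 (g s) H5).
  replace (f (g s) - f (g t) - RtoC (s - t) * (m * l))%C
    with ((f (g s) - f (g t) - m * (g s - g t)) + m * (g s - g t - RtoC (s - t) * l))%C by ring.
  assert (Cmod (g s - g t) <= (1 + Cmod l) * Rabs (s - t)).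
  { replace (g s - g t)%C with ((g s - g t - RtoC (s - t) * l) + RtoC (s - t) * l)%C by ring.
    eapply Rle_trans; [apply Cmod_triangle|]. rewrite Cmod_mult, Cmod_RtoC.
    pose proof (Rabs_pos (s - t)). nra. }
  eapply Rle_trans; [apply Cmod_triangle|]. rewrite Cmod_mult.
  pose proof (Rabs_pos (s - t)).
  assert (Cmod m * Cmod (g s - g t - RtoC (s - t) * l) <= Cmod m * (e2 * Rabs (s - t)))
    by (apply Rmult_le_compat_l; lra).
  assert (e1 * Cmod (g s - g t) <= e1 * ((1 + Cmod l) * Rabs (s - t)))
    by (apply Rmult_le_compat_l; lra).
  assert (e1 * (2 + Cmod l) * Rabs (s - t) <= e / 2 * Rabs (s - t))
    by (apply Rmult_le_compat_r; lra).
  assert (e2 * (1 + Cmod m) * Rabs (s - t) <= e / 2 * Rabs (s - t))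
    by (apply Rmult_le_compat_r; lra).
  nra.
Qed.

Ltac as_R_eq := match goal with |- @eq _ ?a ?b => refine (_ : @eq R a b) end.

(** As a pair of real integrals it inherits linearity, Chasles and the fundamental theorem from the
    components; only the norm estimate [CI_norm] passes through the integral in a normed module. *)
Definition CI (g : R -> C) (a b : R) : C :=
  (RInt (fun t => fst (g t)) a b, RInt (fun t => snd (g t)) a b).

Definition cont_on (g : R -> C) (a b : R) : Prop :=
  forall t, Rmin a b <= t <= Rmax a b -> pcont g t.

Lemma cont_on_fst g a b : cont_on g a b -> ex_RInt (fun t => fst (g t)) a b.
Proof. intros H. apply (ex_RInt_continuous (V := R_CompleteNormedModule)). intros t Ht. apply pcont_fst, H, Ht. Qed.

Lemma cont_on_snd g a b : cont_on g a b -> ex_RInt (fun t => snd (g t)) a b.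
Proof. intros H. apply (ex_RInt_continuous (V := R_CompleteNormedModule)). intros t Ht. apply pcont_snd, H, Ht. Qed.

Lemma CI_ext f g a b : (forall t, Rmin a b < t < Rmax a b -> f t = g t) -> CI f a b = CI g a b.
Proof.
  intros H. unfold CI. f_equal; apply (RInt_ext (V := R_CompleteNormedModule)); intros t Ht; rewrite H; auto.
Qed.

Lemma CI_plus f g a b : cont_on f a b -> cont_on g a b ->
  CI (fun t => f t + g t)%C a b = (CI f a b + CI g a b)%C.
Proof.
  intros Hf Hg. unfold CI, Cplus; simpl. f_equal.
  - apply (RInt_plus (V := R_CompleteNormedModule)); apply cont_on_fst; assumption.
  - apply (RInt_plus (V := R_CompleteNormedModule)); apply cont_on_snd; assumption.
Qed.

Lemma RInt_ext_R (f g : R -> R) a b : (forall t, Rmin a b < t < Rmax a b -> f t = g t) ->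
  RInt f a b = RInt g a b.
Proof. apply (RInt_ext (V := R_CompleteNormedModule)). Qed.

Lemma RInt_lin2 (f g : R -> R) x y a b : ex_RInt f a b -> ex_RInt g a b ->
  RInt (fun t => x * f t + y * g t) a b = x * RInt f a b + y * RInt g a b.
Proof.
  intros Hf Hg.
  rewrite (RInt_plus (V := R_CompleteNormedModule) (fun t => x * f t) (fun t => y * g t)).
  - apply f_equal2; apply (RInt_scal (V := R_CompleteNormedModule)); assumption.
  - apply (ex_RInt_scal (V := R_CompleteNormedModule)); exact Hf.
  - apply (ex_RInt_scal (V := R_CompleteNormedModule)); exact Hg.
Qed.

Lemma RInt_scal_R c (f : R -> R) a b : ex_RInt f a b -> RInt (fun t => c * f t) a b = c * RInt f a b.
Proof. intros H. apply (RInt_scal (V := R_CompleteNormedModule)), H. Qed.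

Lemma RInt_plus_R (f g : R -> R) a b : ex_RInt f a b -> ex_RInt g a b ->
  RInt (fun t => f t + g t) a b = RInt f a b + RInt g a b.
Proof. intros. apply (RInt_plus (V := R_CompleteNormedModule)); assumption. Qed.

Lemma RInt_minus_R (f g : R -> R) a b : ex_RInt f a b -> ex_RInt g a b ->
  RInt (fun t => f t - g t) a b = RInt f a b - RInt g a b.
Proof. intros. apply (RInt_minus (V := R_CompleteNormedModule)); assumption. Qed.

Lemma RInt_const_R c a b : RInt (fun _ => c) a b = (b - a) * c.
Proof. apply (RInt_const (V := R_CompleteNormedModule)). Qed.

Lemma RInt_Chasles_R (f : R -> R) a b c : ex_RInt f a b -> ex_RInt f b c ->
  RInt f a b + RInt f b c = RInt f a c.
Proof. apply (RInt_Chasles (V := R_CompleteNormedModule)). Qed.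

Lemma ex_RInt_cont (f : R -> R) a b : (forall t, continuous f t) -> ex_RInt f a b.
Proof. intros H. apply (ex_RInt_continuous (V := R_CompleteNormedModule)). intros t _. apply H. Qed.

Lemma ex_RInt_plus_R (f g : R -> R) a b : ex_RInt f a b -> ex_RInt g a b -> ex_RInt (fun t => f t + g t) a b.
Proof. apply (ex_RInt_plus (V := R_NormedModule)). Qed.

Lemma ex_RInt_minus_R (f g : R -> R) a b : ex_RInt f a b -> ex_RInt g a b -> ex_RInt (fun t => f t - g t) a b.
Proof. apply (ex_RInt_minus (V := R_NormedModule)). Qed.

Lemma ex_RInt_scal_R c (f : R -> R) a b : ex_RInt f a b -> ex_RInt (fun t => c * f t) a b.
Proof. intros H. apply (ex_RInt_scal (V := R_NormedModule)), H. Qed.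

Lemma CI_scal c g a b : cont_on g a b -> CI (fun t => c * g t)%C a b = (c * CI g a b)%C.
Proof.
  intros Hg. pose proof (cont_on_fst _ _ _ Hg); pose proof (cont_on_snd _ _ _ Hg).
  unfold CI, Cmult; simpl. f_equal.
  - transitivity (RInt (fun t => fst c * fst (g t) + (- snd c) * snd (g t)) a b).
    apply RInt_ext_R; intros; simpl; ring.
    rewrite RInt_lin2 by assumption. as_R_eq. ring.
  - transitivity (RInt (fun t => fst c * snd (g t) + snd c * fst (g t)) a b).
    apply RInt_ext_R; intros; simpl; ring.
    rewrite RInt_lin2 by assumption. as_R_eq. ring.
Qed.

Lemma cont_on_scal c g a b : cont_on g a b -> cont_on (fun t => c * g t)%C a b.
Proof. intros Hg t Ht. apply contg_mult; auto. apply contg_const. Qed.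

Lemma CI_minus f g a b : cont_on f a b -> cont_on g a b ->
  CI (fun t => f t - g t)%C a b = (CI f a b - CI g a b)%C.
Proof.
  intros Hf Hg. transitivity (CI (fun t => f t + Copp (RtoC 1) * g t)%C a b).
  - apply CI_ext; intros. ring.
  - rewrite CI_plus, CI_scal by (try assumption; apply cont_on_scal; assumption).
    ring.
Qed.

Lemma CI_const c a b : CI (fun _ => c) a b = (RtoC (b - a) * c)%C.
Proof.
  unfold CI. rewrite !(RInt_const (V := R_CompleteNormedModule)). unfold scal; simpl; unfold mult; simpl.
  unfold Cmult; simpl. f_equal; ring.
Qed.

Lemma CI_Chasles g a b c : cont_on g a b -> cont_on g b c -> (CI g a b + CI g b c = CI g a c)%C.
Proof.
  intros H1 H2. unfold CI, Cplus; simpl. f_equal.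
  - apply (RInt_Chasles (V := R_CompleteNormedModule)); apply cont_on_fst; assumption.
  - apply (RInt_Chasles (V := R_CompleteNormedModule)); apply cont_on_snd; assumption.
Qed.

Lemma CI_norm g a b : a <= b -> cont_on g a b ->
  Cmod (CI g a b) <= RInt (fun t => Cmod (g t)) a b.
Proof.
  intros Hab Hg.
  assert (H : is_RInt (V := C_R_NormedModule) g a b (CI g a b)).
  { apply (is_RInt_fct_extend_pair (U := R_NormedModule) (V := R_NormedModule));
      apply (RInt_correct (V := R_CompleteNormedModule));
      [apply cont_on_fst|apply cont_on_snd]; assumption. }
  assert (H2 : ex_RInt (fun t => Cmod (g t)) a b).
  { apply (ex_RInt_continuous (V := R_CompleteNormedModule)). intros t Ht.
    apply (pcont_fst (fun t => RtoC (Cmod (g t)))). apply contg_Cmod, Hg, Ht. }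
  (* The product norm of this module is the Euclidean one, hence the modulus. *)
  assert (E : forall z : C, Cmod z = @norm R_AbsRing C_R_NormedModule z).
  { intros z. unfold norm; simpl. unfold Cmod, prod_norm. f_equal.
    unfold norm; simpl. unfold abs; simpl.
    pose proof (pow2_abs (fst z)) as E1; pose proof (pow2_abs (snd z)) as E2.
    simpl in *. lra. }
  rewrite E. eapply norm_RInt_le; [exact Hab| |exact H|apply (RInt_correct (V := R_CompleteNormedModule)); exact H2].
  intros t Ht. rewrite <- E. lra.
Qed.

Lemma CI_bound g a b M : cont_on g a b ->
  (forall t, Rmin a b <= t <= Rmax a b -> Cmod (g t) <= M) -> Cmod (CI g a b) <= M * Rabs (b - a).
Proof.
  assert (Main : forall a b, a <= b -> cont_on g a b ->
    (forall t, Rmin a b <= t <= Rmax a b -> Cmod (g t) <= M) -> Cmod (CI g a b) <= M * Rabs (b - a)).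
  { clear a b. intros a b Hab Hg HM. eapply Rle_trans; [apply CI_norm; assumption|].
    rewrite Rabs_pos_eq by lra.
    replace (M * (b - a)) with (RInt (fun _ => M) a b)
      by (rewrite (RInt_const (V := R_CompleteNormedModule)); unfold scal; simpl; unfold mult; simpl; ring).
    apply RInt_le; [exact Hab| |apply ex_RInt_const|].
    - apply (ex_RInt_continuous (V := R_CompleteNormedModule)). intros t Ht.
      apply (pcont_fst (fun t => RtoC (Cmod (g t)))). apply contg_Cmod, Hg, Ht.
    - intros t Ht. apply HM. rewrite Rmin_left, Rmax_right by lra. lra. }
  intros Hg HM. destruct (Rle_dec a b) as [H|H]; [apply Main; assumption|].
  assert (E : CI g a b = (- CI g b a)%C).
  { assert (Hg' : cont_on g b a) by (intros t Ht; apply Hg; rewrite Rmin_comm, Rmax_comm; exact Ht).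
    unfold CI, Copp; cbn [fst snd]. f_equal; symmetry.
    - apply (opp_RInt_swap (V := R_CompleteNormedModule) _ _ _ (cont_on_fst g b a Hg')).
    - apply (opp_RInt_swap (V := R_CompleteNormedModule) _ _ _ (cont_on_snd g b a Hg')). }
  rewrite E, Cmod_opp, Rabs_minus_sym. apply Main; [lra| |].
  - intros t Ht. apply Hg. rewrite Rmin_comm, Rmax_comm; exact Ht.
  - intros t Ht. apply HM. rewrite Rmin_comm, Rmax_comm; exact Ht.
Qed.

Lemma CI_FTC G g a b : (forall t, Rmin a b <= t <= Rmax a b -> pdiff G t (g t)) ->
  cont_on g a b -> CI g a b = (G b - G a)%C.
Proof.
  intros HG Hg. unfold CI.
  rewrite (surjective_pairing (G b - G a)%C). f_equal;
  apply is_RInt_unique; simpl.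
  - apply (is_RInt_derive (V := R_CompleteNormedModule) (fun t => fst (G t))).
    + intros t Ht. apply HG, Ht.
    + intros t Ht. apply pcont_fst, Hg, Ht.
  - apply (is_RInt_derive (V := R_CompleteNormedModule) (fun t => snd (G t))).
    + intros t Ht. apply HG, Ht.
    + intros t Ht. apply pcont_snd, Hg, Ht.
Qed.

(** Both [s] and [u + s] decrease and are bounded below, so [u] converges as their difference. The
    explicit rate is used for the bisection in Goursat's theorem, for the normalised iterates and
    for the boundary measure. *)
Lemma telescoping_cauchy (u s : nat -> R) :
  (forall n, Rabs (u (S n) - u n) <= s n - s (S n)) -> (forall n, 0 <= s n) ->
  exists l : R, is_lim_seq u l /\ forall n, Rabs (l - u n) <= s n.
Proof.
  intros H H0.
  assert (Hs : forall n, s (S n) <= s n) by (intro n; specialize (H n); pose proof (Rabs_pos (u (S n) - u n)); lra).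
  assert (Hmn : forall n k, Rabs (u (n + k)%nat - u n) <= s n - s (n + k)%nat).
  { intros n k. induction k as [|k IH].
    - rewrite Nat.add_0_r, !Rminus_diag, Rabs_R0. lra.
    - rewrite Nat.add_succ_r. specialize (H (n + k)%nat).
      replace (u (S (n + k)) - u n) with ((u (S (n + k)) - u (n + k)%nat) + (u (n + k)%nat - u n)) by ring.
      eapply Rle_trans; [apply Rabs_triang|]. lra. }
  destruct (ex_finite_lim_seq_decr s 0 Hs H0) as [ls Hls].
  destruct (ex_finite_lim_seq_decr (fun n => u n + s n) (u O - s O)) as [lu Hlu].
  - intros n. specialize (H n). apply Rabs_le_between in H. lra.
  - intros n. specialize (Hmn O n). simpl in Hmn. apply Rabs_le_between in Hmn.
    specialize (H0 n). lra.
  - exists (lu - ls).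
    assert (Hu : is_lim_seq u (lu - ls)).
    { apply is_lim_seq_ext with (fun n => u n + s n - s n); [intros; ring|].
      apply is_lim_seq_minus'; assumption. }
    split; [exact Hu|]. intros n.
    apply is_lim_seq_incr_n with (N := n) in Hu.
    assert (Hb : forall k, - s n <= u (k + n)%nat - u n <= s n).
    { intros k. rewrite Nat.add_comm. specialize (Hmn n k). apply Rabs_le_between.
      specialize (H0 (n + k)%nat). lra. }
    apply Rabs_le_between. split.
    + assert (is_lim_seq (fun k => u (k + n)%nat - u n) (lu - ls - u n))
        by (apply is_lim_seq_minus'; [exact Hu|apply is_lim_seq_const]).
      apply (is_lim_seq_le (fun _ => - s n) (fun k => u (k + n)%nat - u n) (- s n) (lu - ls - u n));
        [intro k; apply Hb|apply is_lim_seq_const|assumption].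
    + assert (is_lim_seq (fun k => u (k + n)%nat - u n) (lu - ls - u n))
        by (apply is_lim_seq_minus'; [exact Hu|apply is_lim_seq_const]).
      apply (is_lim_seq_le (fun k => u (k + n)%nat - u n) (fun _ => s n) (lu - ls - u n) (s n));
        [intro k; apply Hb|assumption|apply is_lim_seq_const].
Qed.

Lemma C2_nz : RtoC 2 <> 0.
Proof. intros E. apply RtoC_inj in E. lra. Qed.

(** * The Cauchy-Goursat theorem *)

(** The endpoints are unordered because primitives are built from rectangles with one corner at 0
    and the opposite one in any quadrant. *)
Definition btw (a b t : R) : Prop := Rmin a b <= t <= Rmax a b.

Lemma btw_l a b : btw a b a.
Proof. unfold btw, Rmin, Rmax; destruct (Rle_dec a b); lra. Qed.

Lemma btw_r a b : btw a b b.
Proof. unfold btw, Rmin, Rmax; destruct (Rle_dec a b); lra. Qed.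

Lemma btw_sub a b c d t : btw a b c -> btw a b d -> btw c d t -> btw a b t.
Proof.
  unfold btw, Rmin, Rmax; destruct (Rle_dec a b), (Rle_dec c d); lra.
Qed.

Lemma btw_dist a b s t : btw a b s -> btw a b t -> Rabs (s - t) <= Rabs (b - a).
Proof.
  unfold btw, Rmin, Rmax, Rabs; destruct (Rle_dec a b), (Rcase_abs (s - t)), (Rcase_abs (b - a)); lra.
Qed.

Definition rect (f : C -> C) (x0 x1 y0 y1 : R) : C :=
  (CI (fun t => f (t, y0)) x0 x1 + Ci * CI (fun t => f (x1, t)) y0 y1
   - CI (fun t => f (t, y1)) x0 x1 - Ci * CI (fun t => f (x0, t)) y0 y1)%C.

Definition cont_rect (f : C -> C) (x0 x1 y0 y1 : R) : Prop :=
  forall x y, btw x0 x1 x -> btw y0 y1 y -> ccont f (x, y).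

Lemma pdiff_horiz y t : pdiff (fun s => (s, y)) t (RtoC 1).
Proof. split; simpl; [apply (is_derive_id (K := R_AbsRing))|apply (is_derive_const (K := R_AbsRing) (V := R_NormedModule))]. Qed.

Lemma pdiff_vert x t : pdiff (fun s => (x, s)) t Ci.
Proof. split; simpl; [apply (is_derive_const (K := R_AbsRing) (V := R_NormedModule))|apply (is_derive_id (K := R_AbsRing))]. Qed.

Lemma pcont_horiz f x y : ccont f (x, y) -> pcont (fun s => f (s, y)) x.
Proof.
  intros H. apply (contg_comp dR f (fun s => (s, y)) x H).
  eapply pdiff_pcont, pdiff_horiz.
Qed.

Lemma pcont_vert f x y : ccont f (x, y) -> pcont (fun s => f (x, s)) y.
Proof.
  intros H. apply (contg_comp dR f (fun s => (x, s)) y H).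
  eapply pdiff_pcont, pdiff_vert.
Qed.

Lemma cont_rect_horiz f x0 x1 y0 y1 y a b : cont_rect f x0 x1 y0 y1 -> btw y0 y1 y ->
  btw x0 x1 a -> btw x0 x1 b -> cont_on (fun t => f (t, y)) a b.
Proof. intros H Hy Ha Hb t Ht. apply pcont_horiz, H; [apply btw_sub with a b|]; assumption. Qed.

Lemma cont_rect_vert f x0 x1 y0 y1 x a b : cont_rect f x0 x1 y0 y1 -> btw x0 x1 x ->
  btw y0 y1 a -> btw y0 y1 b -> cont_on (fun t => f (x, t)) a b.
Proof. intros H Hy Ha Hb t Ht. apply pcont_vert, H; [|apply btw_sub with a b]; assumption. Qed.

Lemma cont_rect_sub f x0 x1 y0 y1 a b c d : cont_rect f x0 x1 y0 y1 ->
  btw x0 x1 a -> btw x0 x1 b -> btw y0 y1 c -> btw y0 y1 d -> cont_rect f a b c d.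
Proof.
  intros H Ha Hb Hc Hd x y Hx Hy.
  apply H; [apply (btw_sub _ _ a b)|apply (btw_sub _ _ c d)]; assumption.
Qed.

Lemma rect_split_x f x0 x1 y0 y1 m : cont_rect f x0 x1 y0 y1 -> btw x0 x1 m ->
  rect f x0 x1 y0 y1 = (rect f x0 m y0 y1 + rect f m x1 y0 y1)%C.
Proof.
  intros H Hm. unfold rect.
  rewrite <- (CI_Chasles (fun t => f (t, y0)) x0 m x1), <- (CI_Chasles (fun t => f (t, y1)) x0 m x1).
  ring.
  all: eapply cont_rect_horiz; eauto using btw_l, btw_r.
Qed.

Lemma rect_split_y f x0 x1 y0 y1 m : cont_rect f x0 x1 y0 y1 -> btw y0 y1 m ->
  rect f x0 x1 y0 y1 = (rect f x0 x1 y0 m + rect f x0 x1 m y1)%C.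
Proof.
  intros H Hm. unfold rect.
  rewrite <- (CI_Chasles (fun t => f (x0, t)) y0 m y1), <- (CI_Chasles (fun t => f (x1, t)) y0 m y1).
  ring.
  all: eapply cont_rect_vert; eauto using btw_l, btw_r.
Qed.

Lemma rect_primitive F f x0 x1 y0 y1 : cont_rect f x0 x1 y0 y1 ->
  (forall x y, btw x0 x1 x -> btw y0 y1 y -> cdiff F (x, y) (f (x, y))) ->
  rect f x0 x1 y0 y1 = 0.
Proof.
  intros Hc HF. unfold rect.
  assert (H : forall y, btw y0 y1 y -> CI (fun t => f (t, y)) x0 x1 = (F (x1, y) - F (x0, y))%C).
  { intros y Hy. apply (CI_FTC (fun t => F (t, y))).
    - intros t Ht. replace (f (t, y)) with (f (t, y) * 1)%C by ring.
      apply (pdiff_comp F (fun t => (t, y))); [apply HF; assumption|apply pdiff_horiz].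
    - eapply cont_rect_horiz; eauto using btw_l, btw_r. }
  assert (V : forall x, btw x0 x1 x -> (Ci * CI (fun t => f (x, t)) y0 y1 = F (x, y1) - F (x, y0))%C).
  { intros x Hx. rewrite <- CI_scal by (eapply cont_rect_vert; eauto using btw_l, btw_r).
    apply (CI_FTC (fun t => F (x, t))).
    - intros t Ht. rewrite Cmult_comm.
      apply (pdiff_comp F (fun t => (x, t))); [apply HF; assumption|apply pdiff_vert].
    - apply cont_on_scal. eapply cont_rect_vert; eauto using btw_l, btw_r. }
  rewrite !H, !V by auto using btw_l, btw_r. ring.
Qed.

Lemma rect_minus f g x0 x1 y0 y1 : cont_rect f x0 x1 y0 y1 -> cont_rect g x0 x1 y0 y1 ->
  rect (fun z => f z - g z)%C x0 x1 y0 y1 = (rect f x0 x1 y0 y1 - rect g x0 x1 y0 y1)%C.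
Proof.
  intros Hf Hg. unfold rect.
  rewrite !(CI_minus (fun t => f (t, _))), !(CI_minus (fun t => f (_, t))).
  ring.
  all: first [eapply cont_rect_horiz; eauto using btw_l, btw_r; fail
             |eapply cont_rect_vert; eauto using btw_l, btw_r].
Qed.

Lemma rect_bound f x0 x1 y0 y1 M : cont_rect f x0 x1 y0 y1 ->
  (forall x y, btw x0 x1 x -> btw y0 y1 y -> Cmod (f (x, y)) <= M) ->
  Cmod (rect f x0 x1 y0 y1) <= 2 * M * (Rabs (x1 - x0) + Rabs (y1 - y0)).
Proof.
  intros Hc HM. unfold rect.
  assert (H : forall y, btw y0 y1 y -> Cmod (CI (fun t => f (t, y)) x0 x1) <= M * Rabs (x1 - x0)).
  { intros y Hy. apply CI_bound.
    - eapply cont_rect_horiz; eauto using btw_l, btw_r.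
    - intros t Ht. apply HM; assumption. }
  assert (V : forall x, btw x0 x1 x -> Cmod (Ci * CI (fun t => f (x, t)) y0 y1) <= M * Rabs (y1 - y0)).
  { intros x Hx. rewrite Cmod_mult, Cmod_Ci, Rmult_1_l. apply CI_bound.
    - eapply cont_rect_vert; eauto using btw_l, btw_r.
    - intros t Ht. apply HM; assumption. }
  pose proof (H y0 (btw_l _ _)). pose proof (H y1 (btw_r _ _)).
  pose proof (V x0 (btw_l _ _)). pose proof (V x1 (btw_r _ _)).
  eapply Rle_trans; [apply Cmod_minus_le|].
  eapply Rle_trans; [apply Rplus_le_compat_r, Cmod_minus_le|].
  eapply Rle_trans; [apply Rplus_le_compat_r, Rplus_le_compat_r, Cmod_triangle|]. lra.
Qed.

(* Along a primitive of the affine part of [f] at [z] the boundary integral vanishes, so only the remainder contributes. *)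
Lemma rect_local f z l : cdiff f z l -> forall eps, 0 < eps -> exists delta, 0 < delta /\
  forall x0 x1 y0 y1, cont_rect f x0 x1 y0 y1 ->
    (forall x y, btw x0 x1 x -> btw y0 y1 y -> Cmod ((x, y) - z) <= 2 * (Rabs (x1 - x0) + Rabs (y1 - y0))) ->
    2 * (Rabs (x1 - x0) + Rabs (y1 - y0)) < delta ->
    Cmod (rect f x0 x1 y0 y1) <= eps * (Rabs (x1 - x0) + Rabs (y1 - y0)) * (Rabs (x1 - x0) + Rabs (y1 - y0)).
Proof.
  intros Hf eps He. destruct (Hf (eps / 4)) as [d [Hd H1]]; [lra|].
  exists d. split; [exact Hd|]. intros x0 x1 y0 y1 Hc Hz Hl.
  set (g := fun w : C => (f z + l * (w - z))%C).
  set (G := fun w : C => (f z * w + l * (w * w * / 2 - z * w))%C).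
  assert (HG : forall w, cdiff G w (g w)).
  { intros w. unfold G, g.
    replace (f z + l * (w - z))%C
      with ((0 * w + f z * 1) + (0 * (w * w * / 2 - z * w)
         + l * (((1 * w + w * 1) * / 2 + w * w * 0) + - (0 * w + z * 1))))%C by (field; exact C2_nz).
    apply cdiff_plus.
    - apply (cdiff_mult (fun _ => f z)); [apply cdiff_const|apply cdiff_id].
    - apply (cdiff_mult (fun _ => l) (fun w => w * w * / 2 - z * w)%C); [apply cdiff_const|].
      apply cdiff_plus.
      + apply (cdiff_mult (fun w => w * w)%C (fun _ => / 2)%C); [|apply cdiff_const].
        apply (cdiff_mult (fun w => w) (fun w => w)); apply cdiff_id.
      + apply cdiff_ext_loc with (fun w => (- (RtoC 1)) * (z * w))%C 1; [lra| |].
        intros; ring.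
        replace (- (0 * w + z * 1))%C with (0 * (z * w) + (- RtoC 1) * (0 * w + z * 1))%C by ring.
        apply (cdiff_mult (fun _ => - RtoC 1)%C (fun w => z * w)%C); [apply cdiff_const|].
        apply (cdiff_mult (fun _ => z)); [apply cdiff_const|apply cdiff_id]. }
  assert (Hg : forall w, ccont g w).
  { intros w. unfold g. apply contg_plus; [apply contg_const|].
    apply contg_mult; [apply contg_const|]. apply contg_minus; [apply ccont_id|apply contg_const]. }
  assert (Hgc : cont_rect g x0 x1 y0 y1) by (intros x y _ _; apply Hg).
  assert (E : rect f x0 x1 y0 y1 = rect (fun w => f w - g w)%C x0 x1 y0 y1).
  { rewrite rect_minus by assumption. rewrite (rect_primitive G g) by (auto; intros; apply HG). ring. }
  rewrite E.
  set (L := Rabs (x1 - x0) + Rabs (y1 - y0)) in *.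
  replace (eps * L * L) with (2 * (eps / 2 * L) * L) by field.
  apply rect_bound.
  - intros x y Hx' Hy'. apply contg_minus; [apply Hc|apply Hg]; assumption.
  - intros x y Hx' Hy'. unfold g.
    specialize (Hz x y Hx' Hy').
    specialize (H1 (x, y) ltac:(lra)).
    replace (f (x, y) - (f z + l * ((x, y) - z)))%C with (f (x, y) - f z - l * ((x, y) - z))%C by ring.
    eapply Rle_trans; [apply H1|].
    replace (eps / 2 * L) with (eps / 4 * (2 * L)) by field. apply Rmult_le_compat_l; lra.
Qed.

Section Goursat.
Variable f : C -> C.
Variables a0 a1 b0 b1 : R.
Hypothesis Hf : forall x y, btw a0 a1 x -> btw b0 b1 y -> exists l, cdiff f (x, y) l.

Let box : Type := ((R * R) * (R * R))%type.
Let bI (q : box) : C := rect f (fst (fst q)) (snd (fst q)) (fst (snd q)) (snd (snd q)).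
Let quarter (q : box) (i j : bool) : box :=
  let '((x0, x1), (y0, y1)) := q in
  ((if i then (x0, (x0 + x1) / 2) else ((x0 + x1) / 2, x1)),
   (if j then (y0, (y0 + y1) / 2) else ((y0 + y1) / 2, y1))).
Let next (q : box) : box :=
  if Rle_dec (Cmod (bI q) / 4) (Cmod (bI (quarter q true true))) then quarter q true true else
  if Rle_dec (Cmod (bI q) / 4) (Cmod (bI (quarter q true false))) then quarter q true false else
  if Rle_dec (Cmod (bI q) / 4) (Cmod (bI (quarter q false true))) then quarter q false true else
  quarter q false false.
Let bx (n : nat) : box := Nat.iter n next ((a0, a1), (b0, b1)).
Let inb (q : box) : Prop := btw a0 a1 (fst (fst q)) /\ btw a0 a1 (snd (fst q)) /\
  btw b0 b1 (fst (snd q)) /\ btw b0 b1 (snd (snd q)).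

Lemma goursat_cont q : inb q -> cont_rect f (fst (fst q)) (snd (fst q)) (fst (snd q)) (snd (snd q)).
Proof.
  intros [H1 [H2 [H3 H4]]] x y Hx Hy.
  destruct (Hf x y) as [l Hl]; [eapply btw_sub; [exact H1|exact H2|exact Hx]|eapply btw_sub; [exact H3|exact H4|exact Hy]|].
  eapply cdiff_ccont, Hl.
Qed.

Lemma btw_mid a b : btw a b ((a + b) / 2).
Proof. unfold btw, Rmin, Rmax; destruct (Rle_dec a b); lra. Qed.

Lemma goursat_quarter_inb q i j : inb q -> inb (quarter q i j).
Proof.
  destruct q as [[x0 x1] [y0 y1]]. unfold inb; simpl. intros [H1 [H2 [H3 H4]]].
  pose proof (btw_sub _ _ _ _ _ H1 H2 (btw_mid x0 x1)).
  pose proof (btw_sub _ _ _ _ _ H3 H4 (btw_mid y0 y1)).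
  destruct i, j; simpl; tauto.
Qed.

Lemma goursat_next_ex q : exists i j, next q = quarter q i j.
Proof.
  unfold next.
  destruct (Rle_dec _ _); [eexists; eexists; reflexivity|].
  destruct (Rle_dec _ _); [eexists; eexists; reflexivity|].
  destruct (Rle_dec _ _); eexists; eexists; reflexivity.
Qed.

(** The four quarters add up to the whole, so if three of them fall below a quarter of its modulus,
    the fourth, which [next] takes without a test, cannot. *)
Lemma goursat_next_ge q : inb q -> Cmod (bI q) / 4 <= Cmod (bI (next q)).
Proof.
  intros Hq.
  assert (E : bI q = (bI (quarter q true true) + bI (quarter q true false)
     + bI (quarter q false true) + bI (quarter q false false))%C).
  { pose proof (goursat_cont q Hq) as Hc.
    destruct q as [[x0 x1] [y0 y1]]. unfold bI; simpl in *.
    rewrite (rect_split_x f x0 x1 y0 y1 ((x0 + x1) / 2)) by (auto using btw_mid).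
    rewrite (rect_split_y f x0 ((x0 + x1) / 2) y0 y1 ((y0 + y1) / 2)).
    rewrite (rect_split_y f ((x0 + x1) / 2) x1 y0 y1 ((y0 + y1) / 2)).
    ring.
    all: try apply btw_mid.
    all: eapply cont_rect_sub; eauto using btw_l, btw_r, btw_mid. }
  unfold next.
  destruct (Rle_dec _ _) as [|H1]; [assumption|].
  destruct (Rle_dec _ _) as [|H2]; [assumption|].
  destruct (Rle_dec _ _) as [|H3]; [assumption|].
  assert (T : Cmod (bI q) <= Cmod (bI (quarter q true true)) + Cmod (bI (quarter q true false))
     + Cmod (bI (quarter q false true)) + Cmod (bI (quarter q false false))).
  { rewrite E at 1.
    eapply Rle_trans; [apply Cmod_triangle|]. apply Rplus_le_compat_r.
    eapply Rle_trans; [apply Cmod_triangle|]. apply Rplus_le_compat_r.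
    apply Cmod_triangle. }
  lra.
Qed.

Lemma goursat_inb n : inb (bx n).
Proof.
  induction n as [|n IH].
  - unfold inb, bx; simpl. auto using btw_l, btw_r.
  - unfold bx in *; simpl. destruct (goursat_next_ex (Nat.iter n next (a0, a1, (b0, b1)))) as [i [j E]].
    rewrite E. apply goursat_quarter_inb, IH.
Qed.

Lemma goursat_size n : 
  snd (fst (bx n)) - fst (fst (bx n)) = (a1 - a0) * (/ 2) ^ n /\
  snd (snd (bx n)) - fst (snd (bx n)) = (b1 - b0) * (/ 2) ^ n.
Proof.
  induction n as [|n IH].
  - unfold bx; simpl. lra.
  - unfold bx in *; simpl. destruct (goursat_next_ex (Nat.iter n next (a0, a1, (b0, b1)))) as [i [j E]].
    rewrite E. destruct (Nat.iter n next (a0, a1, (b0, b1))) as [[x0 x1] [y0 y1]].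
    simpl in IH. destruct i, j; simpl; lra.
Qed.

Lemma goursat_step n : 
  Rabs (fst (fst (bx (S n))) - fst (fst (bx n))) <= Rabs (a1 - a0) * (/ 2) ^ n - Rabs (a1 - a0) * (/ 2) ^ (S n) /\
  Rabs (fst (snd (bx (S n))) - fst (snd (bx n))) <= Rabs (b1 - b0) * (/ 2) ^ n - Rabs (b1 - b0) * (/ 2) ^ (S n).
Proof.
  destruct (goursat_size n) as [H1 H2].
  assert (Hp : 0 < (/ 2) ^ n) by (apply pow_lt; lra).
  unfold bx in *; simpl. destruct (goursat_next_ex (Nat.iter n next (a0, a1, (b0, b1)))) as [i [j E]].
  rewrite E. destruct (Nat.iter n next (a0, a1, (b0, b1))) as [[x0 x1] [y0 y1]].
  simpl in *.
  assert (A1 : Rabs ((x0 + x1) / 2 - x0) = Rabs (a1 - a0) * (/ 2) ^ n * / 2).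
  { replace ((x0 + x1) / 2 - x0) with ((x1 - x0) * / 2) by field. rewrite H1, !Rabs_mult.
    rewrite (Rabs_pos_eq ((/2)^n)), (Rabs_pos_eq (/2)) by lra. ring. }
  assert (A2 : Rabs ((y0 + y1) / 2 - y0) = Rabs (b1 - b0) * (/ 2) ^ n * / 2).
  { replace ((y0 + y1) / 2 - y0) with ((y1 - y0) * / 2) by field. rewrite H2, !Rabs_mult.
    rewrite (Rabs_pos_eq ((/2)^n)), (Rabs_pos_eq (/2)) by lra. ring. }
  pose proof (Rabs_pos (a1 - a0)); pose proof (Rabs_pos (b1 - b0)).
  assert (0 <= Rabs (a1 - a0) * (/ 2) ^ n) by (apply Rmult_le_pos; lra).
  assert (0 <= Rabs (b1 - b0) * (/ 2) ^ n) by (apply Rmult_le_pos; lra).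
  destruct i, j; simpl; rewrite ?Rminus_diag, ?Rabs_R0, ?A1, ?A2; lra.
Qed.

Lemma goursat : rect f a0 a1 b0 b1 = 0.
Proof.
  apply NNPP. intros Hn. apply Cmod_gt_0 in Hn.
  change (rect f a0 a1 b0 b1) with (bI (bx 0)) in Hn. set (m := Cmod (bI (bx 0))) in *.
  assert (Hge : forall n, m * (/ 4) ^ n <= Cmod (bI (bx n))).
  { induction n as [|n IH]; [rewrite pow_O, Rmult_1_r; apply Rle_refl|].
    change (bx (S n)) with (next (bx n)).
    eapply Rle_trans; [|apply goursat_next_ge, goursat_inb]. rewrite <- tech_pow_Rmult. lra. }
  pose proof (Rabs_pos (a1 - a0)); pose proof (Rabs_pos (b1 - b0)).
  assert (Hp : forall n, 0 < (/ 2) ^ n) by (intros; apply pow_lt; lra).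
  destruct (telescoping_cauchy (fun n => fst (fst (bx n))) (fun n => Rabs (a1 - a0) * (/ 2) ^ n)) as [x [Lx Hx]].
  { intros n. apply goursat_step. } { intros n. specialize (Hp n). nra. }
  destruct (telescoping_cauchy (fun n => fst (snd (bx n))) (fun n => Rabs (b1 - b0) * (/ 2) ^ n)) as [y [Ly Hy]].
  { intros n. apply goursat_step. } { intros n. specialize (Hp n). nra. }
  assert (Bx : btw a0 a1 x).
  { split.
    - apply (is_lim_seq_le (fun _ => Rmin a0 a1) (fun n => fst (fst (bx n))) (Rmin a0 a1) x);
        [intros n; apply goursat_inb|apply is_lim_seq_const|exact Lx].
    - apply (is_lim_seq_le (fun n => fst (fst (bx n))) (fun _ => Rmax a0 a1) x (Rmax a0 a1));
        [intros n; apply goursat_inb|exact Lx|apply is_lim_seq_const]. }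
  assert (By : btw b0 b1 y).
  { split.
    - apply (is_lim_seq_le (fun _ => Rmin b0 b1) (fun n => fst (snd (bx n))) (Rmin b0 b1) y);
        [intros n; apply goursat_inb|apply is_lim_seq_const|exact Ly].
    - apply (is_lim_seq_le (fun n => fst (snd (bx n))) (fun _ => Rmax b0 b1) y (Rmax b0 b1));
        [intros n; apply goursat_inb|exact Ly|apply is_lim_seq_const]. }
  destruct (Hf x y Bx By) as [l Hl].
  set (L := Rabs (a1 - a0) + Rabs (b1 - b0)).
  assert (HL : 0 <= L) by (unfold L; lra).
  (* Dividing by [L * L + 1] instead of [L * L] keeps the final bound strictly below [m] even for a
     degenerate rectangle. *)
  destruct (rect_local f (x, y) l Hl (m / (2 * (L * L + 1)))) as [d [Hd Hloc]].
  { apply Rdiv_lt_0_compat; [exact Hn|]. pose proof (Rle_0_sqr L) as HL2. unfold Rsqr in HL2. lra. }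
  destruct (pow_lt_1_zero (/ 2) ltac:(rewrite Rabs_pos_eq; lra) (d / (2 * L + 1))) as [n Hn2].
  { apply Rdiv_lt_0_compat; lra. }
  specialize (Hn2 n (le_n n)). rewrite Rabs_pos_eq in Hn2 by (specialize (Hp n); lra).
  destruct (goursat_size n) as [S1 S2].
  pose proof (goursat_inb n) as Hin. pose proof (goursat_cont _ Hin) as Hc.
  specialize (Hx n); specialize (Hy n); specialize (Hge n); specialize (Hp n). unfold bI in Hge.
  destruct (bx n) as [[x0 x1] [y0 y1]]. simpl in *.
  assert (T1 : Rabs (x1 - x0) = Rabs (a1 - a0) * (/ 2) ^ n)
    by (rewrite S1, Rabs_mult, (Rabs_pos_eq ((/ 2) ^ n)); lra).
  assert (T2 : Rabs (y1 - y0) = Rabs (b1 - b0) * (/ 2) ^ n)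
    by (rewrite S2, Rabs_mult, (Rabs_pos_eq ((/ 2) ^ n)); lra).
  specialize (Hloc x0 x1 y0 y1 Hc).
  replace (Rabs (x1 - x0) + Rabs (y1 - y0)) with (L * (/ 2) ^ n) in Hloc by (rewrite T1, T2; unfold L; ring).
  assert (Hb : Cmod (rect f x0 x1 y0 y1) <= m / (2 * (L * L + 1)) * (L * (/ 2) ^ n) * (L * (/ 2) ^ n)).
  { apply Hloc.
    - intros s t Hs Ht. eapply Rle_trans; [apply Cmod_le_sum|]. simpl.
      pose proof (btw_dist _ _ _ _ Hs (btw_l x0 x1)) as Q1. pose proof (btw_dist _ _ _ _ Ht (btw_l y0 y1)) as Q2.
      rewrite T1 in Q1. rewrite T2 in Q2.
      assert (Rabs (s + - x) <= Rabs (s - x0) + Rabs (x - x0)).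
      { replace (s + - x) with ((s - x0) - (x - x0)) by ring. rewrite <- (Rabs_Ropp (x - x0)). apply Rabs_triang. }
      assert (Rabs (t + - y) <= Rabs (t - y0) + Rabs (y - y0)).
      { replace (t + - y) with ((t - y0) - (y - y0)) by ring.
        rewrite <- (Rabs_Ropp (y - y0)). apply Rabs_triang. }
      unfold L. lra.
    - apply Rle_lt_trans with ((2 * L + 1) * (/ 2) ^ n); [lra|].
      apply Rlt_le_trans with ((2 * L + 1) * (d / (2 * L + 1))); [apply Rmult_lt_compat_l; lra|].
      right; field; lra. }
  assert (E4 : (/ 4) ^ n = (/ 2) ^ n * (/ 2) ^ n).
  { rewrite <- Rpow_mult_distr. f_equal. lra. }
  rewrite E4 in Hge.
  assert (HH : m / (2 * (L * L + 1)) * (L * L) < m).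
  { apply Rmult_lt_reg_r with (2 * (L * L + 1)); [nra|].
    replace (m / (2 * (L * L + 1)) * (L * L) * (2 * (L * L + 1))) with (m * (L * L)) by (field; nra). nra. }
  set (t := (/ 2) ^ n) in *. assert (0 < t * t) by nra. nra.
Qed.
End Goursat.

Lemma btw_0_scale e X : 0 <= e <= 1 -> btw 0 X (e * X).
Proof. intros H. unfold btw, Rmin, Rmax; destruct (Rle_dec 0 X); nra. Qed.

Lemma btw_scale_neq0 e X x : 0 < e -> e <= 1 -> X <> 0 -> btw (e * X) X x -> x <> 0.
Proof.
  intros H H1 HX. unfold btw, Rmin, Rmax; destruct (Rle_dec (e * X) X); intros Hx E; subst x;
  destruct (Rtotal_order X 0) as [h|[h|h]]; nra.
Qed.

Lemma pair_neq0_l (x y : R) : x <> 0 -> (x, y) <> RtoC 0.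
Proof. intros H E. injection E; intros; auto. Qed.

Lemma pair_neq0_r (x y : R) : y <> 0 -> (x, y) <> RtoC 0.
Proof. intros H E. injection E; intros; auto. Qed.

(** The class of difference quotients at 0, before the singularity there is known to be
    removable. *)
Definition hol0 (rad : R) (f : C -> C) : Prop :=
  forall z, Cmod z < rad -> ccont f z /\ (z <> 0 -> exists l, cdiff f z l).

Lemma Cmod_pair_le (x y x' y' : R) : Rabs x <= Rabs x' -> Rabs y <= Rabs y' -> Cmod (x, y) <= Cmod (x', y').
Proof.
  intros Hx Hy. unfold Cmod; simpl. apply sqrt_le_1_alt.
  apply Rsqr_le_abs_1 in Hx, Hy. unfold Rsqr in *. lra.
Qed.

Lemma btw_0_abs X x : btw 0 X x -> Rabs x <= Rabs X.
Proof. unfold btw, Rmin, Rmax, Rabs; destruct (Rle_dec 0 X), (Rcase_abs x), (Rcase_abs X); lra. Qed.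

(* The corner [0] is cut off by a small rectangle on which the integral is small because [f] is bounded. *)
Lemma rect_corner rad f X Y : hol0 rad f -> Cmod (X, Y) < rad -> rect f 0 X 0 Y = 0.
Proof.
  intros Hf Hr.
  assert (Hin : forall x y, btw 0 X x -> btw 0 Y y -> Cmod (x, y) < rad).
  { intros x y Hx Hy. eapply Rle_lt_trans; [apply Cmod_pair_le; apply btw_0_abs; eassumption|exact Hr]. }
  assert (Hc : cont_rect f 0 X 0 Y) by (intros x y Hx Hy; apply Hf; auto).
  destruct (Req_dec X 0) as [HX|HX].
  { subst X. unfold rect.
    assert (E : forall g, CI g 0 0 = 0).
    { intros g. unfold CI. rewrite !(RInt_point (V := R_CompleteNormedModule)). reflexivity. }
    rewrite !E. ring. }
  destruct (Req_dec Y 0) as [HY|HY].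
  { subst Y. unfold rect.
    assert (E : forall g, CI g 0 0 = 0).
    { intros g. unfold CI. rewrite !(RInt_point (V := R_CompleteNormedModule)). reflexivity. }
    rewrite !E. ring. }
  assert (Hsmall : forall e, 0 < e <= 1 -> rect f 0 X 0 Y = rect f 0 (e * X) 0 (e * Y)).
  { intros e He. rewrite (rect_split_x f 0 X 0 Y (e * X) Hc) by (apply btw_0_scale; lra).
    assert (BX := btw_0_scale e X ltac:(lra)). assert (BY := btw_0_scale e Y ltac:(lra)).
    rewrite (rect_split_y f 0 (e * X) 0 Y (e * Y)).
    - rewrite (goursat f (e * X) X 0 Y), (goursat f 0 (e * X) (e * Y) Y).
      + ring.
      + intros x y Hx Hy. apply Hf.
        * apply Hin; [apply (btw_sub _ _ 0 (e * X)); auto using btw_l|apply (btw_sub _ _ (e * Y) Y); auto using btw_r].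
        * apply pair_neq0_r. eapply btw_scale_neq0; [| |exact HY|exact Hy]; lra.
      + intros x y Hx Hy. apply Hf.
        * apply Hin; [apply (btw_sub _ _ (e * X) X); auto using btw_r|assumption].
        * apply pair_neq0_l. eapply btw_scale_neq0; [| |exact HX|exact Hx]; lra.
    - eapply cont_rect_sub; [exact Hc|apply btw_l|exact BX|apply btw_l|apply btw_r].
    - exact BY. }
  assert (H0 : ccont f 0) by (apply Hf; rewrite Cmod_0; pose proof (Cmod_ge_0 (X, Y)); lra).
  destruct (H0 1 ltac:(lra)) as [d [Hd Hb]]. unfold dC in Hb.
  apply NNPP. intros Hn. apply Cmod_gt_0 in Hn. set (m := Cmod (rect f 0 X 0 Y)) in *.
  set (L := Rabs X + Rabs Y).
  assert (HL : 0 < L) by (unfold L; pose proof (Rabs_pos_lt X HX); pose proof (Rabs_pos Y); lra).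
  set (M := Cmod (f 0) + 1). assert (HM : 0 < M) by (unfold M; pose proof (Cmod_ge_0 (f 0)); lra).
  set (e := Rmin 1 (Rmin (d / (2 * L)) (m / (4 * M * L)))).
  assert (He : 0 < e).
  { repeat apply Rmin_pos; [lra|apply Rdiv_lt_0_compat; lra|apply Rdiv_lt_0_compat; [lra|nra]]. }
  assert (He1 : e <= 1) by apply Rmin_l.
  assert (He2 : e * L < d).
  { apply Rle_lt_trans with (d / (2 * L) * L).
    - apply Rmult_le_compat_r; [lra|]. eapply Rle_trans; [apply Rmin_r|apply Rmin_l].
    - replace (d / (2 * L) * L) with (d / 2) by (field; lra). lra. }
  assert (He3 : 2 * M * (e * L) < m).
  { apply Rle_lt_trans with (2 * M * (m / (4 * M * L) * L)).
    - apply Rmult_le_compat_l; [lra|]. apply Rmult_le_compat_r; [lra|].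
      eapply Rle_trans; [apply Rmin_r|apply Rmin_r].
    - replace (2 * M * (m / (4 * M * L) * L)) with (m / 2) by (field; lra). lra. }
  assert (Hle : m <= 2 * M * (Rabs (e * X - 0) + Rabs (e * Y - 0))).
  { unfold m. rewrite (Hsmall e) by lra. apply rect_bound.
    - eapply cont_rect_sub; [exact Hc| | | |]; first [apply btw_l|apply btw_0_scale; lra].
    - intros x y Hx Hy. unfold M.
      assert (Cmod (x, y) < d).
      { eapply Rle_lt_trans; [apply Cmod_le_sum|]. simpl.
        apply btw_0_abs in Hx, Hy. rewrite Rabs_mult, (Rabs_pos_eq e) in Hx, Hy by lra. unfold L in He2. lra. }
      specialize (Hb (x, y)). unfold Cminus in Hb at 1. rewrite Copp_0, Cplus_0_r in Hb.
      specialize (Hb H). pose proof (Cmod_minus_ge (f (x, y)) (f 0)). lra. }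
  rewrite !Rminus_0_r, !Rabs_mult, (Rabs_pos_eq e) in Hle by lra. unfold L in He3. nra.
Qed.

(** F integrates horizontally and then vertically; by [rect_corner] the other order gives the same
    value. An increment of F therefore splits into one vertical and one horizontal segment near the
    point, on both of which f is almost constant. *)
Lemma primitive rad f : hol0 rad f -> exists F, forall z, Cmod z < rad -> cdiff F z (f z).
Proof.
  intros Hf.
  set (F := fun z : C => (CI (fun t => f (t, 0%R)) 0 (fst z) + Ci * CI (fun t => f (fst z, t)) 0 (snd z))%C).
  assert (F2 : forall x y, Cmod (x, y) < rad ->
    F (x, y) = (CI (fun t => f (t, y)) 0 x + Ci * CI (fun t => f (0%R, t)) 0 y)%C).
  { intros x y H. pose proof (rect_corner rad f x y Hf H) as E. unfold rect in E. unfold F; simpl.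
    replace (CI (fun t => f (t, 0%R)) 0 x + Ci * CI (fun t => f (x, t)) 0 y)%C
      with ((CI (fun t => f (t, 0%R)) 0 x + Ci * CI (fun t => f (x, t)) 0 y
        - CI (fun t => f (t, y)) 0 x - Ci * CI (fun t => f (0%R, t)) 0 y)
        + (CI (fun t => f (t, y)) 0 x + Ci * CI (fun t => f (0%R, t)) 0 y))%C by ring.
    rewrite E. ring. }
  exists F. intros [x y] Hz. intros e He.
  destruct (proj1 (Hf (x, y) Hz) (e / 2) ltac:(lra)) as [d [Hd Hcon]]. unfold dC in Hcon.
  (* Halved, because points of the rectangle spanned by z and w may be as far as 2 |w - z| from
     z. *)
  exists (Rmin (d / 2) ((rad - Cmod (x, y)) / 2)).
  split; [apply Rmin_pos; lra|]. intros [x' y'] Hw.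
  pose proof (Rmin_l (d / 2) ((rad - Cmod (x, y)) / 2)); pose proof (Rmin_r (d / 2) ((rad - Cmod (x, y)) / 2)).
  set (h := Cmod ((x', y') - (x, y))) in *.
  pose proof (Cmod_ge_fst ((x', y') - (x, y))) as h1. pose proof (Cmod_ge_snd ((x', y') - (x, y))) as h2.
  fold h in h1, h2. simpl in h1, h2.
  assert (Hnear : forall s t, btw x x' s -> btw y y' t -> Cmod ((s, t) - (x, y)) <= 2 * h).
  { intros s t Hs Ht. eapply Rle_trans; [apply Cmod_le_sum|]. simpl.
    pose proof (btw_dist _ _ _ _ Hs (btw_l x x')). pose proof (btw_dist _ _ _ _ Ht (btw_l y y')).
    unfold Rminus in *. lra. }
  assert (Hin : forall s t, btw x x' s -> btw y y' t -> Cmod (s, t) < rad).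
  { intros s t Hs Ht. specialize (Hnear s t Hs Ht).
    pose proof (Cmod_minus_ge (s, t) (x, y)). lra. }
  assert (Hcv : forall s t, btw x x' s -> btw y y' t -> cont_on (fun u => f (s, u)) 0 t).
  { intros s t Hs Ht u Hu. apply pcont_vert, Hf.
    eapply Rle_lt_trans; [|apply (Hin s t Hs Ht)]. apply Cmod_pair_le; [lra|apply btw_0_abs, Hu]. }
  assert (Hch : forall s t, btw x x' s -> btw y y' t -> cont_on (fun u => f (u, t)) 0 s).
  { intros s t Hs Ht u Hu. apply pcont_horiz, Hf.
    eapply Rle_lt_trans; [|apply (Hin s t Hs Ht)]. apply Cmod_pair_le; [apply btw_0_abs, Hu|lra]. }
  assert (V : (F (x', y') - F (x', y) = Ci * CI (fun t => f (x', t)) y y')%C).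
  { unfold F; simpl. rewrite <- (CI_Chasles (fun t => f (x', t)) 0 y y'). as_C_eq; ring.
    apply Hcv; [apply btw_r|apply btw_l].
    intros u Hu. apply pcont_vert, Hf, Hin; [apply btw_r|exact Hu]. }
  assert (H' : (F (x', y) - F (x, y) = CI (fun t => f (t, y)) x x')%C).
  { rewrite !F2 by (apply Hin; auto using btw_l, btw_r).
    rewrite <- (CI_Chasles (fun t => f (t, y)) 0 x x'). as_C_eq; ring.
    apply Hch; apply btw_l.
    intros u Hu. apply pcont_horiz, Hf, Hin; [exact Hu|apply btw_l]. }
  assert (CV : cont_on (fun t => f (x', t)) y y') by (intros u Hu; apply pcont_vert, Hf, Hin; [apply btw_r|exact Hu]).
  assert (CH : cont_on (fun t => f (t, y)) x x') by (intros u Hu; apply pcont_horiz, Hf, Hin; [exact Hu|apply btw_l]).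
  assert (Cc : forall a b, cont_on (fun _ => f (x, y)) a b) by (intros a b u Hu; apply contg_const).
  assert (E : (F (x', y') - F (x, y) - f (x, y) * ((x', y') - (x, y))
    = Ci * CI (fun t => f (x', t) - f (x, y))%C y y' + CI (fun t => f (t, y) - f (x, y))%C x x')%C).
  { rewrite !CI_minus, !CI_const by auto.
    replace (F (x', y') - F (x, y))%C with ((F (x', y') - F (x', y)) + (F (x', y) - F (x, y)))%C by (as_C_eq; ring).
    rewrite V, H'.
    replace ((x', y') - (x, y))%C with (RtoC (x' - x) + Ci * RtoC (y' - y))%C.
    as_C_eq; ring. apply injective_projections; simpl; ring. }
  rewrite E.
  assert (B1 : Cmod (CI (fun t => f (x', t) - f (x, y))%C y y') <= e / 2 * Rabs (y' - y)).
  { apply CI_bound.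
    - intros u Hu. apply contg_minus; [apply CV, Hu|apply contg_const].
    - intros u Hu. left. apply Hcon. specialize (Hnear x' u (btw_r _ _) Hu). lra. }
  assert (B2 : Cmod (CI (fun t => f (t, y) - f (x, y))%C x x') <= e / 2 * Rabs (x' - x)).
  { apply CI_bound.
    - intros u Hu. apply contg_minus; [apply CH, Hu|apply contg_const].
    - intros u Hu. left. apply Hcon. specialize (Hnear u y Hu (btw_l _ _)). lra. }
  eapply Rle_trans; [apply Cmod_triangle|]. rewrite Cmod_mult, Cmod_Ci, Rmult_1_l.
  unfold Rminus in *. nra.
Qed.

Lemma hol_hol0 rad f : hol rad f -> hol0 rad f.
Proof. intros H z Hz. split; [eapply hol_ccont; eassumption|intros _; apply H, Hz]. Qed.

(** The difference quotient, filled in by the derivative at [z0]. At that point only continuity is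
    available so far; this is enough for a primitive. *)
Lemma slope rad f z0 : hol rad f -> Cmod z0 < rad -> exists k : C -> C,
  (forall w, Cmod w < rad -> ccont k w /\ (w <> z0 -> exists l, cdiff k w l)) /\
  (forall w, f w = (f z0 + (w - z0) * k w)%C).
Proof.
  intros Hf Hz. destruct (Hf z0 Hz) as [l Hl].
  set (k := fun w => if Ceq_dec w z0 then l else ((f w - f z0) / (w - z0))%C).
  exists k. split.
  - assert (D : forall w, Cmod w < rad -> w <> z0 -> exists m, cdiff k w m).
    { intros w Hw Hn. destruct (Hf w Hw) as [m Hm].
      assert (Hnz : (w - z0)%C <> 0) by (apply Cminus_eq_contra; exact Hn).
      eexists. apply cdiff_ext_loc with (fun w => (f w + - f z0) * / (w + - z0))%C (Cmod (w - z0)).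
      - apply (proj1 (Cmod_gt_0 _)). exact Hnz.
      - intros v Hv. unfold k. destruct (Ceq_dec v z0) as [->|E]; [|reflexivity].
        rewrite Cmod_minus_sym in Hv. lra.
      - apply (cdiff_mult (fun w => f w + - f z0)%C (fun w => / (w + - z0))%C).
        + apply cdiff_plus; [exact Hm|apply cdiff_const].
        + apply (cdiff_comp (fun w => / w)%C (fun w => w + - z0)%C); [apply cdiff_inv0; exact Hnz|].
          apply cdiff_plus; [apply cdiff_id|apply cdiff_const]. }
    intros w Hw. split; [|apply D, Hw].
    destruct (Ceq_dec w z0) as [->|E]; [|destruct (D w Hw E) as [m Hm]; eapply cdiff_ccont, Hm].
    intros e He. destruct (Hl (e / 2) ltac:(lra)) as [d [Hd H1]]. exists d. split; [exact Hd|].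
    unfold dC. intros v Hv. unfold k. destruct (Ceq_dec z0 z0) as [_|E]; [|congruence].
    destruct (Ceq_dec v z0) as [E|E]; [rewrite Cminus_diag, Cmod_0; lra|].
    assert (Hnz : (v - z0)%C <> 0) by (apply Cminus_eq_contra; exact E).
    specialize (H1 v Hv).
    replace ((f v - f z0) / (v - z0) - l)%C with ((f v - f z0 - l * (v - z0)) / (v - z0))%C by (field; exact Hnz).
    rewrite Cmod_div by exact Hnz.
    assert (0 < Cmod (v - z0)) by (apply (proj1 (Cmod_gt_0 _)); exact Hnz).
    apply Rle_lt_trans with (e / 2); [|lra].
    apply Rmult_le_reg_r with (Cmod (v - z0)); [assumption|].
    unfold Rdiv. rewrite Rmult_assoc, Rinv_l by lra. lra.
  - intros w. unfold k. destruct (Ceq_dec w z0) as [->|E]; [ring|].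
    field. apply Cminus_eq_contra, E.
Qed.

(** * Integrals over circles *)

Lemma Cmod_polar r t : 0 <= r -> Cmod (polar r t) = r.
Proof.
  intros Hr. unfold polar, Cmod; simpl.
  replace (r * cos t * (r * cos t * 1) + r * sin t * (r * sin t * 1)) with (r * r * (Rsqr (sin t) + Rsqr (cos t)))
    by (unfold Rsqr; ring).
  rewrite sin2_cos2, Rmult_1_r. apply sqrt_square, Hr.
Qed.

Lemma pdiff_polar r t : pdiff (polar r) t (Ci * polar r t).
Proof.
  split; simpl; auto_derive; trivial; ring.
Qed.

Lemma pcont_polar r t : pcont (polar r) t.
Proof. eapply pdiff_pcont, pdiff_polar. Qed.

Lemma polar_2PI r t : polar r (t + 2 * PI) = polar r t.
Proof. unfold polar. rewrite cos_plus, sin_plus, cos_2PI, sin_2PI. f_equal; ring. Qed.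

Lemma polar_nz r t : 0 < r -> polar r t <> RtoC 0.
Proof. intros Hr E. pose proof (Cmod_polar r t ltac:(lra)) as H. rewrite E, Cmod_0 in H. lra. Qed.

Lemma pcont_circle f r t : ccont f (polar r t) -> pcont (fun t => f (polar r t)) t.
Proof. intros H. apply (contg_comp dR f (polar r)); [exact H|apply pcont_polar]. Qed.

(** The derivative of [polar r] is [Ci * polar r], so up to the factor [Ci] the integrand is the
    pull-back of f dz. *)
Lemma circle_primitive F f r a : 0 <= r -> (forall z, Cmod z = r -> cdiff F z (f z)) ->
  (forall z, Cmod z = r -> ccont f z) -> CI (fun t => f (polar r t) * polar r t)%C a (a + 2 * PI) = 0.
Proof.
  intros Hr HF Hc.
  assert (Hcont : cont_on (fun t => f (polar r t) * polar r t)%C a (a + 2 * PI)).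
  { intros t _. apply contg_mult; [apply pcont_circle, Hc, Cmod_polar, Hr|apply pcont_polar]. }
  assert (E : (Ci * CI (fun t => f (polar r t) * polar r t) a (a + 2 * PI) = 0)%C).
  { rewrite <- CI_scal by exact Hcont.
    rewrite (CI_FTC (fun t => F (polar r t))).
    - rewrite polar_2PI. ring.
    - intros t _. replace (Ci * (f (polar r t) * polar r t))%C with (f (polar r t) * (Ci * polar r t))%C by ring.
      apply pdiff_comp; [apply HF, Cmod_polar, Hr|apply pdiff_polar].
    - apply cont_on_scal, Hcont. }
  destruct (Ceq_dec (CI (fun t => f (polar r t) * polar r t)%C a (a + 2 * PI)) 0) as [H|H]; [exact H|].
  exfalso. apply (Cmult_neq_0 Ci _ Ci_nz H). exact E.
Qed.

(** Write f(w) = f(0) + w k(w). The quotient k has a primitive although its differentiability at 0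
    is not yet known, so the second term integrates to 0. *)
Lemma mean_value rad f r a : hol rad f -> 0 <= r < rad ->
  CI (fun t => f (polar r t)) a (a + 2 * PI) = (RtoC (2 * PI) * f 0)%C.
Proof.
  intros Hf Hr. destruct (slope rad f 0 Hf) as [k [Hk E]]; [rewrite Cmod_0; lra|].
  destruct (primitive rad k) as [K HK]; [intros z Hz; apply Hk, Hz|].
  assert (H0 : CI (fun t => k (polar r t) * polar r t)%C a (a + 2 * PI) = 0).
  { apply (circle_primitive K); [lra| |]; intros z Hz; [apply HK; lra|apply Hk; lra]. }
  rewrite (CI_ext _ (fun t => f 0 + k (polar r t) * polar r t)%C).
  - rewrite CI_plus, H0, CI_const. replace (a + 2 * PI - a) with (2 * PI) by ring. ring.
    + intros t _; apply contg_const.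
    + intros t _. apply contg_mult; [apply pcont_circle, Hk; rewrite Cmod_polar; lra|apply pcont_polar].
  - intros t _. rewrite (E (polar r t)). ring.
Qed.

(** * Disk automorphisms *)

Lemma Cmod_lt_nz (b : C) : Cmod b < 1 -> (1 - b)%C <> 0.
Proof. intros H. apply Cmod_lt_neq. rewrite Cmod_1. exact H. Qed.

Lemma Cmod_prod_lt1 (a w : C) : Cmod a < 1 -> Cmod w <= 1 -> Cmod (Cconj a * w) < 1.
Proof.
  intros Ha Hw. rewrite Cmod_mult, Cmod_conj.
  pose proof (Cmod_ge_0 a); pose proof (Cmod_ge_0 w). nra.
Qed.

Definition mob (a w : C) : C := ((w - a) / (1 - Cconj a * w))%C.

Lemma mob_den (a w : C) : Cmod a < 1 -> Cmod w <= 1 -> (1 - Cconj a * w)%C <> 0.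
Proof. intros Ha Hw. apply Cmod_lt_nz, Cmod_prod_lt1; assumption. Qed.

Lemma mob_identity (a w : C) :
  Cmod (1 - Cconj a * w) * Cmod (1 - Cconj a * w) - Cmod (w - a) * Cmod (w - a)
  = (1 - Cmod a * Cmod a) * (1 - Cmod w * Cmod w).
Proof. rewrite !Cmod_sqr. simpl. ring. Qed.

Lemma mob_Cmod (a w : C) : Cmod a < 1 -> Cmod w <= 1 ->
  1 - Cmod (mob a w) * Cmod (mob a w)
  = (1 - Cmod a * Cmod a) * (1 - Cmod w * Cmod w) / (Cmod (1 - Cconj a * w) * Cmod (1 - Cconj a * w)).
Proof.
  intros Ha Hw. assert (Hd := mob_den a w Ha Hw).
  assert (0 < Cmod (1 - Cconj a * w)) by (apply (proj1 (Cmod_gt_0 _)), Hd).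
  unfold mob. rewrite Cmod_div by exact Hd. rewrite <- mob_identity. field. lra.
Qed.

Lemma mob_lt1 (a w : C) : Cmod a < 1 -> Cmod w < 1 -> Cmod (mob a w) < 1.
Proof.
  intros Ha Hw. pose proof (mob_Cmod a w Ha ltac:(lra)) as E.
  assert (Hd := mob_den a w Ha ltac:(lra)).
  assert (0 < Cmod (1 - Cconj a * w)) by (apply (proj1 (Cmod_gt_0 _)), Hd).
  pose proof (Cmod_ge_0 a); pose proof (Cmod_ge_0 w); pose proof (Cmod_ge_0 (mob a w)).
  assert (0 < (1 - Cmod a * Cmod a) * (1 - Cmod w * Cmod w) / (Cmod (1 - Cconj a * w) * Cmod (1 - Cconj a * w))).
  { apply Rdiv_lt_0_compat; [apply Rmult_lt_0_compat|]; nra. }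
  nra.
Qed.

Lemma mob_le1 (a w : C) : Cmod a < 1 -> Cmod w <= 1 -> Cmod (mob a w) <= 1.
Proof.
  intros Ha Hw. pose proof (mob_Cmod a w Ha Hw) as E.
  assert (Hd := mob_den a w Ha Hw).
  assert (0 < Cmod (1 - Cconj a * w)) by (apply (proj1 (Cmod_gt_0 _)), Hd).
  pose proof (Cmod_ge_0 a); pose proof (Cmod_ge_0 w); pose proof (Cmod_ge_0 (mob a w)).
  assert (0 <= (1 - Cmod a * Cmod a) * (1 - Cmod w * Cmod w) / (Cmod (1 - Cconj a * w) * Cmod (1 - Cconj a * w))).
  { apply Rdiv_le_0_compat; [apply Rmult_le_pos|]; nra. }
  nra.
Qed.

Lemma mob_inv (a w : C) : Cmod a < 1 -> Cmod w <= 1 -> mob (- a) (mob a w) = w.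
Proof.
  intros Ha Hw. assert (Hd := mob_den a w Ha Hw). assert (Hd2 := mob_den a a Ha ltac:(lra)).
  unfold mob. rewrite Copp_conj. field. split; [exact Hd|].
  replace (1 - Cconj a * w - - Cconj a * (w - a))%C with (1 - Cconj a * a)%C by ring. exact Hd2.
Qed.

Lemma mob_inv' (a w : C) : Cmod a < 1 -> Cmod w <= 1 -> mob a (mob (- a) w) = w.
Proof.
  intros Ha Hw. replace a with (- - a)%C at 1 by ring. apply mob_inv; [rewrite Cmod_opp|]; assumption.
Qed.

Lemma cdiff_mob (a w : C) : Cmod a < 1 -> Cmod w <= 1 ->
  cdiff (mob a) w ((1 - Cconj a * a) / ((1 - Cconj a * w) * (1 - Cconj a * w))).
Proof.
  intros Ha Hw. assert (Hd := mob_den a w Ha Hw).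
  replace ((1 - Cconj a * a) / ((1 - Cconj a * w) * (1 - Cconj a * w)))%C
    with ((1 + 0) * / (1 + - Cconj a * w)
      + (w + - a) * (- / ((1 + - Cconj a * w) * (1 + - Cconj a * w)) * (0 + (0 * w + - Cconj a * 1))))%C.
  - apply cdiff_ext_loc with (fun w => (w + - a) * / (1 + - Cconj a * w))%C 1; [lra| |].
    + intros v _. unfold mob. replace (1 + - Cconj a * v)%C with (1 - Cconj a * v)%C by ring. reflexivity.
    + apply (cdiff_mult (fun w => w + - a)%C (fun w => / (1 + - Cconj a * w))%C).
      * apply cdiff_plus; [apply cdiff_id|apply cdiff_const].
      * apply (cdiff_comp (fun w => / w)%C (fun w => 1 + - Cconj a * w)%C).
        -- apply cdiff_inv0. replace (1 + - Cconj a * w)%C with (1 - Cconj a * w)%C by ring. exact Hd.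
        -- apply cdiff_plus; [apply cdiff_const|].
           apply (cdiff_mult (fun _ => - Cconj a)%C (fun w => w)); [apply cdiff_const|apply cdiff_id].
  - field. replace (1 + - Cconj a * w)%C with (1 - Cconj a * w)%C by ring. auto.
Qed.

Lemma hol_mob a : Cmod a < 1 -> hol 1 (mob a).
Proof. intros Ha z Hz. eexists. apply cdiff_mob; [exact Ha|lra]. Qed.

(* The exceptional point [z] of the difference quotient is moved to the origin by a disk automorphism. *)
Lemma slope_primitive f z : hol 1 f -> Cmod z < 1 -> exists k K : C -> C,
  (forall w, f w = (f z + (w - z) * k w)%C) /\
  (forall w, Cmod w < 1 -> ccont k w) /\
  (forall w, Cmod w < 1 -> cdiff K w (k w)).
Proof.
  intros Hf Hz. destruct (slope 1 f z Hf Hz) as [k [Hk E]].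
  assert (Hz' : Cmod (- z) < 1) by (rewrite Cmod_opp; exact Hz).
  (* [D] is the derivative of [mob (- z)]. A primitive K of the product of [k] after [mob (- z)]
     with [D] gives, after composition with [mob z], a primitive of [k]. *)
  set (D := fun w : C => ((1 - Cconj (- z) * - z) / ((1 - Cconj (- z) * w) * (1 - Cconj (- z) * w)))%C).
  assert (HD : hol 1 D).
  { unfold D. apply hol_div; [apply hol_const| |].
    - apply hol_mult; (apply hol_minus; [apply hol_const|apply hol_mult; [apply hol_const|apply hol_id]]).
    - intros w Hw. apply Cmult_neq_0; apply mob_den; lra. }
  destruct (primitive 1 (fun w => k (mob (- z) w) * D w)%C) as [K HK].
  { intros w Hw. assert (Hm := mob_lt1 (- z) w Hz' Hw). split.
    - apply contg_mult; [|eapply hol_ccont; eassumption].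
      apply (contg_comp dC k (mob (- z))); [apply Hk, Hm|].
      eapply hol_ccont; [apply hol_mob, Hz'|exact Hw].
    - intros Hn. assert (Hne : mob (- z) w <> z).
      { intros H. apply Hn. rewrite <- (mob_inv' z w Hz) by lra. rewrite H.
        unfold mob. replace (z - z)%C with (RtoC 0) by ring. unfold Cdiv. ring. }
      destruct (proj2 (Hk _ Hm) Hne) as [l Hl].
      destruct (HD w Hw) as [m Hm'].
      eexists. apply (cdiff_mult (fun w => k (mob (- z) w)) D); [|exact Hm'].
      apply (cdiff_comp k (mob (- z))); [exact Hl|apply cdiff_mob; [exact Hz'|lra]]. }
  exists k, (fun w => K (mob z w)). split; [exact E|]. split; [intros w Hw; apply Hk, Hw|].
  intros w Hw.
  assert (P := cdiff_comp K (mob z) w _ _ (HK _ (mob_lt1 z w Hz Hw)) (cdiff_mob z w Hz ltac:(lra))).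
  simpl in P. rewrite mob_inv in P by lra.
  assert (Hd := mob_den z w Hz ltac:(lra)). assert (Hd2 := mob_den z z Hz ltac:(lra)).
  replace (k w * D (mob z w) * ((1 - Cconj z * z) / ((1 - Cconj z * w) * (1 - Cconj z * w))))%C with (k w) in P.
  exact P.
  unfold D, mob. rewrite Copp_conj. field. split; [exact Hd|].
  replace (1 - Cconj z * w - - Cconj z * (w - z))%C with (1 - Cconj z * z)%C by ring. exact Hd2.
Qed.

(** * Cauchy and Poisson formulas *)

Lemma CI_conj g a b : cont_on g a b -> CI (fun t => Cconj (g t)) a b = Cconj (CI g a b).
Proof.
  intros Hg. unfold CI, Cconj; simpl. f_equal. as_R_eq.
  apply (RInt_opp (V := R_CompleteNormedModule)). apply cont_on_snd, Hg.
Qed.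

Lemma RtoC_2PI_nz : RtoC (2 * PI) <> 0.
Proof. intros E. apply RtoC_inj in E. pose proof PI_RGT_0. lra. Qed.

Lemma polar_minus_nz r t z : 0 <= r -> Cmod z < r -> (polar r t - z)%C <> 0.
Proof. intros Hr Hz. apply Cmod_lt_neq. rewrite Cmod_polar; assumption. Qed.

Lemma polar_conj_mult r t : (polar r t * Cconj (polar r t))%C = RtoC (r * r).
Proof.
  unfold polar. apply injective_projections; simpl; [|ring].
  replace (r * r) with (r * r * (Rsqr (sin t) + Rsqr (cos t))) by (rewrite sin2_cos2; ring).
  unfold Rsqr. ring.
Qed.

Lemma hol_poisson_part r z : 0 < r -> Cmod z < r ->
  exists rad, r < rad /\ forall w, Cmod w < rad -> (RtoC (r * r) - Cconj z * w)%C <> 0.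
Proof.
  (* The zero to be avoided has modulus r^2 / |z|; the chosen radius is the harmonic mean of r and
     this number, an expression that also makes sense for z = 0. *)
  intros Hr Hz. pose proof (Cmod_ge_0 z). exists (2 * (r * r) / (Cmod z + r)). split.
  - apply Rmult_lt_reg_r with (Cmod z + r); [lra|].
    unfold Rdiv. rewrite Rmult_assoc, Rinv_l by lra. nra.
  - intros w Hw. apply Cmod_lt_neq. rewrite Cmod_mult, Cmod_conj, Cmod_RtoC, Rabs_pos_eq by nra.
    assert (Hw2 : Cmod w * (Cmod z + r) < 2 * (r * r)).
    { apply Rlt_le_trans with (2 * (r * r) / (Cmod z + r) * (Cmod z + r)); [apply Rmult_lt_compat_r; lra|].
      right; field; lra. }
    pose proof (Cmod_ge_0 w). nra.
Qed.

(** On |w| = r the function w / (w - z) is the conjugate of r^2 / (r^2 - conj z w), which is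
    holomorphic on a larger disk with value 1 at the origin; the mean value property applies to the
    latter. *)
Lemma cauchy_kernel r z a : 0 < r -> Cmod z < r ->
  CI (fun t => polar r t / (polar r t - z))%C a (a + 2 * PI) = RtoC (2 * PI).
Proof.
  intros Hr Hz. destruct (hol_poisson_part r z Hr Hz) as [rad [Hrad Hnz]].
  set (g := fun w : C => (RtoC (r * r) / (RtoC (r * r) - Cconj z * w))%C).
  assert (Hg : hol rad g).
  { apply hol_div; [apply hol_const| |exact Hnz].
    apply hol_minus; [apply hol_const|apply hol_mult; [apply hol_const|apply hol_id]]. }
  assert (Hrr : RtoC (r * r) <> 0) by (intros E; apply RtoC_inj in E; nra).
  rewrite (CI_ext _ (fun t => Cconj (g (polar r t)))).
  - rewrite CI_conj.
    + rewrite (mean_value rad) by (auto; lra). unfold g.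
      replace (RtoC (2 * PI) * (RtoC (r * r) / (RtoC (r * r) - Cconj z * 0)))%C with (RtoC (2 * PI)).
      unfold Cconj; simpl. rewrite Ropp_0. reflexivity.
      replace (RtoC (r * r) - Cconj z * 0)%C with (RtoC (r * r)) by ring. field. exact Hrr.
    + intros t _. apply pcont_circle. eapply hol_ccont; [exact Hg|]. rewrite Cmod_polar; lra.
  - intros t _. unfold g. assert (Hn := polar_minus_nz r t z ltac:(lra) Hz).
    rewrite Cdiv_conj by (apply Hnz; rewrite Cmod_polar; lra).
    rewrite Cminus_conj, Cmult_conj, Cconj_conj.
    replace (Cconj (RtoC (r * r))) with (RtoC (r * r)) by (unfold Cconj, RtoC; simpl; rewrite Ropp_0; reflexivity).
    rewrite <- (polar_conj_mult r t).
    assert (Hpn := polar_nz r t Hr).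
    assert (Hcn : Cconj (polar r t) <> 0).
    { intros E. apply Hpn. rewrite <- (Cconj_conj (polar r t)), E. unfold Cconj, RtoC; simpl. rewrite Ropp_0; reflexivity. }
    field. split; [|exact Hn].
    intros E. apply (Cmult_neq_0 (Cconj (polar r t)) (polar r t - z)); auto. rewrite <- E. ring.
Qed.

(** With f(w) = f(z) + (w - z) k(w) the kernel leaves w k(w) besides the constant, and this
    integrates to 0 because k has a primitive. *)
Lemma cauchy_formula f r z a : hol 1 f -> 0 < r < 1 -> Cmod z < r ->
  CI (fun t => f (polar r t) * (polar r t / (polar r t - z)))%C a (a + 2 * PI) = (RtoC (2 * PI) * f z)%C.
Proof.
  intros Hf Hr Hz. destruct (slope_primitive f z Hf) as [k [K [E [Hk HK]]]]; [lra|].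
  assert (Hc : cont_on (fun t => polar r t / (polar r t - z))%C a (a + 2 * PI)).
  { intros t _. apply contg_div; [apply polar_minus_nz; lra|apply pcont_polar|].
    apply contg_minus; [apply pcont_polar|apply contg_const]. }
  rewrite (CI_ext _ (fun t => f z * (polar r t / (polar r t - z)) + k (polar r t) * polar r t)%C).
  - rewrite CI_plus.
    + rewrite CI_scal, cauchy_kernel by (assumption || lra).
      rewrite (circle_primitive K k); [ring|lra| |]; intros w Hw; [apply HK|apply Hk]; lra.
    + apply cont_on_scal, Hc.
    + intros t _. apply contg_mult; [|apply pcont_polar]. apply pcont_circle, Hk. rewrite Cmod_polar; lra.
  - intros t _. rewrite (E (polar r t)). field. apply polar_minus_nz; lra.
Qed.

(** The Poisson kernel of the disk of radius r, normalised to have integral 2 pi in t. *)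
Definition pk (r : R) (z : C) (t : R) : R :=
  (r * r - Cmod z * Cmod z) / (Cmod (polar r t - z) * Cmod (polar r t - z)).

Lemma pk_pos r z t : 0 <= r -> Cmod z < r -> 0 < pk r z t.
Proof.
  intros Hr Hz. unfold pk.
  assert (0 < Cmod (polar r t - z)) by (apply (proj1 (Cmod_gt_0 _)), polar_minus_nz; assumption).
  pose proof (Cmod_ge_0 z). apply Rdiv_lt_0_compat; nra.
Qed.

Lemma Cmod_sqr_conj (z : C) : RtoC (Cmod z * Cmod z) = (z * Cconj z)%C.
Proof.
  apply injective_projections; simpl.
  - rewrite Cmod_sqr. ring.
  - ring.
Qed.

(** The Cauchy kernel plus a term that is holomorphic in w = [polar r t] and vanishes at w = 0.
    Against a holomorphic f the second term has mean value 0, which turns Cauchy's formula into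
    Poisson's. *)
Lemma pk_split r z t : 0 < r -> Cmod z < r ->
  RtoC (pk r z t) = (polar r t / (polar r t - z) + Cconj z * polar r t / (RtoC (r * r) - Cconj z * polar r t))%C.
Proof.
  intros Hr Hz. assert (Hn := polar_minus_nz r t z ltac:(lra) Hz).
  assert (0 < Cmod (polar r t - z)) by (apply (proj1 (Cmod_gt_0 _)), Hn).
  unfold pk. rewrite RtoC_div by nra. rewrite RtoC_minus, !Cmod_sqr_conj.
  rewrite <- (polar_conj_mult r t), Cminus_conj.
  assert (Hpn := polar_nz r t Hr).
  assert (Hcn : (Cconj (polar r t) - Cconj z)%C <> 0).
  { rewrite <- Cminus_conj. intros E. apply Hn. rewrite <- (Cconj_conj (polar r t - z)), E.
    unfold Cconj, RtoC; simpl. rewrite Ropp_0; reflexivity. }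
  field. split; [|split]; auto.
  intros E. apply (Cmult_neq_0 (polar r t) (Cconj (polar r t) - Cconj z)); auto. rewrite <- E. ring.
Qed.

Lemma pk_cont r z t : 0 < r -> Cmod z < r -> continuous (pk r z) t.
Proof.
  intros Hr Hz. apply continuous_ext with (fun t => fst (RtoC (pk r z t))); [reflexivity|].
  apply (pcont_fst (fun t => RtoC (pk r z t))).
  assert (Hd : pcont (fun t => polar r t - z)%C t) by (apply contg_minus; [apply pcont_polar|apply contg_const]).
  apply (contg_ext_loc dR (fun t => RtoC (r * r - Cmod z * Cmod z) /
    (RtoC (Cmod (polar r t - z)) * RtoC (Cmod (polar r t - z))))%C _ t 1); [unfold dR; rewrite Rminus_diag, Rabs_R0; reflexivity|lra| |].
  - intros s _. unfold pk.
    assert (0 < Cmod (polar r s - z)) by (apply (proj1 (Cmod_gt_0 _)), polar_minus_nz; lra).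
    rewrite RtoC_div, <- !RtoC_mult by nra. reflexivity.
  - assert (0 < Cmod (polar r t - z)) by (apply (proj1 (Cmod_gt_0 _)), polar_minus_nz; lra).
    apply contg_div; [|apply contg_const|].
    + rewrite <- RtoC_mult. intros E. apply RtoC_inj in E. nra.
    + apply contg_mult; apply contg_Cmod, Hd.
Qed.

Lemma poisson_formula f r z a : hol 1 f -> 0 < r < 1 -> Cmod z < r ->
  CI (fun t => RtoC (pk r z t) * f (polar r t))%C a (a + 2 * PI) = (RtoC (2 * PI) * f z)%C.
Proof.
  intros Hf Hr Hz. destruct (hol_poisson_part r z) as [rad [Hrad Hnz]]; [lra|exact Hz|].
  set (g := fun w => (f w * (Cconj z * w / (RtoC (r * r) - Cconj z * w)))%C).
  assert (Hg : hol (Rmin rad 1) g).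
  { apply hol_mult; [apply hol_sub with 1; [apply Rmin_r|exact Hf]|].
    apply hol_sub with rad; [apply Rmin_l|].
    apply hol_div; [apply hol_mult; [apply hol_const|apply hol_id]| |exact Hnz].
    apply hol_minus; [apply hol_const|apply hol_mult; [apply hol_const|apply hol_id]]. }
  assert (Hr2 : 0 <= r < Rmin rad 1) by (split; [lra|apply Rmin_glb_lt; lra]).
  rewrite (CI_ext _ (fun t => f (polar r t) * (polar r t / (polar r t - z)) + g (polar r t))%C).
  - rewrite CI_plus.
    + rewrite cauchy_formula, (mean_value _ g r a Hg Hr2) by (assumption || lra).
      unfold g. replace (Cconj z * 0)%C with (RtoC 0) by ring. unfold Cdiv. ring.
    + intros t _. apply contg_mult.
      * apply pcont_circle. eapply hol_ccont; [exact Hf|rewrite Cmod_polar; lra].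
      * apply contg_div; [apply polar_minus_nz; lra|apply pcont_polar|
          apply contg_minus; [apply pcont_polar|apply contg_const]].
    + intros t _. apply pcont_circle. eapply hol_ccont; [exact Hg|]. rewrite Cmod_polar; lra.
  - intros t _. rewrite pk_split by lra. unfold g. ring.
Qed.

Lemma pk_int r z a : 0 < r < 1 -> Cmod z < r -> RInt (pk r z) a (a + 2 * PI) = 2 * PI.
Proof.
  intros Hr Hz. pose proof (poisson_formula (fun _ => RtoC 1) r z a (hol_const 1 1) Hr Hz) as E.
  apply (f_equal fst) in E. unfold CI in E; simpl in E.
  rewrite (RInt_ext_R (pk r z) (fun t => pk r z t * 1 - 0 * 0)) by (intros; ring).
  rewrite E. as_R_eq. ring.
Qed.

Lemma pk_ex_RInt r z a b : 0 < r -> Cmod z < r -> ex_RInt (pk r z) a b.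
Proof. intros. apply (ex_RInt_continuous (V := R_CompleteNormedModule)). intros t _. apply pk_cont; assumption. Qed.

Lemma max_principle f r z M : hol 1 f -> 0 < r < 1 -> Cmod z < r ->
  (forall w, Cmod w = r -> Cmod (f w) <= M) -> Cmod (f z) <= M.
Proof.
  intros Hf Hr Hz HM. pose proof (poisson_formula f r z 0 Hf Hr Hz) as E.
  pose proof PI_RGT_0 as HPI.
  assert (Hc : cont_on (fun t => RtoC (pk r z t) * f (polar r t))%C 0 (0 + 2 * PI)).
  { intros t _. apply contg_mult; [apply pcont_RtoC, pk_cont; lra|].
    apply pcont_circle. eapply hol_ccont; [exact Hf|rewrite Cmod_polar; lra]. }
  assert (B : Cmod (CI (fun t => RtoC (pk r z t) * f (polar r t))%C 0 (0 + 2 * PI)) <= M * (2 * PI)).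
  { eapply Rle_trans; [apply CI_norm; [lra|exact Hc]|].
    replace (M * (2 * PI)) with (RInt (fun t => M * pk r z t) 0 (0 + 2 * PI))
      by (rewrite RInt_scal_R, pk_int by (lra || (apply pk_ex_RInt; lra)); reflexivity).
    apply RInt_le; [lra| |apply ex_RInt_scal_R, pk_ex_RInt; lra|].
    - apply (ex_RInt_continuous (V := R_CompleteNormedModule)). intros t Ht.
      apply (pcont_fst (fun t => RtoC (Cmod (RtoC (pk r z t) * f (polar r t))))), contg_Cmod, Hc, Ht.
    - intros t _. assert (Hp := pk_pos r z t ltac:(lra) Hz).
      rewrite Cmod_mult, Cmod_RtoC, Rabs_pos_eq, Rmult_comm by lra.
      apply Rmult_le_compat_r; [lra|]. apply HM, Cmod_polar. lra. }
  rewrite E, Cmod_mult, Cmod_RtoC, Rabs_pos_eq in B by lra. nra.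
Qed.

(** * Cauchy-type integrals, locally uniform limits and removable singularities *)

Lemma polar_minus_ge r t z : 0 <= r -> r - Cmod z <= Cmod (polar r t - z).
Proof. intros Hr. pose proof (Cmod_minus_ge (polar r t) z). rewrite Cmod_polar in H; assumption. Qed.

Lemma pcont_cauchy (psi : R -> C) r z t : 0 < r -> Cmod z < r -> pcont psi t ->
  pcont (fun t => psi t / (polar r t - z))%C t.
Proof.
  intros Hr Hz Hp. apply contg_div; [apply polar_minus_nz; lra|exact Hp|].
  apply contg_minus; [apply pcont_polar|apply contg_const].
Qed.

(** Differentiation under the integral sign with an explicit remainder: 1 / (s - w) - 1 / (s - z) -
    (w - z) / (s - z)^2 = (w - z)^2 / ((s - w) (s - z)^2). *)
Lemma cauchy_type_cdiff (psi : R -> C) M r z : 0 < r -> Cmod z < r ->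
  (forall t, pcont psi t) -> (forall t, 0 <= t <= 2 * PI -> Cmod (psi t) <= M) ->
  exists l, cdiff (fun z => CI (fun t => psi t / (polar r t - z))%C 0 (0 + 2 * PI)) z l.
Proof.
  intros Hr Hz Hp HM.
  exists (CI (fun t => psi t / ((polar r t - z) * (polar r t - z)))%C 0 (0 + 2 * PI)).
  intros e He. pose proof PI_RGT_0 as HPI. pose proof (Cmod_ge_0 z).
  set (d := r - Cmod z). assert (Hd : 0 < d) by (unfold d; lra).
  assert (HM0 : 0 <= M) by (eapply Rle_trans; [apply Cmod_ge_0|apply (HM 0); lra]).
  (* For |w - z| < d / 2 the denominator of the remainder has modulus at least d / 2 * d * d. *)
  set (K := M / (d / 2 * d * d) * (2 * PI)).
  assert (Hd3 : 0 < d / 2 * d * d) by (repeat apply Rmult_lt_0_compat; lra).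
  assert (HK : 0 <= K) by (apply Rmult_le_pos; [apply Rdiv_le_0_compat|]; lra).
  exists (Rmin (d / 2) (e / (K + 1))).
  split; [apply Rmin_pos; [lra|apply Rdiv_lt_0_compat; lra]|].
  intros w Hw. pose proof (Rmin_l (d / 2) (e / (K + 1))); pose proof (Rmin_r (d / 2) (e / (K + 1))).
  assert (Hwr : Cmod w < r - d / 2).
  { pose proof (Cmod_minus_ge w z). unfold d in *. lra. }
  assert (Hn1 : forall t, (polar r t - z)%C <> 0) by (intros; apply polar_minus_nz; lra).
  assert (Hn2 : forall t, (polar r t - w)%C <> 0) by (intros; apply polar_minus_nz; lra).
  assert (C1 : forall v, Cmod v < r -> cont_on (fun t => psi t / (polar r t - v))%C 0 (0 + 2 * PI))
    by (intros v Hv t _; apply pcont_cauchy; auto).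
  assert (Pm : forall v t, pcont (fun t => polar r t - v)%C t)
    by (intros; apply contg_minus; [apply pcont_polar|apply contg_const]).
  assert (C2 : cont_on (fun t => psi t / ((polar r t - z) * (polar r t - z)))%C 0 (0 + 2 * PI)).
  { intros t _. apply contg_div; [apply Cmult_neq_0; auto|auto|apply contg_mult; auto]. }
  assert (C3 : cont_on (fun t => (w - z) * (psi t / ((polar r t - w) * (polar r t - z) * (polar r t - z))))%C 0 (0 + 2 * PI)).
  { apply cont_on_scal. intros t _. apply contg_div; [repeat apply Cmult_neq_0; auto|auto|].
    apply contg_mult; [apply contg_mult|]; auto. }
  assert (E : (CI (fun t => psi t / (polar r t - w)) 0 (0 + 2 * PI) - CI (fun t => psi t / (polar r t - z)) 0 (0 + 2 * PI)
     - CI (fun t => psi t / ((polar r t - z) * (polar r t - z))) 0 (0 + 2 * PI) * (w - z)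
     = (w - z) * CI (fun t => (w - z) * (psi t / ((polar r t - w) * (polar r t - z) * (polar r t - z)))) 0 (0 + 2 * PI))%C).
  { rewrite <- CI_scal by exact C3.
    rewrite (Cmult_comm _ (w - z)), <- CI_scal by exact C2.
    rewrite <- CI_minus by (apply C1; lra).
    rewrite <- CI_minus.
    - apply CI_ext. intros t _. field. auto.
    - intros t Ht. apply contg_minus; (apply C1; [lra|exact Ht]).
    - apply cont_on_scal, C2. }
  rewrite E, Cmod_mult, Rmult_comm. apply Rmult_le_compat_r; [apply Cmod_ge_0|].
  eapply Rle_trans; [apply CI_bound with (M := Cmod (w - z) * (M / (d / 2 * d * d))); [exact C3|]|].
  - intros t Ht. rewrite Rmin_left, Rmax_right in Ht by lra.
    rewrite Cmod_mult. apply Rmult_le_compat_l; [apply Cmod_ge_0|].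
    rewrite Cmod_div by (repeat apply Cmult_neq_0; auto).
    rewrite !Cmod_mult.
    pose proof (polar_minus_ge r t z ltac:(lra)). pose proof (polar_minus_ge r t w ltac:(lra)).
    apply Rmult_le_compat; [apply Cmod_ge_0|left; apply Rinv_0_lt_compat|apply HM; lra|apply Rinv_le_contravar; [exact Hd3|]].
    + repeat apply Rmult_lt_0_compat; apply (proj1 (Cmod_gt_0 _)); auto.
    + unfold d in *. apply Rmult_le_compat; [nra|lra| |lra]. apply Rmult_le_compat; lra.
  - rewrite Rabs_pos_eq by lra. rewrite Rplus_0_l, Rminus_0_r.
    apply Rle_trans with (e / (K + 1) * K).
    + unfold K at 2. rewrite Rmult_assoc. apply Rmult_le_compat_r; [exact HK|lra].
    + apply Rmult_le_reg_r with (K + 1); [lra|].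
      replace (e / (K + 1) * K * (K + 1)) with (e * K) by (field; lra). nra.
Qed.

Lemma hol_of_cauchy f r z : 0 < r < 1 -> Cmod z < r ->
  (forall w, Cmod w = r -> ccont f w) -> (exists M, forall w, Cmod w = r -> Cmod (f w) <= M) ->
  (forall v, Cmod v < r -> CI (fun t => f (polar r t) * (polar r t / (polar r t - v)))%C 0 (0 + 2 * PI) = (RtoC (2 * PI) * f v)%C) ->
  exists l, cdiff f z l.
Proof.
  intros Hr Hz Hc [M HM] Hcf.
  destruct (cauchy_type_cdiff (fun t => f (polar r t) * polar r t)%C (M * r) r z) as [l Hl].
  - lra. - exact Hz.
  - intros t. apply contg_mult; [apply pcont_circle, Hc, Cmod_polar; lra|apply pcont_polar].
  - intros t _. rewrite Cmod_mult, Cmod_polar by lra. apply Rmult_le_compat_r; [lra|]. apply HM, Cmod_polar; lra.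
  - eexists. apply cdiff_ext_loc with (fun v => / RtoC (2 * PI) *
      CI (fun t => (f (polar r t) * polar r t) / (polar r t - v)) 0 (0 + 2 * PI))%C (r - Cmod z); [lra| |].
    + intros w Hw. assert (Cmod w < r) by (pose proof (Cmod_minus_ge w z); lra).
      rewrite (CI_ext _ (fun t => f (polar r t) * (polar r t / (polar r t - w)))%C).
      * rewrite Hcf by assumption. field. apply RtoC_2PI_nz.
      * intros t _. field. apply polar_minus_nz; lra.
    + apply (cdiff_mult (fun _ => / RtoC (2 * PI))%C); [apply cdiff_const|exact Hl].
Qed.

Lemma le_all_eps_lin (x K : R) : (forall e, 0 < e -> x <= K * e) -> x <= 0.
Proof.
  intros H. destruct (Rle_dec x 0) as [h|h]; [exact h|].
  assert (0 < x) by lra. destruct (Rle_dec K 0) as [k|k].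
  - specialize (H 1 ltac:(lra)). lra.
  - specialize (H (x / (2 * K)) ltac:(apply Rdiv_lt_0_compat; lra)).
    replace (K * (x / (2 * K))) with (x / 2) in H by (field; lra). lra.
Qed.

(** Weierstrass's theorem: Cauchy's formula passes to the limit, and a function reproduced by its
    Cauchy integral is differentiable. One good index for each radius and eps is all that is
    asked. *)
Lemma hol_limit (fn : nat -> C -> C) f : (forall n, hol 1 (fn n)) ->
  (forall z, Cmod z < 1 -> Cmod (f z) <= 1) ->
  (forall r, r < 1 -> forall eps, 0 < eps -> exists n, forall z, Cmod z <= r -> Cmod (fn n z - f z) < eps) ->
  hol 1 f.
Proof.
  intros Hn Hb Hu z Hz. pose proof (Cmod_ge_0 z). pose proof PI_RGT_0 as HPI.
  set (r := (1 + Cmod z) / 2). assert (Hr : 0 < r < 1) by (unfold r; lra). assert (Hzr : Cmod z < r) by (unfold r; lra).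
  assert (Hc : forall w, Cmod w < 1 -> ccont f w).
  { intros w Hw e He. destruct (Hu ((1 + Cmod w) / 2) ltac:(lra) (e / 3) ltac:(lra)) as [n Hn1].
    destruct (hol_ccont 1 (fn n) w (Hn n) Hw (e / 3) ltac:(lra)) as [d [Hd Hd1]]. unfold dC in *.
    exists (Rmin d ((1 - Cmod w) / 2)). split; [apply Rmin_pos; lra|]. intros v Hv.
    pose proof (Rmin_l d ((1 - Cmod w) / 2)); pose proof (Rmin_r d ((1 - Cmod w) / 2)).
    pose proof (Cmod_minus_ge v w).
    pose proof (Hn1 w ltac:(lra)) as A1. pose proof (Hn1 v ltac:(lra)) as A2. pose proof (Hd1 v ltac:(lra)) as A3.
    replace (f v - f w)%C with ((fn n w - f w) + (fn n v - fn n w) - (fn n v - f v))%C by ring.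
    eapply Rle_lt_trans; [apply Cmod_minus_le|].
    eapply Rle_lt_trans; [apply Rplus_le_compat_r, Cmod_triangle|]. lra. }
  apply (hol_of_cauchy f r z Hr Hzr).
  - intros w Hw. apply Hc. lra.
  - exists 1. intros w Hw. apply Hb. lra.
  - intros v Hv.
    assert (Hk : cont_on (fun t => polar r t / (polar r t - v))%C 0 (0 + 2 * PI)).
    { intros t _. apply pcont_cauchy; [lra|lra|apply pcont_polar]. }
    assert (Hcf : forall g, (forall w, Cmod w < 1 -> ccont g w) ->
      cont_on (fun t => g (polar r t) * (polar r t / (polar r t - v)))%C 0 (0 + 2 * PI)).
    { intros g Hg t Ht. apply contg_mult; [apply pcont_circle, Hg; rewrite Cmod_polar; lra|apply Hk, Ht]. }
    assert (Hdv : 0 < r - Cmod v) by lra.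
    apply Ceq_minus, Cmod_eq_0. apply Rle_antisym; [|apply Cmod_ge_0].
    apply le_all_eps_lin with (r / (r - Cmod v) * (2 * PI) + 2 * PI). intros e He.
    destruct (Hu r ltac:(lra) e He) as [n Hn1].
    replace (CI (fun t => f (polar r t) * (polar r t / (polar r t - v))) 0 (0 + 2 * PI) - RtoC (2 * PI) * f v)%C
      with ((RtoC (2 * PI) * (fn n v - f v)) -
        CI (fun t => (fn n (polar r t) - f (polar r t)) * (polar r t / (polar r t - v))) 0 (0 + 2 * PI))%C.
    + eapply Rle_trans; [apply Cmod_minus_le|]. rewrite Cmod_mult, Cmod_RtoC, Rabs_pos_eq by lra.
      specialize (Hn1 v ltac:(lra)) as Hv1.
      assert (B : Cmod (CI (fun t => (fn n (polar r t) - f (polar r t)) * (polar r t / (polar r t - v)))%C 0 (0 + 2 * PI))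
         <= e * (r / (r - Cmod v)) * Rabs (0 + 2 * PI - 0)).
      { apply CI_bound.
        - apply (Hcf (fun w => fn n w - f w)%C). intros w Hw.
          apply contg_minus; [eapply hol_ccont; [apply Hn|exact Hw]|apply Hc, Hw].
        - intros t _. rewrite Cmod_mult. apply Rmult_le_compat; try apply Cmod_ge_0.
          + left. apply Hn1. rewrite Cmod_polar; lra.
          + rewrite Cmod_div, Cmod_polar by (try apply polar_minus_nz; lra).
            apply Rmult_le_compat_l; [lra|]. apply Rinv_le_contravar; [lra|]. apply polar_minus_ge. lra. }
      rewrite Rabs_pos_eq in B by lra. nra.
    + rewrite (CI_ext _ (fun t => fn n (polar r t) * (polar r t / (polar r t - v)) - f (polar r t) * (polar r t / (polar r t - v)))%C) by (intros; ring).
      rewrite CI_minus; [|apply Hcf; intros; eapply hol_ccont; [apply Hn|assumption]|apply Hcf, Hc].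
      rewrite cauchy_formula by (auto; lra). ring.
Qed.

(** The quotient is differentiable at 0 because near 0 it agrees with [Phi], a Cauchy-type integral
    taken against dt: the identity z / (s - z) = s / (s - z) - 1 shows z Phi(z) = f(z) - f(0).
    Besides Schwarz's lemma this provides the backward shift of a holomorphic function. *)
Lemma factor_zero f : hol 1 f -> exists b, hol 1 b /\ forall z, f z = (f 0 + z * b z)%C.
Proof.
  intros Hf. destruct (slope 1 f 0 Hf) as [k [Hk E]]; [rewrite Cmod_0; lra|].
  pose proof PI_RGT_0 as HPI.
  set (Phi := fun z : C => (/ RtoC (2 * PI) * CI (fun t => f (polar (/2) t) / (polar (/2) t - z)) 0 (0 + 2 * PI))%C).
  assert (Hfc : forall t, pcont (fun t => f (polar (/ 2) t)) t).
  { intros t. apply pcont_circle. eapply hol_ccont; [exact Hf|]. rewrite Cmod_polar; lra. }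
  destruct (continuity_ab_maj (fun t => Cmod (f (polar (/ 2) t))) 0 (2 * PI)) as [m [Hm1 Hm2]]; [lra| |].
  { intros t _. apply continuity_pt_filterlim.
    apply (pcont_fst (fun t => RtoC (Cmod (f (polar (/2) t))))). apply contg_Cmod, Hfc. }
  assert (HPhi : exists l, cdiff Phi 0 l).
  { destruct (cauchy_type_cdiff (fun t => f (polar (/ 2) t)) (Cmod (f (polar (/ 2) m))) (/ 2) 0) as [l Hl];
      [lra|rewrite Cmod_0; lra|exact Hfc|exact Hm1|].
    eexists. apply (cdiff_mult (fun _ => / RtoC (2 * PI))%C); [apply cdiff_const|exact Hl]. }
  assert (EP : forall z, Cmod z < / 2 -> z <> 0 -> Phi z = k z).
  { intros z Hz Hn. unfold Phi.
    assert (Hcz : cont_on (fun t => f (polar (/ 2) t) / (polar (/ 2) t - z))%C 0 (0 + 2 * PI)).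
    { intros t _. apply pcont_cauchy; [lra|lra|apply Hfc]. }
    assert (E1 : (z * CI (fun t => f (polar (/2) t) / (polar (/2) t - z)) 0 (0 + 2 * PI) = RtoC (2 * PI) * (f z - f 0))%C).
    { rewrite <- CI_scal by exact Hcz.
      rewrite (CI_ext _ (fun t => f (polar (/2) t) * (polar (/2) t / (polar (/2) t - z)) - f (polar (/ 2) t))%C).
      - rewrite CI_minus.
        + rewrite cauchy_formula, (mean_value 1 f) by (assumption || lra). ring.
        + intros t _. apply contg_mult; [apply Hfc|apply pcont_cauchy; [lra|lra|apply pcont_polar]].
        + intros t _. apply Hfc.
      - intros t _. field. apply polar_minus_nz; lra. }
    assert (E2 : (f z - f 0 = z * k z)%C) by (rewrite (E z); ring).
    rewrite E2 in E1.
    replace (CI (fun t => f (polar (/2) t) / (polar (/2) t - z)) 0 (0 + 2 * PI))%C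
      with (/ z * (z * CI (fun t => f (polar (/2) t) / (polar (/2) t - z)) 0 (0 + 2 * PI)))%C by (field; exact Hn).
    rewrite E1. field. split; [exact Hn|apply RtoC_2PI_nz]. }
  (* Taking the value at 0 from [Phi] spares a comparison with the derivative of f there. *)
  exists (fun z => if Ceq_dec z 0 then Phi 0 else k z). split.
  - intros z Hz. destruct (Ceq_dec z 0) as [->|Hn].
    + destruct HPhi as [l Hl]. exists l. apply cdiff_ext_loc with Phi (/ 2); [lra| |exact Hl].
      intros w Hw. destruct (Ceq_dec w 0) as [->|Hwn]; [reflexivity|].
      apply EP; [|exact Hwn]. replace (w - 0)%C with w in Hw by ring. exact Hw.
    + destruct (proj2 (Hk z Hz) Hn) as [l Hl]. exists l.
      apply cdiff_ext_loc with k (Cmod z); [apply (proj1 (Cmod_gt_0 _)), Hn| |exact Hl].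
      intros w Hw. destruct (Ceq_dec w 0) as [->|Hwn]; [|reflexivity].
      replace (0 - z)%C with (- z)%C in Hw by ring. rewrite Cmod_opp in Hw. lra.
  - intros z. destruct (Ceq_dec z 0) as [->|Hn]; [ring|]. rewrite (E z). ring.
Qed.

(** * Schwarz's lemma and the Schwarz-Pick inequality *)

Lemma le_scaled_limit (x y K : R) : 0 <= x -> y < 1 -> (forall r, y < r < 1 -> x * r <= K) -> x <= K.
Proof.
  intros Hx Hy H. destruct (Rle_dec x K) as [h|h]; [exact h|exfalso].
  destruct (Req_dec x 0) as [h0|h0].
  - specialize (H ((y + 1) / 2) ltac:(lra)). subst x. lra.
  - assert (Hq : K / x < 1) by (apply Rmult_lt_reg_r with x; [lra|]; unfold Rdiv; rewrite Rmult_assoc, Rinv_l; lra).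
    set (r := Rmax ((y + 1) / 2) ((K / x + 1) / 2)).
    assert (r < 1) by (apply Rmax_lub_lt; lra).
    pose proof (Rmax_l ((y + 1) / 2) ((K / x + 1) / 2)). pose proof (Rmax_r ((y + 1) / 2) ((K / x + 1) / 2)).
    fold r in H1, H2. specialize (H r ltac:(lra)).
    assert (x * (K / x) < x * r) by (apply Rmult_lt_compat_l; lra).
    replace (x * (K / x)) with K in H3 by (field; lra). lra.
Qed.

(** On |w| = r the bound is (M + |f(0)|) / r; the maximum principle carries it inside and r tends to
    1. For f(0) = 0 this is Schwarz's lemma, in general it bounds the backward shift. *)
Lemma factor_bound (f b : C -> C) (M : R) : hol 1 b -> (forall z, f z = (f 0 + z * b z)%C) ->
  (forall z, Cmod z < 1 -> Cmod (f z) <= M) -> forall z, Cmod z < 1 -> Cmod (b z) <= M + Cmod (f 0).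
Proof.
  intros Hb E HM z Hz. apply le_scaled_limit with (Cmod z); [apply Cmod_ge_0|exact Hz|].
  intros r Hr. pose proof (Cmod_ge_0 z).
  assert (B : Cmod (b z) <= (M + Cmod (f 0)) / r).
  { apply (max_principle b r z); [exact Hb|lra|lra|]. intros w Hw.
    assert (Hr0 : 0 < r) by lra.
    apply Rmult_le_reg_l with r; [lra|].
    replace (r * ((M + Cmod (f 0)) / r)) with (M + Cmod (f 0)) by (field; lra).
    rewrite <- Hw at 1. rewrite <- Cmod_mult.
    replace (w * b w)%C with (f w - f 0)%C by (rewrite (E w); ring).
    eapply Rle_trans; [apply Cmod_minus_le|]. specialize (HM w ltac:(lra)). lra. }
  apply Rmult_le_compat_r with (r := r) in B; [|lra].
  unfold Rdiv in B. rewrite Rmult_assoc, Rinv_l in B by lra. lra.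
Qed.

Lemma schwarz f : hol 1 f -> f 0 = 0 -> (forall z, Cmod z < 1 -> Cmod (f z) <= 1) ->
  forall z, Cmod z < 1 -> Cmod (f z) <= Cmod z.
Proof.
  intros Hf H0 H1 z Hz. destruct (factor_zero f Hf) as [b [Hb E]].
  pose proof (factor_bound f b 1 Hb E H1 z Hz) as B. rewrite H0, Cmod_0 in B.
  rewrite (E z), H0, Cplus_0_l, Cmod_mult. pose proof (Cmod_ge_0 z). nra.
Qed.

Lemma schwarz_pick_lt f z w : hol 1 f -> (forall v, Cmod v < 1 -> Cmod (f v) <= 1) ->
  Cmod z < 1 -> Cmod w < 1 -> Cmod (f w) < 1 -> Cmod (mob (f w) (f z)) <= Cmod (mob w z).
Proof.
  intros Hf H1 Hz Hw Hfw.
  assert (Hw' : Cmod (- w) < 1) by (rewrite Cmod_opp; exact Hw).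
  pose proof (schwarz (fun v => mob (f w) (f (mob (- w) v)))) as S.
  rewrite <- (mob_inv w z Hw) at 1 by lra.
  apply S.
  - assert (Hc : hol 1 (fun v => f (mob (- w) v)))
      by (apply (hol_comp 1 1 f); [exact Hf|apply hol_mob, Hw'|intros; apply mob_lt1; assumption]).
    intros v Hv. destruct (Hc v Hv) as [m Hm]. eexists.
    apply (cdiff_comp (mob (f w)) (fun v => f (mob (- w) v))); [|exact Hm].
    apply cdiff_mob; [exact Hfw|]. apply H1, mob_lt1; assumption.
  - replace (mob (- w) 0) with w.
    + unfold mob. rewrite Cminus_diag. unfold Cdiv. ring.
    + unfold mob. replace (1 - Cconj (- w) * 0)%C with (RtoC 1) by ring. field.
  - intros v Hv. apply mob_le1; [exact Hfw|]. apply H1, mob_lt1; assumption.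
  - apply mob_lt1; assumption.
Qed.

Lemma schwarz_pick f z w : hol 1 f -> (forall v, Cmod v < 1 -> Cmod (f v) <= 1) ->
  Cmod z < 1 -> Cmod w < 1 ->
  Cmod (f z - f w) * Cmod (1 - Cconj w * z) <= Cmod (1 - Cconj (f w) * f z) * Cmod (z - w).
Proof.
  intros Hf H1 Hz Hw.
  set (A := Cmod (1 - Cconj w * z)). set (B := Cmod (z - w)).
  assert (HA : 0 < A) by (apply (proj1 (Cmod_gt_0 _)), mob_den; lra).
  assert (HB : 0 <= B) by apply Cmod_ge_0.
  assert (Hs : forall t, 0 < t < 1 -> t * (Cmod (f z - f w) * A) <= (Cmod (1 - Cconj (f w) * f z) + (1 - t * t)) * B).
  { intros t Ht.
    assert (Hft : forall v, Cmod v < 1 -> Cmod (RtoC t * f v) < 1).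
    { intros v Hv. specialize (H1 v Hv). rewrite Cmod_mult, Cmod_RtoC, Rabs_pos_eq by lra.
      pose proof (Cmod_ge_0 (f v)). nra. }
    pose proof (schwarz_pick_lt (fun v => RtoC t * f v)%C z w) as S.
    specialize (S ltac:(apply hol_mult; [apply hol_const|exact Hf]) ltac:(intros v Hv; left; apply Hft, Hv) Hz Hw (Hft w Hw)).
    assert (Hd : (1 - Cconj (RtoC t * f w) * (RtoC t * f z))%C <> 0) by (apply mob_den; [apply Hft, Hw|left; apply Hft, Hz]).
    unfold mob in S. rewrite !Cmod_div in S by (exact Hd || (apply mob_den; lra)).
    fold A B in S.
    assert (HD : 0 < Cmod (1 - Cconj (RtoC t * f w) * (RtoC t * f z))) by (apply (proj1 (Cmod_gt_0 _)), Hd).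
    set (D := Cmod (1 - Cconj (RtoC t * f w) * (RtoC t * f z))) in *.
    assert (S2 : Cmod (RtoC t * f z - RtoC t * f w) * A <= D * B).
    { apply Rmult_le_compat_r with (r := D * A) in S; [|nra].
      replace (Cmod (RtoC t * f z - RtoC t * f w) / D * (D * A)) with (Cmod (RtoC t * f z - RtoC t * f w) * A) in S by (field; lra).
      replace (B / A * (D * A)) with (D * B) in S by (field; lra). exact S. }
    replace (RtoC t * f z - RtoC t * f w)%C with (RtoC t * (f z - f w))%C in S2 by ring.
    rewrite Cmod_mult, Cmod_RtoC, Rabs_pos_eq in S2 by lra. rewrite Rmult_assoc in S2.
    eapply Rle_trans; [exact S2|]. apply Rmult_le_compat_r; [exact HB|]. unfold D.
    replace (1 - Cconj (RtoC t * f w) * (RtoC t * f z))%C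
      with ((1 - Cconj (f w) * f z) + RtoC (1 - t * t) * (Cconj (f w) * f z))%C.
    - eapply Rle_trans; [apply Cmod_triangle|]. apply Rplus_le_compat_l.
      rewrite !Cmod_mult, Cmod_conj, Cmod_RtoC, Rabs_pos_eq by nra.
      pose proof (H1 z Hz); pose proof (H1 w Hw). pose proof (Cmod_ge_0 (f z)); pose proof (Cmod_ge_0 (f w)).
      assert (Cmod (f w) * Cmod (f z) <= 1).
      { rewrite <- (Rmult_1_r 1). apply Rmult_le_compat; lra. }
      rewrite <- (Rmult_1_r (1 - t * t)) at 2. apply Rmult_le_compat_l; [nra|assumption].
    - rewrite Cmult_conj. replace (Cconj (RtoC t)) with (RtoC t) by (unfold Cconj, RtoC; simpl; rewrite Ropp_0; reflexivity).
      rewrite RtoC_minus, RtoC_mult. ring. }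
  set (P := Cmod (f z - f w) * A) in *. set (Q := Cmod (1 - Cconj (f w) * f z)) in *.
  assert (HP : 0 <= P) by (apply Rmult_le_pos; [apply Cmod_ge_0|lra]).
  assert (HL : P - Q * B <= 0).
  { apply le_all_eps_lin with (2 * P + 2 * B). intros e He.
    destruct (Rlt_dec e 1) as [h|h].
    - specialize (Hs (1 - e) ltac:(lra)).
      assert (1 - (1 - e) * (1 - e) <= 2 * e) by nra.
      assert ((1 - (1 - e) * (1 - e)) * B <= 2 * e * B) by (apply Rmult_le_compat_r; lra).
      nra.
    - assert (0 <= Q * B) by (apply Rmult_le_pos; [apply Cmod_ge_0|lra]). nra. }
  lra.
Qed.

(** * Convergence of complex sequences *)

Definition clim (s : nat -> C) (l : C) : Prop :=
  is_lim_seq (fun n => fst (s n)) (fst l) /\ is_lim_seq (fun n => snd (s n)) (snd l).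

Lemma clim_const c : clim (fun _ => c) c.
Proof. split; apply is_lim_seq_const. Qed.

Lemma clim_minus s t a b : clim s a -> clim t b -> clim (fun n => s n - t n)%C (a - b).
Proof.
  intros [H1 H2] [H3 H4]. split; simpl; apply is_lim_seq_minus'; assumption.
Qed.

Lemma clim_mult s t a b : clim s a -> clim t b -> clim (fun n => s n * t n)%C (a * b).
Proof.
  intros [H1 H2] [H3 H4]. split; simpl;
  [apply is_lim_seq_minus'|apply is_lim_seq_plus']; apply is_lim_seq_mult'; assumption.
Qed.

Lemma clim_conj s a : clim s a -> clim (fun n => Cconj (s n)) (Cconj a).
Proof. intros [H1 H2]. split; simpl; [exact H1|]. apply (is_lim_seq_opp _ (snd a)), H2. Qed.

Lemma clim_RtoC s (a : R) : is_lim_seq s a -> clim (fun n => RtoC (s n)) (RtoC a).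
Proof. intros H. split; simpl; [exact H|apply is_lim_seq_const]. Qed.

Lemma clim_inv s (a : C) : a <> 0 -> clim s a -> clim (fun n => / s n)%C (/ a).
Proof.
  intros Hn [H1 H2].
  assert (Hp : fst a ^ 2 + snd a ^ 2 <> 0).
  { intros E. apply Hn. assert (0 < Cmod a) by (apply (proj1 (Cmod_gt_0 _)), Hn).
    pose proof (Cmod_sqr a). nra. }
  assert (Hd : is_lim_seq (fun n => fst (s n) ^ 2 + snd (s n) ^ 2) (fst a ^ 2 + snd a ^ 2)).
  { simpl. apply is_lim_seq_plus'; repeat apply is_lim_seq_mult'; try assumption; apply is_lim_seq_const. }
  split; unfold Cinv; cbn [fst snd].
  - apply is_lim_seq_div'; assumption.
  - apply is_lim_seq_div'; [apply (is_lim_seq_opp _ (snd a))|exact Hd|exact Hp]; exact H2.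
Qed.

Lemma clim_div s t (a b : C) : b <> 0 -> clim s a -> clim t b -> clim (fun n => s n / t n)%C (a / b).
Proof. intros. apply clim_mult; [|apply clim_inv]; assumption. Qed.

Lemma clim_dist s a : clim s a -> is_lim_seq (fun n => Cmod (s n - a)) 0.
Proof.
  intros [H1 H2].
  apply is_lim_seq_le_le with (fun _ => 0) (fun n => Rabs (fst (s n) - fst a) + Rabs (snd (s n) - snd a)).
  - intros n. split; [apply Cmod_ge_0|apply (Cmod_le_sum (s n - a))].
  - apply is_lim_seq_const.
  - replace 0 with (0 + 0) by ring. apply is_lim_seq_plus'.
    + replace (Finite 0) with (Rbar_abs (Finite 0)) by (simpl; rewrite Rabs_R0; reflexivity).
      apply is_lim_seq_abs. replace 0 with (fst a - fst a) by ring.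
      apply is_lim_seq_minus'; [exact H1|apply is_lim_seq_const].
    + replace (Finite 0) with (Rbar_abs (Finite 0)) by (simpl; rewrite Rabs_R0; reflexivity).
      apply is_lim_seq_abs. replace 0 with (snd a - snd a) by ring.
      apply is_lim_seq_minus'; [exact H2|apply is_lim_seq_const].
Qed.

Lemma clim_Cmod s a : clim s a -> is_lim_seq (fun n => Cmod (s n)) (Cmod a).
Proof.
  intros H. apply clim_dist in H.
  apply is_lim_seq_le_le with (fun n => Cmod a - Cmod (s n - a)) (fun n => Cmod a + Cmod (s n - a)).
  - intros n. pose proof (Cmod_minus_ge (s n) a). pose proof (Cmod_minus_ge a (s n)).
    rewrite (Cmod_minus_sym a) in H1. lra.
  - replace (Finite (Cmod a)) with (Finite (Cmod a - 0)) by (f_equal; ring).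
    apply is_lim_seq_minus'; [apply is_lim_seq_const|exact H].
  - replace (Finite (Cmod a)) with (Finite (Cmod a + 0)) by (f_equal; ring).
    apply is_lim_seq_plus'; [apply is_lim_seq_const|exact H].
Qed.

Lemma clim_unique s a b : clim s a -> clim s b -> a = b.
Proof.
  intros [H1 H2] [H3 H4]. apply is_lim_seq_unique in H1, H2, H3, H4.
  apply injective_projections; congruence.
Qed.

Lemma clim_ext s t a : (forall n, s n = t n) -> clim s a -> clim t a.
Proof.
  intros E [H1 H2]. split; [apply is_lim_seq_ext with (fun n => fst (s n))|apply is_lim_seq_ext with (fun n => snd (s n))];
  auto; intros; rewrite E; reflexivity.
Qed.

Lemma clim_incr s a : clim s a -> clim (fun n => s (S n)) a.
Proof. intros [H1 H2]. split; [apply (is_lim_seq_incr_1 (fun n => fst (s n)))|apply (is_lim_seq_incr_1 (fun n => snd (s n)))]; assumption. Qed.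

Lemma clim_mob a s b c : Cmod b < 1 -> Cmod c <= 1 -> clim a b -> clim s c ->
  clim (fun n => mob (a n) (s n)) (mob b c).
Proof.
  intros Hb Hc Ha Hs. apply clim_div; [apply mob_den; assumption|apply clim_minus; assumption|].
  apply clim_minus; [apply clim_const|]. apply clim_mult; [apply clim_conj|]; assumption.
Qed.

(** * The normalised iterates and their limit *)

Lemma rho_mob z w : Cmod z < 1 -> Cmod w < 1 -> rho z w = Cmod (mob z w).
Proof.
  intros Hz Hw. unfold rho, mob.
  rewrite !Cmod_div by (apply mob_den; lra). f_equal.
  rewrite <- (Cmod_conj (1 - Cconj z * w)), Cminus_conj, Cmult_conj, Cconj_conj.
  replace (Cconj 1) with (RtoC 1) by (unfold Cconj, RtoC; simpl; rewrite Ropp_0; reflexivity).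
  f_equal. f_equal. ring.
Qed.

Lemma mob_self a : mob a a = 0.
Proof. unfold mob. rewrite Cminus_diag. unfold Cdiv. ring. Qed.

(** As functions of w, both sides are automorphisms vanishing at b, hence differ by a rotation; the
    unimodular quotient is that rotation. *)
Lemma mob_mob a b w : Cmod a < 1 -> Cmod b < 1 -> Cmod w < 1 ->
  mob (mob a b) (mob a w) = ((1 - Cconj b * a) / (1 - Cconj a * b) * mob b w)%C.
Proof.
  intros Ha Hb Hw.
  assert (D1 := mob_den a b Ha ltac:(lra)). assert (D2 := mob_den a w Ha ltac:(lra)).
  assert (D3 := mob_den b a Hb ltac:(lra)). assert (D4 := mob_den b w Hb ltac:(lra)).
  assert (D5 := mob_den a a Ha ltac:(lra)).
  unfold mob. rewrite Cdiv_conj, !Cminus_conj, Cmult_conj, Cconj_conj by exact D1.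
  replace (Cconj 1) with (RtoC 1) by (unfold Cconj, RtoC; simpl; rewrite Ropp_0; reflexivity).
  assert (D6 : (1 - a * Cconj b)%C <> 0) by (replace (1 - a * Cconj b)%C with (1 - Cconj b * a)%C by ring; exact D3).
  field. repeat split; auto.
  replace ((1 - a * Cconj b) * (1 - Cconj a * w) - (Cconj b - Cconj a) * (w - a))%C
    with ((1 - Cconj a * a) * (1 - Cconj b * w))%C by ring.
  apply Cmult_neq_0; assumption.
Qed.

Lemma mob_Cmod_ge a w c : Cmod a < 1 -> Cmod w < 1 ->
  c <= (1 - Cmod a * Cmod a) * (1 - Cmod w * Cmod w) / 4 -> c <= 1 - Cmod (mob a w) * Cmod (mob a w).
Proof.
  intros Ha Hw Hc. rewrite mob_Cmod by lra. eapply Rle_trans; [exact Hc|].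
  assert (Hd : 0 < Cmod (1 - Cconj a * w)) by (apply (proj1 (Cmod_gt_0 _)), mob_den; lra).
  assert (Hd2 : Cmod (1 - Cconj a * w) <= 2).
  { eapply Rle_trans; [apply Cmod_minus_le|]. pose proof (Cmod_prod_lt1 a w Ha ltac:(lra)). rewrite Cmod_1. lra. }
  pose proof (Cmod_ge_0 a); pose proof (Cmod_ge_0 w).
  apply Rmult_le_compat_l; [apply Rmult_le_pos; nra|]. apply Rinv_le_contravar; nra.
Qed.

Section NormalisedIterates.
Variables (phi : C -> C) (z0 : C) (l : R).
Hypothesis Hphi : hol 1 phi.
Hypothesis Hself : forall z, Cmod z < 1 -> Cmod (phi z) < 1.
Hypothesis Hz0 : Cmod z0 < 1.
Hypothesis Hl : 0 < l.
Hypothesis Hlim : is_lim_seq (fun n => rho (iterate phi n z0) (iterate phi (S n) z0)) l.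

Definition orb (n : nat) : C := iterate phi n z0.
Definition stp (n : nat) : R := Cmod (mob (orb n) (orb (S n))).
(* [kap n] rotates the next orbit point onto the positive axis: [tau n (orb (S n)) = stp n]. *)
Definition kap (n : nat) : C := (Cconj (mob (orb n) (orb (S n))) / RtoC (stp n))%C.
Definition tau (n : nat) (w : C) : C := (kap n * mob (orb n) w)%C.
Definition tauinv (n : nat) (w : C) : C := mob (- orb n) (Cconj (kap n) * w).
Definition sg (n : nat) (w : C) : C := tau n (iterate phi n w).

Lemma iterate_disk n z : Cmod z < 1 -> Cmod (iterate phi n z) < 1.
Proof. intros Hz. induction n; simpl; [exact Hz|apply Hself, IHn]. Qed.

Lemma iterate_phi n z : iterate phi n (phi z) = iterate phi (S n) z.
Proof. unfold iterate. symmetry. apply Nat.iter_succ_r. Qed.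

Lemma hol_iterate n : hol 1 (iterate phi n).
Proof.
  induction n; simpl; [apply hol_id|].
  apply (hol_comp 1 1 phi); [exact Hphi|exact IHn|intros; apply iterate_disk; assumption].
Qed.

Lemma orb_disk n : Cmod (orb n) < 1.
Proof. apply iterate_disk, Hz0. Qed.

Lemma stp_decr n : stp (S n) <= stp n.
Proof.
  unfold stp. change (orb (S (S n))) with (phi (orb (S n))). change (orb (S n)) with (phi (orb n)) at 1.
  apply schwarz_pick_lt; try apply orb_disk; [exact Hphi|intros; left; apply Hself; assumption|].
  apply Hself, orb_disk.
Qed.

Lemma stp_lim : is_lim_seq stp l.
Proof.
  eapply is_lim_seq_ext; [|exact Hlim]. intros n. simpl. apply rho_mob; [|apply (orb_disk (S n))]; apply orb_disk.
Qed.

Lemma stp_ge n : l <= stp n.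
Proof.
  apply (is_lim_seq_decr_compare stp l stp_lim stp_decr).
Qed.

Lemma stp_lt1 n : stp n < 1.
Proof. apply mob_lt1; apply orb_disk. Qed.

Lemma stp_nz n : RtoC (stp n) <> 0.
Proof. intros E. apply RtoC_inj in E. pose proof (stp_ge n). lra. Qed.

Lemma kap_mod n : Cmod (kap n) = 1.
Proof.
  unfold kap. rewrite Cmod_div by apply stp_nz. rewrite Cmod_conj, Cmod_RtoC.
  pose proof (stp_ge n). rewrite Rabs_pos_eq by lra. fold (stp n). field. lra.
Qed.

Lemma kap_conj n : (kap n * Cconj (kap n) = 1)%C.
Proof. rewrite <- Cmod_sqr_conj, kap_mod. f_equal. ring. Qed.

Lemma tau_mod n w : Cmod (tau n w) = Cmod (mob (orb n) w).
Proof. unfold tau. rewrite Cmod_mult, kap_mod. ring. Qed.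

Lemma tau_inv n w : Cmod w < 1 -> tauinv n (tau n w) = w.
Proof.
  intros Hw. unfold tauinv, tau.
  replace (Cconj (kap n) * (kap n * mob (orb n) w))%C with ((kap n * Cconj (kap n)) * mob (orb n) w)%C by ring.
  rewrite kap_conj, Cmult_1_l. apply mob_inv; [apply orb_disk|lra].
Qed.

Lemma tau_orb n : tau n (orb n) = 0.
Proof. unfold tau. rewrite mob_self. ring. Qed.

Lemma tau_next n : tau n (orb (S n)) = RtoC (stp n).
Proof.
  unfold tau, kap. replace (Cconj (mob (orb n) (orb (S n))) / stp n * mob (orb n) (orb (S n)))%C
    with ((mob (orb n) (orb (S n)) * Cconj (mob (orb n) (orb (S n)))) / stp n)%C by (field; apply stp_nz).
  rewrite <- Cmod_sqr_conj. fold (stp n). rewrite RtoC_mult. field. apply stp_nz.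
Qed.

Lemma hol_tau n : hol 1 (tau n).
Proof. apply hol_mult; [apply hol_const|apply hol_mob, orb_disk]. Qed.

Lemma sg_disk n z : Cmod z < 1 -> Cmod (sg n z) < 1.
Proof. intros Hz. unfold sg. rewrite tau_mod. apply mob_lt1; [apply orb_disk|apply iterate_disk, Hz]. Qed.

Lemma hol_sg n : hol 1 (sg n).
Proof. apply (hol_comp 1 1 (tau n)); [apply hol_tau|apply hol_iterate|intros; apply iterate_disk; assumption]. Qed.

(** The number (1 - stp 0 ^ 2) (1 - k^2) / 4 bounds 1 - |mob (stp n) w|^2 from below for |w| <= k.
    The 5 is 4 + 1 from the two parts of |1 - b(w)| in [step_factor], and l converts 1 - stp (n + 1)
    / stp n into a difference of steps. *)
Definition stp_const (k : R) : R := 5 / ((1 - stp 0 * stp 0) * (1 - k * k) / 4 * l).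

Lemma stp_le0 n : stp n <= stp 0.
Proof. induction n; [lra|]. eapply Rle_trans; [apply stp_decr|exact IHn]. Qed.

Lemma stp_const_pos k : 0 <= k < 1 -> 0 < stp_const k.
Proof.
  intros Hk. unfold stp_const. pose proof (stp_lt1 0). pose proof (stp_ge 0).
  apply Rdiv_lt_0_compat; [lra|]. assert (0 < (1 - stp 0 * stp 0) * (1 - k * k)) by (apply Rmult_lt_0_compat; nra). nra.
Qed.

(** The self-map B = tau (n + 1) o phi o (tau n)^(-1) fixes 0 and sends stp n to stp (n + 1).
    Division by w leaves b with |b| <= 1 and b(stp n) = stp (n + 1) / stp n. As the steps decrease
    to l > 0 this value is near 1, and Schwarz-Pick spreads the nearness over compact sets. The
    deviations are controlled by differences of the convergent sequence of steps, hence are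
    summable. *)
Lemma step_factor n : exists b : C -> C, hol 1 b /\ (forall w, Cmod w < 1 -> Cmod (b w) <= 1) /\
  (forall z, Cmod z < 1 -> sg (S n) z = (sg n z * b (sg n z))%C) /\
  (forall k w, 0 <= k < 1 -> Cmod w <= k -> Cmod (1 - b w) <= stp_const k * (stp n - stp (S n))).
Proof.
  set (B := fun w => tau (S n) (phi (tauinv n w))).
  assert (Hkm : forall w, Cmod (Cconj (kap n) * w) = Cmod w) by (intros; rewrite Cmod_mult, Cmod_conj, kap_mod; ring).
  assert (Hon : Cmod (- orb n) < 1) by (rewrite Cmod_opp; apply orb_disk).
  assert (Hti : forall w, Cmod w < 1 -> Cmod (tauinv n w) < 1).
  { intros w Hw. apply mob_lt1; [exact Hon|rewrite Hkm; exact Hw]. }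
  assert (HB : hol 1 B).
  { apply (hol_comp 1 1 (tau (S n))); [apply hol_tau| |intros; apply Hself, Hti; assumption].
    apply (hol_comp 1 1 phi); [exact Hphi| |exact Hti].
    apply (hol_comp 1 1 (mob (- orb n)) (fun w => Cconj (kap n) * w)%C); [apply hol_mob, Hon| |].
    apply hol_mult; [apply hol_const|apply hol_id]. intros z Hz; rewrite Hkm; exact Hz. }
  assert (HB1 : forall w, Cmod w < 1 -> Cmod (B w) <= 1).
  { intros w Hw. unfold B. rewrite tau_mod. left. apply mob_lt1; [apply orb_disk|apply Hself, Hti, Hw]. }
  assert (HBt : forall z, Cmod z < 1 -> B (tau n z) = tau (S n) (phi z)) by (intros; unfold B; rewrite tau_inv; auto).
  assert (HB0 : B 0 = 0).
  { rewrite <- (tau_orb n) at 1. rewrite HBt by apply orb_disk. apply (tau_orb (S n)). }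
  assert (HBs : B (RtoC (stp n)) = RtoC (stp (S n))).
  { rewrite <- (tau_next n), HBt by apply orb_disk. apply (tau_next (S n)). }
  destruct (factor_zero B HB) as [b [Hb E]].
  assert (E' : forall w, B w = (w * b w)%C) by (intros w; rewrite (E w), HB0; ring).
  assert (Hb1 : forall w, Cmod w < 1 -> Cmod (b w) <= 1).
  { intros w Hw. pose proof (factor_bound B b 1 Hb E HB1 w Hw) as H. rewrite HB0, Cmod_0 in H. lra. }
  exists b. split; [exact Hb|]. split; [exact Hb1|]. split.
  { intros z Hz. rewrite <- E'. unfold sg. rewrite HBt by (apply iterate_disk, Hz). reflexivity. }
  intros k w Hk Hw.
  pose proof (stp_ge n) as G1; pose proof (stp_ge (S n)) as G2; pose proof (stp_lt1 n) as G3.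
  pose proof (stp_decr n) as G4; pose proof (stp_le0 n) as G5; pose proof (stp_lt1 0) as G6; pose proof (stp_ge 0) as G7.
  set (beta := stp (S n) / stp n).
  assert (Hbe : b (RtoC (stp n)) = RtoC beta).
  { unfold beta. rewrite RtoC_div by lra. rewrite <- HBs, E'. field. apply stp_nz. }
  assert (Hbe1 : 0 < beta <= 1).
  { unfold beta. split; [apply Rdiv_lt_0_compat; lra|]. apply Rmult_le_reg_r with (stp n); [lra|].
    unfold Rdiv. rewrite Rmult_assoc, Rinv_l by lra. lra. }
  assert (Hsn : Cmod (RtoC (stp n)) < 1) by (rewrite Cmod_RtoC, Rabs_pos_eq; lra).
  pose proof (schwarz_pick b w (RtoC (stp n)) Hb Hb1 ltac:(lra) Hsn) as SP. rewrite Hbe in SP.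
  set (c := (1 - stp 0 * stp 0) * (1 - k * k) / 4).
  assert (Hc : 0 < c) by (unfold c; assert (0 < (1 - stp 0 * stp 0) * (1 - k * k)) by (apply Rmult_lt_0_compat; nra); lra).
  assert (Hmob : c <= 1 - Cmod (mob (RtoC (stp n)) w) * Cmod (mob (RtoC (stp n)) w)).
  { apply mob_Cmod_ge; [exact Hsn|lra|]. rewrite Cmod_RtoC, Rabs_pos_eq by lra. unfold c.
    pose proof (Cmod_ge_0 w).
    apply Rmult_le_compat_r; [lra|]. apply Rmult_le_compat; nra. }
  set (x := Cmod (1 - RtoC beta * b w)).
  (* With y = |b - beta|, Schwarz-Pick gives y^2 <= (1 - c) x^2, while x^2 - y^2 = (1 - beta^2) (1 -
     |b|^2). So c x^2 is at most this product, and 1 - |b| <= x allows one factor x to be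
     cancelled. *)
  assert (Hx : c * x <= 4 * (1 - beta)).
  { assert (Hd := mob_den (RtoC (stp n)) w Hsn ltac:(lra)).
    assert (Hd0 : 0 < Cmod (1 - Cconj (RtoC (stp n)) * w)) by (apply (proj1 (Cmod_gt_0 _)), Hd).
    unfold mob in Hmob. rewrite Cmod_div in Hmob by exact Hd.
    set (A := Cmod (1 - Cconj (RtoC (stp n)) * w)) in *. set (Q := Cmod (w - RtoC (stp n))) in *.
    assert (HcQ : Q * Q <= (1 - c) * (A * A)).
    { assert (Q / A * (Q / A) <= 1 - c) by lra.
      apply Rmult_le_compat_r with (r := A * A) in H; [|nra].
      replace (Q / A * (Q / A) * (A * A)) with (Q * Q) in H by (field; lra). exact H. }
    pose proof (mob_identity (RtoC beta) (b w)) as MI.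
    replace (Cconj (RtoC beta)) with (RtoC beta) in * by (unfold Cconj, RtoC; simpl; rewrite Ropp_0; reflexivity).
    fold x in MI, SP. set (y := Cmod (b w - RtoC beta)) in *.
    rewrite Cmod_RtoC, Rabs_pos_eq in MI by lra.
    assert (Hy0 : 0 <= y) by apply Cmod_ge_0. assert (Hx0 : 0 <= x) by apply Cmod_ge_0.
    assert (HQ0 : 0 <= Q) by apply Cmod_ge_0.
    assert (Hyx : y * y <= (1 - c) * (x * x)).
    { assert ((y * A) * (y * A) <= (x * Q) * (x * Q)) by (apply Rmult_le_compat; nra).
      apply Rmult_le_reg_r with (A * A); [nra|].
      assert ((x * x) * (Q * Q) <= (x * x) * ((1 - c) * (A * A))) by (apply Rmult_le_compat_l; nra). nra. }
    assert (Hbw := Hb1 w ltac:(lra)). pose proof (Cmod_ge_0 (b w)) as Hbw0.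
    assert (Hxb : 1 - Cmod (b w) <= x).
    { unfold x. eapply Rle_trans; [|apply Cmod_minus_ge]. rewrite Cmod_1, Cmod_mult, Cmod_RtoC, Rabs_pos_eq by lra. nra. }
    assert (1 - Cmod (b w) * Cmod (b w) <= 2 * x) by nra.
    assert (H5 : c * (x * x) <= (1 - beta * beta) * (2 * x)).
    { apply Rle_trans with ((1 - beta * beta) * (1 - Cmod (b w) * Cmod (b w))); [lra|].
      apply Rmult_le_compat_l; nra. }
    destruct (Req_dec x 0) as [Z|Z]; [rewrite Z; lra|].
    assert (c * x <= 2 * (1 - beta * beta)).
    { apply Rmult_le_reg_r with x; [lra|]. lra. }
    nra. }
  assert (H1b : Cmod (1 - b w) <= x + (1 - beta)).
  { replace (1 - b w)%C with ((1 - RtoC beta * b w) - RtoC (1 - beta) * b w)%C by (rewrite RtoC_minus; ring).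
    eapply Rle_trans; [apply Cmod_minus_le|]. fold x. apply Rplus_le_compat_l.
    rewrite Cmod_mult, Cmod_RtoC, Rabs_pos_eq by lra. specialize (Hb1 w ltac:(lra)).
    pose proof (Cmod_ge_0 (b w)). nra. }
  assert (Hc1 : c <= 1).
  { unfold c. assert ((1 - stp 0 * stp 0) * (1 - k * k) <= 1 * 1) by (apply Rmult_le_compat; nra). lra. }
  assert (H5 : c * Cmod (1 - b w) <= 5 * (1 - beta)) by nra.
  assert (Hbl : (1 - beta) * l <= stp n - stp (S n)).
  { replace (stp n - stp (S n)) with ((1 - beta) * stp n) by (unfold beta; field; lra).
    apply Rmult_le_compat_l; lra. }
  unfold stp_const. fold c. apply Rmult_le_reg_l with (c * l); [nra|].
  replace (c * l * (5 / (c * l) * (stp n - stp (S n)))) with (5 * (stp n - stp (S n))) by (field; lra).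
  nra.
Qed.

Lemma sg_decr n z : Cmod z < 1 -> Cmod (sg n z) <= Cmod (sg 0 z).
Proof.
  intros Hz. induction n; [lra|]. destruct (step_factor n) as [b [_ [H1 [H2 _]]]].
  rewrite H2, Cmod_mult by exact Hz. specialize (H1 (sg n z) (sg_disk n z Hz)).
  pose proof (Cmod_ge_0 (sg n z)). nra.
Qed.

Lemma sg_step n z k : Cmod z < 1 -> 0 <= k < 1 -> Cmod (sg 0 z) <= k ->
  Cmod (sg (S n) z - sg n z) <= stp_const k * (stp n - stp (S n)).
Proof.
  intros Hz Hk Hzk. destruct (step_factor n) as [b [_ [H1 [H2 H3]]]].
  pose proof (sg_decr n z Hz). pose proof (sg_disk n z Hz).
  specialize (H3 k (sg n z) Hk ltac:(lra)).
  rewrite H2 by exact Hz. replace (sg n z * b (sg n z) - sg n z)%C with (- (sg n z * (1 - b (sg n z))))%C by ring.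
  rewrite Cmod_opp, Cmod_mult. pose proof (Cmod_ge_0 (sg n z)). pose proof (Cmod_ge_0 (1 - b (sg n z))). nra.
Qed.

(** [Lim_seq] makes this total; on the unit disk [sg_clim] shows that the limits exist. *)
Definition sigma (z : C) : C := (real (Lim_seq (fun n => fst (sg n z))), real (Lim_seq (fun n => snd (sg n z)))).

Lemma sg_conv z k : Cmod z < 1 -> 0 <= k < 1 -> Cmod (sg 0 z) <= k ->
  clim (fun n => sg n z) (sigma z) /\
  forall n, Cmod (sg n z - sigma z) <= 2 * (stp_const k * (stp n - l)).
Proof.
  intros Hz Hk Hzk. assert (Hcp := stp_const_pos k Hk).
  assert (Hp : forall n, 0 <= stp_const k * (stp n - l)) by (intros n; pose proof (stp_ge n); nra).
  destruct (telescoping_cauchy (fun n => fst (sg n z)) (fun n => stp_const k * (stp n - l))) as [x [Lx Hx]].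
  { intros n. eapply Rle_trans; [apply (Cmod_ge_fst (sg (S n) z - sg n z))|].
    eapply Rle_trans; [apply sg_step with (k := k); assumption|]. right; ring. } { exact Hp. }
  destruct (telescoping_cauchy (fun n => snd (sg n z)) (fun n => stp_const k * (stp n - l))) as [y [Ly Hy]].
  { intros n. eapply Rle_trans; [apply (Cmod_ge_snd (sg (S n) z - sg n z))|].
    eapply Rle_trans; [apply sg_step with (k := k); assumption|]. right; ring. } { exact Hp. }
  assert (E : sigma z = (x, y)).
  { unfold sigma. rewrite (is_lim_seq_unique _ _ Lx), (is_lim_seq_unique _ _ Ly). reflexivity. }
  rewrite E. split; [split; assumption|]. intros n. rewrite Cmod_minus_sym.
  eapply Rle_trans; [apply Cmod_le_sum|]. specialize (Hx n); specialize (Hy n).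
  change (fst ((x, y) - sg n z)%C) with (x - fst (sg n z)). change (snd ((x, y) - sg n z)%C) with (y - snd (sg n z)). lra.
Qed.

Lemma sg_clim z : Cmod z < 1 -> clim (fun n => sg n z) (sigma z).
Proof.
  intros Hz. apply (sg_conv z (Cmod (sg 0 z))); [exact Hz| |lra].
  split; [apply Cmod_ge_0|apply sg_disk, Hz].
Qed.

Lemma sigma_le z : Cmod z < 1 -> Cmod (sigma z) <= Cmod (sg 0 z).
Proof.
  intros Hz. apply (is_lim_seq_le (fun n => Cmod (sg n z)) (fun _ => Cmod (sg 0 z)) (Cmod (sigma z)) (Cmod (sg 0 z))).
  - intros m. apply sg_decr, Hz.
  - apply clim_Cmod, sg_clim, Hz.
  - apply is_lim_seq_const.
Qed.

Lemma sigma_disk z : Cmod z < 1 -> Cmod (sigma z) < 1.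
Proof. intros Hz. eapply Rle_lt_trans; [apply sigma_le, Hz|apply sg_disk, Hz]. Qed.

Lemma sg_uniform r e : r < 1 -> 0 < e ->
  exists N, forall n, (N <= n)%nat -> forall z, Cmod z <= r -> Cmod (sg n z - sigma z) < e.
Proof.
  intros Hr He.
  set (rr := Rmax 0 r). assert (Hrr : 0 <= rr < 1) by (split; [apply Rmax_l|apply Rmax_lub_lt; lra]).
  set (c := (1 - Cmod z0 * Cmod z0) * (1 - rr * rr) / 4).
  pose proof (Cmod_ge_0 z0).
  assert (Hc : 0 < c) by (unfold c; assert (0 < (1 - Cmod z0 * Cmod z0) * (1 - rr * rr)) by (apply Rmult_lt_0_compat; nra); lra).
  assert (Hc1 : c <= 1).
  { unfold c. assert ((1 - Cmod z0 * Cmod z0) * (1 - rr * rr) <= 1 * 1) by (apply Rmult_le_compat; nra). lra. }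
  (* Since sqrt (1 - c) <= 1 - c / 2, this bounds |sg 0 z| for all |z| <= r at once. *)
  set (k := 1 - c / 2). assert (Hk : 0 <= k < 1) by (unfold k; lra).
  assert (Hcp := stp_const_pos k Hk).
  assert (Hsl : is_lim_seq (fun n => stp n - l) 0).
  { replace 0 with (l - l) by ring. apply is_lim_seq_minus'; [apply stp_lim|apply is_lim_seq_const]. }
  destruct (proj2 (is_lim_seq_spec _ _) Hsl (mkposreal (e / (2 * stp_const k)) ltac:(apply Rdiv_lt_0_compat; lra))) as [N HN].
  exists N. intros n Hn. specialize (HN n Hn). simpl in HN. rewrite Rminus_0_r in HN. apply Rabs_lt_between in HN.
  intros z Hz. assert (Hzr : Cmod z <= rr) by (eapply Rle_trans; [exact Hz|apply Rmax_r]).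
  pose proof (Cmod_ge_0 z).
  eapply Rle_lt_trans; [apply (sg_conv z k); [lra|exact Hk|]|].
  - unfold sg. rewrite tau_mod. change (orb 0) with z0. simpl (iterate phi 0 z).
    assert (Hm : c <= 1 - Cmod (mob z0 z) * Cmod (mob z0 z)).
    { apply mob_Cmod_ge; [exact Hz0|lra|]. unfold c.
      assert (Cmod z * Cmod z <= rr * rr) by (apply Rmult_le_compat; lra).
      assert (Cmod z0 * Cmod z0 <= 1 * 1) by (apply Rmult_le_compat; lra).
      apply Rmult_le_compat_r; [lra|]. apply Rmult_le_compat_l; lra. }
    unfold k. pose proof (Cmod_ge_0 (mob z0 z)). nra.
  - apply Rlt_le_trans with (2 * (stp_const k * (e / (2 * stp_const k)))).
    + apply Rmult_lt_compat_l; [lra|]. apply Rmult_lt_compat_l; lra.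
    + right; field; lra.
Qed.

Lemma hol_sigma : hol 1 sigma.
Proof.
  apply (hol_limit sg); [apply hol_sg|intros; left; apply sigma_disk; assumption|].
  intros r Hr e He. destruct (sg_uniform r e Hr He) as [N HN]. exists N. apply HN. lia.
Qed.

Lemma sigma_base : sigma z0 = 0.
Proof.
  apply (clim_unique (fun n => sg n z0)); [apply sg_clim, Hz0|].
  eapply clim_ext; [|apply clim_const]. intros n. symmetry. apply (tau_orb n).
Qed.

Lemma sigma_next : sigma (phi z0) = RtoC l.
Proof.
  apply (clim_unique (fun n => sg n (phi z0))); [apply sg_clim, Hself, Hz0|].
  eapply clim_ext; [|apply clim_RtoC, stp_lim]. intros n. simpl. unfold sg. rewrite iterate_phi. symmetry. apply tau_next.
Qed.

(** The rotation relating consecutive normalisations: [mob (stp n)] after [tau n] and [tau (S n)]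
    both vanish at [orb (S n)], and [ee n] is their quotient. *)
Definition ee (n : nat) : C :=
  (kap n * ((1 - Cconj (orb (S n)) * orb n) / (1 - Cconj (orb n) * orb (S n))) * Cconj (kap (S n)))%C.

Lemma sg_phi n z : Cmod z < 1 -> mob (RtoC (stp n)) (sg n (phi z)) = (ee n * sg (S n) z)%C.
Proof.
  intros Hz. unfold sg at 1. rewrite iterate_phi, <- (tau_next n). unfold tau at 1 2.
  set (w := iterate phi (S n) z). assert (Hw : Cmod w < 1) by apply iterate_disk, Hz.
  transitivity (kap n * mob (mob (orb n) (orb (S n))) (mob (orb n) w))%C.
  - unfold mob at 1 4. rewrite Cmult_conj.
    replace (1 - Cconj (kap n) * Cconj (mob (orb n) (orb (S n))) * (kap n * mob (orb n) w))%C
      with (1 - (kap n * Cconj (kap n)) * Cconj (mob (orb n) (orb (S n))) * mob (orb n) w)%C by ring.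
    rewrite kap_conj. unfold Cdiv.
    replace (1 - 1 * Cconj (mob (orb n) (orb (S n))) * mob (orb n) w)%C
      with (1 - Cconj (mob (orb n) (orb (S n))) * mob (orb n) w)%C by ring. ring.
  - rewrite mob_mob by (apply orb_disk || exact Hw). unfold ee, sg, tau. fold w.
    replace (kap n * ((1 - Cconj (orb (S n)) * orb n) / (1 - Cconj (orb n) * orb (S n))) * Cconj (kap (S n)) *
      (kap (S n) * mob (orb (S n)) w))%C with (kap n * ((1 - Cconj (orb (S n)) * orb n) / (1 - Cconj (orb n) * orb (S n)))
      * (kap (S n) * Cconj (kap (S n))) * mob (orb (S n)) w)%C by ring.
    rewrite kap_conj. ring.
Qed.

Lemma ee_mod n : Cmod (ee n) = 1.
Proof.
  unfold ee. rewrite !Cmod_mult, Cmod_conj, !kap_mod.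
  rewrite Cmod_div by (apply mob_den; [apply orb_disk|left; apply orb_disk]).
  rewrite <- (Cmod_conj (1 - Cconj (orb (S n)) * orb n)), Cminus_conj, Cmult_conj, Cconj_conj.
  replace (Cconj 1) with (RtoC 1) by (unfold Cconj, RtoC; simpl; rewrite Ropp_0; reflexivity).
  replace (orb (S n) * Cconj (orb n))%C with (Cconj (orb n) * orb (S n))%C by ring.
  field. apply Rgt_not_eq. apply (proj1 (Cmod_gt_0 _)), mob_den; [apply orb_disk|left; apply orb_disk].
Qed.

Lemma l_lt1 : l < 1.
Proof. pose proof (stp_ge 0). pose proof (stp_lt1 0). lra. Qed.

Lemma l_mod : Cmod (RtoC l) < 1.
Proof. rewrite Cmod_RtoC, Rabs_pos_eq by lra. apply l_lt1. Qed.

(** The automorphism A with sigma o phi = A o sigma is kept in the factored form (mob l)^(-1) after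
    a rotation by e. *)
Lemma sigma_phi : exists e : C, Cmod e = 1 /\ forall z, Cmod z < 1 -> mob (RtoC l) (sigma (phi z)) = (e * sigma z)%C.
Proof.
  assert (Hm : forall z, Cmod z < 1 -> clim (fun n => mob (RtoC (stp n)) (sg n (phi z))) (mob (RtoC l) (sigma (phi z)))).
  { intros z Hz. apply clim_mob; [apply l_mod|left; apply sigma_disk, Hself, Hz|apply clim_RtoC, stp_lim|apply sg_clim, Hself, Hz]. }
  assert (Hz1 := Hself z0 Hz0).
  assert (Hln : RtoC l <> 0) by (intros E; apply RtoC_inj in E; lra).
  (* Convergence of the rotations is read off at the point [phi z0], where [sg (S n)] takes the
     value [stp (S n)], which stays away from 0. *)
  set (e := (mob (RtoC l) (sigma (phi (phi z0))) / RtoC l)%C).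
  assert (He : clim ee e).
  { eapply clim_ext; [|apply clim_div; [exact Hln|apply Hm, Hz1|apply clim_incr, clim_RtoC, stp_lim]].
    intros n. simpl. rewrite sg_phi by exact Hz1.
    replace (sg (S n) (phi z0)) with (RtoC (stp (S n))).
    - field. apply stp_nz.
    - unfold sg. rewrite iterate_phi. symmetry. apply tau_next. }
  exists e. split.
  - assert (L1 := clim_Cmod _ _ He). apply is_lim_seq_unique in L1.
    rewrite (Lim_seq_ext _ (fun _ => 1)) in L1 by (intros; apply ee_mod).
    rewrite Lim_seq_const in L1. congruence.
  - intros z Hz. apply (clim_unique (fun n => mob (RtoC (stp n)) (sg n (phi z)))); [apply Hm, Hz|].
    eapply clim_ext; [|apply clim_mult; [exact He|apply clim_incr, sg_clim, Hz]].
    intros n. symmetry. apply sg_phi, Hz.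
Qed.

(** The factors from [step_factor] multiply up, and their deviations from 1 at the origin telescope.
    The resulting bound is uniform in k, which is what passing to [sigma] requires. *)
Lemma sg_product n k : exists p : C -> C, hol 1 p /\ (forall z, Cmod z < 1 -> Cmod (p z) <= 1) /\
  (forall z, Cmod z < 1 -> sg (n + k) z = (sg n z * p z)%C) /\
  Cmod (1 - p 0) <= stp_const (Cmod (sg 0 0)) * (stp n - stp (n + k)%nat).
Proof.
  assert (H0 : Cmod 0 < 1) by (rewrite Cmod_0; lra).
  induction k as [|k IH].
  - exists (fun _ => RtoC 1). split; [apply hol_const|]. rewrite Nat.add_0_r, Rminus_diag, Rmult_0_r.
    split; [intros; rewrite Cmod_1; lra|]. split; [intros; ring|]. rewrite Cminus_diag, Cmod_0; lra.
  - destruct IH as [p [Hp [Hp1 [Hp2 Hp3]]]]. destruct (step_factor (n + k)) as [b [Hb [Hb1 [Hb2 Hb3]]]].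
    exists (fun z => (p z * b (sg (n + k) z))%C). split.
    { apply hol_mult; [exact Hp|]. apply (hol_comp 1 1 b); [exact Hb|apply hol_sg|intros; apply sg_disk; assumption]. }
    split; [|split].
    + intros z Hz. rewrite Cmod_mult. specialize (Hp1 z Hz). specialize (Hb1 _ (sg_disk (n + k) z Hz)).
      pose proof (Cmod_ge_0 (p z)); pose proof (Cmod_ge_0 (b (sg (n + k) z))). nra.
    + intros z Hz. rewrite Nat.add_succ_r, Hb2, Hp2 by exact Hz. ring.
    + rewrite Nat.add_succ_r. specialize (Hb3 (Cmod (sg 0 0)) (sg (n + k) 0)).
      specialize (Hb3 (conj (Cmod_ge_0 _) (sg_disk 0 0 H0)) (sg_decr _ _ H0)).
      replace (1 - p 0 * b (sg (n + k) 0))%C with ((1 - b (sg (n + k) 0)) * p 0 + (1 - p 0))%C by ring.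
      eapply Rle_trans; [apply Cmod_triangle|]. rewrite Cmod_mult. specialize (Hp1 0 H0).
      pose proof (Cmod_ge_0 (1 - b (sg (n + k) 0))). pose proof (Cmod_ge_0 (p 0)). nra.
Qed.

End NormalisedIterates.

(** * Julia's inequality and compactness *)

Lemma clim_eps s a : (forall eps, 0 < eps -> exists N, forall n, (N <= n)%nat -> Cmod (s n - a) < eps) -> clim s a.
Proof.
  intros H. split; apply is_lim_seq_spec; intros e; destruct (H e (cond_pos e)) as [N HN]; exists N; intros n Hn;
  eapply Rle_lt_trans; [|apply (HN n Hn)| |apply (HN n Hn)].
  - apply (Cmod_ge_fst (s n - a)).
  - apply (Cmod_ge_snd (s n - a)).
Qed.

(** Selections satisfy n <= g n instead of being strictly increasing; by [eventually_sub] this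
    already transfers limits. *)
Lemma bolzano_weierstrass_R (u : nat -> R) a b : (forall n, a <= u n <= b) ->
  exists (g : nat -> nat) (l : R), (forall n, (n <= g n)%nat) /\ is_lim_seq (fun n => u (g n)) l.
Proof.
  intros Hu. destruct (Bolzano_Weierstrass u (fun x => a <= x <= b) (compact_P3 a b) Hu) as [l Hl].
  assert (Hc : forall n, exists p, (n <= p)%nat /\ Rabs (u p - l) < / (INR n + 1)).
  { intros n. assert (Hp : 0 < / (INR n + 1)) by (apply Rinv_0_lt_compat; pose proof (pos_INR n); lra).
    destruct (Hl (disc l (mkposreal _ Hp)) n) as [p [Hp1 Hp2]].
    - exists (mkposreal _ Hp). intros x Hx. exact Hx.
    - exists p. split; [exact Hp1|exact Hp2]. }
  destruct (functional_choice _ Hc) as [g Hg]. exists g, l. split; [intros n; apply Hg|].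
  apply is_lim_seq_spec. intros e. destruct (archimed_cor1 e (cond_pos e)) as [N [HN HN0]].
  exists N. intros n Hn. eapply Rlt_trans; [apply Hg|]. eapply Rlt_trans; [|exact HN].
  apply le_INR in Hn. assert (0 < INR N) by (apply lt_0_INR; exact HN0).
  apply Rinv_lt_contravar; [apply Rmult_lt_0_compat|]; lra.
Qed.

Lemma eventually_sub (g : nat -> nat) : (forall n, (n <= g n)%nat) -> filterlim g eventually eventually.
Proof. intros Hg P [N HN]. exists N. intros n Hn. apply HN. specialize (Hg n). lia. Qed.

Lemma clim_sub s a g : (forall n, (n <= g n)%nat) -> clim s a -> clim (fun n => s (g n)) a.
Proof.
  intros Hg [H1 H2]. split; [apply (is_lim_seq_subseq (fun n => fst (s n)))|apply (is_lim_seq_subseq (fun n => snd (s n)))];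
  try assumption; apply eventually_sub, Hg.
Qed.

Lemma bolzano_weierstrass_C (s : nat -> C) : (forall n, Cmod (s n) <= 1) ->
  exists (g : nat -> nat) (a : C), (forall n, (n <= g n)%nat) /\ clim (fun n => s (g n)) a.
Proof.
  intros Hs.
  destruct (bolzano_weierstrass_R (fun n => fst (s n)) (-1) 1) as [g [x [Hg Hx]]].
  { intros n. apply Rabs_le_between. eapply Rle_trans; [apply Cmod_ge_fst|apply Hs]. }
  destruct (bolzano_weierstrass_R (fun n => snd (s (g n))) (-1) 1) as [k [y [Hk Hy]]].
  { intros n. apply Rabs_le_between. eapply Rle_trans; [apply Cmod_ge_snd|apply Hs]. }
  exists (fun n => g (k n)), (x, y). split.
  - intros n. specialize (Hk n). specialize (Hg (k n)). lia.
  - split; simpl; [|exact Hy]. apply (is_lim_seq_subseq (fun n => fst (s (g n)))); [apply eventually_sub, Hk|exact Hx].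
Qed.

Lemma Cconj_nz (a : C) : a <> 0 -> Cconj a <> 0.
Proof. intros H E. apply H. rewrite <- (Cconj_conj a), E. unfold Cconj, RtoC; simpl. rewrite Ropp_0; reflexivity. Qed.

Lemma unit_conj (a : C) : Cmod a = 1 -> (a * Cconj a = 1)%C.
Proof. intros H. rewrite <- Cmod_sqr_conj, H. f_equal. ring. Qed.

Lemma unit_dist (xi w : C) : Cmod xi = 1 -> Cmod (1 - Cconj xi * w) = Cmod (xi - w).
Proof.
  intros H. transitivity (Cmod xi * Cmod (1 - Cconj xi * w)); [rewrite H; ring|]. rewrite <- Cmod_mult. f_equal.
  replace (xi * (1 - Cconj xi * w))%C with (xi - (xi * Cconj xi) * w)%C by ring. rewrite unit_conj by exact H. ring.
Qed.

Lemma unit_minus_nz (xi w : C) : Cmod xi = 1 -> Cmod w < 1 -> (xi - w)%C <> 0.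
Proof. intros H Hw. apply Cmod_lt_neq. lra. Qed.

Lemma unit_minus_pos (xi w : C) : Cmod xi = 1 -> Cmod w < 1 -> 0 < Cmod (xi - w).
Proof. intros H Hw. apply (proj1 (Cmod_gt_0 _)), unit_minus_nz; assumption. Qed.

(** The shift by 2 keeps every modulus strictly between 0 and 1. *)
Definition radial_seq (om : C) (m : nat) : C := (RtoC (1 - / (INR m + 2)) * om)%C.

Lemma radial_seq_facts om m : Cmod om = 1 ->
  0 < 1 - / (INR m + 2) < 1 /\ Cmod (radial_seq om m) = 1 - / (INR m + 2) /\
  Cmod (radial_seq om m - om) = / (INR m + 2).
Proof.
  intros Hom. pose proof (pos_INR m).
  assert (0 < / (INR m + 2)) by (apply Rinv_0_lt_compat; lra).
  assert (/ (INR m + 2) < 1) by (apply Rmult_lt_reg_r with (INR m + 2); [lra|]; rewrite Rinv_l; lra).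
  split; [lra|]. unfold radial_seq. split.
  - rewrite Cmod_mult, Hom, Cmod_RtoC, Rabs_pos_eq by lra. ring.
  - replace (RtoC (1 - / (INR m + 2)) * om - om)%C with (- (RtoC (/ (INR m + 2)) * om))%C by (rewrite RtoC_minus; ring).
    rewrite Cmod_opp, Cmod_mult, Hom, Cmod_RtoC, Rabs_pos_eq by lra. ring.
Qed.

Lemma radial_seq_lim : is_lim_seq (fun m => / (INR m + 2)) 0.
Proof.
  apply is_lim_seq_spec. intros e. destruct (archimed_cor1 e (cond_pos e)) as [N [HN HN0]].
  exists N. intros n Hn. rewrite Rminus_0_r. pose proof (pos_INR n).
  rewrite Rabs_pos_eq by (left; apply Rinv_0_lt_compat; lra).
  eapply Rlt_trans; [|exact HN]. apply le_INR in Hn. assert (0 < INR N) by (apply lt_0_INR; exact HN0).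
  apply Rinv_lt_contravar; [apply Rmult_lt_0_compat|]; lra.
Qed.

Lemma angular_radial g om L : Cmod om = 1 -> angular_limit g om L -> clim (fun m => g (radial_seq om m)) L.
Proof.
  intros Hom H. apply clim_eps. intros e He. destruct (H 2 ltac:(lra) e He) as [d [Hd Hd1]].
  destruct (proj2 (is_lim_seq_spec _ _) radial_seq_lim (mkposreal d Hd)) as [N HN].
  exists N. intros n Hn. specialize (HN n Hn). simpl in HN. rewrite Rminus_0_r in HN. apply Rabs_lt_between in HN.
  destruct (radial_seq_facts om n Hom) as [F1 [F2 F3]].
  apply Hd1; [unfold in_disk; lra|rewrite F2, F3; lra|rewrite F3; lra].
Qed.

(** Apply Schwarz-Pick to z and the radial points x_m and let m tend to infinity; the ratio of 1 -
    |phi(x_m)| to 1 - |x_m| is dominated by the modulus of the difference quotient at [om], which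
    tends to 1. *)
Lemma julia phi om : hol 1 phi -> (forall z, Cmod z < 1 -> Cmod (phi z) < 1) -> Cmod om = 1 ->
  angular_derivative phi om (RtoC 1) -> forall z, Cmod z < 1 ->
  (1 - Cmod z * Cmod z) * (Cmod (om - phi z) * Cmod (om - phi z))
  <= (1 - Cmod (phi z) * Cmod (phi z)) * (Cmod (om - z) * Cmod (om - z)).
Proof.
  intros Hphi Hself Hom [A1 A2] z Hz.
  apply (angular_radial _ _ _ Hom) in A1, A2.
  set (x := radial_seq om) in *. set (r := fun m => 1 - / (INR m + 2)).
  set (k := fun m => ((phi (x m) - om) / (x m - om))%C). fold k in A2.
  assert (Hx : clim x om).
  { apply clim_eps. intros e He. destruct (proj2 (is_lim_seq_spec _ _) radial_seq_lim (mkposreal e He)) as [N HN].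
    exists N. intros n Hn. specialize (HN n Hn). simpl in HN. rewrite Rminus_0_r in HN. apply Rabs_lt_between in HN.
    destruct (radial_seq_facts om n Hom) as [F1 [F2 F3]]. unfold x. rewrite F3. lra. }
  assert (Hr : is_lim_seq r 1).
  { unfold r. replace (Finite 1) with (Finite (1 - 0)) by (f_equal; ring).
    apply is_lim_seq_minus'; [apply is_lim_seq_const|apply radial_seq_lim]. }
  pose proof (Hself z Hz) as Hpz. pose proof (Cmod_ge_0 z). pose proof (Cmod_ge_0 (phi z)).
  rewrite <- (unit_dist om z Hom), <- (unit_dist om (phi z) Hom).
  set (D1 := fun m => Cmod (1 - Cconj (x m) * z)). set (D2 := fun m => Cmod (1 - Cconj (phi (x m)) * phi z)).
  assert (Hm : forall m, (1 - Cmod z * Cmod z) * (D2 m * D2 m) <=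
     (1 - Cmod (phi z) * Cmod (phi z)) * (2 * Cmod (k m) / (1 + r m) * (D1 m * D1 m))).
  { intros m. destruct (radial_seq_facts om m Hom) as [F1 [F2 F3]]. fold (x m) in F2, F3. fold (r m) in F1, F2.
    assert (Hxm : Cmod (x m) < 1) by lra. pose proof (Hself _ Hxm) as Hpx.
    assert (P1 : 0 < D1 m) by (apply (proj1 (Cmod_gt_0 _)), mob_den; lra).
    assert (P2 : 0 < D2 m) by (apply (proj1 (Cmod_gt_0 _)), mob_den; lra).
    pose proof (schwarz_pick_lt phi z (x m) Hphi ltac:(intros; left; apply Hself; assumption) Hz Hxm Hpx) as SP.
    pose proof (mob_Cmod (x m) z Hxm ltac:(lra)) as E1. pose proof (mob_Cmod (phi (x m)) (phi z) Hpx ltac:(lra)) as E2.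
    fold (D1 m) in E1. fold (D2 m) in E2.
    pose proof (Cmod_ge_0 (mob (phi (x m)) (phi z))).
    assert (H3 : (1 - Cmod (x m) * Cmod (x m)) * (1 - Cmod z * Cmod z) / (D1 m * D1 m)
      <= (1 - Cmod (phi (x m)) * Cmod (phi (x m))) * (1 - Cmod (phi z) * Cmod (phi z)) / (D2 m * D2 m)).
    { rewrite <- E1, <- E2. nra. }
    assert (Hne : (x m - om)%C <> 0) by (apply (proj2 (Cmod_gt_0 _)); rewrite F3; unfold r in F1; lra).
    (* On the radius 1 - |x_m| equals |x_m - om|, while 1 - |phi(x_m)| <= |om - phi(x_m)|. *)
    assert (Hk : 1 - Cmod (phi (x m)) <= (1 - r m) * Cmod (k m)).
    { unfold k. rewrite Cmod_div by exact Hne. rewrite F3. replace (1 - r m) with (/ (INR m + 2)) by (unfold r; ring).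
      replace (/ (INR m + 2) * (Cmod (phi (x m) - om) / / (INR m + 2))) with (Cmod (phi (x m) - om))
        by (field; pose proof (pos_INR m); lra).
      rewrite Cmod_minus_sym, <- Hom. apply Cmod_minus_ge. }
    rewrite F2 in H3. pose proof (Cmod_ge_0 (phi (x m))).
    assert (Hk2 : 1 - Cmod (phi (x m)) * Cmod (phi (x m)) <= 2 * ((1 - r m) * Cmod (k m))) by nra.
    apply Rmult_le_reg_r with ((1 - r m * r m) / (D1 m * D1 m * (D2 m * D2 m))).
    { apply Rdiv_lt_0_compat; [|repeat apply Rmult_lt_0_compat]; nra. }
    replace ((1 - Cmod z * Cmod z) * (D2 m * D2 m) * ((1 - r m * r m) / (D1 m * D1 m * (D2 m * D2 m))))
      with ((1 - r m * r m) * (1 - Cmod z * Cmod z) / (D1 m * D1 m)) by (field; lra).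
    eapply Rle_trans; [exact H3|].
    replace ((1 - Cmod (phi z) * Cmod (phi z)) * (2 * Cmod (k m) / (1 + r m) * (D1 m * D1 m)) * ((1 - r m * r m) / (D1 m * D1 m * (D2 m * D2 m))))
      with (2 * ((1 - r m) * Cmod (k m)) * (1 - Cmod (phi z) * Cmod (phi z)) / (D2 m * D2 m)) by (field; lra).
    apply Rmult_le_compat_r; [left; apply Rinv_0_lt_compat; nra|]. apply Rmult_le_compat_r; nra. }
  assert (L1 : is_lim_seq D1 (Cmod (1 - Cconj om * z))).
  { apply clim_Cmod. apply clim_minus; [apply clim_const|]. apply clim_mult; [apply clim_conj, Hx|apply clim_const]. }
  assert (L2 : is_lim_seq D2 (Cmod (1 - Cconj om * phi z))).
  { apply clim_Cmod. apply clim_minus; [apply clim_const|]. apply clim_mult; [apply clim_conj, A1|apply clim_const]. }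
  apply (is_lim_seq_le (fun m => (1 - Cmod z * Cmod z) * (D2 m * D2 m))
    (fun m => (1 - Cmod (phi z) * Cmod (phi z)) * (2 * Cmod (k m) / (1 + r m) * (D1 m * D1 m)))
    ((1 - Cmod z * Cmod z) * (Cmod (1 - Cconj om * phi z) * Cmod (1 - Cconj om * phi z)))
    ((1 - Cmod (phi z) * Cmod (phi z)) * (Cmod (1 - Cconj om * z) * Cmod (1 - Cconj om * z)))).
  - exact Hm.
  - apply is_lim_seq_mult'; [apply is_lim_seq_const|apply is_lim_seq_mult'; exact L2].
  - apply is_lim_seq_mult'; [apply is_lim_seq_const|].
    replace (Finite (Cmod (1 - Cconj om * z) * Cmod (1 - Cconj om * z)))
      with (Finite (2 * Cmod 1 / (1 + 1) * (Cmod (1 - Cconj om * z) * Cmod (1 - Cconj om * z))))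
      by (f_equal; rewrite Cmod_1; field).
    apply is_lim_seq_mult'; [|apply is_lim_seq_mult'; exact L1].
    apply is_lim_seq_div'; [|apply is_lim_seq_plus'; [apply is_lim_seq_const|exact Hr]|lra].
    apply is_lim_seq_mult'; [apply is_lim_seq_const|apply clim_Cmod, A2].
Qed.

(** On the radius phi(x) - x = (x - om) (k - 1) with k the difference quotient at [om], and |1 -
    conj x phi(x)| >= 1 - |x| = |x - om|. So the step is at most |k - 1|. *)
Lemma parabolic_small_step phi om : hol 1 phi -> (forall z, Cmod z < 1 -> Cmod (phi z) < 1) -> Cmod om = 1 ->
  angular_derivative phi om (RtoC 1) -> forall eps, 0 < eps -> exists x, Cmod x < 1 /\ Cmod (mob x (phi x)) < eps.
Proof.
  intros Hphi Hself Hom [A1 A2] eps He.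
  apply (angular_radial _ _ _ Hom) in A2. apply clim_dist in A2.
  destruct (proj2 (is_lim_seq_spec _ _) A2 (mkposreal eps He)) as [N HN].
  specialize (HN N (le_n N)). simpl in HN. rewrite Rminus_0_r in HN.
  destruct (radial_seq_facts om N Hom) as [F1 [F2 F3]].
  set (x := radial_seq om N) in *. set (d := / (INR N + 2)) in *.
  rewrite Rabs_pos_eq in HN by apply Cmod_ge_0.
  assert (Hx : Cmod x < 1) by lra. pose proof (Hself x Hx) as Hpx.
  exists x. split; [exact Hx|]. unfold mob. rewrite Cmod_div by (apply mob_den; lra).
  assert (Hd : 0 < Cmod (1 - Cconj x * phi x)) by (apply (proj1 (Cmod_gt_0 _)), mob_den; lra).
  assert (Hge : d <= Cmod (1 - Cconj x * phi x)).
  { eapply Rle_trans; [|apply Cmod_minus_ge]. rewrite Cmod_1, Cmod_mult, Cmod_conj, F2.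
    pose proof (Cmod_ge_0 (phi x)). nra. }
  assert (Hne : (x - om)%C <> 0) by (apply (proj2 (Cmod_gt_0 _)); rewrite F3; lra).
  replace (phi x - x)%C with ((x - om) * ((phi x - om) / (x - om) - 1))%C by (field; exact Hne).
  rewrite Cmod_mult, F3. apply Rmult_lt_reg_r with (Cmod (1 - Cconj x * phi x)); [exact Hd|].
  unfold Rdiv at 1. rewrite Rmult_assoc, Rinv_l, Rmult_1_r by lra.
  assert (0 < d) by lra. set (t := Cmod ((phi x - om) / (x - om) - 1)) in *.
  apply Rlt_le_trans with (d * eps); [apply Rmult_lt_compat_l; lra|]. rewrite Rmult_comm. apply Rmult_le_compat_l; lra.
Qed.

(** For f = g / c all values are unimodular, so |1 - conj f(w) f(z)| = |f(z) - f(w)|. Schwarz-Pick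
    compares this number multiplied by two unequal factors, which forces it to vanish. *)
Lemma const_modulus g c : hol 1 g -> 0 < c -> (forall z, Cmod z < 1 -> Cmod (g z) = c) ->
  forall z w, Cmod z < 1 -> Cmod w < 1 -> g z = g w.
Proof.
  intros Hg Hc Hm z w Hz Hw.
  set (f := fun v => (RtoC (/ c) * g v)%C).
  assert (Hf1 : forall v, Cmod v < 1 -> Cmod (f v) = 1).
  { intros v Hv. unfold f. assert (0 < / c) by (apply Rinv_0_lt_compat; lra).
    rewrite Cmod_mult, Cmod_RtoC, Rabs_pos_eq, Hm by (assumption || lra). field; lra. }
  pose proof (schwarz_pick f z w) as SP.
  specialize (SP ltac:(apply hol_mult; [apply hol_const|exact Hg]) ltac:(intros v Hv; rewrite Hf1 by exact Hv; lra) Hz Hw).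
  rewrite (unit_dist (f w)), (Cmod_minus_sym (f w)) in SP by (apply Hf1, Hw).
  assert (Hlt : Cmod (z - w) < Cmod (1 - Cconj w * z)).
  { pose proof (mob_identity w z). pose proof (Cmod_ge_0 z); pose proof (Cmod_ge_0 w).
    pose proof (Cmod_ge_0 (z - w)). pose proof (Cmod_ge_0 (1 - Cconj w * z)).
    assert (0 < (1 - Cmod w * Cmod w) * (1 - Cmod z * Cmod z)) by (apply Rmult_lt_0_compat; nra). nra. }
  pose proof (Cmod_ge_0 (f z - f w)).
  assert (E : Cmod (f z - f w) = 0) by nra.
  apply Cmod_eq_0, Ceq_minus in E. unfold f in E.
  assert (Hcn : RtoC (/ c) <> 0) by (intros Z; apply RtoC_inj in Z; pose proof (Rinv_0_lt_compat c Hc); lra).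
  replace (g z) with (/ RtoC (/ c) * (RtoC (/ c) * g z))%C by (field; exact Hcn). rewrite E. field. exact Hcn.
Qed.

(** The Cayley transform (g - i) / (g + i) of a real-valued function has modulus 1. *)
Lemma const_real g : hol 1 g -> (forall z, Cmod z < 1 -> snd (g z) = 0) ->
  forall z w, Cmod z < 1 -> Cmod w < 1 -> g z = g w.
Proof.
  intros Hg Hr z w Hz Hw.
  assert (Hn : forall z, Cmod z < 1 -> (g z + Ci)%C <> 0).
  { intros v Hv E. apply (f_equal snd) in E. simpl in E. rewrite Hr in E by exact Hv. lra. }
  assert (E : ((g z - Ci) / (g z + Ci) = (g w - Ci) / (g w + Ci))%C).
  { apply (const_modulus (fun z => (g z - Ci) / (g z + Ci))%C 1); [| lra| |exact Hz|exact Hw].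
    - apply hol_div; [apply hol_minus|apply hol_plus|exact Hn]; (exact Hg || apply hol_const).
    - intros v Hv. rewrite Cmod_div by (apply Hn, Hv).
      assert (0 < Cmod (g v + Ci)) by (apply (proj1 (Cmod_gt_0 _)), Hn, Hv).
      replace (Cmod (g v - Ci)) with (Cmod (g v + Ci)); [field; lra|].
      unfold Cmod; simpl. rewrite Hr by exact Hv. f_equal. ring. }
  assert (E2 : ((g z - Ci) * (g w + Ci) = (g w - Ci) * (g z + Ci))%C).
  { replace (g z - Ci)%C with ((g z - Ci) / (g z + Ci) * (g z + Ci))%C by (field; apply Hn, Hz).
    rewrite E. field. apply Hn, Hw. }
  assert (E3 : (2 * Ci * (g z - g w) = 0)%C).
  { replace (2 * Ci * (g z - g w))%C with ((g z - Ci) * (g w + Ci) - (g w - Ci) * (g z + Ci))%C by ring. rewrite E2. ring. }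
  apply Ceq_minus. apply NNPP. intros Hx. apply (Cmult_neq_0 (2 * Ci) (g z - g w)); [|exact Hx|exact E3].
  apply Cmult_neq_0; [exact C2_nz|exact Ci_nz].
Qed.

(** * The semiconjugacy with a parabolic automorphism *)

Lemma mob_diff a v w : Cmod a < 1 -> Cmod v <= 1 -> Cmod w <= 1 ->
  Cmod (mob a v - mob a w) * (Cmod (1 - Cconj a * v) * Cmod (1 - Cconj a * w))
  = Cmod (v - w) * (1 - Cmod a * Cmod a).
Proof.
  intros Ha Hv Hw. assert (D1 := mob_den a v Ha Hv). assert (D2 := mob_den a w Ha Hw).
  pose proof (Cmod_ge_0 a).
  replace (1 - Cmod a * Cmod a) with (Cmod (1 - a * Cconj a)).
  - rewrite <- !Cmod_mult. f_equal. unfold mob. field. auto.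
  - rewrite <- Cmod_sqr_conj, <- RtoC_minus, Cmod_RtoC. apply Rabs_pos_eq. nra.
Qed.

Lemma mob_unit a w : Cmod a < 1 -> Cmod w = 1 -> Cmod (mob a w) = 1.
Proof.
  intros Ha Hw. pose proof (mob_Cmod a w Ha ltac:(lra)) as E. rewrite Hw in E.
  replace ((1 - Cmod a * Cmod a) * (1 - 1 * 1)) with 0 in E by ring.
  unfold Rdiv in E. rewrite Rmult_0_l in E. pose proof (Cmod_ge_0 (mob a w)). nra.
Qed.

(* With [c = |1 - conj a v|^2 / (1 - |a|^2)], this is [P_{mob a v}(mob a w) = c P_v(w)] for the Poisson kernel
   [P_v(w) = (1 - |w|^2) / |v - w|^2]. *)
Lemma mob_poisson a v w : Cmod a < 1 -> Cmod v = 1 -> Cmod w < 1 ->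
  (1 - Cmod (mob a w) * Cmod (mob a w)) * (Cmod (v - w) * Cmod (v - w)) * (1 - Cmod a * Cmod a)
  = (1 - Cmod w * Cmod w) * (Cmod (mob a v - mob a w) * Cmod (mob a v - mob a w))
    * (Cmod (1 - Cconj a * v) * Cmod (1 - Cconj a * v)).
Proof.
  intros Ha Hv Hw.
  assert (D1 : 0 < Cmod (1 - Cconj a * v)) by (apply (proj1 (Cmod_gt_0 _)), mob_den; lra).
  assert (D2 : 0 < Cmod (1 - Cconj a * w)) by (apply (proj1 (Cmod_gt_0 _)), mob_den; lra).
  rewrite mob_Cmod by lra. pose proof (mob_diff a v w Ha ltac:(lra) ltac:(lra)) as E.
  replace (Cmod (mob a v - mob a w)) with (Cmod (v - w) * (1 - Cmod a * Cmod a) / (Cmod (1 - Cconj a * v) * Cmod (1 - Cconj a * w)))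
    by (rewrite <- E; field; lra).
  field. lra.
Qed.

Lemma mob_rot e u v : Cmod e = 1 -> Cmod u < 1 -> Cmod v < 1 -> Cmod (mob (e * u) (e * v)) = Cmod (mob u v).
Proof.
  intros He Hu Hv. unfold mob.
  replace (1 - Cconj (e * u) * (e * v))%C with (1 - Cconj u * v)%C.
  - rewrite !Cmod_div by (apply mob_den; lra). f_equal.
    replace (e * v - e * u)%C with (e * (v - u))%C by ring. rewrite Cmod_mult, He. ring.
  - rewrite Cmult_conj. replace (Cconj e * Cconj u * (e * v))%C with ((e * Cconj e) * (Cconj u * v))%C by ring.
    rewrite unit_conj by exact He. ring.
Qed.

Lemma mob_mob_mod a b w : Cmod a < 1 -> Cmod b < 1 -> Cmod w < 1 ->
  Cmod (mob (mob a b) (mob a w)) = Cmod (mob b w).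
Proof.
  intros Ha Hb Hw. rewrite mob_mob by assumption.
  rewrite Cmod_mult, Cmod_div by (apply mob_den; lra).
  rewrite <- (Cmod_conj (1 - Cconj b * a)), Cminus_conj, Cmult_conj, Cconj_conj.
  replace (Cconj 1) with (RtoC 1) by (unfold Cconj, RtoC; simpl; rewrite Ropp_0; reflexivity).
  replace (b * Cconj a)%C with (Cconj a * b)%C by ring.
  field. apply Rgt_not_eq. apply (proj1 (Cmod_gt_0 _)), mob_den; lra.
Qed.

Section Classification.
Variables (phi : C -> C) (z0 om : C) (l : R).
Hypothesis Hphi : hol 1 phi.
Hypothesis Hself : forall z, Cmod z < 1 -> Cmod (phi z) < 1.
Hypothesis Hz0 : Cmod z0 < 1.
Hypothesis Hl : 0 < l.
Hypothesis Hlim : is_lim_seq (fun n => rho (iterate phi n z0) (iterate phi (S n) z0)) l.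
Hypothesis Hom : Cmod om = 1.
Hypothesis Hang : angular_derivative phi om (RtoC 1).

Let sigma := sigma phi z0.
Let Hsig : hol 1 sigma := hol_sigma phi z0 l Hphi Hself Hz0 Hl Hlim.
Let Hsd : forall z, Cmod z < 1 -> Cmod (sigma z) < 1 := sigma_disk phi z0 l Hphi Hself Hz0 Hl Hlim.

(** The point w' lies in the closed horodisk at xi through w: the Poisson kernel at xi does not
    decrease from w to w'. The cross-multiplied form passes to limits. *)
Definition julia_ineq (xi w w' : C) : Prop :=
  (1 - Cmod w * Cmod w) * (Cmod (xi - w') * Cmod (xi - w')) <= (1 - Cmod w' * Cmod w') * (Cmod (xi - w) * Cmod (xi - w)).

(** By [mob_poisson] the normalisation multiplies the Poisson kernels at both points by the same
    factor, so Julia's inequality for phi carries over. *)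
Lemma julia_sg n z : Cmod z < 1 -> julia_ineq (tau phi z0 n om) (sg phi z0 n z) (sg phi z0 n (phi z)).
Proof.
  intros Hz. unfold julia_ineq.
  set (a := orb phi z0 n). assert (Ha : Cmod a < 1) by (apply orb_disk; assumption).
  set (w := iterate phi n z). assert (Hw : Cmod w < 1) by (apply iterate_disk; assumption).
  assert (Ew : iterate phi n (phi z) = phi w) by apply iterate_phi.
  assert (Hkap : Cmod (kap phi z0 n) = 1) by (eapply kap_mod; eassumption).
  assert (Hpw := Hself w Hw).
  unfold sg. rewrite Ew. fold w.
  assert (Hd : forall u v, Cmod (tau phi z0 n u - tau phi z0 n v) = Cmod (mob a u - mob a v)).
  { intros u v. unfold tau. fold a. replace (kap phi z0 n * mob a u - kap phi z0 n * mob a v)%C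
      with (kap phi z0 n * (mob a u - mob a v))%C by ring. rewrite Cmod_mult, Hkap. ring. }
  rewrite !Hd. unfold tau. fold a. rewrite !Cmod_mult, Hkap, !Rmult_1_l.
  pose proof (mob_poisson a om w Ha Hom Hw) as E1. pose proof (mob_poisson a om (phi w) Ha Hom Hpw) as E2.
  pose proof (julia phi om Hphi Hself Hom Hang w Hw) as J.
  assert (P1 := unit_minus_pos om w Hom Hw). assert (P2 := unit_minus_pos om (phi w) Hom Hpw).
  assert (D1 : 0 < Cmod (1 - Cconj a * om)) by (apply (proj1 (Cmod_gt_0 _)), mob_den; lra).
  assert (Hca : 0 < 1 - Cmod a * Cmod a) by (pose proof (Cmod_ge_0 a); nra).
  pose proof (Cmod_ge_0 w) as Gw. pose proof (Cmod_ge_0 (phi w)) as Gp.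
  set (X := 1 - Cmod (mob a w) * Cmod (mob a w)) in *. set (X' := 1 - Cmod (mob a (phi w)) * Cmod (mob a (phi w))) in *.
  set (Y := Cmod (mob a om - mob a w) * Cmod (mob a om - mob a w)) in *.
  set (Y' := Cmod (mob a om - mob a (phi w)) * Cmod (mob a om - mob a (phi w))) in *.
  set (u := 1 - Cmod w * Cmod w) in *. set (u' := 1 - Cmod (phi w) * Cmod (phi w)) in *.
  set (v := Cmod (om - w) * Cmod (om - w)) in *. set (v' := Cmod (om - phi w) * Cmod (om - phi w)) in *.
  set (D := Cmod (1 - Cconj a * om) * Cmod (1 - Cconj a * om)) in *. set (c := 1 - Cmod a * Cmod a) in *.
  assert (HX : X = u * Y * D / (v * c)) by (rewrite <- E1; field; unfold v; split; nra).
  assert (HX' : X' = u' * Y' * D / (v' * c)) by (rewrite <- E2; field; unfold v'; split; nra).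
  assert (0 < v) by (unfold v; nra). assert (0 < v') by (unfold v'; nra). assert (0 < D) by (unfold D; nra).
  assert (0 <= Y) by (unfold Y; apply Rle_0_sqr). assert (0 <= Y') by (unfold Y'; apply Rle_0_sqr).
  rewrite HX, HX'. apply Rmult_le_reg_r with (v * v' * c / D).
  { apply Rdiv_lt_0_compat; [|assumption]. repeat apply Rmult_lt_0_compat; assumption. }
  replace (u * Y * D / (v * c) * Y' * (v * v' * c / D)) with (u * v' * (Y * Y')) by (field; lra).
  replace (u' * Y' * D / (v' * c) * Y * (v * v' * c / D)) with (u' * v * (Y * Y')) by (field; lra).
  apply Rmult_le_compat_r; [apply Rmult_le_pos; assumption|exact J].
Qed.

(** Convergence of the points [tau n om] is not asserted; since the inequality is closed, any
    cluster point serves as xi. *)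
Lemma julia_sigma : exists xi, Cmod xi = 1 /\ forall z, Cmod z < 1 -> julia_ineq xi (sigma z) (sigma (phi z)).
Proof.
  assert (Hxn : forall n, Cmod (tau phi z0 n om) = 1).
  { intros n. unfold tau. rewrite Cmod_mult, (kap_mod phi z0 l Hphi Hself Hz0 Hl Hlim), mob_unit;
      [ring|apply orb_disk; assumption|exact Hom]. }
  destruct (bolzano_weierstrass_C (fun n => tau phi z0 n om)) as [g [xi [Hg Hxi]]]; [intros n; rewrite Hxn; lra|].
  exists xi. split.
  - assert (L := clim_Cmod _ _ Hxi). apply is_lim_seq_unique in L.
    rewrite (Lim_seq_ext _ (fun _ => 1)) in L by (intros; apply Hxn). rewrite Lim_seq_const in L. congruence.
  - intros z Hz. unfold julia_ineq.
    assert (L1 : clim (fun n => sg phi z0 (g n) z) (sigma z)).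
    { apply (clim_sub (fun n => sg phi z0 n z)); [exact Hg|]. eapply sg_clim; eassumption. }
    assert (L2 : clim (fun n => sg phi z0 (g n) (phi z)) (sigma (phi z))).
    { apply (clim_sub (fun n => sg phi z0 n (phi z))); [exact Hg|]. eapply sg_clim; try eassumption. apply Hself, Hz. }
    assert (M1 : forall s w, clim s w -> is_lim_seq (fun n => 1 - Cmod (s n) * Cmod (s n)) (1 - Cmod w * Cmod w)).
    { intros s w H. apply is_lim_seq_minus'; [apply is_lim_seq_const|apply is_lim_seq_mult'; apply clim_Cmod, H]. }
    assert (M2 : forall s w, clim s w -> is_lim_seq (fun n => Cmod (tau phi z0 (g n) om - s n) * Cmod (tau phi z0 (g n) om - s n))
       (Cmod (xi - w) * Cmod (xi - w))).
    { intros s w H. apply is_lim_seq_mult'; apply clim_Cmod; apply clim_minus; assumption. }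
    assert (T1 := is_lim_seq_mult' _ _ _ _ (M1 _ _ L1) (M2 _ _ L2)).
    assert (T2 := is_lim_seq_mult' _ _ _ _ (M1 _ _ L2) (M2 _ _ L1)).
    exact (is_lim_seq_le _ _ _ _ (fun n => julia_sg (g n) z Hz) T1 T2).
Qed.

Lemma julia_ineq_trans xi u v w : Cmod xi = 1 -> Cmod u < 1 -> Cmod v < 1 -> Cmod w < 1 ->
  julia_ineq xi u v -> julia_ineq xi v w -> julia_ineq xi u w.
Proof.
  unfold julia_ineq. intros Hx Hu Hv Hw H1 H2.
  assert (Pu := unit_minus_pos xi u Hx Hu). assert (Pv := unit_minus_pos xi v Hx Hv). assert (Pw := unit_minus_pos xi w Hx Hw).
  set (a := Cmod (xi - u) * Cmod (xi - u)) in *. set (b := Cmod (xi - v) * Cmod (xi - v)) in *. set (c := Cmod (xi - w) * Cmod (xi - w)) in *.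
  assert (0 < a) by (unfold a; nra). assert (0 < b) by (unfold b; nra). assert (0 < c) by (unfold c; nra).
  apply Rmult_le_reg_r with b; [assumption|].
  apply Rle_trans with ((1 - Cmod v * Cmod v) * c * a); [|].
  - replace ((1 - Cmod u * Cmod u) * c * b) with ((1 - Cmod u * Cmod u) * b * c) by ring.
    replace ((1 - Cmod v * Cmod v) * c * a) with ((1 - Cmod v * Cmod v) * a * c) by ring.
    apply Rmult_le_compat_r; lra.
  - replace ((1 - Cmod w * Cmod w) * a * b) with ((1 - Cmod w * Cmod w) * b * a) by ring.
    apply Rmult_le_compat_r; lra.
Qed.

Lemma sigma_isometry z w : Cmod z < 1 -> Cmod w < 1 ->
  Cmod (mob (sigma (phi z)) (sigma (phi w))) = Cmod (mob (sigma z) (sigma w)).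
Proof.
  intros Hz Hw. destruct (sigma_phi phi z0 l Hphi Hself Hz0 Hl Hlim) as [e [He E]]. fold sigma in E.
  rewrite <- (mob_rot e (sigma z) (sigma w)), <- !E by auto.
  symmetry. apply mob_mob_mod; [eapply (l_mod phi z0); eassumption| |]; apply Hsd, Hself; assumption.
Qed.

Lemma sigma_isometry_iter n z w : Cmod z < 1 -> Cmod w < 1 ->
  Cmod (mob (sigma (iterate phi n z)) (sigma (iterate phi n w))) = Cmod (mob (sigma z) (sigma w)).
Proof.
  intros Hz Hw. induction n as [|n IH]; [reflexivity|]. simpl. rewrite sigma_isometry; [exact IH| |]; apply iterate_disk; assumption.
Qed.

(* A relatively compact orbit of the automorphism is recurrent; monotonicity along it then forces equality. *)
Lemma julia_recurrent xi delta : Cmod xi = 1 -> 0 < delta ->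
  (forall z, Cmod z < 1 -> julia_ineq xi (sigma z) (sigma (phi z))) ->
  (forall z, Cmod z < 1 -> delta <= Cmod (xi - sigma z)) ->
  forall z, Cmod z < 1 -> julia_ineq xi (sigma (phi z)) (sigma z).
Proof.
  intros Hxi Hd HJ Hdel z Hz.
  set (w := fun k => sigma (iterate phi k z)).
  assert (Hit : forall k, Cmod (iterate phi k z) < 1) by (intros; apply iterate_disk; assumption).
  assert (Hw : forall k, Cmod (w k) < 1) by (intros; apply Hsd, Hit).
  assert (HJ1 : forall k m, julia_ineq xi (w k) (w (m + k)%nat)).
  { intros k m. induction m as [|m IH]; simpl.
    - unfold julia_ineq. lra.
    - apply julia_ineq_trans with (w (m + k)%nat); auto. apply HJ, Hit. }
  (* Monotonicity along the orbit and the distance [delta] from xi keep 1 - |w k|^2 above c, so the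
     orbit stays in a compact part of the disk. The 4 comes from |xi - w 0| <= 2. *)
  set (c := (1 - Cmod (w 0%nat) * Cmod (w 0%nat)) * (delta * delta) / 4).
  pose proof (Hw 0%nat) as Hw0. pose proof (Cmod_ge_0 (w 0%nat)) as Gw0.
  assert (Hc : 0 < c) by (unfold c; assert (0 < (1 - Cmod (w 0%nat) * Cmod (w 0%nat)) * (delta * delta)) by (apply Rmult_lt_0_compat; nra); lra).
  assert (Hcw : forall k, c <= 1 - Cmod (w k) * Cmod (w k)).
  { intros k. specialize (HJ1 0%nat k). rewrite Nat.add_0_r in HJ1. unfold julia_ineq in HJ1.
    specialize (Hdel _ (Hit k)). fold (w k) in Hdel. unfold c.
    assert (delta * delta <= Cmod (xi - w k) * Cmod (xi - w k)) by (apply Rmult_le_compat; lra).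
    assert (Cmod (xi - w 0%nat) <= 2) by (eapply Rle_trans; [apply Cmod_minus_le|lra]).
    pose proof (Cmod_ge_0 (xi - w 0%nat)). pose proof (Cmod_ge_0 (w k)). specialize (Hw k).
    assert (Cmod (xi - w 0%nat) * Cmod (xi - w 0%nat) <= 4) by nra.
    assert ((1 - Cmod (w 0%nat) * Cmod (w 0%nat)) * (delta * delta) <= (1 - Cmod (w k) * Cmod (w k)) * 4).
    { eapply Rle_trans; [apply Rmult_le_compat_l; [nra|eassumption]|]. eapply Rle_trans; [exact HJ1|].
      apply Rmult_le_compat_l; nra. }
    lra. }
  destruct (bolzano_weierstrass_C w) as [g [a [Hg Ha]]]; [intros; left; apply Hw|].
  apply clim_dist in Ha.
  assert (Hrec : forall eps, 0 < eps -> exists m, Cmod (w (S m) - w 0%nat) <= eps).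
  { intros eps He.
    destruct (proj2 (is_lim_seq_spec _ _) Ha (mkposreal (eps * c / 8) ltac:(apply Rdiv_lt_0_compat; nra))) as [N HN].
    assert (H1 := HN N (le_n N)).
    pose proof (Hg N) as G1. pose proof (Hg (S (g N))) as G2.
    assert (H2 := HN (S (g N)) ltac:(lia)). simpl in H1, H2. rewrite Rminus_0_r in H1, H2.
    rewrite Rabs_pos_eq in H1, H2 by apply Cmod_ge_0.
    (* At the late times j < k the orbit nearly returns to itself. Invariance of the
       pseudo-hyperbolic distance under A moves the pair of times back to 0 and k - j. *)
    set (j := g N) in *. set (k := g (S j)) in *.
    exists (k - j - 1)%nat. replace (S (k - j - 1)) with (k - j)%nat by lia.
    assert (Hjk : Cmod (w k - w j) <= eps * c / 4).
    { replace (w k - w j)%C with ((w k - a) - (w j - a))%C by ring. eapply Rle_trans; [apply Cmod_minus_le|]. lra. }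
    assert (Hdj : c / 2 <= Cmod (1 - Cconj (w j) * w k)).
    { eapply Rle_trans; [|apply Cmod_minus_ge]. rewrite Cmod_1, Cmod_mult, Cmod_conj.
      pose proof (Hcw j); pose proof (Hw j); pose proof (Hw k). pose proof (Cmod_ge_0 (w j)); pose proof (Cmod_ge_0 (w k)). nra. }
    assert (Hm : Cmod (mob (w j) (w k)) <= eps / 2).
    { unfold mob. rewrite Cmod_div by (apply mob_den; [apply Hw|left; apply Hw]).
      apply Rmult_le_reg_r with (Cmod (1 - Cconj (w j) * w k)); [lra|].
      unfold Rdiv at 1. rewrite Rmult_assoc, Rinv_l by lra. nra. }
    assert (Ek : w k = sigma (iterate phi j (iterate phi (k - j) z))).
    { unfold w. f_equal. replace k with (j + (k - j))%nat at 1 by lia. unfold iterate. apply Nat.iter_add. }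
    rewrite Ek in Hm. unfold w at 1 in Hm. rewrite sigma_isometry_iter in Hm by auto.
    fold (w (k - j)%nat) in Hm. change (sigma z) with (w 0%nat) in Hm.
    set (v := w (k - j)%nat) in *. assert (Hv : Cmod v < 1) by apply Hw.
    unfold mob in Hm. rewrite Cmod_div in Hm by (apply mob_den; lra).
    assert (Hd0 : 0 < Cmod (1 - Cconj (w 0%nat) * v)) by (apply (proj1 (Cmod_gt_0 _)), mob_den; lra).
    apply Rmult_le_compat_r with (r := Cmod (1 - Cconj (w 0%nat) * v)) in Hm; [|lra].
    unfold Rdiv at 1 in Hm. rewrite Rmult_assoc, Rinv_l, Rmult_1_r in Hm by lra.
    assert (Cmod (1 - Cconj (w 0%nat) * v) <= 2).
    { eapply Rle_trans; [apply Cmod_minus_le|]. rewrite Cmod_1. pose proof (Cmod_prod_lt1 (w 0%nat) v Hw0 ltac:(lra)). lra. }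
    nra. }
  unfold julia_ineq. change (sigma z) with (w 0%nat). change (sigma (phi z)) with (w 1%nat).
  (* The Poisson kernel at xi does not decrease from time 1 to the return time S m, where the orbit
     is eps-close to its start. Replacing [w (S m)] by [w 0] costs 4 eps on one side and 8 eps on
     the other. *)
  assert (HH : (1 - Cmod (w 1%nat) * Cmod (w 1%nat)) * (Cmod (xi - w 0%nat) * Cmod (xi - w 0%nat))
    - (1 - Cmod (w 0%nat) * Cmod (w 0%nat)) * (Cmod (xi - w 1%nat) * Cmod (xi - w 1%nat)) <= 0).
  { apply le_all_eps_lin with 12. intros eps He. destruct (Hrec eps He) as [m Hm].
    pose proof (HJ1 1%nat m) as J. replace (m + 1)%nat with (S m) in J by lia. unfold julia_ineq in J.
    set (v := w (S m)) in *. assert (Hv : Cmod v < 1) by apply Hw. pose proof (Hw 1%nat) as Hw1.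
    pose proof (Cmod_ge_0 v). pose proof (Cmod_ge_0 (w 1%nat)).
    pose proof (Cmod_ge_0 (xi - v)); pose proof (Cmod_ge_0 (xi - w 0%nat)); pose proof (Cmod_ge_0 (xi - w 1%nat)).
    assert (B0 : Cmod (xi - w 0%nat) <= 2) by (eapply Rle_trans; [apply Cmod_minus_le|lra]).
    assert (B1 : Cmod (xi - w 1%nat) <= 2) by (eapply Rle_trans; [apply Cmod_minus_le|lra]).
    assert (Bv : Cmod (xi - v) <= 2) by (eapply Rle_trans; [apply Cmod_minus_le|lra]).
    assert (T1 : Cmod (xi - w 0%nat) <= Cmod (xi - v) + eps).
    { replace (xi - w 0%nat)%C with ((xi - v) + (v - w 0%nat))%C by ring. eapply Rle_trans; [apply Cmod_triangle|]. lra. }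
    assert (T2 : Cmod (w 0%nat) <= Cmod v + eps).
    { pose proof (Cmod_minus_ge (w 0%nat) v) as Q. rewrite Cmod_minus_sym in Q. lra. }
    assert (Q1 : Cmod (xi - w 0%nat) * Cmod (xi - w 0%nat) <= Cmod (xi - v) * Cmod (xi - v) + 4 * eps) by nra.
    assert (Q2 : Cmod (w 0%nat) * Cmod (w 0%nat) <= Cmod v * Cmod v + 2 * eps) by nra.
    set (X := Cmod (xi - w 1%nat) * Cmod (xi - w 1%nat)) in *. assert (0 <= X <= 4) by (unfold X; nra).
    set (Y := 1 - Cmod (w 1%nat) * Cmod (w 1%nat)) in *. assert (0 <= Y <= 1) by (unfold Y; nra).
    assert (Y * (Cmod (xi - w 0%nat) * Cmod (xi - w 0%nat)) <= Y * (Cmod (xi - v) * Cmod (xi - v) + 4 * eps))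
      by (apply Rmult_le_compat_l; lra).
    assert ((Cmod (w 0%nat) * Cmod (w 0%nat)) * X <= (Cmod v * Cmod v + 2 * eps) * X) by (apply Rmult_le_compat_r; lra).
    nra. }
  lra.
Qed.

(** Sends xi to infinity and the disk to the upper half-plane, so automorphisms fixing xi become
    affine. By [cayley_im] its imaginary part is the Poisson kernel at xi. *)
Definition cayley (xi w : C) : C := (Ci * (xi + w) / (xi - w))%C.

Lemma cayley_im xi w : Cmod xi = 1 -> Cmod w < 1 ->
  snd (cayley xi w) = (1 - Cmod w * Cmod w) / (Cmod (xi - w) * Cmod (xi - w)).
Proof.
  intros Hx Hw. assert (Hn := unit_minus_nz xi w Hx Hw). assert (Hp := unit_minus_pos xi w Hx Hw).
  assert (E : cayley xi w = (Ci * ((xi + w) * Cconj (xi - w)) * RtoC (/ (Cmod (xi - w) * Cmod (xi - w))))%C).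
  { unfold cayley. rewrite RtoC_inv by nra. rewrite Cmod_sqr_conj. field. split; [apply Cconj_nz, Hn|exact Hn]. }
  rewrite E. rewrite im_scal_r.
  assert (E2 : snd (Ci * ((xi + w) * Cconj (xi - w)))%C = 1 - Cmod w * Cmod w).
  { rewrite (Cmod_sqr w). pose proof (Cmod_sqr xi) as Q. rewrite Hx in Q. simpl. nra. }
  unfold Im. rewrite E2. reflexivity.
Qed.

Lemma semiconjugacy : exists (xi : C) (b : R), Cmod xi = 1 /\ b <> 0 /\
  forall z, Cmod z < 1 -> cayley xi (sigma (phi z)) = (cayley xi (sigma z) + RtoC b)%C.
Proof.
  destruct julia_sigma as [xi [Hxi HJ]].
  destruct (sigma_phi phi z0 l Hphi Hself Hz0 Hl Hlim) as [e [He E]]. fold sigma in E.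
  assert (Hl1 : Cmod (RtoC l) < 1) by (eapply (l_mod phi z0); eassumption).
  assert (Hll : l < 1) by (eapply (l_lt1 phi z0); eassumption).
  assert (Hs0 : sigma z0 = 0) by (eapply sigma_base; eassumption).
  assert (Hs1 : sigma (phi z0) = RtoC l) by (eapply sigma_next; eassumption).
  assert (Hz1 := Hself z0 Hz0).
  assert (Hx0 : xi <> 0) by (intros Z; rewrite Z, Cmod_0 in Hxi; lra).
  (* [eta] is the preimage of xi under A; the goal of the first half is [eta = xi]. *)
  set (eta := (Cconj e * mob (RtoC l) xi)%C).
  assert (Eeta : mob (RtoC l) xi = (e * eta)%C).
  { unfold eta. replace (e * (Cconj e * mob (RtoC l) xi))%C with ((e * Cconj e) * mob (RtoC l) xi)%C by ring.
    rewrite unit_conj by exact He. ring. }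
  set (D := Cmod (1 - Cconj (RtoC l) * xi)).
  assert (HD : 0 < D) by (apply (proj1 (Cmod_gt_0 _)), mob_den; lra).
  (* The boundary factor of [mob l] at xi; once [eta = xi], it is the multiplier of A, that is Im
     h(phi z) = q Im h(z). *)
  set (q := (1 - l * l) / (D * D)).
  assert (Hq : 0 < q) by (apply Rdiv_lt_0_compat; nra).
  assert (Cl : Cmod (RtoC l) = l) by (rewrite Cmod_RtoC, Rabs_pos_eq; lra).
  assert (I1 : forall z, Cmod z < 1 ->
    (1 - Cmod (sigma (phi z)) * Cmod (sigma (phi z))) * (Cmod (eta - sigma z) * Cmod (eta - sigma z))
    = q * ((1 - Cmod (sigma z) * Cmod (sigma z)) * (Cmod (xi - sigma (phi z)) * Cmod (xi - sigma (phi z))))).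
  { intros z Hz. pose proof (mob_poisson (RtoC l) xi (sigma (phi z)) Hl1 Hxi ltac:(auto)) as MP.
    rewrite E, Eeta in MP by exact Hz. replace (e * eta - e * sigma z)%C with (e * (eta - sigma z))%C in MP by ring.
    rewrite !Cmod_mult, He, Cl, !Rmult_1_l in MP. fold D in MP.
    unfold q. apply Rmult_eq_reg_r with (D * D); [|nra].
    rewrite <- MP. field. lra. }
  assert (I2 : forall z, Cmod z < 1 -> Cmod (eta - sigma z) * Cmod (eta - sigma z) <= q * (Cmod (xi - sigma z) * Cmod (xi - sigma z))).
  { intros z Hz. specialize (I1 z Hz). specialize (HJ z Hz). unfold julia_ineq in HJ.
    assert (H1 := Hsd _ (Hself z Hz)). pose proof (Cmod_ge_0 (sigma (phi z))).
    apply Rmult_le_reg_l with (1 - Cmod (sigma (phi z)) * Cmod (sigma (phi z))); [nra|]. rewrite I1.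
    replace ((1 - Cmod (sigma (phi z)) * Cmod (sigma (phi z))) * (q * (Cmod (xi - sigma z) * Cmod (xi - sigma z))))
      with (q * ((1 - Cmod (sigma (phi z)) * Cmod (sigma (phi z))) * (Cmod (xi - sigma z) * Cmod (xi - sigma z)))) by ring.
    apply Rmult_le_compat_l; lra. }
  (* If A moved xi, then [I2] would keep [sigma] at distance |eta - xi| / (1 + sqrt q) from xi.
     [julia_recurrent] then turns Julia's inequality into an equality, and (eta - sigma) / (xi -
     sigma) has constant modulus sqrt q. So it is constant, although [sigma] takes the distinct
     values 0 and l. *)
  assert (Heq : eta = xi).
  { apply NNPP. intros Hne.
    assert (Hd : 0 < Cmod (eta - xi)) by (apply (proj1 (Cmod_gt_0 _)), Cminus_eq_contra, Hne).
    set (sq := sqrt q). assert (Hsq : 0 < sq) by (apply sqrt_lt_R0, Hq). assert (Hsq2 : sq * sq = q) by (apply sqrt_sqrt; lra).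
    assert (Hdel : forall z, Cmod z < 1 -> Cmod (eta - xi) / (1 + sq) <= Cmod (xi - sigma z)).
    { intros z Hz. specialize (I2 z Hz). pose proof (Cmod_ge_0 (eta - sigma z)). pose proof (Cmod_ge_0 (xi - sigma z)).
      assert (Cmod (eta - sigma z) <= sq * Cmod (xi - sigma z)).
      { apply Rsqr_incr_0_var; [|nra]. unfold Rsqr. rewrite <- Hsq2 in I2. lra. }
      assert (Cmod (eta - xi) <= Cmod (eta - sigma z) + Cmod (xi - sigma z)).
      { replace (eta - xi)%C with ((eta - sigma z) - (xi - sigma z))%C by ring. apply Cmod_minus_le. }
      apply Rmult_le_reg_r with (1 + sq); [lra|]. unfold Rdiv. rewrite Rmult_assoc, Rinv_l by lra. lra. }
    assert (Hdp : 0 < Cmod (eta - xi) / (1 + sq)) by (apply Rdiv_lt_0_compat; lra).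
    assert (HR := julia_recurrent xi _ Hxi Hdp HJ Hdel).
    assert (HC : forall z w, Cmod z < 1 -> Cmod w < 1 ->
      ((eta - sigma z) / (xi - sigma z) = (eta - sigma w) / (xi - sigma w))%C).
    { intros z w. apply (const_modulus (fun z => (eta - sigma z) / (xi - sigma z))%C sq); [|exact Hsq|].
      - apply hol_div; [| |intros; apply unit_minus_nz; auto]; (apply hol_minus; [apply hol_const|exact Hsig]).
      - intros v Hv. assert (Hp := unit_minus_pos xi (sigma v) Hxi (Hsd v Hv)).
        rewrite Cmod_div by (apply unit_minus_nz; auto).
        assert (Q : Cmod (eta - sigma v) * Cmod (eta - sigma v) = (sq * Cmod (xi - sigma v)) * (sq * Cmod (xi - sigma v))).
        { specialize (HJ v Hv). specialize (HR v Hv). unfold julia_ineq in HJ, HR. specialize (I1 v Hv).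
          assert (H1 := Hsd _ (Hself v Hv)). pose proof (Cmod_ge_0 (sigma (phi v))).
          apply Rmult_eq_reg_l with (1 - Cmod (sigma (phi v)) * Cmod (sigma (phi v))); [|nra].
          rewrite I1. replace ((1 - Cmod (sigma v) * Cmod (sigma v)) * (Cmod (xi - sigma (phi v)) * Cmod (xi - sigma (phi v))))
            with ((1 - Cmod (sigma (phi v)) * Cmod (sigma (phi v))) * (Cmod (xi - sigma v) * Cmod (xi - sigma v))) by lra.
          rewrite <- Hsq2. ring. }
        assert (Cmod (eta - sigma v) = sq * Cmod (xi - sigma v)).
        { apply Rsqr_inj; [apply Cmod_ge_0|nra|exact Q]. }
        rewrite H. field. lra. }
    specialize (HC z0 (phi z0) Hz0 Hz1). rewrite Hs0, Hs1 in HC.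
    assert (Hxn : (xi - 0)%C <> 0) by (apply unit_minus_nz; [exact Hxi|rewrite Cmod_0; lra]).
    assert (Hxl : (xi - RtoC l)%C <> 0) by (apply unit_minus_nz; assumption).
    assert (HC2 : ((eta - 0) * (xi - RtoC l) = (eta - RtoC l) * (xi - 0))%C).
    { replace (eta - 0)%C with ((eta - 0) / (xi - 0) * (xi - 0))%C by (field; exact Hx0). rewrite HC. field. exact Hxl. }
    assert (HC3 : (RtoC l * (xi - eta) = 0)%C).
    { replace (RtoC l * (xi - eta))%C with ((eta - 0) * (xi - RtoC l) - (eta - RtoC l) * (xi - 0))%C by ring. rewrite HC2. ring. }
    apply (Cmult_neq_0 (RtoC l) (xi - eta)); [|apply Cminus_eq_contra; congruence|exact HC3].
    intros Z. apply RtoC_inj in Z. lra. }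
  rewrite Heq in I1, I2. clear Heq.
  assert (Hq1 : 1 <= q).
  { specialize (I2 z0 Hz0). rewrite Hs0 in I2. assert (P := unit_minus_pos xi 0 Hxi ltac:(rewrite Cmod_0; lra)).
    apply Rmult_le_reg_r with (Cmod (xi - 0) * Cmod (xi - 0)); [nra|]. lra. }
  set (h := fun z => cayley xi (sigma z)).
  assert (Him : forall z, Cmod z < 1 -> snd (h (phi z)) = q * snd (h z) /\ 0 < snd (h z)).
  { intros z Hz. unfold h. assert (H1 := Hsd _ (Hself z Hz)). assert (H2 := Hsd _ Hz).
    rewrite !cayley_im by assumption.
    assert (P1 := unit_minus_pos xi _ Hxi H1). assert (P2 := unit_minus_pos xi _ Hxi H2). specialize (I1 z Hz).
    pose proof (Cmod_ge_0 (sigma z)).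
    split; [|apply Rdiv_lt_0_compat; nra].
    apply Rmult_eq_reg_r with ((Cmod (xi - sigma (phi z)) * Cmod (xi - sigma (phi z))) * (Cmod (xi - sigma z) * Cmod (xi - sigma z)));
      [|apply Rgt_not_eq; repeat apply Rmult_lt_0_compat; assumption].
    transitivity ((1 - Cmod (sigma (phi z)) * Cmod (sigma (phi z))) * (Cmod (xi - sigma z) * Cmod (xi - sigma z))); [field; lra|].
    rewrite I1. field. lra. }
  (* In the half-plane the pseudo-hyperbolic distance is |h' - h| / |h' - conj h|, which is at least
     (q - 1) / (q + 1) when Im h' = q Im h. By Schwarz-Pick for [sigma] it is at most the step of
     phi at x, and that can be made arbitrarily small. *)
  assert (Hqe : q = 1).
  { apply Rle_antisym; [|exact Hq1]. apply Rminus_le.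
    apply le_all_eps_lin with (q + 1). intros eps Heps.
    destruct (parabolic_small_step phi om Hphi Hself Hom Hang eps Heps) as [x [Hx Hxs]].
    assert (Hsx := Hsd x Hx). assert (Hpx := Hsd _ (Hself x Hx)).
    pose proof (schwarz_pick_lt sigma (phi x) x Hsig ltac:(intros; left; auto) (Hself x Hx) Hx Hsx) as SP.
    destruct (Him x Hx) as [Y1 Y2].
    set (W := sigma x) in *. set (W' := sigma (phi x)) in *.
    assert (P1 := unit_minus_pos xi W Hxi Hsx). assert (P2 := unit_minus_pos xi W' Hxi Hpx).
    assert (N1 := unit_minus_nz xi W Hxi Hsx). assert (N2 := unit_minus_nz xi W' Hxi Hpx).
    assert (A1 : Cmod (h (phi x) - h x) * (Cmod (xi - W) * Cmod (xi - W')) = 2 * Cmod (W' - W)).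
    { rewrite <- !Cmod_mult. replace ((h (phi x) - h x) * ((xi - W) * (xi - W')))%C with (RtoC 2 * Ci * xi * (W' - W))%C.
      - rewrite !Cmod_mult, Cmod_RtoC, Rabs_pos_eq, Cmod_Ci, Hxi by lra. ring.
      - unfold h, cayley. fold W W'. field. auto. }
    assert (A2 : Cmod (h (phi x) - Cconj (h x)) * (Cmod (xi - W) * Cmod (xi - W')) = 2 * Cmod (1 - Cconj W * W')).
    { rewrite <- (Cmod_conj (xi - W)), <- !Cmod_mult.
      replace ((h (phi x) - Cconj (h x)) * (Cconj (xi - W) * (xi - W')))%C with (RtoC 2 * Ci * (1 - Cconj W * W'))%C.
      - rewrite !Cmod_mult, Cmod_RtoC, Rabs_pos_eq, Cmod_Ci by lra. ring.
      - unfold h, cayley. fold W W'. rewrite Cdiv_conj, Cmult_conj, Cplus_conj, Cminus_conj by exact N1.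
        replace (Cconj Ci) with (- Ci)%C by (unfold Cconj, Ci, Copp; simpl; f_equal; ring).
        assert (N3 : (Cconj xi - Cconj W)%C <> 0) by (rewrite <- Cminus_conj; apply Cconj_nz, N1).
        transitivity (Ci * ((xi * Cconj xi) - xi * Cconj W + W' * Cconj xi - W' * Cconj W
           + ((xi * Cconj xi) - Cconj xi * W' + Cconj W * xi - Cconj W * W')))%C.
        + rewrite unit_conj by exact Hxi. ring.
        + field. auto. }
    assert (A3 : Cmod (mob W W') * Cmod (h (phi x) - Cconj (h x)) = Cmod (h (phi x) - h x)).
    { assert (P3 : 0 < Cmod (1 - Cconj W * W')) by (apply (proj1 (Cmod_gt_0 _)), mob_den; lra).
      unfold mob. rewrite Cmod_div by (apply mob_den; lra).
      apply Rmult_eq_reg_r with (Cmod (xi - W) * Cmod (xi - W')); [|apply Rgt_not_eq, Rmult_lt_0_compat; assumption].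
      rewrite A1. rewrite Rmult_assoc, A2. field. lra. }
    assert (B1 : Cmod (h (phi x) - h x) * Cmod (h (phi x) - h x) =
      (fst (h (phi x)) - fst (h x)) * (fst (h (phi x)) - fst (h x)) + (q - 1) * snd (h x) * ((q - 1) * snd (h x))).
    { rewrite Cmod_sqr. unfold Cminus, Cplus, Copp, Cconj; cbn [fst snd]. rewrite Y1. ring. }
    assert (B2 : Cmod (h (phi x) - Cconj (h x)) * Cmod (h (phi x) - Cconj (h x)) =
      (fst (h (phi x)) - fst (h x)) * (fst (h (phi x)) - fst (h x)) + (q + 1) * snd (h x) * ((q + 1) * snd (h x))).
    { rewrite Cmod_sqr. unfold Cminus, Cplus, Copp, Cconj; cbn [fst snd]. rewrite Y1. ring. }
    set (m := Cmod (mob W W')) in *. assert (Hm0 : 0 <= m) by apply Cmod_ge_0.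
    assert (Hm1 : m < 1) by (apply mob_lt1; assumption).
    set (d := fst (h (phi x)) - fst (h x)) in *. set (y := snd (h x)) in *.
    rewrite <- A3 in B1.
    replace (m * Cmod (h (phi x) - Cconj (h x)) * (m * Cmod (h (phi x) - Cconj (h x))))
      with (m * m * (Cmod (h (phi x) - Cconj (h x)) * Cmod (h (phi x) - Cconj (h x)))) in B1 by ring.
    rewrite B2 in B1.
    assert (B3 : ((q - 1) * y) * ((q - 1) * y) <= (m * ((q + 1) * y)) * (m * ((q + 1) * y))).
    { assert (0 <= d * d) by apply Rle_0_sqr. assert (m * m <= 1) by nra. nra. }
    assert (B4 : (q - 1) * y <= m * ((q + 1) * y)).
    { apply Rsqr_incr_0_var; [exact B3|]. apply Rmult_le_pos; [lra|]. apply Rmult_le_pos; lra. }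
    assert (B5 : q - 1 <= m * (q + 1)) by (apply Rmult_le_reg_r with y; [exact Y2|lra]).
    nra. }
  assert (Hh : hol 1 h).
  { unfold h, cayley. apply hol_div; [| |intros; apply unit_minus_nz; auto].
    - apply hol_mult; [apply hol_const|apply hol_plus; [apply hol_const|exact Hsig]].
    - apply hol_minus; [apply hol_const|exact Hsig]. }
  assert (Hreal : forall z, Cmod z < 1 -> snd (h (phi z) - h z)%C = 0).
  { intros z Hz. destruct (Him z Hz) as [Y1 _]. unfold Cminus, Cplus, Copp; cbn [fst snd]. rewrite Y1, Hqe. ring. }
  exists xi, (fst (h (phi z0) - h z0)%C).
  assert (Hcst : forall z, Cmod z < 1 -> (h (phi z) - h z = RtoC (fst (h (phi z0) - h z0)%C))%C).
  { intros z Hz. transitivity (h (phi z0) - h z0)%C.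
    - apply (const_real (fun z => h (phi z) - h z)%C); [|exact Hreal|exact Hz|exact Hz0].
      apply hol_minus; [|exact Hh]. apply (hol_comp 1 1 h); assumption.
    - apply injective_projections; [reflexivity|]. rewrite Hreal by exact Hz0. reflexivity. }
  split; [exact Hxi|]. split.
  (* For b = 0 the Cayley transform would take the same value at 0 and at l; clearing denominators
     gives 2 l xi = 0. *)
  - intros Hb. specialize (Hcst z0 Hz0). rewrite Hb in Hcst. apply Ceq_minus in Hcst.
    unfold h, cayley in Hcst. rewrite Hs0, Hs1 in Hcst.
    assert (Hxn : (xi - 0)%C <> 0) by (apply unit_minus_nz; [exact Hxi|rewrite Cmod_0; lra]).
    assert (Hxl : (xi - RtoC l)%C <> 0) by (apply unit_minus_nz; assumption).
    assert (HC2 : ((xi + RtoC l) * (xi - 0) = (xi + 0) * (xi - RtoC l))%C).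
    { transitivity (- Ci * (Ci * (xi + RtoC l) / (xi - RtoC l)) * ((xi - RtoC l) * (xi - 0)))%C.
      - transitivity ((- (Ci * Ci)) * ((xi + RtoC l) * (xi - 0)))%C; [|field; exact Hxl].
        replace (- (Ci * Ci))%C with (RtoC 1) by (unfold Ci, Cmult, Copp, RtoC; simpl; f_equal; ring). ring.
      - rewrite Hcst. transitivity ((- (Ci * Ci)) * ((xi + 0) * (xi - RtoC l)))%C; [field; exact Hx0|].
        replace (- (Ci * Ci))%C with (RtoC 1) by (unfold Ci, Cmult, Copp, RtoC; simpl; f_equal; ring). ring. }
    assert (HC3 : (RtoC 2 * (RtoC l * xi) = 0)%C).
    { replace (RtoC 2 * (RtoC l * xi))%C with ((xi + RtoC l) * (xi - 0) - (xi + 0) * (xi - RtoC l))%C by ring. rewrite HC2. ring. }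
    apply (Cmult_neq_0 (RtoC 2) (RtoC l * xi)); [exact C2_nz| |exact HC3].
    apply Cmult_neq_0; [intros Z; apply RtoC_inj in Z; lra|]. intros Z. rewrite Z, Cmod_0 in Hxi. lra.
  - intros z Hz. specialize (Hcst z Hz). change (h (phi z) = (h z + RtoC (fst (h (phi z0) - h z0)%C))%C).
    rewrite <- Hcst. ring.
Qed.

End Classification.

(** * Functions that are inner in the mean *)

Lemma cont_mult_R (f g : R -> R) t : continuous f t -> continuous g t -> continuous (fun s => f s * g s) t.
Proof. apply (continuous_mult (K := R_AbsRing)). Qed.

Lemma cont_plus_R (f g : R -> R) t : continuous f t -> continuous g t -> continuous (fun s => f s + g s) t.
Proof. apply (continuous_plus (K := R_AbsRing) (V := R_NormedModule)). Qed.

Lemma cont_minus_R (f g : R -> R) t : continuous f t -> continuous g t -> continuous (fun s => f s - g s) t.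
Proof. apply (continuous_minus (K := R_AbsRing) (V := R_NormedModule)). Qed.

Lemma cont_const_R (c t : R) : continuous (fun _ : R => c) t.
Proof. apply continuous_const. Qed.

Lemma circle_pcont f r t : hol 1 f -> 0 <= r < 1 -> pcont (fun t => f (polar r t)) t.
Proof. intros Hf Hr. apply pcont_circle. eapply hol_ccont; [exact Hf|]. rewrite Cmod_polar; lra. Qed.

Lemma circle_cont f r t : hol 1 f -> 0 <= r < 1 -> continuous (fun t => Cmod (f (polar r t))) t.
Proof. intros Hf Hr. apply (pcont_fst (fun t => RtoC (Cmod (f (polar r t))))), contg_Cmod, circle_pcont; assumption. Qed.

Definition nrm2 (f : C -> C) (r t : R) : R := Cmod (f (polar r t)) * Cmod (f (polar r t)).

Lemma nrm2_cont f r t : hol 1 f -> 0 <= r < 1 -> continuous (nrm2 f r) t.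
Proof. intros Hf Hr. apply cont_mult_R; apply circle_cont; assumption. Qed.

Lemma nrm2_pos f r t : 0 <= nrm2 f r t.
Proof. apply Rle_0_sqr. Qed.

Lemma nrm2_ex f r a b : hol 1 f -> 0 <= r < 1 -> ex_RInt (nrm2 f r) a b.
Proof. intros. apply ex_RInt_cont. intros t. apply nrm2_cont; assumption. Qed.

Lemma mean_value_re f r : hol 1 f -> 0 <= r < 1 ->
  RInt (fun t => fst (f (polar r t))) 0 (2 * PI) = 2 * PI * fst (f 0).
Proof.
  intros Hf Hr. pose proof (mean_value 1 f r 0 Hf Hr) as E. rewrite Rplus_0_l in E.
  apply (f_equal fst) in E. unfold CI in E. cbn [fst] in E. rewrite E. simpl. as_R_eq. ring.
Qed.

Lemma poisson_re_at f r a x : hol 1 f -> 0 < r < 1 -> Cmod a < r ->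
  RInt (fun t => pk r a t * fst (f (polar r t))) x (x + 2 * PI) = 2 * PI * fst (f a).
Proof.
  intros Hf Hr Ha. pose proof (poisson_formula f r a x Hf Hr Ha) as E.
  apply (f_equal fst) in E. unfold CI in E. cbn [fst] in E.
  rewrite (RInt_ext_R _ (fun t => fst (RtoC (pk r a t) * f (polar r t))%C)) by (intros; simpl; ring).
  rewrite E. simpl. as_R_eq. ring.
Qed.

Lemma poisson_re f r a : hol 1 f -> 0 < r < 1 -> Cmod a < r ->
  RInt (fun t => pk r a t * fst (f (polar r t))) 0 (2 * PI) = 2 * PI * fst (f a).
Proof. intros. rewrite <- (poisson_re_at f r a 0) by assumption. rewrite Rplus_0_l. reflexivity. Qed.

Lemma factor_norm (f f1 : C -> C) w : (forall z, f z = (f 0 + z * f1 z)%C) ->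
  Cmod (f w) * Cmod (f w) = Cmod (f 0) * Cmod (f 0) + 2 * fst (Cconj (f 0) * (w * f1 w))%C
    + Cmod w * Cmod w * (Cmod (f1 w) * Cmod (f1 w)).
Proof.
  intros E.
  replace (Cmod w * Cmod w * (Cmod (f1 w) * Cmod (f1 w))) with (Cmod (w * f1 w) * Cmod (w * f1 w)) by (rewrite Cmod_mult; ring).
  rewrite (E w). set (x := f 0). set (y := (w * f1 w)%C). rewrite !Cmod_sqr. simpl. ring.
Qed.

(** * Backward shifts and composition of functions inner in the mean *)

Section Shift.
Variables (f f1 : C -> C).
Hypothesis Hf : hol 1 f.
Hypothesis Hf1 : hol 1 f1.
Hypothesis E : forall z, f z = (f 0 + z * f1 z)%C.

(** By [factor_norm] this is |f(0)|^2 + 2 Re (conj f(0) a f1(a)), a harmonic function of a. Hence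
    the circle mean after composition with phi and the Poisson mean at a = phi(0) produce the same
    number, which is what links f o phi to f. *)
Definition shift_gap (a : C) : R := Cmod (f a) * Cmod (f a) - Cmod a * Cmod a * (Cmod (f1 a) * Cmod (f1 a)).

(** For phi the identity this is the recursion that splits off one squared Taylor coefficient of
    f. *)
Lemma shift_comp phi r : hol 1 phi -> (forall z, Cmod z < 1 -> Cmod (phi z) < 1) -> 0 <= r < 1 ->
  RInt (nrm2 (fun z => f (phi z)) r) 0 (2 * PI)
  = 2 * PI * shift_gap (phi 0) + RInt (fun t => nrm2 phi r t * nrm2 (fun z => f1 (phi z)) r t) 0 (2 * PI).
Proof.
  intros Hp Hs Hr.
  assert (Hg : hol 1 (fun z => Cconj (f 0) * (phi z * f1 (phi z)))%C).
  { apply hol_mult; [apply hol_const|]. apply hol_mult; [exact Hp|]. apply (hol_comp 1 1 f1); assumption. }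
  assert (Hf1p : hol 1 (fun z => f1 (phi z))) by (apply (hol_comp 1 1 f1); assumption).
  rewrite (RInt_ext_R _ (fun t => (Cmod (f 0) * Cmod (f 0) + 2 * fst (Cconj (f 0) * (phi (polar r t) * f1 (phi (polar r t))))%C)
     + nrm2 phi r t * nrm2 (fun z => f1 (phi z)) r t)).
  2: { intros t _. unfold nrm2 at 1. rewrite (factor_norm f f1 (phi (polar r t)) E). unfold nrm2. ring. }
  assert (X1 : ex_RInt (fun t => fst (Cconj (f 0) * (phi (polar r t) * f1 (phi (polar r t))))%C) 0 (2 * PI)).
  { apply ex_RInt_cont. intros t. apply (pcont_fst (fun t => Cconj (f 0) * (phi (polar r t) * f1 (phi (polar r t))))%C).
    apply (circle_pcont _ r t Hg Hr). }
  assert (X2 : ex_RInt (fun t => nrm2 phi r t * nrm2 (fun z => f1 (phi z)) r t) 0 (2 * PI)).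
  { apply ex_RInt_cont. intros t. apply cont_mult_R; apply nrm2_cont; assumption. }
  rewrite RInt_plus_R; [|apply ex_RInt_plus_R; [apply ex_RInt_const|apply ex_RInt_scal_R, X1]|exact X2].
  rewrite RInt_plus_R; [|apply ex_RInt_const|apply ex_RInt_scal_R, X1].
  rewrite RInt_const_R, RInt_scal_R by exact X1.
  pose proof (mean_value_re _ r Hg Hr) as MV. cbv beta in MV. rewrite MV. clear MV.
  f_equal. pose proof (factor_norm f f1 (phi 0) E) as F. unfold shift_gap. rewrite F. ring.
Qed.

Lemma shift_poisson a r : 0 < r < 1 -> Cmod a < r ->
  RInt (fun t => pk r a t * nrm2 f r t) 0 (2 * PI)
  = 2 * PI * shift_gap a + r * r * RInt (fun t => pk r a t * nrm2 f1 r t) 0 (2 * PI).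
Proof.
  intros Hr Ha.
  assert (Hg : hol 1 (fun z => Cconj (f 0) * (z * f1 z))%C).
  { apply hol_mult; [apply hol_const|]. apply hol_mult; [apply hol_id|exact Hf1]. }
  assert (Hr' : 0 <= r < 1) by lra.
  assert (Cp : forall t, continuous (pk r a) t) by (intros; apply pk_cont; lra).
  rewrite (RInt_ext_R _ (fun t => (Cmod (f 0) * Cmod (f 0) * pk r a t + 2 * (pk r a t * fst (Cconj (f 0) * (polar r t * f1 (polar r t)))%C))
     + r * r * (pk r a t * nrm2 f1 r t))).
  2: { intros t _. unfold nrm2 at 1. rewrite (factor_norm f f1 (polar r t) E), Cmod_polar by lra. unfold nrm2. ring. }
  assert (X0 : ex_RInt (pk r a) 0 (2 * PI)) by (apply ex_RInt_cont; exact Cp).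
  assert (X1 : ex_RInt (fun t => pk r a t * fst (Cconj (f 0) * (polar r t * f1 (polar r t)))%C) 0 (2 * PI)).
  { apply ex_RInt_cont. intros t. apply cont_mult_R; [apply Cp|].
    apply (pcont_fst (fun t => Cconj (f 0) * (polar r t * f1 (polar r t)))%C). apply (circle_pcont _ r t Hg Hr'). }
  assert (X2 : ex_RInt (fun t => pk r a t * nrm2 f1 r t) 0 (2 * PI)).
  { apply ex_RInt_cont. intros t. apply cont_mult_R; [apply Cp|apply nrm2_cont; assumption]. }
  rewrite RInt_plus_R; [|apply ex_RInt_plus_R; apply ex_RInt_scal_R; assumption|apply ex_RInt_scal_R, X2].
  rewrite RInt_plus_R; [|apply ex_RInt_scal_R; assumption|apply ex_RInt_scal_R; assumption].
  rewrite !RInt_scal_R by assumption.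
  pose proof (poisson_re _ r a Hg Hr Ha) as MV. cbv beta in MV. rewrite MV. clear MV.
  pose proof (pk_int r a 0 Hr Ha) as PI1. rewrite Rplus_0_l in PI1. rewrite PI1.
  f_equal. pose proof (factor_norm f f1 a E) as F. unfold shift_gap. rewrite F. ring.
Qed.
End Shift.

Fixpoint psum (L : list R) (x : R) : R :=
  match L with nil => 0 | cons c L => c + x * psum L x end.

Lemma psum_bounds L : List.Forall (fun c => 0 <= c) L -> exists K, 0 <= K /\ forall x, 0 <= x <= 1 ->
  0 <= psum L x <= psum L 1 /\ psum L 1 - psum L x <= K * (1 - x).
Proof.
  induction 1 as [|c L Hc _ [K [HK IH]]].
  - exists 0. split; [lra|]. intros x Hx. simpl. lra.
  - exists (K + psum L 1). pose proof (IH 1 ltac:(lra)) as [B1 _]. split; [lra|].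
    intros x Hx. destruct (IH x Hx) as [B2 B3]. simpl. split; [nra|].
    replace (c + 1 * psum L 1 - (c + x * psum L x)) with ((1 - x) * psum L 1 + x * (psum L 1 - psum L x)) by ring. nra.
Qed.

(* [L] lists the squared Taylor coefficients, [g] is the [N]-th iterated backward shift of [f]. *)
Lemma shift_chain (phi : C -> C) : hol 1 phi -> (forall z, Cmod z < 1 -> Cmod (phi z) < 1) ->
  forall N f K, hol 1 f -> (forall z, Cmod z < 1 -> Cmod (f z) <= K) ->
  exists (g : C -> C) (L : list R) (A B : R), hol 1 g /\ List.Forall (fun c => 0 <= c) L /\ 0 <= B /\
   (forall r, 0 <= r < 1 -> RInt (nrm2 f r) 0 (2 * PI) = 2 * PI * psum L (r * r) + (r * r) ^ N * RInt (nrm2 g r) 0 (2 * PI)) /\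
   (forall r, Cmod (phi 0) < r < 1 -> RInt (fun t => pk r (phi 0) t * nrm2 f r t) 0 (2 * PI)
      <= 2 * PI * A + RInt (fun t => pk r (phi 0) t * nrm2 g r t) 0 (2 * PI)) /\
   (forall r, 0 <= r < 1 -> 2 * PI * A - B * RInt (fun t => 1 - nrm2 phi r t) 0 (2 * PI)
      <= RInt (nrm2 (fun z => f (phi z)) r) 0 (2 * PI)).
Proof.
  intros Hp Hs. pose proof PI_RGT_0 as HPI. pose proof (Cmod_ge_0 (phi 0)) as Hp0.
  induction N as [|N IH]; intros f K Hf HK.
  - exists f, nil, 0, 0. split; [exact Hf|]. split; [constructor|]. split; [lra|]. split; [|split].
    + intros r Hr. simpl. lra.
    + intros r Hr. lra.
    + intros r Hr. rewrite Rmult_0_r, Rmult_0_l, Rminus_diag. apply RInt_ge_0; [lra| |intros; apply nrm2_pos].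
      apply nrm2_ex; [|exact Hr]. apply (hol_comp 1 1 f); assumption.
  - destruct (factor_zero f Hf) as [f1 [Hf1 E]].
    assert (B1 := factor_bound f f1 K Hf1 E HK). set (K1 := K + Cmod (f 0)) in *.
    destruct (IH f1 K1 Hf1 B1) as [g [L [A [B [Hg [HL [HB [G1 [G2 G3]]]]]]]]].
    (* [A] collects the gaps at [phi 0], shared by the Poisson mean of f and the mean of f o phi.
       [B] collects squared sup bounds of the shifts, the price of replacing |phi|^2 by 1 at each
       stage. *)
    exists g, (cons (Cmod (f 0) * Cmod (f 0)) L), (shift_gap f f1 (phi 0) + A), (B + K1 * K1).
    split; [exact Hg|]. split; [constructor; [apply Rle_0_sqr|exact HL]|].
    split; [pose proof (Rle_0_sqr K1) as Q; unfold Rsqr in Q; lra|]. split; [|split].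
    + intros r Hr.
      pose proof (shift_comp f f1 Hf1 E (fun z => z) r (hol_id 1) ltac:(auto) Hr) as S. cbv beta in S.
      change (nrm2 (fun z => f z) r) with (nrm2 f r) in S. rewrite S.
      rewrite (RInt_ext_R _ (fun t => r * r * nrm2 f1 r t)) by (intros; unfold nrm2 at 1; rewrite Cmod_polar by lra; reflexivity).
      rewrite RInt_scal_R, G1 by (auto; apply nrm2_ex; assumption).
      unfold shift_gap. rewrite Cmod_0. simpl. generalize (RInt (nrm2 g r) 0 (2 * PI) : R). intros J. as_R_eq. ring.
    + intros r Hr.
      assert (Xg : ex_RInt (fun t => pk r (phi 0) t * nrm2 f1 r t) 0 (2 * PI)).
      { apply ex_RInt_cont. intros t. apply cont_mult_R; [apply pk_cont; lra|apply nrm2_cont; [exact Hf1|lra]]. }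
      rewrite (shift_poisson f f1 Hf1 E) by lra. specialize (G2 r Hr).
      assert (0 <= RInt (fun t => pk r (phi 0) t * nrm2 f1 r t) 0 (2 * PI)).
      { apply RInt_ge_0; [lra|exact Xg|]. intros t _. apply Rmult_le_pos; [left; apply pk_pos; lra|apply nrm2_pos]. }
      assert (r * r <= 1) by nra. nra.
    + intros r Hr. rewrite (shift_comp f f1 Hf1 E phi r Hp Hs Hr). specialize (G3 r Hr).
      assert (Hf1p : hol 1 (fun z => f1 (phi z))) by (apply (hol_comp 1 1 f1); assumption).
      assert (X1 : ex_RInt (nrm2 (fun z => f1 (phi z)) r) 0 (2 * PI)) by (apply nrm2_ex; assumption).
      assert (X2 : ex_RInt (fun t => 1 - nrm2 phi r t) 0 (2 * PI)).
      { apply ex_RInt_cont. intros t. apply cont_minus_R; [apply cont_const_R|apply nrm2_cont; assumption]. }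
      assert (RInt (nrm2 (fun z => f1 (phi z)) r) 0 (2 * PI) - K1 * K1 * RInt (fun t => 1 - nrm2 phi r t) 0 (2 * PI)
        <= RInt (fun t => nrm2 phi r t * nrm2 (fun z => f1 (phi z)) r t) 0 (2 * PI)).
      { rewrite <- (RInt_scal_R (K1 * K1) (fun t => 1 - nrm2 phi r t)) by exact X2.
        rewrite <- (RInt_minus_R (nrm2 (fun z => f1 (phi z)) r)); [|exact X1|apply ex_RInt_scal_R, X2].
        apply RInt_le; [lra|apply ex_RInt_minus_R; [exact X1|apply ex_RInt_scal_R, X2]| |].
        - apply ex_RInt_cont. intros t. apply cont_mult_R; apply nrm2_cont; assumption.
        - intros t _. assert (Hpt : Cmod (polar r t) < 1) by (rewrite Cmod_polar; lra).
          assert (Q1 := B1 _ (Hs _ Hpt)). assert (Q2 := Hs _ Hpt).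
          pose proof (Cmod_ge_0 (f1 (phi (polar r t)))). pose proof (Cmod_ge_0 (phi (polar r t))).
          unfold nrm2. set (x := Cmod (phi (polar r t))) in *. set (y := Cmod (f1 (phi (polar r t)))) in *.
          assert (y * y <= K1 * K1) by (apply Rmult_le_compat; lra).
          assert (0 <= 1 - x * x) by nra. nra. }
      nra.
Qed.

Lemma pk_upper r z t : 0 <= r -> Cmod z < r -> pk r z t <= (r + Cmod z) / (r - Cmod z).
Proof.
  intros Hr Hz. unfold pk. pose proof (polar_minus_ge r t z Hr) as H. pose proof (Cmod_ge_0 z).
  apply Rmult_le_reg_r with (Cmod (polar r t - z) * Cmod (polar r t - z)); [nra|].
  unfold Rdiv at 1. rewrite Rmult_assoc, Rinv_l by nra.
  apply Rmult_le_reg_r with (r - Cmod z); [lra|].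
  replace ((r + Cmod z) / (r - Cmod z) * (Cmod (polar r t - z) * Cmod (polar r t - z)) * (r - Cmod z))
    with ((r + Cmod z) * (Cmod (polar r t - z) * Cmod (polar r t - z))) by (field; lra).
  assert ((r - Cmod z) * (r - Cmod z) <= Cmod (polar r t - z) * Cmod (polar r t - z)) by (apply Rmult_le_compat; lra).
  nra.
Qed.

Lemma poisson_le f r a : hol 1 f -> 0 < r < 1 -> Cmod a < r ->
  RInt (fun t => pk r a t * nrm2 f r t) 0 (2 * PI) <= (r + Cmod a) / (r - Cmod a) * RInt (nrm2 f r) 0 (2 * PI).
Proof.
  intros Hf Hr Ha. pose proof PI_RGT_0. assert (Hr' : 0 <= r < 1) by lra.
  rewrite <- RInt_scal_R by (apply nrm2_ex; assumption).
  apply RInt_le; [lra| |apply ex_RInt_scal_R, nrm2_ex; assumption|].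
  - apply ex_RInt_cont. intros t. apply cont_mult_R; [apply pk_cont; lra|apply nrm2_cont; assumption].
  - intros t _. apply Rmult_le_compat_r; [apply nrm2_pos|apply pk_upper; lra].
Qed.

(* Expand [|f - f(z)|^2 >= 0] under the Poisson kernel at [z]. *)
Lemma nrm2_subharmonic f r z : hol 1 f -> 0 < r < 1 -> Cmod z < r ->
  2 * PI * (Cmod (f z) * Cmod (f z)) <= RInt (fun t => pk r z t * nrm2 f r t) 0 (2 * PI).
Proof.
  intros Hf Hr Hz. pose proof PI_RGT_0. assert (Hr' : 0 <= r < 1) by lra.
  assert (Hg : hol 1 (fun w => Cconj (f z) * f w)%C) by (apply hol_mult; [apply hol_const|exact Hf]).
  assert (Cp : forall t, continuous (pk r z) t) by (intros; apply pk_cont; lra).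
  assert (X0 : ex_RInt (pk r z) 0 (2 * PI)) by (apply ex_RInt_cont; exact Cp).
  assert (X1 : ex_RInt (fun t => pk r z t * nrm2 f r t) 0 (2 * PI)).
  { apply ex_RInt_cont. intros t. apply cont_mult_R; [apply Cp|apply nrm2_cont; assumption]. }
  assert (X2 : ex_RInt (fun t => pk r z t * fst (Cconj (f z) * f (polar r t))%C) 0 (2 * PI)).
  { apply ex_RInt_cont. intros t. apply cont_mult_R; [apply Cp|].
    apply (pcont_fst (fun t => Cconj (f z) * f (polar r t))%C). apply (circle_pcont _ r t Hg Hr'). }
  pose proof (poisson_re _ r z Hg Hr Hz) as MV. cbv beta in MV.
  pose proof (pk_int r z 0 Hr Hz) as PI1. rewrite Rplus_0_l in PI1.
  assert (P : 0 <= RInt (fun t => (pk r z t * nrm2 f r t + Cmod (f z) * Cmod (f z) * pk r z t)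
     - 2 * (pk r z t * fst (Cconj (f z) * f (polar r t))%C)) 0 (2 * PI)).
  { apply RInt_ge_0; [lra|apply ex_RInt_minus_R; [apply ex_RInt_plus_R; [exact X1|apply ex_RInt_scal_R, X0]|apply ex_RInt_scal_R, X2]|].
    intros t _. replace (pk r z t * nrm2 f r t + Cmod (f z) * Cmod (f z) * pk r z t - 2 * (pk r z t * fst (Cconj (f z) * f (polar r t))%C))
      with (pk r z t * (Cmod (f (polar r t) - f z) * Cmod (f (polar r t) - f z))).
    - apply Rmult_le_pos; [left; apply pk_pos; lra|apply Rle_0_sqr].
    - unfold nrm2. rewrite !Cmod_sqr. simpl. ring. }
  rewrite RInt_minus_R in P; [|apply ex_RInt_plus_R; [exact X1|apply ex_RInt_scal_R, X0]|apply ex_RInt_scal_R, X2].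
  rewrite RInt_plus_R in P; [|exact X1|apply ex_RInt_scal_R, X0].
  rewrite !RInt_scal_R, MV, PI1 in P by assumption.
  replace (fst (Cconj (f z) * f z)%C) with (Cmod (f z) * Cmod (f z)) in P by (rewrite Cmod_sqr; simpl; ring). lra.
Qed.

Definition inner_mean (f : C -> C) : Prop :=
  hol 1 f /\ (forall z, Cmod z < 1 -> Cmod (f z) <= 1) /\
  forall eps, 0 < eps -> exists r0, 0 <= r0 < 1 /\ forall r, r0 < r < 1 ->
    RInt (fun t => 1 - nrm2 f r t) 0 (2 * PI) < eps.

Lemma defect_eq f r : hol 1 f -> 0 <= r < 1 ->
  RInt (fun t => 1 - nrm2 f r t) 0 (2 * PI) = 2 * PI - RInt (nrm2 f r) 0 (2 * PI).
Proof.
  intros Hf Hr. rewrite RInt_minus_R; [|apply ex_RInt_const|apply nrm2_ex; assumption].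
  rewrite RInt_const_R. lra.
Qed.

Lemma defect_ge0 f r : hol 1 f -> (forall z, Cmod z < 1 -> Cmod (f z) <= 1) -> 0 <= r < 1 ->
  0 <= RInt (fun t => 1 - nrm2 f r t) 0 (2 * PI).
Proof.
  intros Hf Hb Hr. pose proof PI_RGT_0. apply RInt_ge_0; [lra| |].
  - apply ex_RInt_cont. intros t. apply cont_minus_R; [apply cont_const_R|apply nrm2_cont; assumption].
  - intros t _. unfold nrm2. specialize (Hb (polar r t) ltac:(rewrite Cmod_polar; lra)). pose proof (Cmod_ge_0 (f (polar r t))). nra.
Qed.

(** First N is chosen so that the squared Taylor coefficients split off account for almost all of
    the mean of |f|^2; the N-th shift g then has small mean near the boundary. The Poisson mean of
    |f|^2 at phi(0) tends to 1, and by Harnack g contributes little to it, so [A] is almost 1.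
    Finally |f o phi|^2 has mean at least [A] minus a multiple of the defect of phi; as N, hence
    [B], is already fixed, that defect can be made negligible. *)
Lemma inner_mean_comp f phi : inner_mean f -> inner_mean phi -> (forall z, Cmod z < 1 -> Cmod (phi z) < 1) ->
  inner_mean (fun z => f (phi z)).
Proof.
  intros [Hf [Hfb Hfm]] [Hp [_ Hpm]] Hs. pose proof PI_RGT_0 as HPI.
  assert (Hfp : hol 1 (fun z => f (phi z))) by (apply (hol_comp 1 1 f); assumption).
  split; [exact Hfp|]. split; [intros z Hz; apply Hfb, Hs, Hz|].
  intros eps Heps.
  assert (H00 : Cmod 0 < 1) by (rewrite Cmod_0; lra). assert (Ha := Hs 0 H00). set (a := phi 0) in *.
  pose proof (Cmod_ge_0 a) as Ha0.
  (* A Harnack constant: it bounds the Poisson kernel at a = phi(0) on every circle with r > (1 +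
     |a|) / 2. *)
  set (kap := 4 / (1 - Cmod a)).
  assert (Hkap : 0 < kap) by (apply Rdiv_lt_0_compat; lra).
  assert (Hkap2 : forall r, (1 + Cmod a) / 2 < r < 1 -> (r + Cmod a) / (r - Cmod a) <= kap).
  { intros r Hr. unfold kap. apply Rmult_le_reg_r with ((r - Cmod a) * (1 - Cmod a)); [apply Rmult_lt_0_compat; lra|].
    replace ((r + Cmod a) / (r - Cmod a) * ((r - Cmod a) * (1 - Cmod a))) with ((r + Cmod a) * (1 - Cmod a)) by (field; lra).
    replace (4 / (1 - Cmod a) * ((r - Cmod a) * (1 - Cmod a))) with (4 * (r - Cmod a)) by (field; lra).
    assert ((r + Cmod a) * (1 - Cmod a) <= 2 * (1 - Cmod a)) by (apply Rmult_le_compat_r; lra). lra. }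
  set (e1 := eps / (2 * (2 * PI) * (2 * kap + 1))).
  assert (He1 : 0 < e1) by (apply Rdiv_lt_0_compat; [lra|]; apply Rmult_lt_0_compat; lra).
  destruct (Hfm (2 * PI * (e1 / 2))) as [rr [Hrr Hrr2]]; [apply Rmult_lt_0_compat; lra|].
  (* Two radii are needed: on [R1] the remainder is bounded for every N, and passing to the smaller
     [R0] gains the factor (R0 / R1)^(2 N), which makes it small. *)
  set (R0 := (1 + rr) / 2). set (R1 := (1 + R0) / 2).
  assert (HR0 : 0 < R0 < 1) by (unfold R0; lra). assert (HR1 : R0 < R1 < 1) by (unfold R1; lra).
  specialize (Hrr2 R0 ltac:(unfold R0; lra)). rewrite defect_eq in Hrr2 by (auto; lra).
  set (kp := (R1 + R0) / (R1 - R0)). assert (Hkp : 0 < kp) by (apply Rdiv_lt_0_compat; lra).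
  set (x := (R0 * R0) / (R1 * R1)).
  assert (Hx : 0 < x < 1).
  { unfold x. split; [apply Rdiv_lt_0_compat; nra|]. apply Rmult_lt_reg_r with (R1 * R1); [nra|].
    unfold Rdiv. rewrite Rmult_assoc, Rinv_l by nra. nra. }
  destruct (pow_lt_1_zero x ltac:(rewrite Rabs_pos_eq; lra) (e1 / (2 * kp))) as [N HN]; [apply Rdiv_lt_0_compat; lra|].
  specialize (HN N (le_n N)). rewrite Rabs_pos_eq in HN by (apply pow_le; lra).
  destruct (shift_chain phi Hp Hs N f 1 Hf Hfb) as [g [L [A [B [Hg [HL [HB [G1 [G2 G3]]]]]]]]].
  destruct (psum_bounds L HL) as [K [HK HKL]].
  assert (Ig0 : forall r, 0 <= r < 1 -> 0 <= RInt (nrm2 g r) 0 (2 * PI))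
    by (intros r Hr; apply RInt_ge_0; [lra|apply nrm2_ex; assumption|intros; apply nrm2_pos]).
  assert (If1 : forall r, 0 <= r < 1 -> RInt (nrm2 f r) 0 (2 * PI) <= 2 * PI).
  { intros r Hr. pose proof (defect_ge0 f r Hf Hfb Hr). rewrite defect_eq in H by assumption. lra. }
  assert (HA : 1 - e1 <= psum L 1).
  { assert (Q1 := G1 R1 ltac:(lra)). assert (Q2 := If1 R1 ltac:(lra)).
    destruct (HKL (R1 * R1) ltac:(nra)) as [[Q3 _] _].
    assert (Q4 : (R1 * R1) ^ N * RInt (nrm2 g R1) 0 (2 * PI) <= 2 * PI) by nra.
    assert (Q5 : RInt (nrm2 g R0) 0 (2 * PI) <= kp * RInt (nrm2 g R1) 0 (2 * PI)).
    { replace (kp * RInt (nrm2 g R1) 0 (2 * PI)) with (RInt (fun _ => / (2 * PI) * (kp * RInt (nrm2 g R1) 0 (2 * PI))) 0 (2 * PI))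
        by (rewrite RInt_const_R; generalize (RInt (nrm2 g R1) 0 (2 * PI) : R); intros J; as_R_eq; field; lra).
      apply RInt_le; [lra|apply nrm2_ex; [exact Hg|lra]|apply ex_RInt_const|].
      intros t _. assert (Hm : Cmod (polar R0 t) = R0) by (apply Cmod_polar; lra).
      pose proof (nrm2_subharmonic g R1 (polar R0 t) Hg ltac:(lra) ltac:(lra)) as S1.
      pose proof (poisson_le g R1 (polar R0 t) Hg ltac:(lra) ltac:(lra)) as S2.
      rewrite Hm in S2. fold kp in S2. unfold nrm2 at 1.
      apply Rmult_le_reg_l with (2 * PI); [lra|].
      replace (2 * PI * (/ (2 * PI) * (kp * RInt (nrm2 g R1) 0 (2 * PI)))) with (kp * RInt (nrm2 g R1) 0 (2 * PI)) by (field; lra). lra. }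
    assert (Q6 : (R0 * R0) ^ N = x ^ N * (R1 * R1) ^ N).
    { rewrite <- Rpow_mult_distr. f_equal. unfold x. field. lra. }
    assert (Q7 : (R0 * R0) ^ N * RInt (nrm2 g R0) 0 (2 * PI) <= 2 * PI * (e1 / 2)).
    { assert (P1 : 0 < (R1 * R1) ^ N) by (apply pow_lt; nra). assert (P2 : 0 < x ^ N) by (apply pow_lt; lra).
      rewrite Q6. apply Rle_trans with (x ^ N * (R1 * R1) ^ N * (kp * RInt (nrm2 g R1) 0 (2 * PI))).
      - apply Rmult_le_compat_l; [nra|exact Q5].
      - replace (x ^ N * (R1 * R1) ^ N * (kp * RInt (nrm2 g R1) 0 (2 * PI)))
          with (x ^ N * kp * ((R1 * R1) ^ N * RInt (nrm2 g R1) 0 (2 * PI))) by ring.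
        assert (x ^ N * kp <= e1 / 2).
        { apply Rle_trans with (e1 / (2 * kp) * kp); [apply Rmult_le_compat_r; lra|right; field; lra]. }
        assert (0 < x ^ N * kp) by (apply Rmult_lt_0_compat; lra). nra. }
    rewrite (G1 R0) in Hrr2 by lra. destruct (HKL (R0 * R0) ltac:(nra)) as [[_ Q8] _].
    assert (2 * PI * (1 - e1) <= 2 * PI * psum L 1) by nra. apply Rmult_le_reg_l with (2 * PI); lra. }
  assert (HE : 1 - 2 * kap * e1 <= A).
  { assert (HH : (1 - 2 * kap * e1 - A) <= 0); [|lra].
    apply le_all_eps_lin with (kap + 2 * kap * K). intros d Hd.
    destruct (Hfm (2 * PI * d)) as [r1 [Hr1 Hr12]]; [apply Rmult_lt_0_compat; lra|].
    (* With N fixed, Bernoulli's inequality keeps (r^2)^N above 1 / 2 for r near 1, so this factor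
       can be divided out of the remainder. *)
    assert (Hc : exists r2, r2 < 1 /\ forall r, r2 < r < 1 -> / 2 <= (r * r) ^ N /\ 1 - r * r <= d).
    { exists (1 - Rmin (/ 2) (Rmin (d / 2) (/ (4 * (INR N + 1))))).
      pose proof (pos_INR N) as HN0.
      assert (Hi : 0 < / (4 * (INR N + 1))) by (apply Rinv_0_lt_compat; lra).
      pose proof (Rmin_l (/ 2) (Rmin (d / 2) (/ (4 * (INR N + 1))))). pose proof (Rmin_r (/ 2) (Rmin (d / 2) (/ (4 * (INR N + 1))))).
      pose proof (Rmin_l (d / 2) (/ (4 * (INR N + 1)))). pose proof (Rmin_r (d / 2) (/ (4 * (INR N + 1)))).
      assert (0 < Rmin (/ 2) (Rmin (d / 2) (/ (4 * (INR N + 1))))) by (repeat apply Rmin_pos; lra).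
      split; [lra|]. intros r Hr. split; [|nra].
      set (y := 1 - r * r). assert (Hy : 0 <= y <= 1) by (unfold y; nra).
      assert (Hy2 : y * (INR N + 1) <= / 2).
      { apply Rle_trans with (2 * / (4 * (INR N + 1)) * (INR N + 1)); [apply Rmult_le_compat_r; [lra|unfold y; nra]|right; field; lra]. }
      replace (r * r) with (1 - y) by (unfold y; ring).
      assert (Bern : forall n, 1 - INR n * y <= (1 - y) ^ n).
      { induction n as [|n IHn]; [simpl; lra|]. rewrite S_INR. simpl.
        assert (0 <= (1 - y) ^ n) by (apply pow_le; lra). pose proof (pos_INR n). nra. }
      specialize (Bern N). nra. }
    destruct Hc as [r2 [Hr2 Hr22]].
    set (r := (1 + Rmax (Rmax r1 r2) ((1 + Cmod a) / 2)) / 2).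
    pose proof (Rmax_l (Rmax r1 r2) ((1 + Cmod a) / 2)). pose proof (Rmax_r (Rmax r1 r2) ((1 + Cmod a) / 2)).
    pose proof (Rmax_l r1 r2). pose proof (Rmax_r r1 r2).
    assert (Rmax (Rmax r1 r2) ((1 + Cmod a) / 2) < 1) by (repeat apply Rmax_lub_lt; lra).
    assert (Hr : r1 < r /\ r2 < r /\ (1 + Cmod a) / 2 < r /\ r < 1) by (unfold r; lra).
    specialize (Hr12 r ltac:(lra)). specialize (Hr22 r ltac:(lra)) as [Hr3 Hr4]. specialize (Hkap2 r ltac:(lra)).
    specialize (G2 r ltac:(fold a; lra)). fold a in G2.
    assert (Hr0 : 0 <= r < 1) by lra.
    pose proof (poisson_le g r a Hg ltac:(lra) ltac:(lra)) as S2.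
    pose proof (Ig0 r Hr0) as S3. pose proof (G1 r Hr0) as S4. pose proof (If1 r Hr0) as S5.
    destruct (HKL (r * r) ltac:(nra)) as [[S6 S7] S8].
    assert (S9 : RInt (nrm2 g r) 0 (2 * PI) <= 2 * (2 * PI * (e1 + K * d))).
    { assert (K * (1 - r * r) <= K * d) by (apply Rmult_le_compat_l; lra).
      assert (2 * PI * (1 - psum L (r * r)) <= 2 * PI * (e1 + K * d)) by (apply Rmult_le_compat_l; lra).
      assert ((r * r) ^ N * RInt (nrm2 g r) 0 (2 * PI) <= 2 * PI * (e1 + K * d)) by lra.
      assert (/ 2 * RInt (nrm2 g r) 0 (2 * PI) <= (r * r) ^ N * RInt (nrm2 g r) 0 (2 * PI)) by (apply Rmult_le_compat_r; lra).
      lra. }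
    (* The kernel has total mass 2 pi and is at most [kap], so the defect of f costs at most [kap]
       times as much under it. *)
    assert (S10 : 2 * PI - kap * (2 * PI * d) <= RInt (fun t => pk r a t * nrm2 f r t) 0 (2 * PI)).
    { assert (Cp : forall t, continuous (pk r a) t) by (intros; apply pk_cont; lra).
      assert (X0 : ex_RInt (pk r a) 0 (2 * PI)) by (apply ex_RInt_cont; exact Cp).
      assert (X1 : ex_RInt (fun t => pk r a t * nrm2 f r t) 0 (2 * PI)).
      { apply ex_RInt_cont. intros t. apply cont_mult_R; [apply Cp|apply nrm2_cont; assumption]. }
      assert (X2 : ex_RInt (fun t => 1 - nrm2 f r t) 0 (2 * PI)).
      { apply ex_RInt_cont. intros t. apply cont_minus_R; [apply cont_const_R|apply nrm2_cont; assumption]. }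
      pose proof (pk_int r a 0 ltac:(lra) ltac:(lra)) as PI1. rewrite Rplus_0_l in PI1.
      assert (Q : RInt (fun t => pk r a t - pk r a t * nrm2 f r t) 0 (2 * PI) <= RInt (fun t => kap * (1 - nrm2 f r t)) 0 (2 * PI)).
      { apply RInt_le; [lra|apply ex_RInt_minus_R; assumption|apply ex_RInt_scal_R, X2|].
        intros t _. pose proof (pk_upper r a t ltac:(lra) ltac:(lra)).
        assert (0 <= 1 - nrm2 f r t).
        { unfold nrm2. specialize (Hfb (polar r t) ltac:(rewrite Cmod_polar; lra)). pose proof (Cmod_ge_0 (f (polar r t))). nra. }
        nra. }
      rewrite RInt_minus_R, RInt_scal_R, PI1 in Q by assumption. nra. }
    assert (S11 : (r + Cmod a) / (r - Cmod a) * RInt (nrm2 g r) 0 (2 * PI) <= kap * (2 * (2 * PI * (e1 + K * d)))).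
    { apply Rmult_le_compat; [|exact S3|exact Hkap2|exact S9]. apply Rdiv_le_0_compat; lra. }
    assert (S12 : 2 * PI - kap * (2 * PI * d) <= 2 * PI * A + kap * (2 * (2 * PI * (e1 + K * d)))) by lra.
    apply Rmult_le_reg_l with (2 * PI); [lra|]. lra. }
  destruct (Hpm (eps / (2 * (B + 1)))) as [r0 [Hr0 Hr02]]; [apply Rdiv_lt_0_compat; lra|].
  exists r0. split; [exact Hr0|]. intros r Hr. specialize (Hr02 r Hr). specialize (G3 r ltac:(lra)).
  rewrite defect_eq by (auto; lra).
  assert (B * RInt (fun t => 1 - nrm2 phi r t) 0 (2 * PI) <= eps / 2).
  { apply Rle_trans with ((B + 1) * (eps / (2 * (B + 1)))); [|right; field; lra].
    assert (0 <= RInt (fun t => 1 - nrm2 phi r t) 0 (2 * PI)) by (apply defect_ge0; [exact Hp|intros; left; auto|lra]).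
    apply Rmult_le_compat; lra. }
  assert (2 * PI * (2 * kap * e1) < eps / 2).
  { replace (eps / 2) with (2 * PI * ((2 * kap + 1) * e1)) by (unfold e1; field; lra).
    apply Rmult_lt_compat_l; [lra|]. nra. }
  nra.
Qed.

(** * Bounded convergence outside a null set *)

Lemma cont_max_R (f g : R -> R) t : continuous f t -> continuous g t -> continuous (fun s => Rmax (f s) (g s)) t.
Proof.
  intros Hf Hg. apply continuous_ext with (fun s => / 2 * (f s + g s + Rabs (f s - g s))).
  - intros s. unfold Rmax, Rabs. destruct (Rle_dec (f s) (g s)), (Rcase_abs (f s - g s)); lra.
  - apply cont_mult_R; [apply cont_const_R|]. apply cont_plus_R; [apply cont_plus_R; assumption|].
    apply (continuous_comp (fun s => f s - g s) Rabs); [apply cont_minus_R; assumption|apply continuous_Rabs].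
Qed.

Lemma cont_min_R (f g : R -> R) t : continuous f t -> continuous g t -> continuous (fun s => Rmin (f s) (g s)) t.
Proof.
  intros Hf Hg. apply continuous_ext with (fun s => / 2 * (f s + g s - Rabs (f s - g s))).
  - intros s. unfold Rmin, Rabs. destruct (Rle_dec (f s) (g s)), (Rcase_abs (f s - g s)); lra.
  - apply cont_mult_R; [apply cont_const_R|]. apply cont_minus_R; [apply cont_plus_R; assumption|].
    apply (continuous_comp (fun s => f s - g s) Rabs); [apply cont_minus_R; assumption|apply continuous_Rabs].
Qed.

Lemma RInt_sum (u : nat -> R -> R) a b K : (forall i, ex_RInt (u i) a b) ->
  ex_RInt (fun t => sum_f_R0 (fun i => u i t) K) a b /\
  RInt (fun t => sum_f_R0 (fun i => u i t) K) a b = sum_f_R0 (fun i => RInt (u i) a b) K.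
Proof.
  intros H. induction K as [|K [IH1 IH2]]; [split; [apply H|reflexivity]|]. split.
  - apply (ex_RInt_plus_R (fun t => sum_f_R0 (fun i => u i t) K)); [exact IH1|apply H].
  - simpl. rewrite (RInt_plus_R (fun t => sum_f_R0 (fun i => u i t) K)) by (assumption || apply H).
    rewrite IH2. reflexivity.
Qed.

Lemma sum_nonneg (u : nat -> R) K : (forall i, (i <= K)%nat -> 0 <= u i) -> 0 <= sum_f_R0 u K.
Proof.
  intros H. induction K as [|K IH]; simpl; [apply H; lia|].
  specialize (IH ltac:(intros; apply H; lia)). specialize (H (S K) (le_n _)). lra.
Qed.

Lemma geom_sum_lt e K : 0 < e -> sum_f_R0 (fun i => e * (/ 2) ^ i) K < 2 * e.
Proof.
  intros He. assert (E : sum_f_R0 (fun i => e * (/ 2) ^ i) K = e * (2 - (/ 2) ^ K)).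
  { induction K as [|K IH]; simpl in *; [ring|]. rewrite IH. field. }
  rewrite E. assert (0 < (/ 2) ^ K) by (apply pow_lt; lra). nra.
Qed.

Definition ind (c d t : R) : R := if Rlt_dec c t then (if Rlt_dec t d then 1 else 0) else 0.

Lemma ind_int c d T : 0 < T -> c <= d -> ex_RInt (ind c d) 0 T /\ RInt (ind c d) 0 T <= d - c.
Proof.
  intros HT Hcd. set (c' := Rmax 0 (Rmin c T)). set (d' := Rmax 0 (Rmin d T)).
  assert (Hc : 0 <= c' /\ c' <= d' /\ d' <= T /\ d' - c' <= d - c).
  { unfold c', d', Rmax, Rmin. destruct (Rle_dec c T), (Rle_dec d T); repeat destruct (Rle_dec _ _); lra. }
  assert (E1 : forall t, Rmin 0 c' < t < Rmax 0 c' -> 0 = ind c d t).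
  { intros t. rewrite Rmin_left, Rmax_right by lra. intros Ht. unfold ind. destruct (Rlt_dec c t) as [h|]; [|reflexivity].
    exfalso. unfold c', Rmax, Rmin in Ht. destruct (Rle_dec c T); repeat destruct (Rle_dec _ _); lra. }
  assert (E2 : forall t, Rmin c' d' < t < Rmax c' d' -> 1 = ind c d t).
  { intros t. rewrite Rmin_left, Rmax_right by lra. intros Ht. unfold ind.
    assert (c < t < d).
    { unfold c', d', Rmax, Rmin in Ht. destruct (Rle_dec c T), (Rle_dec d T); repeat destruct (Rle_dec _ _); lra. }
    destruct (Rlt_dec c t); [|lra]. destruct (Rlt_dec t d); [reflexivity|lra]. }
  assert (E3 : forall t, Rmin d' T < t < Rmax d' T -> 0 = ind c d t).
  { intros t. rewrite Rmin_left, Rmax_right by lra. intros Ht. unfold ind. destruct (Rlt_dec c t) as [h|]; [|reflexivity].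
    destruct (Rlt_dec t d); [|reflexivity].
    exfalso. unfold d', Rmax, Rmin in Ht. destruct (Rle_dec d T); repeat destruct (Rle_dec _ _); lra. }
  assert (X1 : ex_RInt (ind c d) 0 c') by (apply (ex_RInt_ext (V := R_NormedModule) (fun _ => 0)); [exact E1|apply ex_RInt_const]).
  assert (X2 : ex_RInt (ind c d) c' d') by (apply (ex_RInt_ext (V := R_NormedModule) (fun _ => 1)); [exact E2|apply ex_RInt_const]).
  assert (X3 : ex_RInt (ind c d) d' T) by (apply (ex_RInt_ext (V := R_NormedModule) (fun _ => 0)); [exact E3|apply ex_RInt_const]).
  assert (X12 : ex_RInt (ind c d) 0 d') by (apply (ex_RInt_Chasles (V := R_NormedModule)) with c'; assumption).
  split; [apply (ex_RInt_Chasles (V := R_NormedModule)) with d'; assumption|].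
  rewrite <- (RInt_Chasles_R (ind c d) 0 d' T), <- (RInt_Chasles_R (ind c d) 0 c' d') by assumption.
  rewrite <- (RInt_ext_R _ _ 0 c' E1), <- (RInt_ext_R _ _ c' d' E2), <- (RInt_ext_R _ _ d' T E3), !RInt_const_R. lra.
Qed.

Section BoundedConvergence.
Variables (g : nat -> R -> R) (N : R -> Prop) (T eps : R).
Hypothesis HT : 0 < T.
Hypothesis Heps : 0 < eps.
Hypothesis Hcont : forall j t, continuous (g j) t.
Hypothesis Hb : forall j t, 0 <= g j t <= 1.
Hypothesis HN : null_set N.
Hypothesis Hconv : forall t, 0 <= t <= T -> ~ N t -> is_lim_seq (fun j => g j t) 0.
Hypothesis Hlow : forall j, eps <= RInt (g j) 0 T.

(** A continuous stand-in for the supremum of all g j with j >= k, which need not be Riemann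
    integrable. *)
Fixpoint gmax (k m : nat) (t : R) : R :=
  match m with O => g k t | S m => Rmax (gmax k m t) (g (k + S m)%nat t) end.

Lemma gmax_cont k m t : continuous (gmax k m) t.
Proof. induction m; [apply Hcont|]. apply cont_max_R; [exact IHm|apply Hcont]. Qed.

Lemma gmax_ex k m : ex_RInt (gmax k m) 0 T.
Proof. apply ex_RInt_cont. apply gmax_cont. Qed.

Lemma gmax_ge k m j t : (k <= j <= k + m)%nat -> g j t <= gmax k m t.
Proof.
  induction m; intros Hj; simpl.
  - replace j with k by lia. lra.
  - destruct (Nat.eq_dec j (k + S m)) as [->|Hn]; [apply Rmax_r|]. eapply Rle_trans; [apply IHm; lia|apply Rmax_l].
Qed.

Lemma gmax_le k m t y : (forall j, (k <= j <= k + m)%nat -> g j t <= y) -> gmax k m t <= y.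
Proof.
  induction m; intros H; simpl; [apply H; lia|]. apply Rmax_lub; [apply IHm; intros; apply H; lia|apply H; lia].
Qed.

Lemma gmax_sub k m k' m' t : (k' <= k)%nat -> (k + m <= k' + m')%nat -> gmax k m t <= gmax k' m' t.
Proof. intros. apply gmax_le. intros j Hj. apply gmax_ge. lia. Qed.

(** The integrals increase with m and stay below T, so some finite maximum nearly exhausts all later
    ones. *)
Lemma gmax_near_sup k d : 0 < d -> exists m, forall m', RInt (gmax k m') 0 T <= RInt (gmax k m) 0 T + d.
Proof.
  intros Hd.
  assert (Hi : forall m, RInt (gmax k m) 0 T <= RInt (gmax k (S m)) 0 T).
  { intros m. apply RInt_le; [lra|apply gmax_ex|apply gmax_ex|]. intros t _. apply gmax_sub; lia. }
  destruct (ex_finite_lim_seq_incr (fun m => RInt (gmax k m) 0 T) T Hi) as [L HL].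
  { intros m. replace T with (RInt (fun _ => 1) 0 T) at 2 by (rewrite RInt_const_R; lra).
    apply RInt_le; [lra|apply gmax_ex|apply ex_RInt_const|]. intros t _. apply gmax_le. intros; apply Hb. }
  destruct (proj2 (is_lim_seq_spec _ _) HL (mkposreal d Hd)) as [m Hm]. exists m. intros m'.
  specialize (Hm m (le_n m)). simpl in Hm. apply Rabs_lt_between in Hm.
  pose proof (is_lim_seq_incr_compare _ _ HL Hi m'). simpl in H. lra.
Qed.

(** The functions [f k] nearly exhaust the suprema of the tails, with losses that sum to less than
    eps / 4. Hence their running minima [H K], a decreasing sequence of continuous functions, keep
    integral at least eps / 2. But [H K] tends to 0 off N, and a Dini argument makes some [H K]
    small outside finitely many short intervals, so that its integral is below eps / 4. *)
Lemma bounded_convergence_absurd : False.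
Proof.
  destruct (functional_choice (fun k m => forall m', RInt (gmax k m') 0 T <= RInt (gmax k m) 0 T + eps / 8 * (/ 2) ^ k)) as [mm Hmm].
  { intros k. apply gmax_near_sup. apply Rmult_lt_0_compat; [lra|apply pow_lt; lra]. }
  set (f := fun k => gmax k (mm k)).
  set (H := fix H (k : nat) (t : R) : R := match k with O => f O t | S k => Rmin (H k t) (f (S k) t) end).
  assert (Hc : forall k t, continuous (H k) t).
  { induction k; intros t; [apply gmax_cont|]. apply cont_min_R; [apply IHk|apply gmax_cont]. }
  assert (Hle : forall k t, H k t <= f k t) by (destruct k; intros t; [simpl; lra|apply Rmin_r]).
  assert (Hdec : forall j k t, H (j + k)%nat t <= H j t).
  { intros j k t. induction k; [rewrite Nat.add_0_r; lra|]. rewrite Nat.add_succ_r. eapply Rle_trans; [apply Rmin_l|exact IHk]. }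
  assert (HJ : forall K, exists J, forall i, (i <= K)%nat -> (i + mm i <= J)%nat).
  { induction K as [|K [J HJ]]; [exists (mm 0%nat); intros i Hi; replace i with 0%nat by lia; lia|].
    exists (J + (S K + mm (S K)))%nat. intros i Hi. destruct (Nat.eq_dec i (S K)) as [->|Hn]; [lia|]. specialize (HJ i ltac:(lia)). lia. }
  assert (Hint : forall K, eps / 2 <= RInt (H K) 0 T).
  { intros K. destruct (HJ K) as [J HJK].
    (* [u i] is what [f i] misses of the maximum up to the common index J. All these maxima dominate
       [f K], so taking the minimum costs at most the sum of the misses. *)
    set (u := fun i t => gmax i (J - i) t - f i t).
    assert (Hu0 : forall i t, (i <= K)%nat -> 0 <= u i t).
    { intros i t Hi. unfold u, f. specialize (HJK i Hi). pose proof (gmax_sub i (mm i) i (J - i) t ltac:(lia) ltac:(lia)). lra. }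
    assert (P : forall t L h, (L <= K)%nat -> (forall i, (i <= L)%nat -> h <= gmax i (J - i) t) ->
      h - sum_f_R0 (fun i => u i t) L <= H L t).
    { intros t. induction L as [|L IH]; intros h HL Hh.
      - simpl. specialize (Hh 0%nat ltac:(lia)). unfold u. lra.
      - simpl sum_f_R0. change (H (S L) t) with (Rmin (H L t) (f (S L) t)).
        specialize (IH h ltac:(lia) ltac:(intros; apply Hh; lia)).
        pose proof (Hu0 (S L) t HL). pose proof (Hh (S L) (le_n _)).
        assert (0 <= sum_f_R0 (fun i => u i t) L).
        { apply sum_nonneg. intros i Hi. apply Hu0. lia. }
        apply Rmin_glb; [lra|]. unfold u in *. lra. }
    assert (Xu : forall i, ex_RInt (u i) 0 T) by (intros i; apply ex_RInt_minus_R; apply gmax_ex).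
    destruct (RInt_sum u 0 T K Xu) as [X1 X2].
    assert (Q1 : RInt (fun t => f K t - sum_f_R0 (fun i => u i t) K) 0 T <= RInt (H K) 0 T).
    { apply RInt_le; [lra|apply ex_RInt_minus_R; [apply gmax_ex|exact X1]|apply ex_RInt_cont, Hc|].
      intros t _. apply P; [lia|]. intros i Hi. apply gmax_sub; [lia|]. specialize (HJK K ltac:(lia)). lia. }
    rewrite RInt_minus_R in Q1; [|apply gmax_ex|exact X1]. rewrite X2 in Q1.
    assert (Q2 : sum_f_R0 (fun i => RInt (u i) 0 T) K <= sum_f_R0 (fun i => eps / 8 * (/ 2) ^ i) K).
    { apply sum_Rle. intros i Hi. unfold u. rewrite RInt_minus_R by apply gmax_ex. specialize (Hmm i (J - i)%nat). unfold f. lra. }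
    pose proof (geom_sum_lt (eps / 8) K ltac:(lra)).
    assert (Q3 : eps <= RInt (f K) 0 T).
    { eapply Rle_trans; [apply (Hlow K)|]. apply RInt_le; [lra|apply ex_RInt_cont, Hcont|apply gmax_ex|].
      intros t _. apply gmax_ge. lia. }
    lra. }
  destruct (HN (eps / 16)) as [a [b [Hab [Hcov Hsum]]]]; [lra|].
  (* The closed covering intervals are widened to open ones at a total cost below 4 e = eps / 16;
     openness is what the compactness argument uses. *)
  set (e := eps / 64). set (c := fun k => a k - e * (/ 2) ^ k). set (d := fun k => b k + e * (/ 2) ^ k).
  assert (He : 0 < e) by (unfold e; lra).
  assert (Hpw : forall k, 0 < e * (/ 2) ^ k) by (intros; apply Rmult_lt_0_compat; [lra|apply pow_lt; lra]).
  set (eta := eps / (8 * T)). assert (Heta : 0 < eta) by (apply Rdiv_lt_0_compat; lra).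
  (* Otherwise there are points x K outside the first K intervals with [H K] at least eta there. By
     monotonicity a cluster point has H j >= eta for all j: off N this contradicts convergence, and
     inside N an open interval would already have captured some of the x K. *)
  assert (HK : exists K, forall t, 0 <= t <= T -> H K t < eta \/ exists i, (i <= K)%nat /\ c i < t < d i).
  { apply NNPP. intros Hn.
    assert (Hx : forall K, exists x, 0 <= x <= T /\ eta <= H K x /\ forall i, (i <= K)%nat -> ~ (c i < x < d i)).
    { intros K. apply NNPP. intros Hn2. apply Hn. exists K. intros t Ht.
      destruct (Rlt_dec (H K t) eta) as [h|h]; [left; exact h|right].
      apply NNPP. intros Hn3. apply Hn2. exists t. split; [exact Ht|]. split; [lra|].
      intros i Hi Hc1. apply Hn3. exists i. split; assumption. }
    destruct (functional_choice _ Hx) as [x Hxx].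
    destruct (bolzano_weierstrass_R x 0 T) as [s [l [Hs Hl]]]; [intros; apply Hxx|].
    assert (Hl0 : 0 <= l <= T).
    { split.
      - apply (is_lim_seq_le (fun _ => 0) (fun n => x (s n)) 0 l); [intros; apply Hxx|apply is_lim_seq_const|exact Hl].
      - apply (is_lim_seq_le (fun n => x (s n)) (fun _ => T) l T); [intros; apply Hxx|exact Hl|apply is_lim_seq_const]. }
    assert (HHl : forall j, eta <= H j l).
    { intros j.
      assert (L1 : is_lim_seq (fun n => H j (x (s (n + j)%nat))) (H j l)).
      { apply (is_lim_seq_continuous (H j) (fun n => x (s (n + j)%nat)) l); [apply continuity_pt_filterlim, Hc|].
        apply (is_lim_seq_incr_n (fun n => x (s n)) j), Hl. }
      apply (is_lim_seq_le (fun _ => eta) (fun n => H j (x (s (n + j)%nat))) eta (H j l)); [|apply is_lim_seq_const|exact L1].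
      intros n. destruct (Hxx (s (n + j)%nat)) as [_ [h _]]. specialize (Hs (n + j)%nat).
      replace (s (n + j)%nat) with (j + (s (n + j)%nat - j))%nat in h at 1 by lia.
      eapply Rle_trans; [exact h|apply Hdec]. }
    destruct (classic (N l)) as [Nl|Nl].
    - destruct (Hcov l Nl) as [i Hi]. specialize (Hpw i).
      assert (Ho : c i < l < d i) by (unfold c, d; lra).
      assert (Hr : 0 < Rmin (l - c i) (d i - l)) by (apply Rmin_pos; lra).
      destruct (proj2 (is_lim_seq_spec _ _) Hl (mkposreal _ Hr)) as [n0 Hn0].
      specialize (Hn0 (n0 + i)%nat ltac:(lia)). simpl in Hn0. apply Rabs_lt_between in Hn0.
      pose proof (Rmin_l (l - c i) (d i - l)). pose proof (Rmin_r (l - c i) (d i - l)).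
      destruct (Hxx (s (n0 + i)%nat)) as [_ [_ h]]. apply (h i); [specialize (Hs (n0 + i)%nat); lia|lra].
    - pose proof (Hconv l Hl0 Nl) as L1.
      destruct (proj2 (is_lim_seq_spec _ _) L1 (mkposreal (eta / 2) ltac:(lra))) as [n0 Hn0].
      specialize (HHl n0). pose proof (Hle n0 l).
      assert (f n0 l <= eta / 2).
      { apply gmax_le. intros j Hj. specialize (Hn0 j ltac:(lia)). simpl in Hn0. apply Rabs_lt_between in Hn0. lra. }
      lra. }
  destruct HK as [K HK].
  assert (Hcd : forall i, c i <= d i) by (intros i; specialize (Hpw i); specialize (Hab i); unfold c, d; lra).
  destruct (RInt_sum (fun i => ind (c i) (d i)) 0 T K) as [X1 X2]; [intros i; apply ind_int; auto|].
  assert (Q : RInt (H K) 0 T <= RInt (fun t => eta + sum_f_R0 (fun i => ind (c i) (d i) t) K) 0 T).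
  { apply RInt_le; [lra|apply ex_RInt_cont, Hc|apply ex_RInt_plus_R; [apply ex_RInt_const|exact X1]|].
    intros t Ht.
    assert (Hi0 : forall i, 0 <= ind (c i) (d i) t) by (intros i; unfold ind; destruct (Rlt_dec _ _); [destruct (Rlt_dec _ _)|]; lra).
    assert (Hs0 : forall M, 0 <= sum_f_R0 (fun i => ind (c i) (d i) t) M) by (intros; apply cond_pos_sum; exact Hi0).
    destruct (HK t ltac:(lra)) as [h|[i [Hi1 Hi2]]]; [specialize (Hs0 K); lra|].
    assert (1 <= sum_f_R0 (fun i => ind (c i) (d i) t) K).
    { clear - Hi0 Hs0 Hi1 Hi2. induction K as [|K IH].
      - replace i with 0%nat in Hi2 by lia. simpl. unfold ind. destruct (Rlt_dec _ _); [destruct (Rlt_dec _ _)|]; lra.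
      - simpl. destruct (Nat.eq_dec i (S K)) as [->|Hn].
        + specialize (Hs0 K). unfold ind at 2. destruct (Rlt_dec _ _); [destruct (Rlt_dec _ _)|]; lra.
        + specialize (IH ltac:(lia)). specialize (Hi0 (S K)). lra. }
    assert (H K t <= 1) by (eapply Rle_trans; [apply Hle|]; apply gmax_le; intros; apply Hb). lra. }
  rewrite RInt_plus_R in Q; [|apply ex_RInt_const|exact X1]. rewrite RInt_const_R, X2 in Q.
  assert (Q2 : sum_f_R0 (fun i => RInt (ind (c i) (d i)) 0 T) K <= sum_f_R0 (fun i => (b i - a i) + 2 * e * (/ 2) ^ i) K).
  { apply sum_Rle. intros i _. destruct (ind_int (c i) (d i) T HT (Hcd i)) as [_ h]. unfold c, d in *. lra. }
  rewrite sum_plus in Q2. pose proof (Hsum K). pose proof (geom_sum_lt (2 * e) K ltac:(lra)).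
  specialize (Hint K).
  assert ((T - 0) * eta = eps / 8) by (unfold eta; field; lra). unfold e in *. lra.
Qed.
End BoundedConvergence.

(** Moduli tending to 1 are enough. A failure yields radii tending to 1 with defect at least eps,
    which bounded convergence excludes. *)
Lemma inner_mean_of_ae f N : hol 1 f -> (forall z, Cmod z < 1 -> Cmod (f z) <= 1) -> null_set N ->
  (forall t, 0 <= t <= 2 * PI -> ~ N t -> forall eps, 0 < eps -> exists delta, 0 < delta /\
    forall r, 1 - delta < r < 1 -> 1 - eps < Cmod (f (polar r t))) -> inner_mean f.
Proof.
  intros Hf Hb HN Hae. split; [exact Hf|]. split; [exact Hb|]. intros eps He. apply NNPP. intros Hn.
  pose proof PI_RGT_0 as HPI.
  assert (Hr : forall j : nat, exists r, 1 - / (INR j + 1) < r < 1 /\ 0 <= r /\ eps <= RInt (fun t => 1 - nrm2 f r t) 0 (2 * PI)).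
  { intros j. pose proof (pos_INR j). assert (0 < / (INR j + 1)) by (apply Rinv_0_lt_compat; lra).
    assert (/ (INR j + 1) <= 1) by (rewrite <- Rinv_1; apply Rinv_le_contravar; lra).
    apply NNPP. intros Hn2. apply Hn. exists (1 - / (INR j + 1)). split; [lra|].
    intros r Hr. apply Rnot_le_lt. intros Hle. apply Hn2. exists r. split; [lra|]. split; [lra|exact Hle]. }
  destruct (functional_choice _ Hr) as [rr Hrr].
  apply (bounded_convergence_absurd (fun j t => 1 - nrm2 f (rr j) t) N (2 * PI) eps).
  - lra.
  - exact He.
  - intros j t. destruct (Hrr j) as [H1 [H2 _]]. apply cont_minus_R; [apply cont_const_R|apply nrm2_cont; [exact Hf|lra]].
  - intros j t. destruct (Hrr j) as [H1 [H2 _]]. pose proof (nrm2_pos f (rr j) t). unfold nrm2 in *.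
    specialize (Hb (polar (rr j) t) ltac:(rewrite Cmod_polar; lra)). pose proof (Cmod_ge_0 (f (polar (rr j) t))). nra.
  - exact HN.
  - intros t Ht Nt. apply is_lim_seq_spec. intros e.
    destruct (Hae t Ht Nt (e / 2) ltac:(pose proof (cond_pos e); lra)) as [d [Hd Hd2]].
    destruct (archimed_cor1 d Hd) as [n0 [Hn0 Hn1]]. exists n0. intros n Hnn.
    destruct (Hrr n) as [H1 [H2 _]].
    assert (/ (INR n + 1) < d).
    { eapply Rlt_trans; [|exact Hn0]. apply le_INR in Hnn. assert (0 < INR n0) by (apply lt_0_INR; exact Hn1).
      apply Rinv_lt_contravar; [apply Rmult_lt_0_compat|]; lra. }
    specialize (Hd2 (rr n) ltac:(lra)). specialize (Hb (polar (rr n) t) ltac:(rewrite Cmod_polar; lra)).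
    rewrite Rminus_0_r. unfold nrm2. pose proof (Cmod_ge_0 (f (polar (rr n) t))).
    apply Rabs_def1; [|nra].
    replace (1 - Cmod (f (polar (rr n) t)) * Cmod (f (polar (rr n) t)))
      with ((1 - Cmod (f (polar (rr n) t))) * (1 + Cmod (f (polar (rr n) t)))) by ring. nra.
  - intros j. apply Hrr.
Qed.

Lemma inner_mean_of_inner f : inner f -> inner_mean f.
Proof.
  intros [Hf [Hb [N [HN Hae]]]]. apply (inner_mean_of_ae f N); [apply hol_on_disk, Hf|exact Hb|exact HN|].
  intros t _ Nt eps He. destruct (Hae t Nt) as [L [HL Hrad]]. destruct (Hrad eps He) as [d [Hd Hd2]].
  exists d. split; [exact Hd|]. intros r Hr. specialize (Hd2 r Hr).
  pose proof (Cmod_minus_ge L (f (polar r t))) as H. rewrite Cmod_minus_sym in H. lra.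
Qed.

(** * Stability of the mean condition and the case of the limit map *)

Lemma defect_ex f r : hol 1 f -> 0 <= r < 1 -> ex_RInt (fun t => 1 - nrm2 f r t) 0 (2 * PI).
Proof.
  intros Hf Hr. apply ex_RInt_cont. intros t. apply cont_minus_R; [apply cont_const_R|apply nrm2_cont; assumption].
Qed.

Lemma inner_mean_dom f g K : hol 1 g -> inner_mean f -> 0 < K ->
  (forall z, Cmod z < 1 -> Cmod (g z) <= 1) ->
  (forall z, Cmod z < 1 -> 1 - Cmod (g z) * Cmod (g z) <= K * (1 - Cmod (f z) * Cmod (f z))) -> inner_mean g.
Proof.
  intros Hg [Hf [Hfb Hfm]] HK Hgb Hd. split; [exact Hg|]. split; [exact Hgb|].
  pose proof PI_RGT_0 as HPI.
  intros eps He. destruct (Hfm (eps / K)) as [r0 [Hr0 Hr]]; [apply Rdiv_lt_0_compat; lra|].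
  exists r0. split; [exact Hr0|]. intros r Hrr. specialize (Hr r Hrr).
  apply Rle_lt_trans with (RInt (fun t => K * (1 - nrm2 f r t)) 0 (2 * PI)).
  - apply RInt_le; [lra|apply defect_ex; [exact Hg|lra]|apply ex_RInt_scal_R, defect_ex; [exact Hf|lra]|].
    intros t _. apply Hd. rewrite Cmod_polar; lra.
  - rewrite RInt_scal_R by (apply defect_ex; [exact Hf|lra]).
    apply Rlt_le_trans with (K * (eps / K)); [apply Rmult_lt_compat_l; lra|right; field; lra].
Qed.

Lemma inner_mean_id : inner_mean (fun z => z).
Proof.
  split; [apply hol_id|]. split; [intros; lra|]. intros eps He. pose proof PI_RGT_0 as HPI.
  exists (Rmax 0 (1 - eps / (8 * PI))).
  assert (0 < eps / (8 * PI)) by (apply Rdiv_lt_0_compat; lra).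
  split; [split; [apply Rmax_l|apply Rmax_lub_lt; lra]|]. intros r Hr.
  pose proof (Rmax_l 0 (1 - eps / (8 * PI))). pose proof (Rmax_r 0 (1 - eps / (8 * PI))).
  rewrite (RInt_ext_R _ (fun _ => 1 - r * r)) by (intros t _; unfold nrm2; rewrite Cmod_polar by lra; reflexivity).
  rewrite RInt_const_R.
  assert (1 - r < eps / (8 * PI)) by lra.
  assert (1 - r * r <= 2 * (1 - r)) by nra.
  apply Rle_lt_trans with (2 * PI * (2 * (1 - r))); [rewrite Rminus_0_r; apply Rmult_le_compat_l; lra|].
  apply Rlt_le_trans with (2 * PI * (2 * (eps / (8 * PI)))); [apply Rmult_lt_compat_l; lra|].
  replace (2 * PI * (2 * (eps / (8 * PI)))) with (eps / 2) by (field; lra). lra.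
Qed.

Lemma inner_mean_ext f g : (forall z, Cmod z < 1 -> f z = g z) -> inner_mean f -> inner_mean g.
Proof.
  intros E Hf. apply (inner_mean_dom f g 1); [apply (hol_ext 1 f g E), Hf|exact Hf|lra| |];
  intros z Hz; rewrite <- E by exact Hz; [apply Hf, Hz|lra].
Qed.

Lemma inner_mean_mob f a k : inner_mean f -> Cmod a < 1 -> Cmod k = 1 -> (forall z, Cmod z < 1 -> Cmod (f z) < 1) ->
  inner_mean (fun z => k * mob a (f z))%C.
Proof.
  intros Hf Ha Hk Hs. pose proof (Cmod_ge_0 a).
  assert (Hm : forall z, Cmod (k * mob a (f z)) = Cmod (mob a (f z))) by (intros; rewrite Cmod_mult, Hk; ring).
  apply (inner_mean_dom f _ (/ ((1 - Cmod a) * (1 - Cmod a)))).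
  - apply hol_mult; [apply hol_const|]. apply (hol_comp 1 1 (mob a)); [apply hol_mob, Ha|apply Hf|exact Hs].
  - exact Hf.
  - apply Rinv_0_lt_compat. nra.
  - intros z Hz. rewrite Hm. apply mob_le1; [exact Ha|left; apply Hs, Hz].
  - intros z Hz. rewrite Hm. specialize (Hs z Hz). rewrite mob_Cmod by lra.
    set (w := f z) in *. pose proof (Cmod_ge_0 w).
    assert (Hd : 1 - Cmod a <= Cmod (1 - Cconj a * w)).
    { eapply Rle_trans; [|apply Cmod_minus_ge]. rewrite Cmod_1, Cmod_mult, Cmod_conj. nra. }
    unfold Rdiv. rewrite Rmult_comm. apply Rmult_le_compat.
    + left. apply Rinv_0_lt_compat. nra.
    + apply Rmult_le_pos; nra.
    + apply Rinv_le_contravar; nra.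
    + rewrite <- (Rmult_1_l (1 - Cmod w * Cmod w)) at 2. apply Rmult_le_compat_r; nra.
Qed.

Section SigmaInner.
Variables (phi : C -> C) (z0 : C) (l : R).
Hypothesis Hphi : hol 1 phi.
Hypothesis Hself : forall z, Cmod z < 1 -> Cmod (phi z) < 1.
Hypothesis Hz0 : Cmod z0 < 1.
Hypothesis Hl : 0 < l.
Hypothesis Hlim : is_lim_seq (fun n => rho (iterate phi n z0) (iterate phi (S n) z0)) l.
Hypothesis Hin : inner_mean phi.

Lemma inner_mean_iterate n : inner_mean (iterate phi n).
Proof.
  induction n as [|n IH]; [apply inner_mean_id|].
  apply inner_mean_ext with (fun z => iterate phi n (phi z)); [intros; apply iterate_phi|].
  apply inner_mean_comp; assumption.
Qed.

Lemma inner_mean_sg n : inner_mean (sg phi z0 n).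
Proof.
  apply (inner_mean_mob (iterate phi n)); [apply inner_mean_iterate|apply orb_disk; assumption|
    apply (kap_mod phi z0 l); assumption|intros; apply iterate_disk; assumption].
Qed.

(* The quotients [p = sg (n + m) / sg n] are bounded by 1 and close to 1 at the origin, hence close to 1 in mean. *)
Lemma inner_mean_sigma : inner_mean (sigma phi z0).
Proof.
  assert (Hsd := sigma_disk phi z0 l Hphi Hself Hz0 Hl Hlim). pose proof PI_RGT_0 as HPI.
  assert (Hsig := hol_sigma phi z0 l Hphi Hself Hz0 Hl Hlim).
  split; [exact Hsig|]. split; [intros z Hz; left; apply Hsd, Hz|].
  intros eps He. set (d := eps / (24 * PI)). assert (Hd : 0 < d) by (apply Rdiv_lt_0_compat; lra).
  set (C0 := stp_const phi z0 l (Cmod (sg phi z0 0 0))).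
  assert (H00 : Cmod 0 < 1) by (rewrite Cmod_0; lra).
  assert (HC0 : 0 < C0).
  { apply stp_const_pos; try assumption. split; [apply Cmod_ge_0|]. apply (sg_disk phi z0 l); assumption. }
  assert (Hsl : is_lim_seq (fun n => stp phi z0 n - l) 0).
  { replace 0 with (l - l) by ring. apply is_lim_seq_minus'; [apply stp_lim; assumption|apply is_lim_seq_const]. }
  destruct (proj2 (is_lim_seq_spec _ _) Hsl (mkposreal (eps * d / (32 * PI * C0))
    ltac:(apply Rdiv_lt_0_compat; [nra|]; apply Rmult_lt_0_compat; lra))) as [n Hn].
  specialize (Hn n (le_n n)). simpl in Hn. rewrite Rminus_0_r in Hn. apply Rabs_lt_between in Hn.
  destruct (proj2 (proj2 (inner_mean_sg n)) (eps / 4)) as [r0 [Hr0 Hr02]]; [lra|].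
  exists r0. split; [exact Hr0|]. intros r Hr. specialize (Hr02 r Hr). assert (Hr' : 0 <= r < 1) by lra.
  (* [m], and with it [p], depends on the radius r, but [1 - fst (p 0)] is bounded in terms of n
     alone; so n and r0 can be fixed first. *)
  destruct (sg_uniform phi z0 l Hphi Hself Hz0 Hl Hlim r d ltac:(lra) Hd) as [m Hm].
  specialize (Hm (n + m)%nat ltac:(lia)).
  destruct (sg_product phi z0 l Hphi Hself Hz0 Hl Hlim n m) as [p [Hp [Hp1 [Hp2 Hp3]]]]. fold C0 in Hp3.
  assert (Hsn : hol 1 (sg phi z0 n)) by apply inner_mean_sg.
  assert (X1 := defect_ex (sg phi z0 n) r Hsn Hr').
  assert (X2 : ex_RInt (fun t => 1 - fst (p (polar r t))) 0 (2 * PI)).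
  { apply ex_RInt_cont. intros t. apply cont_minus_R; [apply cont_const_R|].
    apply (pcont_fst (fun t => p (polar r t))). apply circle_pcont; assumption. }
  apply Rle_lt_trans with (RInt (fun t => ((1 - nrm2 (sg phi z0 n) r t) + 3 * d) + 2 / d * (1 - fst (p (polar r t)))) 0 (2 * PI)).
  - apply RInt_le; [lra|apply defect_ex; assumption|
      apply ex_RInt_plus_R; [apply ex_RInt_plus_R; [exact X1|apply ex_RInt_const]|apply ex_RInt_scal_R, X2]|].
    intros t _. unfold nrm2. set (z := polar r t). assert (Hzr : Cmod z = r) by (apply Cmod_polar; lra).
    assert (Hz : Cmod z < 1) by lra. specialize (Hm z ltac:(lra)). specialize (Hp1 z Hz). specialize (Hp2 z Hz).
    specialize (Hsd z Hz). assert (Hsg := sg_disk phi z0 l Hphi Hself Hz0 Hl Hlim n z Hz).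
    set (A := Cmod (sg phi z0 n z)) in *. set (B := Cmod (sigma phi z0 z)) in *.
    assert (HA : 0 <= A) by apply Cmod_ge_0. assert (HB : 0 <= B) by apply Cmod_ge_0.
    assert (T1 : A - B <= Cmod (1 - p z) + d).
    { eapply Rle_trans; [apply Cmod_minus_ge|].
      replace (sg phi z0 n z - sigma phi z0 z)%C with (sg phi z0 n z * (1 - p z) + (sg phi z0 (n + m) z - sigma phi z0 z))%C by (rewrite Hp2; ring).
      eapply Rle_trans; [apply Cmod_triangle|]. rewrite Cmod_mult. fold A. pose proof (Cmod_ge_0 (1 - p z)). nra. }
    (* As |p| <= 1, the square of |1 - p| is dominated by the harmonic function 2 (1 - Re p), whose
       mean is its value at 0. [T3] removes the square with the arithmetic-geometric mean
       inequality. *)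
    assert (T2 : Cmod (1 - p z) * Cmod (1 - p z) <= 2 * (1 - fst (p z))).
    { pose proof (Cmod_sqr (p z)) as Q. rewrite Cmod_sqr. pose proof (Cmod_ge_0 (p z)). simpl. nra. }
    assert (T3 : 2 * Cmod (1 - p z) <= d + 2 / d * (1 - fst (p z))).
    { apply Rmult_le_reg_r with d; [lra|].
      replace ((d + 2 / d * (1 - fst (p z))) * d) with (d * d + 2 * (1 - fst (p z))) by (field; lra).
      set (y := Cmod (1 - p z)) in *. assert (0 <= (y - d) * (y - d)) by apply Rle_0_sqr. nra. }
    assert (A * A - B * B <= 2 * (Cmod (1 - p z) + d)).
    { pose proof (Cmod_ge_0 (1 - p z)). destruct (Rle_dec A B); nra. }
    lra.
  - rewrite RInt_plus_R; [|apply ex_RInt_plus_R; [exact X1|apply ex_RInt_const]|apply ex_RInt_scal_R, X2].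
    rewrite RInt_plus_R; [|exact X1|apply ex_RInt_const]. rewrite RInt_const_R, RInt_scal_R by exact X2.
    assert (E : RInt (fun t => 1 - fst (p (polar r t))) 0 (2 * PI) = 2 * PI * (1 - fst (p 0))).
    { rewrite RInt_minus_R; [|apply ex_RInt_const|].
      - rewrite RInt_const_R, mean_value_re by assumption. lra.
      - apply ex_RInt_cont. intros t. apply (pcont_fst (fun t => p (polar r t))). apply circle_pcont; assumption. }
    rewrite E.
    assert (Hp4 : 1 - fst (p 0) <= C0 * (stp phi z0 n - l)).
    { pose proof (Cmod_ge_fst (1 - p 0)) as Q. change (fst (1 - p 0)%C) with (1 - fst (p 0)) in Q.
      pose proof (Rle_abs (1 - fst (p 0))). pose proof (stp_ge phi z0 l Hphi Hself Hz0 Hlim (n + m)). nra. }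
    assert (2 / d * (2 * PI * (1 - fst (p 0))) < eps / 4).
    { apply Rle_lt_trans with (2 / d * (2 * PI * (C0 * (stp phi z0 n - l)))).
      - apply Rmult_le_compat_l; [left; apply Rdiv_lt_0_compat; lra|]. apply Rmult_le_compat_l; lra.
      - apply Rlt_le_trans with (2 / d * (2 * PI * (C0 * (eps * d / (32 * PI * C0))))).
        + apply Rmult_lt_compat_l; [apply Rdiv_lt_0_compat; lra|]. apply Rmult_lt_compat_l; [lra|]. apply Rmult_lt_compat_l; lra.
        + replace (2 / d * (2 * PI * (C0 * (eps * d / (32 * PI * C0))))) with (eps / 8) by (field; lra). lra. }
    assert ((2 * PI - 0) * (3 * d) = eps / 4) by (unfold d; field; lra). lra.
Qed.
End SigmaInner.

(** * Countable covers *)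

Definition lsum {A : Type} (f : A -> R) (l : list A) : R := fold_right (fun x s => f x + s) 0 l.

Lemma lsum_app {A} (f : A -> R) l l' : lsum f (l ++ l') = lsum f l + lsum f l'.
Proof. induction l; simpl; [ring|]. rewrite IHl. ring. Qed.

Lemma lsum_nonneg {A} (f : A -> R) l : (forall x, 0 <= f x) -> 0 <= lsum f l.
Proof. intros H. induction l; simpl; [lra|]. specialize (H a). lra. Qed.

Lemma lsum_incl {A} (f : A -> R) l : (forall x, 0 <= f x) -> NoDup l -> forall l', incl l l' -> lsum f l <= lsum f l'.
Proof.
  intros Hf. induction 1 as [|x l Hx Hn IH]; intros l' Hi; [simpl; apply lsum_nonneg, Hf|].
  destruct (in_split x l') as [l1 [l2 E]]; [apply Hi; left; reflexivity|]. subst l'.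
  assert (IH' : lsum f l <= lsum f (l1 ++ l2)).
  { apply IH. intros y Hy. assert (Hy2 : In y (l1 ++ x :: l2)) by (apply Hi; right; exact Hy).
    apply in_app_or in Hy2. apply in_or_app. destruct Hy2 as [h|[h|h]]; [left; exact h|subst; contradiction|right; exact h]. }
  rewrite !lsum_app in *. simpl. lra.
Qed.

Lemma lsum_seq (f : nat -> R) K : lsum f (seq 0 (S K)) = sum_f_R0 f K.
Proof.
  induction K; [simpl; ring|]. rewrite seq_S, lsum_app, IHK. simpl. ring.
Qed.

Lemma lsum_map {A B} (f : B -> R) (g : A -> B) l : lsum f (map g l) = lsum (fun x => f (g x)) l.
Proof. induction l; simpl; [reflexivity|]. rewrite IHl. reflexivity. Qed.

Lemma lsum_list_prod {A B} (f : A * B -> R) l l' : lsum f (list_prod l l') = lsum (fun x => lsum (fun y => f (x, y)) l') l.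
Proof. induction l; simpl; [reflexivity|]. rewrite lsum_app, IHl, lsum_map. reflexivity. Qed.

(** The inequality is weak, unlike the one in [null_set], so that bounds simply add up over
    countable unions. *)
Definition covered (E : R -> Prop) (c : R) : Prop :=
  exists a b : nat -> R, (forall k, a k <= b k) /\ (forall t, E t -> exists k, a k <= t <= b k) /\
    forall n, sum_f_R0 (fun k => b k - a k) n <= c.

Lemma null_covered E : null_set E <-> forall eps, 0 < eps -> covered E eps.
Proof.
  split; intros H eps He.
  - destruct (H eps He) as [a [b [H1 [H2 H3]]]]. exists a, b. split; [exact H1|]. split; [exact H2|]. intros n. left. apply H3.
  - destruct (H (eps / 2) ltac:(lra)) as [a [b [H1 [H2 H3]]]]. exists a, b. split; [exact H1|]. split; [exact H2|].
    intros n. specialize (H3 n). lra.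
Qed.

Lemma covered_sub E E' c c' : (forall t, E' t -> E t) -> c <= c' -> covered E c -> covered E' c'.
Proof.
  intros HE Hc [a [b [H1 [H2 H3]]]]. exists a, b. split; [exact H1|]. split; [auto|]. intros n. specialize (H3 n). lra.
Qed.

(** The double family is enumerated by Cantor pairing. An index k codes a pair (i, j) with i + j <=
    k, so a partial sum lies inside a square block, which is summed row by row. *)
Lemma covered_union (E : nat -> R -> Prop) (c : nat -> R) M : (forall i, covered (E i) (c i)) ->
  (forall n, sum_f_R0 c n <= M) -> covered (fun t => exists i, E i t) M.
Proof.
  intros H HM.
  destruct (functional_choice (fun i (ab : (nat -> R) * (nat -> R)) => (forall k, fst ab k <= snd ab k) /\
    (forall t, E i t -> exists k, fst ab k <= t <= snd ab k) /\
    forall n, sum_f_R0 (fun k => snd ab k - fst ab k) n <= c i)) as [ab Hab].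
  { intros i. destruct (H i) as [a [b Q]]. exists (a, b). exact Q. }
  set (len := fun p : nat * nat => snd (ab (fst p)) (snd p) - fst (ab (fst p)) (snd p)).
  assert (Hlen : forall p, 0 <= len p) by (intros [i j]; unfold len; simpl; destruct (Hab i) as [h _]; specialize (h j); lra).
  exists (fun k => fst (ab (fst (Cantor.of_nat k))) (snd (Cantor.of_nat k))), (fun k => snd (ab (fst (Cantor.of_nat k))) (snd (Cantor.of_nat k))).
  split; [|split].
  - intros k. apply Hab.
  - intros t [i Ht]. destruct (Hab i) as [_ [h _]]. destruct (h t Ht) as [j Hj].
    exists (Cantor.to_nat (i, j)). rewrite Cantor.cancel_of_to. exact Hj.
  - intros n. change (sum_f_R0 (fun k => len (Cantor.of_nat k)) n <= M).
    rewrite <- lsum_seq, <- (lsum_map len Cantor.of_nat).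
    apply Rle_trans with (lsum len (list_prod (seq 0 (S n)) (seq 0 (S n)))).
    + apply lsum_incl; [exact Hlen| |].
      * apply NoDup_map_inv with (f := Cantor.to_nat). rewrite map_map.
        rewrite (map_ext _ (fun x => x)) by (intros; apply Cantor.cancel_to_of). rewrite map_id. apply seq_NoDup.
      * intros [i j] Hp. apply in_map_iff in Hp. destruct Hp as [k [Ek Hk]]. apply in_seq in Hk.
        assert (Hij : (i + j <= k)%nat).
        { pose proof (Cantor.to_nat_non_decreasing i j) as Q. rewrite <- Ek, Cantor.cancel_to_of in Q. lia. }
        apply in_prod; apply in_seq; lia.
    + rewrite lsum_list_prod, lsum_seq. eapply Rle_trans; [|apply (HM n)]. apply sum_Rle. intros i _.
      rewrite lsum_seq. unfold len; simpl. apply Hab.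
Qed.

Lemma covered_list (l : list (R * R)) : (forall p, In p l -> fst p <= snd p) ->
  covered (fun t => exists p, In p l /\ fst p <= t <= snd p) (lsum (fun p => snd p - fst p) l).
Proof.
  (* Beyond the end of the list the sequence is padded with the degenerate interval [0, 0]. *)
  intros H. set (d := fun k => nth k l (0, 0)).
  assert (Hd : forall k, fst (d k) <= snd (d k)).
  { intros k. destruct (Nat.lt_ge_cases k (length l)) as [h|h].
    - apply H, nth_In, h.
    - unfold d. rewrite nth_overflow by exact h. simpl. lra. }
  exists (fun k => fst (d k)), (fun k => snd (d k)). split; [exact Hd|]. split.
  - intros t [p [Hp Ht]]. destruct (In_nth l p (0, 0) Hp) as [k [_ Ek]]. exists k. unfold d. rewrite Ek. exact Ht.
  - intros n. unfold d. clear d Hd. revert n. induction l as [|p l IH]; intros n.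
    + simpl. rewrite (sum_eq _ (fun _ => 0)) by (intros i _; destruct i; simpl; ring).
      rewrite sum_cte. lra.
    + assert (Hl : forall q, In q l -> fst q <= snd q) by (intros; apply H; right; assumption).
      assert (0 <= snd p - fst p) by (specialize (H p (or_introl eq_refl)); lra).
      destruct n as [|n].
      * simpl. specialize (IH Hl 0%nat). assert (Q : forall l', (forall q, In q l' -> fst q <= snd q) -> 0 <= lsum (fun q : R * R => snd q - fst q) l').
        { clear. induction l' as [|q l' IH']; intros Hq; simpl; [lra|]. pose proof (Hq q (or_introl eq_refl)).
          specialize (IH' ltac:(intros; apply Hq; right; assumption)). lra. }
        specialize (Q l Hl). lra.
      * rewrite decomp_sum by lia. simpl. specialize (IH Hl n). lra.
Qed.

Lemma null_union (E : nat -> R -> Prop) : (forall i, null_set (E i)) -> null_set (fun t => exists i, E i t).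
Proof.
  intros H. apply null_covered. intros eps He.
  apply covered_union with (c := fun i => eps / 2 * (/ 2) ^ i).
  - intros i. apply null_covered; [apply H|]. apply Rmult_lt_0_compat; [lra|apply pow_lt; lra].
  - intros n. pose proof (geom_sum_lt (eps / 2) n ltac:(lra)). lra.
Qed.

Lemma null_translate E s : null_set E -> null_set (fun t => E (t + s)).
Proof.
  intros H eps He. destruct (H eps He) as [a [b [H1 [H2 H3]]]].
  exists (fun k => a k - s), (fun k => b k - s). split; [intros k; specialize (H1 k); lra|]. split.
  - intros t Ht. destruct (H2 _ Ht) as [k Hk]. exists k. lra.
  - intros n. rewrite (sum_eq _ (fun k => b k - a k)) by (intros; ring). apply H3.
Qed.

(** * Dyadic stopping intervals *)

Section Dyadic.
Variables (nu : R -> R -> R) (al L lam : R).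
Hypothesis HL : 0 < L.
Hypothesis Hlam : 0 < lam.
Hypothesis nu_pos : forall a b, a <= b -> 0 <= nu a b.
Hypothesis nu_add : forall a b c, a <= b -> b <= c -> nu a b + nu b c = nu a c.

Definition dlen (n : nat) : R := L * (/ 2) ^ n.
Definition mass (n : nat) (a : R) : R := nu a (a + dlen n).
Definition heavy (n : nat) (a : R) : bool := if Rlt_dec (lam * dlen n) (mass n a) then true else false.
(** The stopping rule of a Calderon-Zygmund decomposition: [act n] lists the left endpoints of the
    level n cells without heavy proper ancestor. A heavy cell is selected and never divided, so the
    cells of [sel] are the maximal heavy ones. *)
Fixpoint act (n : nat) : list R :=
  match n with
  | O => al :: nil
  | S n => flat_map (fun a => if heavy n a then nil else a :: a + dlen (S n) :: nil) (act n)
  end.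
Definition sel (n : nat) : list R := filter (heavy n) (act n).

Lemma dlen_pos n : 0 < dlen n.
Proof. apply Rmult_lt_0_compat; [exact HL|apply pow_lt; lra]. Qed.

Lemma dlen_S n : dlen n = dlen (S n) + dlen (S n).
Proof. unfold dlen. simpl. field. Qed.

Lemma dlen_decr m n : (m <= n)%nat -> dlen n <= dlen m.
Proof.
  induction 1 as [|n _ IH]; [lra|]. rewrite (dlen_S n) in IH. pose proof (dlen_pos (S n)). lra.
Qed.

Lemma act_step l n : lsum (fun a => if heavy n a then lam * dlen n else 0) l
  + lsum (mass (S n)) (flat_map (fun a => if heavy n a then nil else a :: a + dlen (S n) :: nil) l) <= lsum (mass n) l.
Proof.
  pose proof (dlen_pos (S n)) as Hp.
  induction l as [|a l IH]; simpl; [lra|]. rewrite lsum_app. unfold heavy at 1 3. destruct (Rlt_dec _ _) as [h|h].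
  - simpl. lra.
  - simpl. assert (mass (S n) a + mass (S n) (a + dlen (S n)) = mass n a).
    { unfold mass. rewrite nu_add by lra. f_equal. rewrite (dlen_S n). ring. }
    lra.
Qed.

(** A heavy cell pays lam times its length out of its own mass and a light cell hands its mass to
    its halves; the amount paid plus the active mass never exceeds the initial mass. This avoids any
    statement about disjointness. *)
Lemma sel_total N : sum_f_R0 (fun n => lsum (fun _ => lam * dlen n) (sel n)) N <= mass 0 al.
Proof.
  assert (Q : sum_f_R0 (fun n => lsum (fun _ => lam * dlen n) (sel n)) N + lsum (mass (S N)) (act (S N)) <= mass 0 al).
  { assert (E : forall n, lsum (fun _ => lam * dlen n) (sel n) = lsum (fun a => if heavy n a then lam * dlen n else 0) (act n)).
    { intros n. unfold sel. induction (act n) as [|a l IH]; simpl; [reflexivity|]. destruct (heavy n a); simpl; rewrite IH; ring. }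
    induction N as [|N IH].
    - simpl sum_f_R0. rewrite E. pose proof (act_step (act 0) 0) as S. assert (E0 : lsum (mass 0) (act 0) = mass 0 al) by (simpl; ring).
      change (flat_map (fun a => if heavy 0 a then nil else a :: a + dlen 1 :: nil) (act 0)) with (act 1) in S. lra.
    - simpl sum_f_R0. rewrite E. pose proof (act_step (act (S N)) (S N)) as Q.
      change (flat_map (fun a => if heavy (S N) a then nil else a :: a + dlen (S (S N)) :: nil) (act (S N))) with (act (S (S N))) in Q. lra. }
  assert (0 <= lsum (mass (S N)) (act (S N))).
  { apply lsum_nonneg. intros a. apply nu_pos. pose proof (dlen_pos (S N)). lra. }
  lra.
Qed.

Lemma act_aligned n : forall a, In a (act n) -> exists i : nat, a = al + INR i * dlen n.
Proof.
  induction n as [|n IH]; intros a Ha.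
  - destruct Ha as [<-|[]]. exists 0%nat. simpl. ring.
  - simpl in Ha. apply in_flat_map in Ha. destruct Ha as [a' [Ha' Ha]]. destruct (IH a' Ha') as [i Ei].
    rewrite (dlen_S n) in Ei. destruct (heavy n a'); [destruct Ha|].
    destruct Ha as [<-|[<-|[]]].
    + exists (2 * i)%nat. rewrite mult_INR. simpl (INR 2). lra.
    + exists (2 * i + 1)%nat. rewrite plus_INR, mult_INR. simpl (INR 2). simpl (INR 1). lra.
Qed.

Lemma act_cover n : forall x, al <= x < al + L -> (exists a, In a (act n) /\ a <= x < a + dlen n) \/
  exists m a, (m < n)%nat /\ In a (sel m) /\ a <= x < a + dlen m.
Proof.
  induction n as [|n IH]; intros x Hx.
  - left. exists al. split; [left; reflexivity|]. unfold dlen. simpl. lra.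
  - destruct (IH x Hx) as [[a [Ha Hax]]|[m [a [Hm Q]]]].
    + destruct (heavy n a) eqn:Eh.
      * right. exists n, a. split; [lia|]. split; [apply filter_In; auto|exact Hax].
      * left. rewrite (dlen_S n) in Hax. destruct (Rlt_dec x (a + dlen (S n))) as [h|h].
        -- exists a. split; [|lra]. simpl. apply in_flat_map. exists a. split; [exact Ha|]. rewrite Eh. left; reflexivity.
        -- exists (a + dlen (S n)). split; [|lra]. simpl. apply in_flat_map. exists a. split; [exact Ha|]. rewrite Eh. right; left; reflexivity.
    + right. exists m, a. split; [lia|exact Q].
Qed.

(* The fivefold enlargements of the maximal dyadic intervals of [nu]-density above [lam]. *)
Definition stopped (t : R) : Prop := exists n a, In a (sel n) /\ a - 2 * dlen n <= t <= a + 3 * dlen n.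

Lemma stopped_covered : covered stopped (5 * nu al (al + L) / lam).
Proof.
  apply covered_sub with (fun t => exists n, exists p, In p (map (fun a => (a - 2 * dlen n, a + 3 * dlen n)) (sel n)) /\ fst p <= t <= snd p)
    (5 * nu al (al + L) / lam); [|lra|].
  - intros t [n [a [Ha Ht]]]. exists n, (a - 2 * dlen n, a + 3 * dlen n). split; [|exact Ht]. apply in_map_iff. exists a. auto.
  - apply covered_union with (c := fun n => lsum (fun p => snd p - fst p) (map (fun a => (a - 2 * dlen n, a + 3 * dlen n)) (sel n))).
    + intros n. apply covered_list. intros p Hp. apply in_map_iff in Hp. destruct Hp as [a [<- _]]. simpl. pose proof (dlen_pos n). lra.
    + intros N. pose proof (sel_total N) as S. unfold mass in S. replace (dlen 0) with L in S by (unfold dlen; simpl; ring).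
      apply Rle_trans with (5 / lam * sum_f_R0 (fun n => lsum (fun _ => lam * dlen n) (sel n)) N).
      * rewrite scal_sum. apply sum_Rle. intros n _. rewrite lsum_map. right.
        induction (sel n) as [|a l IH]; simpl in *; [ring|]. rewrite IH. field. lra.
      * unfold Rdiv. rewrite (Rmult_assoc 5), (Rmult_assoc 5 (nu _ _)). apply Rmult_le_compat_l; [lra|].
        rewrite Rmult_comm. apply Rmult_le_compat_r; [left; apply Rinv_0_lt_compat; exact Hlam|exact S].
Qed.

(** If x were in no active cell of level n, it would lie in a selected cell at least as long, whose
    enlargement would contain t. A heavy active cell is excluded for the same reason. *)
Lemma light_cell t n x : ~ stopped t -> al <= x < al + L -> Rabs (x - t) <= 2 * dlen n ->
  exists i : nat, al + INR i * dlen n <= x < al + INR i * dlen n + dlen n /\ mass n (al + INR i * dlen n) <= lam * dlen n.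
Proof.
  intros Ht Hx Hd. apply Rabs_le_between in Hd.
  destruct (act_cover n x Hx) as [[a [Ha Hax]]|[m [a [Hm [Ha Hax]]]]].
  - destruct (act_aligned n a Ha) as [i Ei]. exists i. rewrite <- Ei. split; [exact Hax|].
    destruct (heavy n a) eqn:Eh; [|unfold heavy in Eh; destruct (Rlt_dec _ _); [discriminate|lra]].
    exfalso. apply Ht. exists n, a. split; [apply filter_In; auto|]. lra.
  - exfalso. apply Ht. exists m, a. split; [exact Ha|]. pose proof (dlen_decr m n ltac:(lia)). lra.
Qed.

Lemma INR_cell_unique (i j : nat) (k : Z) y len : 0 < len ->
  INR i * len <= y < INR i * len + len -> INR j * len <= y + IZR k * len < INR j * len + len -> INR j = INR i + IZR k.
Proof.
  intros Hlen Hi Hj. rewrite !INR_IZR_INZ in *.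
  assert (H1 : IZR (Z.of_nat j) < IZR (Z.of_nat i) + IZR k + 1).
  { apply Rmult_lt_reg_r with len; [exact Hlen|]. lra. }
  assert (H2 : IZR (Z.of_nat i) + IZR k < IZR (Z.of_nat j) + 1).
  { apply Rmult_lt_reg_r with len; [exact Hlen|]. lra. }
  rewrite <- plus_IZR in *. rewrite <- plus_IZR in H1, H2. apply lt_IZR in H1, H2. f_equal. lia.
Qed.

(** At the scale dlen n <= s < 2 dlen n, the cell of t and its two neighbours on each side cover (t
    - s, t + s), and all five are light. The margin 3 s keeps the sample points t + k dlen n, |k| <=
    2, inside the root interval. *)
Lemma small_mass t s : ~ stopped t -> 0 < s -> al + 3 * s <= t -> t + 3 * s <= al + L -> nu (t - s) (t + s) <= 5 * lam * s.
Proof.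
  intros Ht Hs H1 H2.
  assert (Hn : exists n, dlen n <= s < 2 * dlen n).
  { assert (Hex : exists n, dlen n <= s).
    { destruct (pow_lt_1_zero (/ 2) ltac:(rewrite Rabs_pos_eq; lra) (s / L)) as [n Hn]; [apply Rdiv_lt_0_compat; lra|].
      exists n. specialize (Hn n (le_n n)). rewrite Rabs_pos_eq in Hn by (apply pow_le; lra). unfold dlen.
      left. apply Rlt_le_trans with (L * (s / L)); [apply Rmult_lt_compat_l; lra|right; field; lra]. }
    destruct Hex as [n Hn]. induction n as [|n IH].
    - exfalso. unfold dlen in Hn. simpl in Hn. lra.
    - destruct (Rle_dec (dlen n) s) as [h|h]; [apply IH, h|]. exists (S n). rewrite (dlen_S n) in h. lra. }
  destruct Hn as [n Hn]. pose proof (dlen_pos n) as Hp. set (len := dlen n) in *.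
  assert (Hcell : forall k : Z, Rabs (IZR k) <= 2 -> exists i : nat, al + INR i * len <= t + IZR k * len < al + INR i * len + len /\
    mass n (al + INR i * len) <= lam * len).
  { intros k Hk. apply (light_cell t n (t + IZR k * len)); [exact Ht| |].
    - apply Rabs_le_between in Hk. nra.
    - replace (t + IZR k * len - t) with (IZR k * len) by ring. rewrite Rabs_mult, (Rabs_pos_eq len) by lra.
      fold len. apply Rmult_le_compat_r; lra. }
  destruct (Hcell 0%Z ltac:(rewrite Rabs_pos_eq; lra)) as [i [Hi Mi]].
  set (a := al + INR i * len) in *.
  assert (Hk : forall k : Z, Rabs (IZR k) <= 2 -> mass n (a + IZR k * len) <= lam * len).
  { intros k Hk. destruct (Hcell k Hk) as [j [Hj Mj]].
    assert (E : INR j = INR i + IZR k).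
    { apply (INR_cell_unique i j k (t - al) len Hp); unfold a in *; lra. }
    replace (a + IZR k * len) with (al + INR j * len) by (unfold a; rewrite E; ring). exact Mj. }
  assert (B : forall k : Z, (-2 <= k <= 2)%Z -> Rabs (IZR k) <= 2).
  { intros k K. apply Rabs_le_between. split; [replace (- (2)) with (IZR (-2)) by (simpl; lra)|]; apply IZR_le; lia. }
  pose proof (Hk (-2)%Z ltac:(apply B; lia)) as K1. pose proof (Hk (-1)%Z ltac:(apply B; lia)) as K2.
  pose proof (Hk 0%Z ltac:(apply B; lia)) as K3. pose proof (Hk 1%Z ltac:(apply B; lia)) as K4. pose proof (Hk 2%Z ltac:(apply B; lia)) as K5.
  unfold mass in *. fold len in K1, K2, K3, K4, K5.
  assert (Htot : nu (a - 2 * len) (a + 3 * len) <= 5 * (lam * len)).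
  { rewrite <- (nu_add (a - 2 * len) (a + 2 * len) (a + 3 * len)) by lra.
    rewrite <- (nu_add (a - 2 * len) (a + len) (a + 2 * len)) by lra.
    rewrite <- (nu_add (a - 2 * len) a (a + len)) by lra.
    rewrite <- (nu_add (a - 2 * len) (a - len) a) by lra.
    replace (a + -2 * len + len) with (a - len) in K1 by ring. replace (a + -2 * len) with (a - 2 * len) in K1 by ring.
    replace (a + -1 * len + len) with a in K2 by ring. replace (a + -1 * len) with (a - len) in K2 by ring.
    replace (a + 0 * len) with a in K3 by ring. 
    replace (a + 1 * len + len) with (a + 2 * len) in K4 by ring. replace (a + 1 * len) with (a + len) in K4 by ring.
    replace (a + 2 * len + len) with (a + 3 * len) in K5 by ring. lra. }
  assert (Hsub : nu (t - s) (t + s) <= nu (a - 2 * len) (a + 3 * len)).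
  { rewrite <- (nu_add (a - 2 * len) (t - s) (a + 3 * len)) by lra.
    rewrite <- (nu_add (t - s) (t + s) (a + 3 * len)) by lra.
    pose proof (nu_pos (a - 2 * len) (t - s) ltac:(lra)). pose proof (nu_pos (t + s) (a + 3 * len) ltac:(lra)). lra. }
  assert (lam * len <= lam * s) by (apply Rmult_le_compat_l; lra). lra.
Qed.
End Dyadic.

(** * Radial limits of functions inner in the mean *)

Lemma RInt_symmetric (q : R -> R) th s : (forall t, continuous q t) ->
  RInt q (th - s) (th + s) = RInt (fun t => q (th + t) + q (th - t)) 0 s.
Proof.
  intros Hq.
  assert (Xq : forall a b, ex_RInt q a b) by (intros; apply ex_RInt_cont, Hq).
  pose proof (RInt_comp_lin (V := R_CompleteNormedModule) q 1 th 0 s (Xq _ _)) as E1.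
  pose proof (RInt_comp_lin (V := R_CompleteNormedModule) q (-1) th s 0 (Xq _ _)) as E2.
  replace (1 * 0 + th) with th in E1 by ring. replace (1 * s + th) with (th + s) in E1 by ring.
  replace (-1 * s + th) with (th - s) in E2 by ring. replace (-1 * 0 + th) with th in E2 by ring.
  assert (Xp : ex_RInt (fun t => q (th + t)) 0 s).
  { apply ex_RInt_cont. intros t. apply (continuous_comp (fun t => th + t) q); [|apply Hq].
    apply cont_plus_R; [apply cont_const_R|apply continuous_id]. }
  assert (Xm : forall a b, ex_RInt (fun t => q (th - t)) a b).
  { intros a b. apply ex_RInt_cont. intros t. apply (continuous_comp (fun t => th - t) q); [|apply Hq].
    apply cont_minus_R; [apply cont_const_R|apply continuous_id]. }
  rewrite RInt_plus_R by (exact Xp || apply Xm).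
  rewrite <- (RInt_Chasles_R q (th - s) th (th + s)) by apply Xq.
  rewrite <- E1, <- E2. rewrite Rplus_comm. apply f_equal2.
  - apply RInt_ext_R. intros t _. unfold scal; simpl; unfold mult; simpl. rewrite Rmult_1_l. f_equal. ring.
  - rewrite <- (opp_RInt_swap (V := R_CompleteNormedModule) (fun y => scal (-1) (q (-1 * y + th)))).
    + rewrite <- (RInt_opp (V := R_CompleteNormedModule)).
      * apply RInt_ext_R. intros t _. unfold opp, scal; simpl; unfold mult; simpl. replace (-1 * t + th) with (th - t) by ring. ring.
      * apply (ex_RInt_ext (V := R_NormedModule) (fun t => -1 * q (th - t))); [|apply ex_RInt_scal_R, Xm].
        intros t _. unfold scal; simpl; unfold mult; simpl. f_equal. f_equal. ring.
    + apply (ex_RInt_ext (V := R_NormedModule) (fun t => -1 * q (th - t))); [|apply ex_RInt_scal_R, Xm].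
      intros t _. unfold scal; simpl; unfold mult; simpl. f_equal. f_equal. ring.
Qed.

(** Integration by parts against W(t), the integral of w from 0 to t, phrased as monotonicity of
    [Q]: its derivative is -P'(t) (W(t) - mu t - e), which is not positive. The slack e absorbs the
    error of replacing the boundary measure by a circle. *)
Lemma monotone_kernel (P P' w : R -> R) x0 mu e : 0 < x0 ->
  (forall t, is_derive P t (P' t)) -> (forall t, 0 <= t <= x0 -> P' t <= 0) -> 0 <= P x0 ->
  (forall t, continuous w t) -> (forall t, 0 <= t <= x0 -> RInt w 0 t <= mu * t + e) ->
  RInt (fun t => P t * w t) 0 x0 <= mu * RInt P 0 x0 + e * P 0.
Proof.
  intros Hx HP HP' HPx Hw HW.
  assert (CP : forall t, continuous P t) by (intros t; apply (ex_derive_continuous P); eexists; apply HP).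
  assert (CPw : forall t, continuous (fun t => P t * w t) t) by (intros; apply cont_mult_R; auto).
  set (Q := fun t => RInt (fun t => P t * w t) 0 t - mu * RInt P 0 t - P t * (RInt w 0 t - mu * t - e)).
  set (Q' := fun t => - P' t * (RInt w 0 t - mu * t - e)).
  assert (D : forall (f : R -> R), (forall t, continuous f t) -> forall t, is_derive (fun t => RInt f 0 t) t (f t)).
  { intros f Hf t. apply (is_derive_RInt f (fun t => RInt f 0 t) 0 t); [|apply Hf].
    exists (mkposreal 1 Rlt_0_1). intros y _. apply (RInt_correct (V := R_CompleteNormedModule)), ex_RInt_cont, Hf. }
  assert (HQ : forall t, is_derive Q t (Q' t)).
  { intros t. unfold Q, Q'.
    replace (- P' t * (RInt w 0 t - mu * t - e)) with ((P t * w t - mu * P t) - (P' t * (RInt w 0 t - mu * t - e) + P t * (w t - mu * 1 - 0))) by ring.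
    apply (is_derive_minus (K := R_AbsRing) (V := R_NormedModule)).
    - apply (is_derive_minus (K := R_AbsRing) (V := R_NormedModule)); [apply (D _ CPw)|].
      apply (is_derive_scal (fun t => RInt P 0 t)), (D _ CP).
    - apply (is_derive_mult (K := R_AbsRing) P (fun t => RInt w 0 t - mu * t - e)); [apply HP| |intros; apply Rmult_comm].
      apply (is_derive_minus (K := R_AbsRing) (V := R_NormedModule)); [|apply (is_derive_const (K := R_AbsRing) (V := R_NormedModule))].
      apply (is_derive_minus (K := R_AbsRing) (V := R_NormedModule)); [apply (D _ Hw)|].
      apply (is_derive_scal (fun t => t)), (is_derive_id (K := R_AbsRing)). }
  destruct (MVT_gen Q 0 x0 Q') as [c [Hc E]].
  - intros t _. apply HQ.
  - intros t _. apply continuity_pt_filterlim, (ex_derive_continuous Q). eexists; apply HQ.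
  - rewrite Rmin_left, Rmax_right in Hc by lra.
    assert (Q x0 <= Q 0).
    { assert (Q' c <= 0).
      { unfold Q'. specialize (HW c Hc). specialize (HP' c Hc). nra. }
      nra. }
    assert (Q0 : Q 0 = e * P 0).
    { unfold Q. rewrite !(RInt_point (V := R_CompleteNormedModule)). unfold zero; simpl. ring. }
    rewrite Q0 in H. unfold Q in H. specialize (HW x0 ltac:(lra)). nra.
Qed.

Definition kern (R0 r t : R) : R := (R0 * R0 - r * r) / (R0 * R0 + r * r - 2 * R0 * r * cos t).

Lemma kern_den R0 r t : 0 < r < R0 -> (R0 - r) * (R0 - r) <= R0 * R0 + r * r - 2 * R0 * r * cos t.
Proof. intros H. pose proof (COS_bound t). assert (0 < R0 * r) by nra. nra. Qed.

Lemma kern_pk R0 r th t : 0 < r < R0 -> pk R0 (polar r th) (th + t) = kern R0 r t /\ pk R0 (polar r th) (th - t) = kern R0 r t.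
Proof.
  intros H. unfold pk, kern. rewrite Cmod_polar by lra.
  assert (E : forall s, Cmod (polar R0 s - polar r th) * Cmod (polar R0 s - polar r th) = R0 * R0 + r * r - 2 * R0 * r * cos (s - th)).
  { intros s. rewrite Cmod_sqr, cos_minus. simpl.
    pose proof (sin2_cos2 s) as S1. pose proof (sin2_cos2 th) as S2. unfold Rsqr in *.
    transitivity (R0 * R0 * (sin s * sin s + cos s * cos s) + r * r * (sin th * sin th + cos th * cos th)
      - 2 * R0 * r * (cos s * cos th + sin s * sin th)); [ring|]. rewrite S1, S2. ring. }
  rewrite !E. replace (th + t - th) with t by ring. replace (th - t - th) with (- t) by ring. rewrite cos_neg. auto.
Qed.

Lemma kern_derive R0 r t : 0 < r < R0 ->
  is_derive (kern R0 r) t (- ((R0 * R0 - r * r) * (2 * R0 * r * sin t)) / ((R0 * R0 + r * r - 2 * R0 * r * cos t) * (R0 * R0 + r * r - 2 * R0 * r * cos t))).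
Proof.
  intros H. pose proof (kern_den R0 r t H) as Hd. assert (0 < (R0 - r) * (R0 - r)) by nra.
  unfold kern. auto_derive; [lra|]. field. lra.
Qed.

Section RadialLimits.
Variable u : C -> C.
Hypothesis Hu : hol 1 u.
Hypothesis Hub : forall z, Cmod z < 1 -> Cmod (u z) <= 1.

(** If F is a primitive of the backward shift of u, then the arc integral is (b - a) u(0) plus an
    endpoint difference of F divided by i. The shift is bounded by 2, so each endpoint term is
    Lipschitz in the radius. This rate is what makes the boundary measure an honest limit. *)
Lemma arc_integral_rate a b R1 R2 : 0 < R1 < 1 -> 0 < R2 < 1 ->
  Cmod (CI (fun s => u (polar R1 s)) a b - CI (fun s => u (polar R2 s)) a b) <= 4 * Rabs (R1 - R2).
Proof.
  intros H1 H2. destruct (factor_zero u Hu) as [f1 [Hf1 E]].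
  assert (B1 : forall z, Cmod z < 1 -> Cmod (f1 z) <= 2).
  { intros z Hz. pose proof (factor_bound u f1 1 Hf1 E Hub z Hz). specialize (Hub 0 ltac:(rewrite Cmod_0; lra)). lra. }
  destruct (primitive 1 f1 (hol_hol0 1 f1 Hf1)) as [F HF].
  assert (EI : forall R0, 0 < R0 < 1 -> (Ci * CI (fun s => u (polar R0 s)) a b
     = Ci * (RtoC (b - a) * u 0) + (F (polar R0 b) - F (polar R0 a)))%C).
  { intros R0 HR.
    assert (Cc : cont_on (fun s => polar R0 s * f1 (polar R0 s))%C a b).
    { intros s _. apply contg_mult; [apply pcont_polar|apply circle_pcont; [exact Hf1|lra]]. }
    rewrite (CI_ext _ (fun s => u 0 + polar R0 s * f1 (polar R0 s))%C) by (intros s _; apply E).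
    rewrite CI_plus by (exact Cc || (intros s _; apply contg_const)). rewrite CI_const.
    replace (Ci * (RtoC (b - a) * u 0 + CI (fun s => polar R0 s * f1 (polar R0 s)) a b))%C
      with (Ci * (RtoC (b - a) * u 0) + Ci * CI (fun s => polar R0 s * f1 (polar R0 s)) a b)%C by ring.
    f_equal. rewrite <- CI_scal by exact Cc.
    apply (CI_FTC (fun s => F (polar R0 s))).
    - intros s _. replace (Ci * (polar R0 s * f1 (polar R0 s)))%C with (f1 (polar R0 s) * (Ci * polar R0 s))%C by ring.
      apply pdiff_comp; [apply HF; rewrite Cmod_polar; lra|apply pdiff_polar].
    - apply cont_on_scal, Cc. }
  assert (Rad : forall s, Cmod (F (polar R1 s) - F (polar R2 s)) <= 2 * Rabs (R1 - R2)).
  { intros s. assert (Hd : forall x, pdiff (fun x => polar x s) x (polar 1 s)).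
    { intros x. split; simpl; auto_derive; trivial; ring. }
    assert (Hb : forall x, Rmin R2 R1 <= x <= Rmax R2 R1 -> 0 < x < 1).
    { intros x Hx. unfold Rmin, Rmax in Hx. destruct (Rle_dec R2 R1); lra. }
    assert (Cc : cont_on (fun x => f1 (polar x s) * polar 1 s)%C R2 R1).
    { intros x Hx. apply contg_mult; [|apply contg_const]. apply (contg_comp dR f1 (fun x => polar x s)).
      - eapply hol_ccont; [exact Hf1|]. specialize (Hb x Hx). rewrite Cmod_polar; lra.
      - eapply pdiff_pcont, Hd. }
    rewrite <- (CI_FTC (fun x => F (polar x s)) (fun x => f1 (polar x s) * polar 1 s)%C R2 R1).
    - apply CI_bound; [exact Cc|]. intros x Hx. specialize (Hb x Hx). rewrite Cmod_mult, (Cmod_polar 1) by lra.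
      rewrite Rmult_1_r. apply B1. rewrite Cmod_polar; lra.
    - intros x Hx. specialize (Hb x Hx). apply (pdiff_comp F (fun x => polar x s)); [apply HF; rewrite Cmod_polar; lra|apply Hd].
    - exact Cc. }
  rewrite <- (Rmult_1_l (Cmod _)), <- Cmod_Ci, <- Cmod_mult.
  replace (Ci * (CI (fun s => u (polar R1 s)) a b - CI (fun s => u (polar R2 s)) a b))%C
    with ((F (polar R1 b) - F (polar R2 b)) - (F (polar R1 a) - F (polar R2 a)))%C.
  - eapply Rle_trans; [apply Cmod_minus_le|]. pose proof (Rad a); pose proof (Rad b). lra.
  - replace (Ci * (CI (fun s => u (polar R1 s)) a b - CI (fun s => u (polar R2 s)) a b))%C
      with (Ci * CI (fun s => u (polar R1 s)) a b - Ci * CI (fun s => u (polar R2 s)) a b)%C by ring.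
    rewrite !EI by assumption. ring.
Qed.

Variable c : C.
Hypothesis Hc : Cmod c = 1.

(** It is nonnegative since |u| <= 1, and by [dist_unimodular] twice its value bounds |u - c|^2, so
    smallness of [vv] means that u is close to c. *)
Definition vv (z : C) : R := 1 - fst (Cconj c * u z)%C.
Definition V (R0 a b : R) : R := RInt (fun s => vv (polar R0 s)) a b.

Lemma vv_bounds z : Cmod z < 1 -> 0 <= vv z <= 2.
Proof.
  intros Hz. unfold vv. pose proof (Cmod_ge_fst (Cconj c * u z)) as H. rewrite Cmod_mult, Cmod_conj, Hc in H.
  apply Rabs_le_between in H. specialize (Hub z Hz). lra.
Qed.

Lemma vv_cont R0 t : 0 <= R0 < 1 -> continuous (fun s => vv (polar R0 s)) t.
Proof.
  intros HR. apply cont_minus_R; [apply cont_const_R|]. apply (pcont_fst (fun s => Cconj c * u (polar R0 s))%C).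
  apply contg_mult; [apply contg_const|apply circle_pcont; assumption].
Qed.

Lemma vv_ex R0 a b : 0 <= R0 < 1 -> ex_RInt (fun s => vv (polar R0 s)) a b.
Proof. intros HR. apply ex_RInt_cont. intros t. apply vv_cont, HR. Qed.

Lemma V_eq R0 a b : 0 <= R0 < 1 -> V R0 a b = (b - a) - fst (Cconj c * CI (fun s => u (polar R0 s)) a b)%C.
Proof.
  intros HR. assert (Cc : cont_on (fun s => u (polar R0 s)) a b) by (intros s _; apply circle_pcont; assumption).
  rewrite <- CI_scal by exact Cc. unfold V, vv.
  assert (X := cont_on_fst _ _ _ (cont_on_scal (Cconj c) _ a b Cc)).
  rewrite (RInt_minus_R (fun _ => 1)); [|apply ex_RInt_const|exact X]. rewrite RInt_const_R.
  unfold CI. cbn [fst]. lra.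
Qed.

Lemma V_rate R1 R2 a b : 0 < R1 < 1 -> 0 < R2 < 1 -> Rabs (V R1 a b - V R2 a b) <= 4 * Rabs (R1 - R2).
Proof.
  intros H1 H2. rewrite !V_eq by lra. eapply Rle_trans; [|apply (arc_integral_rate a b R1 R2 H1 H2)].
  set (I1 := CI (fun s => u (polar R1 s)) a b). set (I2 := CI (fun s => u (polar R2 s)) a b).
  replace (b - a - fst (Cconj c * I1)%C - (b - a - fst (Cconj c * I2)%C)) with (- fst (Cconj c * (I1 - I2))%C) by (simpl; ring).
  rewrite Rabs_Ropp. eapply Rle_trans; [apply Cmod_ge_fst|]. rewrite Cmod_mult, Cmod_conj, Hc. lra.
Qed.

Definition Rj (j : nat) : R := 1 - / (INR j + 2).
(* The boundary measure of the positive harmonic function [vv]. *)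
Definition nu (a b : R) : R := real (Lim_seq (fun j => V (Rj j) a b)).

Lemma Rj_bounds j : 0 < Rj j < 1.
Proof. apply (radial_seq_facts (RtoC 1) j Cmod_1). Qed.

Lemma nu_lim a b : is_lim_seq (fun j => V (Rj j) a b) (nu a b).
Proof.
  destruct (telescoping_cauchy (fun j => V (Rj j) a b) (fun j => 4 * / (INR j + 2))) as [l [Hl _]].
  - intros n. eapply Rle_trans; [apply V_rate; apply Rj_bounds|]. unfold Rj. rewrite S_INR. pose proof (pos_INR n).
    assert (/ (INR n + 1 + 2) <= / (INR n + 2)) by (apply Rinv_le_contravar; lra).
    rewrite Rabs_pos_eq; lra.
  - intros n. pose proof (pos_INR n). assert (0 < / (INR n + 2)) by (apply Rinv_0_lt_compat; lra). lra.
  - unfold nu. rewrite (is_lim_seq_unique _ _ Hl). exact Hl.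
Qed.

Lemma nu_rate R0 a b : 0 < R0 < 1 -> Rabs (nu a b - V R0 a b) <= 4 * (1 - R0).
Proof.
  intros HR.
  assert (L1 : is_lim_seq (fun j => Rabs (V (Rj j) a b - V R0 a b)) (Rabs (nu a b - V R0 a b))).
  { apply (is_lim_seq_abs _ (nu a b - V R0 a b)). apply is_lim_seq_minus'; [apply nu_lim|apply is_lim_seq_const]. }
  assert (L2 : is_lim_seq (fun j => 4 * Rabs (Rj j - R0)) (4 * (1 - R0))).
  { apply is_lim_seq_mult'; [apply is_lim_seq_const|]. replace (1 - R0) with (Rabs (1 - 0 - R0)) by (rewrite Rabs_pos_eq; lra).
    apply (is_lim_seq_abs _ (1 - 0 - R0)). apply is_lim_seq_minus'; [|apply is_lim_seq_const].
    apply is_lim_seq_minus'; [apply is_lim_seq_const|apply radial_seq_lim]. }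
  apply (is_lim_seq_le _ _ _ _ (fun j => V_rate (Rj j) R0 a b (Rj_bounds j) HR) L1 L2).
Qed.

Lemma nu_nonneg a b : a <= b -> 0 <= nu a b.
Proof.
  intros Hab. apply (is_lim_seq_le (fun _ => 0) (fun j => V (Rj j) a b) 0 (nu a b)); [|apply is_lim_seq_const|apply nu_lim].
  intros j. pose proof (Rj_bounds j). apply RInt_ge_0; [exact Hab|apply vv_ex; lra|]. intros s _. apply vv_bounds. rewrite Cmod_polar; lra.
Qed.

Lemma nu_additive a b d : a <= b -> b <= d -> nu a b + nu b d = nu a d.
Proof.
  intros _ _. assert (L := is_lim_seq_plus' _ _ _ _ (nu_lim a b) (nu_lim b d)).
  assert (L2 := nu_lim a d). apply is_lim_seq_unique in L, L2.
  rewrite (Lim_seq_ext _ (fun j => V (Rj j) a d)) in L; [congruence|].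
  intros j. pose proof (Rj_bounds j). apply RInt_Chasles_R; apply vv_ex; lra.
Qed.

Lemma vv_poisson R0 z x : 0 < R0 < 1 -> Cmod z < R0 ->
  RInt (fun s => pk R0 z s * vv (polar R0 s)) x (x + 2 * PI) = 2 * PI * vv z.
Proof.
  intros HR Hz. assert (Hg : hol 1 (fun w => 1 - Cconj c * u w)%C).
  { apply hol_minus; [apply hol_const|]. apply hol_mult; [apply hol_const|exact Hu]. }
  exact (poisson_re_at _ R0 z x Hg HR Hz).
Qed.

Lemma kern_half R0 r : 0 < r < R0 -> R0 < 1 -> RInt (kern R0 r) 0 PI = PI.
Proof.
  intros Hr HR. assert (Hm : Cmod (polar r 0) < R0) by (rewrite Cmod_polar; lra).
  pose proof (pk_int R0 (polar r 0) (0 - PI) ltac:(lra) Hm) as E.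
  replace (0 - PI + 2 * PI) with (0 + PI) in E by ring.
  rewrite RInt_symmetric in E by (intros; apply pk_cont; lra).
  rewrite (RInt_ext_R _ (fun t => 2 * kern R0 r t)) in E
    by (intros t _; destruct (kern_pk R0 r 0 t Hr) as [-> ->]; ring).
  rewrite RInt_scal_R in E; [lra|]. apply ex_RInt_cont. intros t. apply (ex_derive_continuous (kern R0 r)). eexists. apply kern_derive, Hr.
Qed.

(** The Poisson integral is folded at [th]. On [0, x0] the kernel decreases and [monotone_kernel]
    applies; on [x0, pi] the kernel is at most its value at x0 and the folded function [w] is at
    most 4. *)
Lemma vv_upper R0 r th x0 mu e : 0 < r < R0 -> R0 < 1 -> 0 < x0 < PI -> 0 <= mu ->
  (forall t, 0 < t <= x0 -> V R0 (th - t) (th + t) <= mu * t + e) -> 0 <= e ->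
  2 * PI * vv (polar r th) <= mu * PI + e * kern R0 r 0 + 4 * PI * kern R0 r x0.
Proof.
  intros Hr HR Hx Hmu HV He. assert (Hm : Cmod (polar r th) < R0) by (rewrite Cmod_polar; lra).
  assert (Ck : forall t, continuous (kern R0 r) t) by (intros t; apply (ex_derive_continuous (kern R0 r)); eexists; apply kern_derive, Hr).
  assert (Cv : forall t, continuous (fun s => vv (polar R0 s)) t) by (intros; apply vv_cont; lra).
  set (w := fun t => vv (polar R0 (th + t)) + vv (polar R0 (th - t))).
  assert (Cw : forall t, continuous w t).
  { intros t. apply cont_plus_R.
    - apply (continuous_comp (fun t => th + t) (fun s => vv (polar R0 s))); [apply cont_plus_R; [apply cont_const_R|apply continuous_id]|apply Cv].
    - apply (continuous_comp (fun t => th - t) (fun s => vv (polar R0 s))); [apply cont_minus_R; [apply cont_const_R|apply continuous_id]|apply Cv]. }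
  assert (Hw4 : forall t, 0 <= w t <= 4).
  { intros t. unfold w. pose proof (vv_bounds (polar R0 (th + t)) ltac:(rewrite Cmod_polar; lra)).
    pose proof (vv_bounds (polar R0 (th - t)) ltac:(rewrite Cmod_polar; lra)). lra. }
  assert (Hkp : forall t, 0 < kern R0 r t).
  { intros t. destruct (kern_pk R0 r th t Hr) as [<- _]. apply pk_pos; lra. }
  assert (Xkw : forall a b, ex_RInt (fun t => kern R0 r t * w t) a b) by (intros; apply ex_RInt_cont; intros; apply cont_mult_R; auto).
  assert (Xk : forall a b, ex_RInt (kern R0 r) a b) by (intros; apply ex_RInt_cont, Ck).
  assert (E : 2 * PI * vv (polar r th) = RInt (fun t => kern R0 r t * w t) 0 PI).
  { rewrite <- (vv_poisson R0 (polar r th) (th - PI) ltac:(lra) Hm). replace (th - PI + 2 * PI) with (th + PI) by ring.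
    rewrite RInt_symmetric by (intros; apply cont_mult_R; [apply pk_cont; lra|apply Cv]).
    apply RInt_ext_R. intros t _. unfold w. destruct (kern_pk R0 r th t Hr) as [-> ->]. ring. }
  rewrite E, <- (RInt_Chasles_R _ 0 x0 PI) by apply Xkw.
  assert (P1 : RInt (fun t => kern R0 r t * w t) 0 x0 <= mu * RInt (kern R0 r) 0 x0 + e * kern R0 r 0).
  { apply (monotone_kernel (kern R0 r) _ w x0 mu e ltac:(lra) (fun t => kern_derive R0 r t Hr)).
    - intros t Ht. pose proof (kern_den R0 r t Hr) as Hd. assert (0 < (R0 - r) * (R0 - r)) by nra.
      assert (0 <= sin t) by (apply sin_ge_0; lra).
      set (D := R0 * R0 + r * r - 2 * R0 * r * cos t) in *.
      assert (0 <= (R0 * R0 - r * r) * (2 * R0 * r * sin t)).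
      { apply Rmult_le_pos; [nra|]. apply Rmult_le_pos; [nra|assumption]. }
      assert (0 < / (D * D)) by (apply Rinv_0_lt_compat; nra). unfold Rdiv. nra.
    - left; apply Hkp.
    - exact Cw.
    - intros t Ht. destruct (Req_dec t 0) as [->|Hn].
      + rewrite (RInt_point (V := R_CompleteNormedModule)). unfold zero; simpl. lra.
      + specialize (HV t ltac:(lra)). unfold V in HV. rewrite RInt_symmetric in HV by exact Cv. exact HV. }
  assert (P2 : RInt (kern R0 r) 0 x0 <= PI).
  { pose proof (kern_half R0 r Hr HR) as KH. rewrite <- (RInt_Chasles_R (kern R0 r) 0 x0 PI) in KH by apply Xk.
    assert (0 <= RInt (kern R0 r) x0 PI) by (apply RInt_ge_0; [lra|apply Xk|intros; left; apply Hkp]). lra. }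
  assert (P3 : RInt (fun t => kern R0 r t * w t) x0 PI <= 4 * PI * kern R0 r x0).
  { apply Rle_trans with (RInt (fun _ => 4 * kern R0 r x0) x0 PI).
    - apply RInt_le; [lra|apply Xkw|apply ex_RInt_const|]. intros t Ht.
      assert (kern R0 r t <= kern R0 r x0).
      { unfold kern. apply Rmult_le_compat_l; [nra|]. pose proof (kern_den R0 r x0 Hr). assert (0 < (R0 - r) * (R0 - r)) by nra.
        apply Rinv_le_contravar; [lra|]. assert (cos t <= cos x0) by (left; apply cos_decreasing_1; lra).
        assert (0 < R0 * r) by nra. nra. }
      specialize (Hw4 t). specialize (Hkp t). nra.
    - rewrite RInt_const_R. specialize (Hkp x0). nra. }
  assert (mu * RInt (kern R0 r) 0 x0 <= mu * PI) by (apply Rmult_le_compat_l; lra). lra.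
Qed.

(** A radial half of Fatou's theorem: the density of the boundary measure at [th] bounds the radial
    upper limit. The contributions to 2 pi vv are at most 5 pi lam from the density, lam from
    replacing [nu] by a circle and 2 pi lam from the far part, well below 14 pi lam. *)
Lemma vv_limsup th x0 lam : 0 < x0 < PI -> 0 < lam -> (forall t, 0 < t <= x0 -> nu (th - t) (th + t) <= 5 * lam * t) ->
  exists delta, 0 < delta /\ forall r, 1 - delta < r < 1 -> vv (polar r th) <= 7 * lam.
Proof.
  intros Hx Hlam Hnu. pose proof PI_RGT_0 as HPI.
  assert (Hcx : 0 < 1 - cos x0).
  { assert (cos x0 < cos 0) by (apply cos_decreasing_1; lra). rewrite cos_0 in H. lra. }
  set (d := Rmin (/ 4) (lam * (1 - cos x0) / 16)). assert (Hd : 0 < d).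
  { apply Rmin_pos; [lra|]. apply Rdiv_lt_0_compat; [apply Rmult_lt_0_compat; lra|lra]. }
  pose proof (Rmin_l (/ 4) (lam * (1 - cos x0) / 16)). pose proof (Rmin_r (/ 4) (lam * (1 - cos x0) / 16)). fold d in H, H0.
  exists d. split; [exact Hd|]. intros r Hr.
  (* The auxiliary circle [R0 = 1 - e] lies between r and 1, with 1 - R0 a small multiple of 1 - r.
     The discrepancy 4 e between [nu] and [V R0], multiplied by the kernel's peak of order 1 / (1 -
     r), then stays below lam. *)
  set (e := Rmin (/ 2) (lam / 16) * (1 - r)).
  pose proof (Rmin_l (/ 2) (lam / 16)). pose proof (Rmin_r (/ 2) (lam / 16)).
  assert (0 < Rmin (/ 2) (lam / 16)) by (apply Rmin_pos; lra).
  assert (He : 0 < e) by (apply Rmult_lt_0_compat; lra).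
  assert (He1 : e <= (1 - r) / 2) by (unfold e; nra). assert (He2 : e <= lam / 16 * (1 - r)) by (unfold e; nra).
  set (R0 := 1 - e). assert (HR : 0 < r < R0 /\ R0 < 1) by (unfold R0; lra). destruct HR as [HR1 HR2].
  pose proof (vv_upper R0 r th x0 (5 * lam) (4 * e) HR1 HR2 Hx ltac:(lra)) as U.
  assert (U' := U ltac:(intros t Ht; specialize (Hnu t Ht); pose proof (nu_rate R0 (th - t) (th + t) ltac:(lra)) as Q;
    apply Rabs_le_between in Q; unfold R0 in *; lra) ltac:(lra)). clear U.
  assert (K0 : 4 * e * kern R0 r 0 <= lam).
  { unfold kern. rewrite cos_0. replace (R0 * R0 + r * r - 2 * R0 * r * 1) with ((R0 - r) * (R0 - r)) by ring.
    replace ((R0 * R0 - r * r) / ((R0 - r) * (R0 - r))) with ((R0 + r) / (R0 - r)) by (field; lra).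
    apply Rmult_le_reg_r with (R0 - r); [lra|].
    replace (4 * e * ((R0 + r) / (R0 - r)) * (R0 - r)) with (4 * e * (R0 + r)) by (field; lra).
    assert ((1 - r) / 2 <= R0 - r) by (unfold R0; lra).
    assert (4 * e * (R0 + r) <= 4 * (lam / 16 * (1 - r)) * 2) by (apply Rmult_le_compat; lra). nra. }
  assert (K1 : kern R0 r x0 <= lam / 2).
  { unfold kern. pose proof (kern_den R0 r x0 HR1) as Hd0. assert (0 < (R0 - r) * (R0 - r)) by nra.
    apply Rmult_le_reg_r with (R0 * R0 + r * r - 2 * R0 * r * cos x0); [lra|].
    unfold Rdiv at 1. rewrite Rmult_assoc, Rinv_l, Rmult_1_r by lra.
    assert (9 / 16 <= R0 * r) by (unfold R0 in *; nra).
    assert (R0 * r * (1 - cos x0) * 2 <= R0 * R0 + r * r - 2 * R0 * r * cos x0) by nra.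
    assert (9 / 16 * (1 - cos x0) <= R0 * r * (1 - cos x0)) by (apply Rmult_le_compat_r; lra).
    assert (R0 * R0 - r * r <= 2 * (1 - r)) by nra.
    assert (2 * (1 - r) <= lam * (1 - cos x0) / 8) by lra.
    assert (lam / 2 * (9 / 16 * (1 - cos x0) * 2) <= lam / 2 * (R0 * R0 + r * r - 2 * R0 * r * cos x0)) by (apply Rmult_le_compat_l; lra).
    nra. }
  assert (4 * PI * kern R0 r x0 <= 4 * PI * (lam / 2)) by (apply Rmult_le_compat_l; lra).
  pose proof PI2_3_2. assert (lam <= PI * lam) by (assert (1 <= PI) by lra; nra).
  apply Rmult_le_reg_l with (2 * PI); [lra|]. nra.
Qed.

Lemma chord_le s t : Cmod (polar 1 s - polar 1 t) <= Rabs (s - t).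
Proof.
  rewrite <- (CI_FTC (polar 1) (fun x => Ci * polar 1 x)%C t s).
  - rewrite <- (Rmult_1_l (Rabs (s - t))). apply CI_bound.
    + intros x _. apply contg_mult; [apply contg_const|apply pcont_polar].
    + intros x _. rewrite Cmod_mult, Cmod_Ci, Cmod_polar; lra.
  - intros x _. apply pdiff_polar.
  - intros x _. apply contg_mult; [apply contg_const|apply pcont_polar].
Qed.

(** For R0 >= 1 - ell / 2 the points over the threefold arc are within 3 ell of z, and R0^2 - |z|^2
    >= ell / 2, so the Poisson kernel at z is at least 1 / (18 ell) there. The constant is 18 times
    the total mass 2 pi. *)
Lemma nu_local p ell th : 0 < ell <= / 4 -> p <= th <= p + ell ->
  nu (p - ell) (p + 2 * ell) <= 36 * PI * ell * vv (polar (1 - ell) th).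
Proof.
  intros Hl Hth. pose proof PI_RGT_0 as HPI. pose proof PI2_3_2 as HP2. assert (HPI3 : 3 <= PI) by lra.
  set (z := polar (1 - ell) th). assert (Hz : Cmod z = 1 - ell) by (apply Cmod_polar; lra).
  assert (Main : forall R0, 1 - ell / 2 <= R0 < 1 -> V R0 (p - ell) (p + 2 * ell) <= 36 * PI * ell * vv z).
  { intros R0 HR. assert (Hz0 : Cmod z < R0) by lra.
    pose proof (vv_poisson R0 z (p - ell) ltac:(lra) Hz0) as E.
    assert (Xa : forall a b, ex_RInt (fun s => pk R0 z s * vv (polar R0 s)) a b).
    { intros. apply ex_RInt_cont. intros t. apply cont_mult_R; [apply pk_cont; lra|apply vv_cont; lra]. }
    rewrite <- (RInt_Chasles_R _ (p - ell) (p + 2 * ell)) in E by apply Xa.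
    assert (P1 : 0 <= RInt (fun s => pk R0 z s * vv (polar R0 s)) (p + 2 * ell) (p - ell + 2 * PI)).
    { apply RInt_ge_0; [lra|apply Xa|]. intros s _. apply Rmult_le_pos; [left; apply pk_pos; lra|]. apply vv_bounds. rewrite Cmod_polar; lra. }
    assert (P2 : / (18 * ell) * V R0 (p - ell) (p + 2 * ell) <= RInt (fun s => pk R0 z s * vv (polar R0 s)) (p - ell) (p + 2 * ell)).
    { unfold V. rewrite <- RInt_scal_R by (apply vv_ex; lra).
      apply RInt_le; [lra|apply ex_RInt_scal_R, vv_ex; lra|apply Xa|]. intros s Hs.
      apply Rmult_le_compat_r; [apply vv_bounds; rewrite Cmod_polar; lra|].
      unfold pk. rewrite Hz.
      assert (Hdist : Cmod (polar R0 s - z) <= 3 * ell).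
      { replace (polar R0 s - z)%C with (RtoC (R0 - (1 - ell)) * polar 1 s + RtoC (1 - ell) * (polar 1 s - polar 1 th))%C.
        - eapply Rle_trans; [apply Cmod_triangle|]. rewrite !Cmod_mult, !Cmod_RtoC, (Cmod_polar 1), !Rabs_pos_eq by lra.
          pose proof (chord_le s th). assert (Rabs (s - th) <= 2 * ell) by (apply Rabs_le_between; lra).
          pose proof (Cmod_ge_0 (polar 1 s - polar 1 th)). nra.
        - unfold z, polar. apply injective_projections; simpl; ring. }
      assert (Hpos : 0 < Cmod (polar R0 s - z)) by (apply (proj1 (Cmod_gt_0 _)), polar_minus_nz; lra).
      apply Rmult_le_reg_r with (Cmod (polar R0 s - z) * Cmod (polar R0 s - z)); [nra|].
      unfold Rdiv at 1. rewrite Rmult_assoc, Rinv_l by nra.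
      assert (Cmod (polar R0 s - z) * Cmod (polar R0 s - z) <= 9 * (ell * ell)) by nra.
      apply Rle_trans with (/ (18 * ell) * (9 * (ell * ell))).
      - apply Rmult_le_compat_l; [left; apply Rinv_0_lt_compat; lra|assumption].
      - replace (/ (18 * ell) * (9 * (ell * ell))) with (ell / 2) by (field; lra). nra. }
    assert (P3 : / (18 * ell) * V R0 (p - ell) (p + 2 * ell) <= 2 * PI * vv z) by lra.
    apply Rmult_le_compat_l with (r := 18 * ell) in P3; [|lra].
    replace (18 * ell * (/ (18 * ell) * V R0 (p - ell) (p + 2 * ell))) with (V R0 (p - ell) (p + 2 * ell)) in P3 by (field; lra). lra. }
  assert (HH : nu (p - ell) (p + 2 * ell) - 36 * PI * ell * vv z <= 0); [|lra].
  apply le_all_eps_lin with 4. intros e He.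
  set (R0 := 1 - Rmin e (ell / 2)). pose proof (Rmin_l e (ell / 2)). pose proof (Rmin_r e (ell / 2)).
  assert (0 < Rmin e (ell / 2)) by (apply Rmin_pos; lra).
  specialize (Main R0 ltac:(unfold R0; lra)). pose proof (nu_rate R0 (p - ell) (p + 2 * ell) ltac:(unfold R0; lra)) as Q.
  apply Rabs_le_between in Q. unfold R0 in *. lra.
Qed.

(** The stopping argument runs on the threefold arc, so points of the middle third keep a margin
    ell. [small_mass] asks for three half-widths on each side, whence half-widths up to ell / 4. The
    constant is 36 pi from [nu_local] times 5 from the enlargements. *)
Lemma good_arc p ell th0 lam : 0 < ell <= / 4 -> 0 < lam -> p <= th0 <= p + ell ->
  exists E : R -> Prop, covered E (180 * PI / lam * (ell * vv (polar (1 - ell) th0))) /\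
   forall th, p <= th <= p + ell -> ~ E th ->
     exists delta, 0 < delta /\ forall r, 1 - delta < r < 1 -> vv (polar r th) <= 7 * lam.
Proof.
  intros Hl Hlam Hth0. pose proof PI_RGT_0 as HPI. pose proof PI2_3_2 as HP2. assert (HPI3 : 3 <= PI) by lra.
  assert (HL : 0 < 3 * ell) by lra.
  exists (stopped nu (p - ell) (3 * ell) lam). split.
  - eapply covered_sub; [intros t Ht; exact Ht| |apply stopped_covered; [exact HL|exact Hlam|exact nu_nonneg|exact nu_additive]].
    pose proof (nu_local p ell th0 Hl Hth0) as Q. replace (p - ell + 3 * ell) with (p + 2 * ell) by ring.
    unfold Rdiv. replace (180 * PI * / lam * (ell * vv (polar (1 - ell) th0))) with (5 * (36 * PI * ell * vv (polar (1 - ell) th0)) * / lam) by ring.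
    apply Rmult_le_compat_r; [left; apply Rinv_0_lt_compat; exact Hlam|]. lra.
  - intros th Hth HE. apply (vv_limsup th (ell / 4) lam); [lra|exact Hlam|]. intros t Ht.
    apply (small_mass nu (p - ell) (3 * ell) lam HL Hlam nu_nonneg nu_additive); [exact HE|lra|lra|lra].
Qed.
End RadialLimits.

(** * From the mean condition to radial limits *)

Lemma min_le_mean (g : R -> R) a b : a <= b -> (forall t, continuous g t) ->
  exists t, a <= t <= b /\ (b - a) * g t <= RInt g a b.
Proof.
  intros Hab Hg. destruct (continuity_ab_min g a b Hab) as [m [Hm Hmb]].
  { intros t _. apply continuity_pt_filterlim, Hg. }
  exists m. split; [exact Hmb|]. rewrite <- (RInt_const_R (g m) a b).
  apply RInt_le; [exact Hab|apply ex_RInt_const|apply ex_RInt_cont, Hg|]. intros t Ht. apply Hm. lra.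
Qed.

Lemma phase_exists (z : C) : exists c, Cmod c = 1 /\ fst (Cconj c * z)%C = Cmod z.
Proof.
  destruct (Req_dec (Cmod z) 0) as [E|E].
  - exists (RtoC 1). split; [apply Cmod_1|]. rewrite E. apply Cmod_eq_0 in E. rewrite E. simpl. ring.
  - pose proof (Cmod_ge_0 z). exists (z * RtoC (/ Cmod z))%C. split.
    + rewrite Cmod_mult, Cmod_RtoC, Rabs_pos_eq; [field; exact E|]. left. apply Rinv_0_lt_compat. lra.
    + transitivity (Cmod z * Cmod z * / Cmod z); [|field; exact E]. rewrite Cmod_sqr. simpl. ring.
Qed.

(** The value c may change with e, so countably many accuracies can be treated separately and
    reconciled by compactness. *)
Definition near_unimodular (u : C -> C) (th e : R) : Prop :=
  exists c delta, Cmod c = 1 /\ 0 < delta /\ forall r, 1 - delta < r < 1 -> Cmod (u (polar r th) - c) <= e.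

Lemma dist_unimodular (w c : C) : Cmod c = 1 -> Cmod w <= 1 ->
  Cmod (w - c) * Cmod (w - c) <= 2 * (1 - fst (Cconj c * w)%C).
Proof.
  intros Hc Hw. pose proof (Cmod_ge_0 w). pose proof (Cmod_sqr w) as Qw. pose proof (Cmod_sqr c) as Qc. rewrite Hc in Qc.
  rewrite Cmod_sqr. simpl. nra.
Qed.

Lemma cell_exists ell t n : 0 <= t <= INR (S n) * ell -> exists i, (i < S n)%nat /\ INR i * ell <= t <= INR i * ell + ell.
Proof.
  induction n as [|n IH]; intros Ht.
  - exists 0%nat. split; [lia|]. simpl in *. lra.
  - rewrite S_INR in Ht. destruct (Rle_dec t (INR (S n) * ell)) as [h|h].
    + destruct IH as [i [Hi Hc]]; [lra|]. exists i. split; [lia|exact Hc].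
    + exists (S n). split; [lia|]. lra.
Qed.

Section MeanToRadial.
Variable u : C -> C.
Hypothesis Hum : inner_mean u.

Let Hu : hol 1 u := proj1 Hum.
Let Hub : forall z, Cmod z < 1 -> Cmod (u z) <= 1 := proj1 (proj2 Hum).

(** The circle is cut into arcs of length ell, and on each one u is compared with its phase at a
    single point of radius 1 - ell. [good_arc] bounds the exceptional set of an arc by a multiple of
    the integral of 1 - |u|^2 over it at that radius; the sum over all arcs is small by the mean
    condition. *)
Lemma far_null e : 0 < e -> null_set (fun t => 0 <= t <= 2 * PI /\ ~ near_unimodular u t e).
Proof.
  intros He. apply null_covered. intros eps Heps. pose proof PI_RGT_0 as HPI.
  (* Then [vv <= 7 * lam] gives |u - c|^2 <= 14 lam = e^2. *)
  set (lam := e * e / 14). assert (Hlam : 0 < lam) by (unfold lam; nra).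
  set (K := 180 * PI / lam). assert (HK : 0 < K) by (apply Rdiv_lt_0_compat; lra).
  destruct (proj2 (proj2 Hum) (eps / K)) as [r0 [Hr0 Hmean]]; [apply Rdiv_lt_0_compat; lra|].
  assert (Hm0 : 0 < Rmin (/ 4) ((1 - r0) / 2)) by (apply Rmin_pos; lra).
  pose proof (Rmin_l (/ 4) ((1 - r0) / 2)). pose proof (Rmin_r (/ 4) ((1 - r0) / 2)).
  set (m0 := Rmin (/ 4) ((1 - r0) / 2)) in *.
  assert (Hn : exists n, 2 * PI / INR (S n) <= m0).
  { destruct (INR_unbounded (2 * PI / m0)) as [n Hn]. exists n. pose proof (pos_INR n).
    assert (HS : INR n < INR (S n)) by (rewrite S_INR; lra). apply Rmult_le_reg_r with (INR (S n)); [lra|].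
    replace (2 * PI / INR (S n) * INR (S n)) with (2 * PI / m0 * m0) by (field; lra).
    rewrite (Rmult_comm m0). apply Rmult_le_compat_r; lra. }
  destruct Hn as [n Hn]. set (ell := 2 * PI / INR (S n)) in *.
  assert (HSn : 0 < INR (S n)) by (apply lt_0_INR; lia).
  assert (Hell : 0 < ell) by (apply Rdiv_lt_0_compat; lra).
  assert (Eell : INR (S n) * ell = 2 * PI) by (unfold ell; field; lra).
  set (g := fun t => 1 - nrm2 u (1 - ell) t).
  assert (Cg : forall t, continuous g t) by (intros t; apply cont_minus_R; [apply cont_const_R|apply nrm2_cont; [exact Hu|lra]]).
  assert (Xg : forall a b, ex_RInt g a b) by (intros; apply ex_RInt_cont, Cg).
  assert (Hg0 : forall t, 0 <= g t).
  { intros t. unfold g, nrm2. specialize (Hub (polar (1 - ell) t) ltac:(rewrite Cmod_polar; lra)).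
    pose proof (Cmod_ge_0 (u (polar (1 - ell) t))). nra. }
  (* Truncation at [S n] makes the increments of [G] vanish after the last arc, so a finite
     partition fits the countable union. *)
  set (G := fun k => RInt g 0 (INR (min k (S n)) * ell)).
  assert (HG : forall k, G k <= RInt g 0 (2 * PI)).
  { intros k. unfold G. set (x := INR (min k (S n)) * ell).
    assert (Hx : x <= 2 * PI). { rewrite <- Eell. apply Rmult_le_compat_r; [lra|]. apply le_INR. lia. }
    rewrite <- (RInt_Chasles_R g 0 x (2 * PI)) by apply Xg.
    assert (0 <= RInt g x (2 * PI)) by (apply RInt_ge_0; [exact Hx|apply Xg|intros; apply Hg0]). lra. }
  assert (Hcell : forall i, exists E : R -> Prop, covered E (K * (G (S i) - G i)) /\ ((i < S n)%nat ->
     forall th, INR i * ell <= th <= INR i * ell + ell -> ~ E th -> near_unimodular u th e)).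
  { intros i. destruct (Compare_dec.lt_dec i (S n)) as [Hi|Hi].
    (* At a minimum of [g] on the arc, ell times [g] is at most the arc's share of the defect. With
       c the phase of u there, [vv] equals 1 - |u|, which is at most [g]. *)
    - set (p := INR i * ell). destruct (min_le_mean g p (p + ell) ltac:(lra) Cg) as [th0 [Hth0 Hmin]].
      replace (p + ell - p) with ell in Hmin by ring.
      destruct (phase_exists (u (polar (1 - ell) th0))) as [c [Hc Ec]].
      destruct (good_arc u Hu Hub c Hc p ell th0 lam ltac:(lra) Hlam Hth0) as [E [HE Hgood]].
      exists E. split.
      + eapply covered_sub; [intros t Ht; exact Ht| |exact HE]. fold K. apply Rmult_le_compat_l; [lra|].
        assert (EG : G (S i) - G i = RInt g p (p + ell)).
        { unfold G. rewrite !Nat.min_l by lia. fold p. replace (INR (S i) * ell) with (p + ell) by (rewrite S_INR; unfold p; ring).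
          rewrite <- (RInt_Chasles_R g 0 p (p + ell)) by apply Xg. lra. }
        rewrite EG. eapply Rle_trans; [|exact Hmin]. apply Rmult_le_compat_l; [lra|].
        unfold vv, g, nrm2. rewrite Ec. specialize (Hub (polar (1 - ell) th0) ltac:(rewrite Cmod_polar; lra)).
        pose proof (Cmod_ge_0 (u (polar (1 - ell) th0))). nra.
      + intros _ th Hth HE'. destruct (Hgood th Hth HE') as [d [Hd Hd2]].
        exists c, (Rmin d 1). split; [exact Hc|]. split; [apply Rmin_pos; lra|]. intros r Hr.
        pose proof (Rmin_l d 1). pose proof (Rmin_r d 1). specialize (Hd2 r ltac:(lra)). unfold vv in Hd2.
        pose proof (dist_unimodular (u (polar r th)) c Hc (Hub (polar r th) ltac:(rewrite Cmod_polar; lra))) as Q.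
        pose proof (Cmod_ge_0 (u (polar r th) - c)). unfold lam in Hd2.
        apply Rnot_lt_le. intros Hlt. nra.
    - exists (fun _ => False). split; [|intros; contradiction].
      apply covered_sub with (fun t => exists p : R * R, In p nil /\ fst p <= t <= snd p) (lsum (fun p : R * R => snd p - fst p) nil).
      + intros t [].
      + unfold G. rewrite !Nat.min_r by lia. simpl. lra.
      + apply covered_list. intros p []. }
  destruct (functional_choice _ Hcell) as [E HE].
  apply covered_sub with (fun t => exists i, E i t) eps; [|lra|].
  - intros t [Ht Hnear]. rewrite <- Eell in Ht. destruct (cell_exists ell t n Ht) as [i [Hi Hc]]. exists i.
    apply NNPP. intros Hni. apply Hnear. exact (proj2 (HE i) Hi t Hc Hni).
  - apply covered_union with (fun i => K * (G (S i) - G i)); [intros i; apply HE|]. intros N.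
    assert (ES : sum_f_R0 (fun i => K * (G (S i) - G i)) N = K * (G (S N) - G 0%nat)).
    { induction N as [|N IH]; simpl sum_f_R0; [reflexivity|]. rewrite IH. ring. }
    rewrite ES. assert (E0 : G 0%nat = 0).
    { unfold G. simpl. rewrite Rmult_0_l. apply (RInt_point (V := R_CompleteNormedModule)). }
    rewrite E0. specialize (HG (S N)). specialize (Hmean (1 - ell) ltac:(lra)). fold g in Hmean.
    apply Rle_trans with (K * (eps / K)); [apply Rmult_le_compat_l; lra|]. right. field. lra.
Qed.

(** The approximating phases have a cluster point L on the circle; one late index controls both the
    distance of u from its phase and that of the phase from L. *)
Lemma unimodular_radial_limit th : (forall k : nat, near_unimodular u th (/ (INR k + 1))) ->
  exists L : C, Cmod L = 1 /\ radial_limit u th L.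
Proof.
  intros H. destruct (functional_choice _ H) as [c Hc].
  assert (Hc1 : forall n, Cmod (c n) = 1) by (intros n; destruct (Hc n) as [d [h _]]; exact h).
  destruct (bolzano_weierstrass_C c) as [s [L [Hs HL]]]; [intros n; rewrite Hc1; lra|].
  exists L. split.
  - apply clim_Cmod in HL. apply (is_lim_seq_ext _ (fun _ => 1)) in HL; [|intros n; apply Hc1].
    apply is_lim_seq_unique in HL. rewrite Lim_seq_const in HL. injection HL. auto.
  - intros eps He. apply clim_dist in HL. apply is_lim_seq_spec in HL.
    destruct (HL (mkposreal (eps / 2) ltac:(lra))) as [N HN]. simpl in HN.
    destruct (INR_unbounded (2 / eps)) as [M HM]. set (n := max N M).
    specialize (HN n ltac:(lia)). rewrite Rminus_0_r, Rabs_pos_eq in HN by apply Cmod_ge_0.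
    destruct (Hc (s n)) as [d [_ [Hd Hr]]]. exists d. split; [exact Hd|]. intros r Hrr. specialize (Hr r Hrr).
    assert (/ (INR (s n) + 1) < eps / 2).
    { assert (HMn : INR M <= INR (s n)) by (apply le_INR; specialize (Hs n); lia).
      assert (0 < 2 / eps) by (apply Rdiv_lt_0_compat; lra).
      replace (eps / 2) with (/ (2 / eps)) by (field; lra). apply Rinv_lt_contravar; [apply Rmult_lt_0_compat; lra|lra]. }
    replace (u (polar r th) - L)%C with ((u (polar r th) - c (s n)) + (c (s n) - L))%C by ring.
    eapply Rle_lt_trans; [apply Cmod_triangle|]. lra.
Qed.
End MeanToRadial.

Lemma polar_period r t (k : nat) : polar r (t + 2 * PI * INR k) = polar r t.
Proof.
  induction k as [|k IH]; [simpl; f_equal; ring|].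
  replace (t + 2 * PI * INR (S k)) with (t + 2 * PI * INR k + 2 * PI) by (rewrite S_INR; ring).
  rewrite polar_2PI. exact IH.
Qed.

(** The integer multiple is written as a difference of naturals to match unions indexed by [nat]. *)
Lemma reduce_mod_2PI t : exists i j : nat, 0 <= t + 2 * PI * (INR j - INR i) <= 2 * PI.
Proof.
  pose proof PI_RGT_0. destruct (archimed (t / (2 * PI))) as [A1 A2].
  set (m := (up (t / (2 * PI)) - 1)%Z). exists (Z.to_nat m), (Z.to_nat (- m)).
  assert (E : INR (Z.to_nat (- m)) - INR (Z.to_nat m) = - IZR m).
  { rewrite !INR_IZR_INZ, <- minus_IZR, <- opp_IZR. f_equal. lia. }
  assert (Em : IZR m = IZR (up (t / (2 * PI))) - 1) by (unfold m; rewrite minus_IZR; reflexivity).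
  rewrite E. assert (Et : t = 2 * PI * (t / (2 * PI))) by (field; lra).
  set (q := t / (2 * PI)) in *. rewrite Et. assert (IZR m <= q <= IZR m + 1) by lra. nra.
Qed.

Lemma inner_of_inner_mean u : inner_mean u -> inner u.
Proof.
  intros Hum. split; [apply hol_on_disk, Hum|]. split; [apply Hum|].
  set (B := fun k t => 0 <= t <= 2 * PI /\ ~ near_unimodular u t (/ (INR k + 1))).
  (* [inner] quantifies over all real angles, so the exceptional sets in [0, 2 pi] are repeated
     along all multiples of 2 pi. *)
  exists (fun t => exists i j k, B k (t + 2 * PI * (INR j - INR i))). split.
  - apply null_union. intros i. apply null_union. intros j. apply null_union. intros k.
    apply (null_translate (B k)). apply far_null; [exact Hum|]. apply Rinv_0_lt_compat. pose proof (pos_INR k). lra.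
  - intros t Ht. destruct (reduce_mod_2PI t) as [i [j Hij]]. set (s := t + 2 * PI * (INR j - INR i)) in *.
    destruct (unimodular_radial_limit u s) as [L [HL Hrad]].
    + intros k. apply NNPP. intros Hn. apply Ht. exists i, j, k. split; assumption.
    + exists L. split; [exact HL|]. intros eps He. destruct (Hrad eps He) as [d Hd]. exists d.
      assert (E : forall r, polar r t = polar r s).
      { intros r. rewrite <- (polar_period r t j), <- (polar_period r s i). f_equal. unfold s. ring. }
      split; [apply Hd|]. intros r Hr. rewrite E. apply Hd, Hr.
Qed.

(** * The complex exponential and atomic singular inner functions *)

Definition cexp (z : C) : C := (exp (fst z) * cos (snd z), exp (fst z) * sin (snd z)).

Lemma cexp_plus z w : cexp (z + w) = (cexp z * cexp w)%C.
Proof.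
  unfold cexp. apply injective_projections; simpl; rewrite exp_plus, ?cos_plus, ?sin_plus; ring.
Qed.

Lemma Cmod_cexp z : Cmod (cexp z) = exp (fst z).
Proof. apply (Cmod_polar (exp (fst z)) (snd z)). left. apply exp_pos. Qed.

Lemma linear_approx_0 f l : derivable_pt_lim f 0 l -> forall e, 0 < e ->
  exists d, 0 < d /\ forall h, Rabs h < d -> Rabs (f h - f 0 - l * h) <= e * Rabs h.
Proof.
  intros H e He. destruct (H e He) as [d Hd]. exists d. split; [apply cond_pos|]. intros h Hh.
  destruct (Req_dec h 0) as [->|Hn].
  - replace (f 0 - f 0 - l * 0) with 0 by ring. rewrite Rabs_R0. lra.
  - specialize (Hd h Hn Hh). rewrite Rplus_0_l in Hd.
    replace (f h - f 0 - l * h) with (((f h - f 0) / h - l) * h) by (field; exact Hn).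
    rewrite Rabs_mult. apply Rmult_le_compat_r; [apply Rabs_pos|lra].
Qed.

Lemma cexp_linear_approx_0 e : 0 < e -> exists d, 0 < d /\ forall h, Cmod h < d -> Cmod (cexp h - 1 - h) <= e * Cmod h.
Proof.
  intros He. set (k := Rmin 1 (e / 8)). assert (Hk : 0 < k) by (apply Rmin_pos; lra).
  pose proof (Rmin_l 1 (e / 8)). pose proof (Rmin_r 1 (e / 8)). fold k in H, H0.
  destruct (linear_approx_0 exp 1 derivable_pt_lim_exp_0 k Hk) as [d1 [Hd1 E1]].
  destruct (linear_approx_0 cos 0 derivable_pt_lim_cos_0 k Hk) as [d2 [Hd2 E2]].
  destruct (linear_approx_0 sin 1 derivable_pt_lim_sin_0 k Hk) as [d3 [Hd3 E3]].
  rewrite exp_0 in E1. rewrite cos_0 in E2. rewrite sin_0 in E3.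
  set (d := Rmin (Rmin d1 (k / 2)) (Rmin d2 d3)).
  assert (Hd : 0 < d /\ d <= d1 /\ d <= k / 2 /\ d <= d2 /\ d <= d3).
  { unfold d, Rmin. repeat destruct (Rle_dec _ _); lra. }
  exists d. split; [lra|]. intros [x y] Hh. pose proof (Cmod_ge_fst (x, y)) as Hx. pose proof (Cmod_ge_snd (x, y)) as Hy.
  cbn [fst snd] in Hx, Hy. set (M := Cmod (x, y)) in *.
  specialize (E1 x ltac:(lra)). specialize (E2 y ltac:(lra)). specialize (E3 y ltac:(lra)).
  assert (k * Rabs x <= k * M) by (apply Rmult_le_compat_l; lra).
  assert (k * Rabs y <= k * M) by (apply Rmult_le_compat_l; lra).
  assert (Hex : Rabs (exp x - 1) <= k).
  { replace (exp x - 1) with ((exp x - 1 - 1 * x) + x) by ring. eapply Rle_trans; [apply Rabs_triang|].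
    pose proof (Rabs_pos x). nra. }
  assert (Hex2 : Rabs (exp x) <= 2).
  { rewrite Rabs_pos_eq by (left; apply exp_pos). apply Rabs_le_between in Hex. lra. }
  assert (Hs : Rabs (sin y) <= 2 * M).
  { replace (sin y) with ((sin y - 0 - 1 * y) + y) by ring. eapply Rle_trans; [apply Rabs_triang|].
    pose proof (Rabs_pos y). nra. }
  eapply Rle_trans; [apply Cmod_le_sum|].
  assert (P1 : Rabs (fst (cexp (x, y) - 1 - (x, y))%C) <= 3 * (k * M)).
  { replace (fst (cexp (x, y) - 1 - (x, y))%C) with ((exp x - 1 - 1 * x) + exp x * (cos y - 1 - 0 * y)) by (simpl; ring).
    eapply Rle_trans; [apply Rabs_triang|]. rewrite Rabs_mult.
    assert (Rabs (exp x) * Rabs (cos y - 1 - 0 * y) <= 2 * (k * M)).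
    { apply Rmult_le_compat; [apply Rabs_pos|apply Rabs_pos|exact Hex2|lra]. }
    lra. }
  assert (P2 : Rabs (snd (cexp (x, y) - 1 - (x, y))%C) <= 3 * (k * M)).
  { replace (snd (cexp (x, y) - 1 - (x, y))%C) with ((exp x - 1) * sin y + (sin y - 0 - 1 * y)) by (simpl; ring).
    eapply Rle_trans; [apply Rabs_triang|]. rewrite Rabs_mult.
    assert (Rabs (exp x - 1) * Rabs (sin y) <= k * (2 * M)).
    { apply Rmult_le_compat; [apply Rabs_pos|apply Rabs_pos|exact Hex|lra]. }
    lra. }
  assert (0 <= M) by apply Cmod_ge_0. assert (k * M <= e / 8 * M) by (apply Rmult_le_compat_r; lra).
  assert (0 <= e * M) by (apply Rmult_le_pos; lra). lra.
Qed.

Lemma cdiff_cexp z : cdiff cexp z (cexp z).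
Proof.
  intros e He. pose proof (Cmod_ge_0 (cexp z)).
  assert (Hk : 0 < e / (1 + Cmod (cexp z))) by (apply Rdiv_lt_0_compat; lra).
  destruct (cexp_linear_approx_0 _ Hk) as [d [Hd E]]. exists d. split; [exact Hd|]. intros w Hw. specialize (E _ Hw).
  replace (cexp w) with (cexp z * cexp (w - z))%C by (rewrite <- cexp_plus; f_equal; ring).
  replace (cexp z * cexp (w - z) - cexp z - cexp z * (w - z))%C with (cexp z * (cexp (w - z) - 1 - (w - z)))%C by ring.
  rewrite Cmod_mult. pose proof (Cmod_ge_0 (w - z)).
  apply Rle_trans with ((1 + Cmod (cexp z)) * (e / (1 + Cmod (cexp z)) * Cmod (w - z))).
  - apply Rmult_le_compat; [lra|apply Cmod_ge_0|lra|exact E].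
  - right. field. lra.
Qed.

Lemma hol_cexp rad f : hol rad f -> hol rad (fun z => cexp (f z)).
Proof. intros Hf z Hz. destruct (Hf z Hz) as [m Hm]. eexists. apply (cdiff_comp cexp f); [apply cdiff_cexp|exact Hm]. Qed.

Lemma fst_i_scal (c : R) (w : C) : fst (Ci * RtoC c * w)%C = - (c * snd w).
Proof. simpl. ring. Qed.

Lemma cexp_i_real (x y : R) : cexp (Ci * RtoC x * RtoC y) = polar 1 (x * y).
Proof.
  unfold cexp, polar. rewrite fst_i_scal. replace (snd (Ci * RtoC x * RtoC y)%C) with (x * y) by (simpl; ring).
  replace (- (x * snd (RtoC y))) with 0 by (simpl; ring). rewrite exp_0. reflexivity.
Qed.

Lemma hol_cayley rad xi f : Cmod xi = 1 -> hol rad f -> (forall z, Cmod z < rad -> Cmod (f z) < 1) ->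
  hol rad (fun z => cayley xi (f z)).
Proof.
  intros Hxi Hf Hs. unfold cayley. apply hol_div; [| |intros; apply unit_minus_nz; auto].
  - apply hol_mult; [apply hol_const|apply hol_plus; [apply hol_const|exact Hf]].
  - apply hol_minus; [apply hol_const|exact Hf].
Qed.

(** The modulus is exp (- c P) with P the Poisson kernel at 1, and P tends to 0 along every radius
    except the one ending at 1. On [0, 2 pi] this leaves the two angles 0 and 2 pi, covered by
    degenerate intervals. *)
Lemma inner_mean_atomic c : 0 < c -> inner_mean (fun w => cexp (Ci * RtoC c * cayley 1 w)).
Proof.
  intros Hc. pose proof PI_RGT_0 as HPI.
  assert (Hm : forall w, Cmod w < 1 -> Cmod (cexp (Ci * RtoC c * cayley 1 w))
     = exp (- (c * ((1 - Cmod w * Cmod w) / (Cmod (1 - w) * Cmod (1 - w)))))).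
  { intros w Hw. rewrite Cmod_cexp, fst_i_scal, cayley_im by (assumption || apply Cmod_1). reflexivity. }
  apply (inner_mean_of_ae _ (fun t => exists p, In p ((0, 0) :: (2 * PI, 2 * PI) :: nil) /\ fst p <= t <= snd p)).
  - apply hol_cexp, hol_mult; [apply hol_const|]. apply hol_cayley; [apply Cmod_1|apply hol_id|auto].
  - intros w Hw. rewrite Hm by exact Hw. apply Rle_trans with (exp 0); [|rewrite exp_0; lra].
    pose proof (unit_minus_pos 1 w Cmod_1 Hw). pose proof (Cmod_ge_0 w).
    assert (0 <= c * ((1 - Cmod w * Cmod w) / (Cmod (1 - w) * Cmod (1 - w)))).
    { apply Rmult_le_pos; [lra|]. left. apply Rdiv_lt_0_compat; nra. }
    destruct (Req_dec (c * ((1 - Cmod w * Cmod w) / (Cmod (1 - w) * Cmod (1 - w)))) 0) as [E|E].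
    + rewrite E, Ropp_0. lra.
    + left. apply exp_increasing. lra.
  - apply null_covered. intros eps He. eapply covered_sub; [intros t Ht; exact Ht| |apply covered_list].
    + simpl. lra.
    + intros p [<-|[<-|[]]]; simpl; lra.
  - intros t Ht HN eps He.
    assert (Ht2 : 0 < t < 2 * PI).
    { split; apply Rnot_le_lt; intros h; apply HN.
      - exists (0, 0). simpl. split; [auto|lra].
      - exists (2 * PI, 2 * PI). simpl. split; [auto|lra]. }
    assert (Hcos : 0 < 1 - cos t).
    { replace t with (2 * (t / 2)) by field. rewrite cos_2a_sin. assert (0 < sin (t / 2)) by (apply sin_gt_0; lra). nra. }
    assert (0 < eps * (1 - cos t) / (2 * c)) by (apply Rdiv_lt_0_compat; [apply Rmult_lt_0_compat|]; lra).
    exists (Rmin (/ 2) (eps * (1 - cos t) / (2 * c))). split; [apply Rmin_pos; lra|]. intros r Hr.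
    pose proof (Rmin_l (/ 2) (eps * (1 - cos t) / (2 * c))). pose proof (Rmin_r (/ 2) (eps * (1 - cos t) / (2 * c))).
    assert (Hr1 : 1 - r < eps * (1 - cos t) / (2 * c)) by lra.
    rewrite Hm by (rewrite Cmod_polar; lra). rewrite Cmod_polar by lra.
    eapply Rlt_le_trans; [|apply exp_ineq1_le].
    assert (Q : c * ((1 - r * r) / (Cmod (1 - polar r t) * Cmod (1 - polar r t))) < eps); [|lra].
    (* For r >= 1 / 2 the difference of the two sides is at least (1 - r)^2. *)
    assert (HD : 1 - cos t <= Cmod (1 - polar r t) * Cmod (1 - polar r t)).
    { rewrite Cmod_sqr. simpl. pose proof (sin2_cos2 t) as S. unfold Rsqr in S. nra. }
    set (D := Cmod (1 - polar r t) * Cmod (1 - polar r t)) in *.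
    apply Rmult_lt_reg_r with D; [lra|]. replace (c * ((1 - r * r) / D) * D) with (c * (1 - r * r)) by (field; lra).
    apply Rmult_lt_compat_l with (r := 2 * c) in Hr1; [|lra].
    replace (2 * c * (eps * (1 - cos t) / (2 * c))) with (eps * (1 - cos t)) in Hr1 by (field; lra).
    assert (c * (1 - r * r) <= c * (2 * (1 - r))) by (apply Rmult_le_compat_l; nra).
    assert (eps * (1 - cos t) <= eps * D) by (apply Rmult_le_compat_l; lra). lra.
Qed.

Lemma cayley_rotate xi w : Cmod xi = 1 -> Cmod w < 1 -> cayley 1 (Cconj xi * w) = cayley xi w.
Proof.
  intros Hxi Hw. pose proof (unit_minus_nz xi w Hxi Hw) as H1.
  assert (H2 : (1 - Cconj xi * w)%C <> 0).
  { apply unit_minus_nz; [apply Cmod_1|]. rewrite Cmod_mult, Cmod_conj, Hxi. lra. }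
  assert (Hx : xi <> 0) by (intros E; rewrite E, Cmod_0 in Hxi; lra).
  unfold cayley. transitivity (Ci * (xi * (1 + Cconj xi * w)) / (xi * (1 - Cconj xi * w)))%C; [field; auto|].
  replace (xi * (1 + Cconj xi * w))%C with (xi + xi * Cconj xi * w)%C by ring.
  replace (xi * (1 - Cconj xi * w))%C with (xi - xi * Cconj xi * w)%C by ring.
  rewrite unit_conj by exact Hxi. f_equal; [|f_equal]; ring.
Qed.

Lemma polar_arg tau : Cmod tau = 1 -> exists al, polar 1 al = tau.
Proof.
  intros H. pose proof (Cmod_sqr tau) as Q. rewrite H in Q. destruct tau as [x y]. cbn [fst snd] in Q.
  assert (Hx : -1 <= x <= 1) by nra.
  assert (Hs : sqrt (1 - Rsqr x) = Rabs y).
  { replace (1 - Rsqr x) with (Rsqr y) by (unfold Rsqr; lra). apply sqrt_Rsqr_abs. }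
  destruct (Rle_dec 0 y) as [Hy|Hy].
  - exists (acos x). unfold polar. rewrite cos_acos, sin_acos, Hs, Rabs_pos_eq by lra. f_equal; ring.
  - exists (- acos x). unfold polar. rewrite cos_neg, sin_neg, cos_acos, sin_acos, Hs, Rabs_left by lra. f_equal; ring.
Qed.

(** The frequency must be positive for exp (i c h) to be bounded by 1, whatever the sign of b. A
    large multiple of 2 pi, added or subtracted according to that sign, adjusts the argument of
    tau. *)
Lemma frequency_exists b tau : b <> 0 -> Cmod tau = 1 -> exists c, 0 < c /\ polar 1 (c * b) = tau.
Proof.
  intros Hb Ht. pose proof PI_RGT_0. destruct (polar_arg tau Ht) as [al Hal].
  destruct (INR_unbounded (Rabs al / (2 * PI))) as [k Hk].
  assert (Hk2 : Rabs al < 2 * PI * INR k).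
  { apply Rmult_lt_compat_l with (r := 2 * PI) in Hk; [|lra]. replace (2 * PI * (Rabs al / (2 * PI))) with (Rabs al) in Hk by (field; lra). exact Hk. }
  apply Rabs_def2 in Hk2. destruct (Rlt_dec 0 b) as [h|h].
  - exists ((al + 2 * PI * INR k) / b). split; [apply Rdiv_lt_0_compat; lra|].
    replace ((al + 2 * PI * INR k) / b * b) with (al + 2 * PI * INR k) by (field; exact Hb). rewrite polar_period. exact Hal.
  - exists ((2 * PI * INR k - al) / (- b)). split; [apply Rdiv_lt_0_compat; lra|].
    rewrite <- Hal, <- (polar_period 1 _ k). f_equal. field. exact Hb.
Qed.

Theorem theorem4p1 (phi : C -> C) :
  holo_self_map phi -> inner phi -> parabolic phi ->
  positive_hyperbolic_step phi ->
  forall tau : C, Cmod tau = 1 ->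
    exists u : C -> C, inner u /\ ~ constant_on_disk u /\
      forall z : C, in_disk z -> u (phi z) = Cmult tau (u z).
Proof.
  intros [Hhol Hself] Hin [om [Hom [_ Hang]]] [z0 [Hz0 [l [Hl Hlim]]]] tau Htau.
  apply hol_on_disk in Hhol. apply inner_mean_of_inner in Hin.
  destruct (semiconjugacy phi z0 om l Hhol Hself Hz0 Hl Hlim Hom Hang) as [xi [b [Hxi [Hb Hsemi]]]].
  pose proof (sigma_disk phi z0 l Hhol Hself Hz0 Hl Hlim) as Hsd.
  pose proof (inner_mean_sigma phi z0 l Hhol Hself Hz0 Hl Hlim Hin) as Hsm.
  set (h := fun z => cayley xi (sigma phi z0 z)).
  assert (Hh : hol 1 h) by (apply hol_cayley; [exact Hxi|apply Hsm|exact Hsd]).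
  destruct (frequency_exists b tau Hb Htau) as [c [Hc Ec]].
  (* Stated for every frequency x: x = c gives the functional equation, x = pi / b the sign change
     that excludes constant u. *)
  assert (Hstep : forall x z, Cmod z < 1 -> cexp (Ci * RtoC x * h (phi z)) = (polar 1 (x * b) * cexp (Ci * RtoC x * h z))%C).
  { intros x z Hz. unfold h. rewrite Hsemi by exact Hz. rewrite <- cexp_i_real, <- cexp_plus. f_equal. ring. }
  exists (fun z => cexp (Ci * RtoC c * h z)). split; [|split].
  - apply inner_of_inner_mean.
    apply inner_mean_ext with (fun z => cexp (Ci * RtoC c * cayley 1 (Cconj xi * sigma phi z0 z))).
    { intros z Hz. unfold h. rewrite cayley_rotate; auto. }
    assert (Hrot : forall z, Cmod (Cconj xi * sigma phi z0 z) = Cmod (sigma phi z0 z)).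
    { intros z. rewrite Cmod_mult, Cmod_conj, Hxi. ring. }
    apply (inner_mean_comp (fun w => cexp (Ci * RtoC c * cayley 1 w)) (fun z => Cconj xi * sigma phi z0 z)%C).
    + apply inner_mean_atomic, Hc.
    + apply (inner_mean_dom (sigma phi z0) _ 1); [|exact Hsm|lra| |].
      * apply hol_mult; [apply hol_const|apply Hsm].
      * intros z Hz. rewrite Hrot. left. apply Hsd, Hz.
      * intros z Hz. rewrite Hrot. lra.
    + intros z Hz. rewrite Hrot. apply Hsd, Hz.
  - (* Constancy of [u] makes [Im h] constant, hence also [exp (i pi h / b)], which changes sign under [phi]. *)
    intros [k Hk].
    assert (Him : forall z, Cmod z < 1 -> snd (h z) = snd (h z0)).
    { intros z Hz. pose proof (f_equal Cmod (Hk z Hz)) as E1. pose proof (f_equal Cmod (Hk z0 Hz0)) as E2. cbv beta in E1, E2.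
      rewrite Cmod_cexp, fst_i_scal in E1, E2. rewrite <- E2 in E1. apply exp_inv in E1. nra. }
    set (g := fun z => cexp (Ci * RtoC (PI / b) * h z)).
    assert (Hg : g (phi z0) = g z0).
    { apply (const_modulus g (exp (- (PI / b * snd (h z0))))).
      - apply hol_cexp, hol_mult; [apply hol_const|exact Hh].
      - apply exp_pos.
      - intros z Hz. unfold g. rewrite Cmod_cexp, fst_i_scal, Him by exact Hz. reflexivity.
      - apply Hself, Hz0.
      - exact Hz0. }
    unfold g in Hg. rewrite Hstep in Hg by exact Hz0. replace (PI / b * b) with PI in Hg by (field; exact Hb).
    pose proof (Cmod_cexp (Ci * RtoC (PI / b) * h z0)) as Hm. pose proof (exp_pos (fst (Ci * RtoC (PI / b) * h z0)%C)) as Hp.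
    rewrite <- Hm in Hp. set (q := cexp (Ci * RtoC (PI / b) * h z0)) in *.
    assert (Hq : (RtoC 2 * q = 0)%C).
    { transitivity (q - polar 1 PI * q)%C; [|rewrite Hg; ring].
      clear. generalize q. intros [x y]. unfold polar. rewrite cos_PI, sin_PI. apply injective_projections; simpl; ring. }
    apply (f_equal Cmod) in Hq. rewrite Cmod_mult, Cmod_RtoC, Cmod_0, Rabs_pos_eq in Hq; lra.
  - intros z Hz. rewrite Hstep by exact Hz. rewrite Ec. reflexivity.
Qed.
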